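(* Let $\Omega\subseteq\mathbf{R}^d$ be a domain with boundary $\Gamma$, let $C=(c_{kl})$ be a symmetric matrix of real, bounded, Lipschitz functions on $\Omega$ with $C(x)$ positive-definite for each $x\in\Omega$, and let $H$ be the closure in $L_2(\Omega)$ of $-\mathrm{div}(C\nabla)$ defined on $C_c^\infty(\Omega)$. Let $\delta\in[0,2)$ and $r_0>0$. Assume that $C$ satisfies the boundary condition $$\inf_{r\in(0,r_0]}\ \sup_{x\in\Gamma_r}\big\|C(x)\,d_\Gamma(x)^{-\delta}-c(x)I\big\|=0,$$ where $c$ is a real bounded Lipschitz function with $\inf_{x\in\Gamma_{r_0}}c(x)>0$. Assume also that for each $r\in(0,r_0]$ there is a $b_{\delta,r}>0$ such that the weighted boundary Hardy inequality $$\int_{\Gamma_r}d_\Gamma^{\,\delta}\,|\nabla\psi|^2\ \ge\ b_{\delta,r}^{\,2}\int_{\Gamma_r}d_\Gamma^{\,\delta-2}\,|\psi|^2$$ holds for all $\psi\in C_c^1(\Gamma_r)$. Let $b_\delta$ be the supremum over $r$ of all possible $b_{\delta,r}$ in this inequality. If $(2-\delta)/2<b_\delta$ then $H$ is self-adjoint.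
   Context: A domain is a connected open set. $d_\Gamma(x)$ is the Euclidean distance from $x$ to $\Gamma$, and $\Gamma_r=\{x\in\Omega: d_\Gamma(x)<r\}$. $\|\cdot\|$ is the matrix norm and $I$ the identity matrix. ''$H$ is self-adjoint'' means that $-\mathrm{div}(C\nabla)$ is essentially self-adjoint on $C_c^\infty(\Omega)\subset L_2(\Omega)$. The (boundary) Hardy constant is $$b_\delta=\sup_{r>0}\ \inf_{0\ne\psi\in C_c^1(\Gamma_r)}\Big(\int_{\Gamma_r} d_\Gamma^{\,\delta}|\nabla\psi|^2\Big)^{1/2}\Big/\Big(\int_{\Gamma_r} d_\Gamma^{\,\delta-2}|\psi|^2\Big)^{1/2}.$$ *)

(* Defs.v *)
From HB Require Import structures.
From mathcomp Require Import all_boot all_order all_algebra.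
From mathcomp Require Import all_classical all_reals all_analysis.
From mathcomp.real_closed Require Import complex.

Set Implicit Arguments.
Unset Strict Implicit.
Unset Printing Implicit Defensive.

Import Order.TTheory GRing.Theory Num.Theory.
Import numFieldNormedType.Exports.
Import ComplexField.Normc.

Local Open Scope classical_set_scope.
Local Open Scope ring_scope.

Definition rV_display : measure_display.
Proof. exact: default_measure_display. Qed.

(* The sigma-algebra generated by the coordinates, i.e. the Borel sets. *)
Section measurable_rV.
Variables (R : realType) (n : nat).

Definition rV_coord (i : 'I_n) (x : 'rV[R]_n) : measurableTypeR R := x ord0 i.

Let rV_set0 : g_sigma_preimage rV_coord set0.
Proof. exact: sigma_algebra0. Qed.

Let rV_setC A : g_sigma_preimage rV_coord A -> g_sigma_preimage rV_coord (~` A).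
Proof. exact: sigma_algebraC. Qed.

Let rV_bigcup (F : _^nat) : (forall i, g_sigma_preimage rV_coord (F i)) ->
  g_sigma_preimage rV_coord (\bigcup_i (F i)).
Proof. exact: sigma_algebra_bigcup. Qed.

HB.instance Definition _ := @isMeasurable.Build rV_display
  'rV[R]_n (g_sigma_preimage rV_coord) rV_set0 rV_setC rV_bigcup.

End measurable_rV.

Lemma measurable_rV_coord (R : realType) (n : nat) (i : 'I_n) :
  measurable_fun [set: 'rV[R]_n] (rV_coord i).
Proof.
move=> _ A mA; apply: sub_sigma_algebra.
case: n i => [[]//|n] i.
rewrite -bigcup_mkord_ord; exists i; first exact: ltn_ord.
by exists A => //; rewrite inord_val.
Qed.

Lemma measurable_fun_rVP d (T : measurableType d) (R : realType) (n : nat)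
    (f : T -> 'rV[R]_n) :
  measurable_fun [set: T] f <->
  forall i, measurable_fun [set: T] (rV_coord i \o f).
Proof.
split=> [mf i|mf].
  by apply: measurableT_comp => //; exact: measurable_rV_coord.
have sub : g_sigma_preimage (fun i => rV_coord i \o f) `<=` measurable.
  apply: smallest_sub; first exact: sigma_algebra_measurable.
  case: n => [|n] in f mf *; first by rewrite big_ord0.
  rewrite -bigcup_mkord_ord; apply: bigcup_sub => i Ii.
  by move=> A [B mB <-]; exact: mf.
move=> _ A mA; apply: sub.
by rewrite g_sigma_preimage_comp; exists A.
Qed.

Lemma product_sigma_finite d1 d2 (T1 : measurableType d1)
    (T2 : measurableType d2) (R : realType)
    (m1 : {sigma_finite_measure set T1 -> \bar R})
    (m2 : {sigma_finite_measure set T2 -> \bar R}) :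
  sigma_finite setT (m1 \x m2)%E.
Proof.
have /sigma_finiteP[F [TF ndF Foo]] := sigma_finiteT m1.
have /sigma_finiteP[G [TG ndG Goo]] := sigma_finiteT m2.
exists (fun n => F n `*` G n).
  rewrite -setXTT TF TG predeqE => -[x y]; split.
    move=> [/= [n _ Fnx] [k _ Gky]]; exists (maxn n k) => //; split.
    - by move: x Fnx; exact/subsetPset/ndF/leq_maxl.
    - by move: y Gky; exact/subsetPset/ndG/leq_maxr.
  by move=> [n _ []/= ? ?]; split; exists n.
move=> k; have [? ?] := Foo k; have [? ?] := Goo k.
split; first exact: measurableX.
by rewrite product_measure1E// lte_mul_pinfty// ge0_fin_numE.
Qed.

Section rV_cons.
Variables (R : realType) (n : nat).

Definition rV_cons (p : measurableTypeR R * 'rV[R]_n) : 'rV[R]_n.+1 :=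
  row_mx (const_mx (p.1 : R) : 'rV[R]_1) p.2.

Definition rV_uncons (x : 'rV[R]_n.+1) : measurableTypeR R * 'rV[R]_n :=
  (x ord0 ord0, rsubmx (x : 'rV[R]_(1 + n))).

Let split01 (i : 'I_n.+1) :
  i = lshift n (ord0 : 'I_1) :> 'I_(1 + n) \/
  exists j, i = rshift 1 j :> 'I_(1 + n).
Proof.
case: (split_ordP (i : 'I_(1 + n))) => j ->; first by left; rewrite (ord1 j).
by right; exists j.
Qed.

Lemma rV_consK : cancel rV_cons rV_uncons.
Proof.
move=> [a v]; rewrite /rV_uncons /rV_cons row_mxKr; congr pair.
case: (split01 ord0) => [->|[j /(congr1 val)//]].
by rewrite [LHS]row_mxEl mxE.
Qed.

Lemma measurable_rV_cons : measurable_fun setT rV_cons.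
Proof.
apply/measurable_fun_rVP => i.
case: (split01 i) => [->|[j ->]].
- rewrite (_ : _ \o _ = fst); first exact: measurable_fst.
  by apply/funext => p; rewrite /= /rV_coord [LHS]row_mxEl mxE.
- rewrite (_ : _ \o _ = rV_coord j \o snd).
    by apply: measurableT_comp => //; exact: measurable_rV_coord.
  by apply/funext => p; rewrite /= /rV_coord [LHS]row_mxEr.
Qed.

Lemma measurable_rV_uncons : measurable_fun setT rV_uncons.
Proof.
apply/measurable_fun_pairP; split; first exact: measurable_rV_coord.
apply/measurable_fun_rVP => i.
rewrite (_ : _ \o _ = rV_coord (rshift 1 i : 'I_n.+1)).
  exact: measurable_rV_coord.
by apply/funext => x; rewrite /= /rV_coord mxE.
Qed.

Variable mu : {sigma_finite_measure set 'rV[R]_n -> \bar R}.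

Definition lebesgue_cons : set 'rV[R]_n.+1 -> \bar R :=
  pushforward (@lebesgue_measure R \x mu)%E rV_cons.

Let lebesgue_cons0 : lebesgue_cons set0 = 0%E.
Proof. by rewrite /lebesgue_cons /pushforward preimage_set0 measure0. Qed.

Let lebesgue_cons_ge0 A : (0 <= lebesgue_cons A)%E.
Proof. by rewrite /lebesgue_cons /pushforward; exact: measure_ge0. Qed.

Let lebesgue_cons_sigma_additive : semi_sigma_additive lebesgue_cons.
Proof.
apply: (@measure_semi_sigma_additive _ _ _
  (pushforward (@lebesgue_measure R \x mu)%E rV_cons)).
exact: measurable_rV_cons.
Qed.

HB.instance Definition _ := isMeasure.Build _ _ _ lebesgue_cons
  lebesgue_cons0 lebesgue_cons_ge0 lebesgue_cons_sigma_additive.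

Let sigma_finite_lebesgue_cons : sigma_finite setT lebesgue_cons.
Proof.
have [F FT Ffin] := product_sigma_finite (@lebesgue_measure R) mu.
exists (fun k => rV_uncons @^-1` F k).
  by rewrite -preimage_bigcup -FT preimage_setT.
move=> k; have [mF Foo] := Ffin k; split.
  by rewrite -[X in measurable X]setTI; exact: measurable_rV_uncons.
rewrite /lebesgue_cons /pushforward -comp_preimage.
rewrite (_ : _ \o _ = id); first by rewrite preimage_id.
by apply/funext => p; rewrite /= rV_consK.
Qed.

HB.instance Definition _ := Measure_isSigmaFinite.Build _ _ _ lebesgue_cons
  sigma_finite_lebesgue_cons.

End rV_cons.

Fixpoint rV_lebesgue (R : realType) (n : nat) :
    {sigma_finite_measure set 'rV[R]_n -> \bar R} :=
  match n with
  | 0 => \d_(0 : 'rV[R]_0)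
  | n'.+1 => lebesgue_cons (rV_lebesgue R n')
  end.

Lemma measurable_rV_box (R : realType) n (A : 'I_n -> set (measurableTypeR R)) :
  (forall i, measurable (A i)) ->
  measurable [set x : 'rV[R]_n | forall i, A i (x ord0 i)].
Proof.
move=> mA.
rewrite (_ : [set _ | _] = \bigcap_(i in setT) (rV_coord i @^-1` A i)); last first.
  by apply/seteqP; split => x /= h i; [move=> _|]; exact: h.
apply: fin_bigcap_measurable => // i _.
by rewrite -[X in measurable X]setTI; exact: measurable_rV_coord.
Qed.

Lemma rV_lebesgue_box (R : realType) n (A : 'I_n -> set (measurableTypeR R)) :
  (forall i, measurable (A i)) ->
  rV_lebesgue R n [set x | forall i, A i (x ord0 i)] =
  (\prod_(i < n) lebesgue_measure (A i))%E.
Proof.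
elim: n A => [|n IH] A mA.
  by rewrite big_ord0 /= diracE mem_set //= => -[].
rewrite big_ord_recl -(IH (fun i => A (lift ord0 i))) => [|i]; last exact: mA.
rewrite /= /lebesgue_cons /pushforward.
rewrite -product_measure1E; [|exact: mA|exact: (@measurable_rV_box R n (fun i => A (lift ord0 i)) (fun i => mA _))].
have coordE p (i : 'I_n.+1) : rV_cons p ord0 i =
    if unlift ord0 i is Some j then p.2 ord0 j else p.1.
  case: unliftP => [j ->|->].
  - rewrite (_ : lift ord0 j = rshift 1 j :> 'I_(1 + n)); last exact/val_inj.
    by rewrite [LHS]row_mxEr.
  - rewrite (_ : ord0 = lshift n (ord0 : 'I_1) :> 'I_(1 + n)); last exact/val_inj.
    by rewrite [LHS]row_mxEl mxE.
congr (product_measure1 _ _ _); apply/seteqP; split => -[a v] /= h.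
- split; first by have := h ord0; rewrite coordE unlift_none.
  by move=> i; have := h (lift ord0 i); rewrite coordE liftK.
- case: h => h0 h1 i; rewrite coordE.
  by case: unliftP => [j|] ->; [exact: h1|exact: h0].
Qed.

Section geometry.
Variables (R : realType) (d : nat).
Implicit Types (x y v : 'rV[R]_d) (U : set 'rV[R]_d).

(* The library norm `|x| on 'rV[R]_d is the sup norm. *)
Definition enorm v : R := Num.sqrt (\sum_i v ord0 i ^+ 2).

Definition opnorm (M : 'M[R]_d) : R :=
  sup [set enorm (v *m M^T) | v in [set v | enorm v <= 1]].

Definition domain U := open U /\ connected U.

Definition boundary U : set 'rV[R]_d := closure U `\` interior U.

(* Extended-real valued, so that the distance to the empty set is +oo. *)
Definition bdist U x : \bar R :=
  ereal_inf [set (enorm (x - y))%:E | y in boundary U].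

Definition collar U (r : R) : set 'rV[R]_d :=
  [set x | U x /\ (bdist U x < r%:E)%E].

(* d_Gamma^s, used only on the collars, where the distance is finite. *)
Definition bweight U (s : R) x : R := fine (bdist U x) `^ s.

End geometry.

Section test_functions.
Variables (R : realType) (d : nat).
Implicit Types (U : set 'rV[R]_d) (phi : 'rV[R]_d -> R[i]).

Definition partial (i : 'I_d) (f : 'rV[R]_d -> R) : 'rV[R]_d -> R :=
  'D_(delta_mx ord0 i) f.

Definition cpartial (i : 'I_d) phi : 'rV[R]_d -> R[i] := fun x =>
  Complex (partial i (fun y => complex.Re (phi y)) x)
          (partial i (fun y => complex.Im (phi y)) x).

Fixpoint Ck (k : nat) (f : 'rV[R]_d -> R) : Prop :=
  match k with
  | 0 => continuous f
  | k'.+1 => continuous f /\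
      forall i, (forall x, derivable f x (delta_mx ord0 i)) /\
                Ck k' (partial i f)
  end.

(* C_c^k(U): functions are extended by 0 outside of U. *)
Definition Cck (k : nat) U phi : Prop :=
  [/\ Ck k (fun x => complex.Re (phi x)),
      Ck k (fun x => complex.Im (phi x)),
      compact (closure [set x | phi x != 0]) &
      closure [set x | phi x != 0] `<=` U].

Definition Ccoo U phi : Prop := forall k, Cck k U phi.

Definition sqgrad phi (x : 'rV[R]_d) : R := \sum_i normc (cpartial i phi x) ^+ 2.

End test_functions.

Section hardy.
Variables (R : realType) (d : nat).
Local Open Scope ereal_scope.

Definition hardy (U : set 'rV[R]_d) (delta r b : R) : Prop :=
  forall psi, Cck 1 (collar U r) psi ->
    (b ^+ 2)%:E * \int[rV_lebesgue R d]_(x in collar U r)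
                     (bweight U (delta - 2) x * normc (psi x) ^+ 2)%:E
    <= \int[rV_lebesgue R d]_(x in collar U r)
          (bweight U delta x * sqgrad psi x)%:E.

Definition hardy_constant (U : set 'rV[R]_d) (delta r0 : R) : \bar R :=
  ereal_sup [set b%:E | b in [set b : R |
    (0 < b)%R /\ exists2 r : R, (0 < r <= r0)%R & hardy U delta r b]].

End hardy.

Section L2.
Variables (R : realType) (d : nat) (U : set 'rV[R]_d).
Implicit Types (u v f g : 'rV[R]_d -> R[i]).

Definition L2sq f : \bar R :=
  (\int[rV_lebesgue R d]_(x in U) (normc (f x) ^+ 2)%:E)%E.

Definition L2 f : Prop :=
  [/\ measurable_fun U (fun x => complex.Re (f x) : measurableTypeR R),
      measurable_fun U (fun x => complex.Im (f x) : measurableTypeR R) &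
      (L2sq f < +oo)%E].

Definition L2dot f g : R[i] :=
  Complex (\int[rV_lebesgue R d]_(x in U) complex.Re (f x * conjc (g x)))
          (\int[rV_lebesgue R d]_(x in U) complex.Im (f x * conjc (g x))).

Definition L2cvg (un : nat -> 'rV[R]_d -> R[i]) u : Prop :=
  L2sq (fun x => un n x - u x) @[n --> \oo] --> 0%E.

(* Operators are given by their graphs: A u f stands for "u belongs to the
   domain of A and A u = f".  Graphs relate functions rather than classes
   modulo a.e. equality; closures and adjoints are saturated for the latter. *)
Notation graph := (('rV[R]_d -> R[i]) -> ('rV[R]_d -> R[i]) -> Prop).

Definition op_closure (A : graph) : graph := fun u f =>
  [/\ L2 u, L2 f & exists un fn,
    [/\ forall n, A (un n) (fn n), L2cvg un u & L2cvg fn f]].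

Definition op_adjoint (A : graph) : graph := fun v g =>
  [/\ L2 v, L2 g & forall u f, A u f -> L2dot f v = L2dot u g].

Definition densely_defined (A : graph) : Prop :=
  forall u, L2 u -> exists un fn, (forall n, A (un n) (fn n)) /\ L2cvg un u.

Definition self_adjoint (A : graph) : Prop :=
  densely_defined A /\ forall u f, A u f <-> op_adjoint A u f.

Definition div_form (C : 'rV[R]_d -> 'M[R]_d) (phi : 'rV[R]_d -> R[i]) :
    'rV[R]_d -> R[i] := fun x =>
  - \sum_k cpartial k (fun y => \sum_l (C y k l)%:C%C * cpartial l phi y) x.

(* The coefficients being Lipschitz, div_form C phi is defined almost
   everywhere only. *)
Definition minimal_op (C : 'rV[R]_d -> 'M[R]_d) : graph := fun phi f =>
  [/\ Ccoo U phi, L2 f &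
      {ae rV_lebesgue R d, forall x, U x -> f x = div_form C phi x}].

Definition op_H (C : 'rV[R]_d -> 'M[R]_d) : graph := op_closure (minimal_op C).

End L2.

Section coefficients.
Variables (R : realType) (d : nat).
Implicit Types (U : set 'rV[R]_d) (C : 'rV[R]_d -> 'M[R]_d).

Definition bounded_lipschitz U (f : 'rV[R]_d -> R) : Prop :=
  [bounded f x | x in U] /\ [lipschitz f x | x in U].

Definition posdef (M : 'M[R]_d) : Prop :=
  forall v : 'rV[R]_d, v != 0 -> 0 < (v *m M *m v^T) ord0 ord0.

(* The supremum is taken in [0, +oo]: it is 0 over an empty collar. *)
Definition boundary_condition U C (c : 'rV[R]_d -> R) (delta r0 : R) : Prop :=
  ereal_inf [set ereal_sup (0%E |`
      [set (opnorm (bweight U (- delta) x *: C x - (c x)%:M))%:E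
        | x in collar U r])
    | r in [set r : R | 0 < r <= r0]] = 0%E.

End coefficients.

(* Main.v *)
Require Import Defs.
From HB Require Import structures.
From mathcomp Require Import all_boot all_order all_algebra.
From mathcomp Require Import all_classical all_reals all_analysis measurable_realfun.
From mathcomp.real_closed Require Import complex.
From mathcomp Require Import ring lra.

Set Implicit Arguments.
Unset Strict Implicit.
Unset Printing Implicit Defensive.

Import Order.TTheory GRing.Theory Num.Theory.
Import numFieldNormedType.Exports.
Import ComplexField.Normc.

Local Open Scope classical_set_scope.
Local Open Scope ring_scope.

(* Write H for the minimal operator and d for the distance to the boundary.
   H is nonnegative, so it is essentially self-adjoint as soon as the range of
   H + lam is dense for some lam > 0, i.e. as soon as every v in L2 orthogonal
   to (H + lam) C_c^oo vanishes.  Since C is real, real functions suffice.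
   Such a v is a weak solution of H v = - lam v.  Mollifying it (the
   Friedrichs commutators with the Lipschitz coefficients tend to 0 in L2) and
   testing against eta^2 v gives the Agmon-type bound
     int C grad(eta v).grad(eta v) + lam int (eta v)^2
       <= int v^2 C grad eta.grad eta.
   Near the boundary C is comparable to c d^delta.  For eta ~ d^a with
   a = (2 - delta)/2, C grad eta.grad eta is about a^2 c d^(delta-2) eta^2, and
   the Hardy inequality applied to sqrt(c) eta v bounds the left-hand side
   below by about b^2 int c d^(delta-2) (eta v)^2.  As a < b, the boundary terms
   are absorbed, and all remaining terms are dominated by lam int (eta v)^2
   for lam large, up to errors that vanish when the cutoffs are removed. *)

(** * Topology and Lebesgue measure on row vectors *)

(** The exponent $a = (2-\delta)/2$ is the one for which $d^\delta |\nabla d^a|^2 = a^2$ is bounded.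
    The zone where the cutoff is switched on therefore costs only a fixed multiple of the integral
    of $v^2$ over a collar that shrinks to the boundary, and this tends to 0 without any decay rate
    of $v$. The Hardy weight is $d^{\delta-2} = d^{-2a}$, the square of the inverse of the same
    power. The order of the limits is forced. The commutator error carries a constant that depends
    on the cutoff, because $C$ is uniformly elliptic only on compact subsets of $\Omega$. So the
    mollification is removed first with the cutoff fixed; the level of the cutoff tends to 0 and its
    radius to infinity only afterwards, in a bound whose constants are uniform in both. Each
    approximation (of $C$ by $c d^\delta$, the smoothing of $d$ and of $\sqrt c$, Young's
    inequality) loses a factor $1 \pm t$. Together they require $a^2 (1+t)^6 \le (1-t)^7 b^2$, which
    the strict inequality $a < b$ permits for some $t > 0$. *)

Section rV_topology.
Variables (R : realType) (d : nat).
Local Notation V := 'rV[R]_d.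

Lemma rV_ballE (x : V) (e : R) : 0 < e ->
  ball x e = [set y : V | forall i, ball (x ord0 i) e (y ord0 i)].
Proof.
move=> e0; apply/seteqP; split => y.
  by move=> [_ h] i; exact: h.
by move=> h; split => // i j; rewrite (ord1 i); exact: h.
Qed.

(** Sup-norm balls are boxes, hence measurable, and the balls of rational centre and radius 1/(n+1)
    contained in [A] cover it. [B] sends all other pairs to the empty set, so that the union runs
    over a whole countable type. *)
Lemma open_measurable_rV (A : set V) : open A -> measurable A.
Proof.
move=> oA.
pose f (q : 'rV[rat]_d) : V := map_mx ratr q.
pose B (p : 'rV[rat]_d * nat) : set V :=
  if asbool (ball (f p.1) p.2.+1%:R^-1 `<=` A) then ball (f p.1) p.2.+1%:R^-1
  else set0.
have -> : A = \bigcup_p B p.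
  apply/seteqP; split => [x Ax|x [p _]]; last first.
    by rewrite /B; case: asboolP => // h; exact: h.
  have /nbhs_ballP[e /= e0 xeA] : nbhs x A by exact: open_nbhs_nbhs.
  have [n ne] : exists n : nat, n.+1%:R^-1 < e / 2.
    have e20 : 0 < e / 2 by rewrite divr_gt0.
    have [n _ hn] := near_infty_natSinv_lt (PosNum e20).
    by exists n; apply: hn => /=.
  have /choice[q hq] : forall i : 'I_d, exists q : rat,
      ball (x ord0 i) n.+1%:R^-1 (ratr q : R).
    move=> i; have xl : x ord0 i < x ord0 i + n.+1%:R^-1 by rewrite ltrDl invr_gt0.
    have [q] := rat_in_itvoo xl; rewrite in_itv /= => /andP[q1 q2].
    exists q; rewrite /ball /= ltr_distlC; apply/andP; split => //.
    by rewrite (lt_trans _ q1)// gtrBl.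
  exists (\row_i q i, n) => //; rewrite /B /=.
  have qx : ball (f (\row_i q i)) n.+1%:R^-1 x.
    rewrite rV_ballE ?invr_gt0//= => i; apply: ball_sym.
    by rewrite !mxE; exact: hq.
  case: asboolP => // -[] y qy; apply: xeA.
  apply: (@le_ball _ _ _ (n.+1%:R^-1 + n.+1%:R^-1)).
    by rewrite (splitr e); apply: lerD; exact: ltW.
  by apply: ball_triangle qy; exact: ball_sym.
apply: countable_bigcupT_measurable => [|p]; first exact: countableP.
rewrite /B; case: asboolP => // _; rewrite rV_ballE ?invr_gt0//.
apply: (measurable_rV_box (A := fun i => ball (f p.1 ord0 i) p.2.+1%:R^-1)) => i.
by rewrite ball_itv; exact: measurable_itv.
Qed.

Lemma closed_measurable_rV (A : set V) : closed A -> measurable A.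
Proof.
move=> cA; rewrite -(setCK A); apply: measurableC.
by apply: open_measurable_rV; exact: closed_openC.
Qed.

Lemma continuous_measurable_rV (f : V -> R) :
  continuous f -> measurable_fun setT f.
Proof.
move=> cf; apply: (measurability _ (RGenOpens.measurableE R)).
move=> _ [B [a [b ->]] <-]; rewrite setTI; apply: open_measurable_rV.
by apply: open_comp => //; exact: interval_open.
Qed.

End rV_topology.

Section rV_continuous.
Variables (R : realType) (d : nat).
Local Notation V := 'rV[R]_d.
Implicit Types (f g : V -> R).

Lemma rV_continuousP f : continuous f <->
  forall x e, 0 < e -> exists2 r, 0 < r &
    forall y, `|y - x| < r -> `|f y - f x| <= e.
Proof.
split=> [cf x e e0|h x].
  have /cvgrPdist_le/(_ e e0) h := cf x.
  have /nbhs_ballP[r /= r0 hr] : nbhs x [set y | `|f x - f y| <= e] by exact: h.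
  exists r => // y yx; rewrite distrC; apply: hr.
  by rewrite -ball_normE /ball_ /= distrC.
have Fx := nbhs_filter x.
apply/cvgrPdist_le => e e0; have [r r0 hr] := h x e e0.
have H : nbhs x [set t | `|f x - f t| <= e].
  apply/nbhs_ballP; exists r => //= y.
  by rewrite -ball_normE /ball_ /= => xy; rewrite distrC hr// distrC.
exact: H.
Qed.

Lemma lipschitz_continuous_rV f (L : R) :
  (forall x y, `|f y - f x| <= L * `|y - x|) -> continuous f.
Proof.
move=> lf; apply/rV_continuousP => x e e0.
have L0 : 0 < `|L| + 1 by rewrite ltr_wpDl.
exists (e / (`|L| + 1)); first by rewrite divr_gt0.
move=> y; rewrite ltr_pdivlMr// => h; apply: (le_trans (lf x y)).
apply: (le_trans _ (ltW h)); rewrite mulrC ler_wpM2l//.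
by rewrite (le_trans (ler_norm _))// lerDl.
Qed.

Lemma continuousD_rV f g : continuous f -> continuous g ->
  continuous (fun x => f x + g x).
Proof. by move=> cf cg y; exact: (continuousD (cf y) (cg y)). Qed.

Lemma continuousB_rV f g : continuous f -> continuous g ->
  continuous (fun x => f x - g x).
Proof. by move=> cf cg y; exact: (continuousB (cf y) (cg y)). Qed.

Lemma continuousM_rV f g : continuous f -> continuous g ->
  continuous (fun x => f x * g x).
Proof. by move=> cf cg y; exact: (continuousM (cf y) (cg y)). Qed.

Lemma continuous_cst_rV (a : R) : continuous (fun _ : V => a).
Proof. by move=> y; exact: cst_continuous. Qed.

Lemma continuousZ_rV (a : R) f : continuous f -> continuous (fun x => a * f x).
Proof. by move=> cf; apply: continuousM_rV => //; exact: continuous_cst_rV. Qed.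

Lemma continuous_comp_rV f (h : R -> R) : continuous f -> continuous h ->
  continuous (fun x => h (f x)).
Proof. by move=> cf ch y; exact: (continuous_comp (cf y) (ch _)). Qed.

Lemma continuous_norm_rV f : continuous f -> continuous (fun x => `|f x|).
Proof. by move=> cf; apply: continuous_comp_rV cf _; exact: norm_continuous. Qed.

Lemma continuous_sum_rV (I : finType) (F : I -> V -> R) :
  (forall i, continuous (F i)) -> continuous (fun x => \sum_i F i x).
Proof.
move=> cF; rewrite (_ : (fun x => _) = (fun x => \sum_(i <- index_enum I) F i x))//.
elim: (index_enum I) => [|i s IH].
  by under eq_fun do rewrite big_nil; exact: continuous_cst_rV.
by under eq_fun do rewrite big_cons; exact: continuousD_rV.
Qed.

Lemma continuous_coord_rV i : continuous (fun x : V => x ord0 i).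
Proof. exact: coord_continuous. Qed.

Lemma continuous_translation_rV f (z : V) : continuous f ->
  continuous (fun x : V => f (x + z)).
Proof.
move=> /rV_continuousP cf; apply/rV_continuousP => x e e0.
have [r r0 hr] := cf (x + z) e e0; exists r => // y yx; apply: hr.
by rewrite opprD addrACA subrr addr0.
Qed.

End rV_continuous.

Section translation.
Variable R : realType.

(** A translated half-open interval keeps its length, and these lengths determine Lebesgue
    measure. *)
Lemma lebesgue_translation (z : R) (A : set (measurableTypeR R)) :
  measurable A -> lebesgue_measure ((fun x : R => x + z) @^-1` A) = lebesgue_measure A.
Proof.
move=> mA.
have mf : measurable_fun setT (fun x : measurableTypeR R => (x : R) + z : measurableTypeR R).
  by apply: (@measurable_funD _ _ R setT (@id R) (cst z)).
rewrite [RHS](@lebesgue_measure_unique R (pushforward lebesgue_measure (fun x : measurableTypeR R => (x : R) + z : measurableTypeR R)))//.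
move=> _ [[a b] _ <-] /=.
rewrite -[RHS]/(lebesgue_measure ((fun x : R => x + z) @^-1` `]a, b]%classic)).
have -> : (fun x : R => x + z) @^-1` `]a, b]%classic = `]a - z, b - z]%classic.
  by apply/seteqP; split => x /=; rewrite !in_itv /= ltrBlDr lerBrDr.
by rewrite !lebesgue_measure_itv /= !lte_fin ltrD2r -!EFinB opprB addrA subrK.
Qed.

End translation.

Section rV_measure.
Variables (R : realType) (d : nat).
Local Notation V := 'rV[R]_d.
Local Notation mu := (rV_lebesgue R d).

Definition box (A : 'I_d -> set (measurableTypeR R)) : set V :=
  [set x | forall i, A i (x ord0 i)].

Definition boxes : set (set V) :=
  [set box A | A in [set A | forall i, measurable (A i)]].

Lemma measurable_box A : (forall i, measurable (A i)) -> measurable (box A).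
Proof. exact: measurable_rV_box. Qed.

Lemma measurable_boxes : @measurable _ V = <<s boxes >>.
Proof.
apply/seteqP; split; last first.
  apply: smallest_sub; first exact: sigma_algebra_measurable.
  by move=> _ [A mA <-]; exact: measurable_box.
apply: smallest_sub; first exact: smallest_sigma_algebra.
apply: (big_ind (fun X => X `<=` <<s boxes >>)) => //.
- by move=> X Y hX hY; rewrite subUset; split.
- move=> i _ _ [B mB <-]; apply: sub_gen_smallest.
  exists (fun j => if j == i then B else setT) => [j|]; first by case: ifP.
  rewrite setTI; apply/seteqP; split => x /=.
    by move=> /(_ i); rewrite eqxx.
  by move=> Bx j; case: eqP => // ->.
Qed.

Lemma boxes_setI : setI_closed boxes.
Proof.
move=> _ _ [A mA <-] [B mB <-]; exists (fun i => A i `&` B i).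
  by move=> i; exact: measurableI.
apply/seteqP; split => x /=; first by move=> h; split => i; have [] := h i.
by move=> [h1 h2] i; split; [exact: h1|exact: h2].
Qed.

Lemma rV_norm_le (x : V) (e : R) : 0 <= e ->
  `|x| <= e <-> forall i, `|x ord0 i| <= e.
Proof.
move=> e0; rewrite [`|x|]mx_normrE; split.
  by move=> h i; apply: le_trans h; exact: (le_bigmax _ _ (ord0, i)).
move=> h; apply: bigmax_le => // -[i j] _ /=; rewrite (ord1 i); exact: h.
Qed.

Lemma rV_coord_le (x : V) i : `|x ord0 i| <= `|x|.
Proof. by move: i; exact/rV_norm_le. Qed.

Definition cube (x : V) (e : R) : set V := [set y | `|y - x| <= e].

Lemma cubeE x e : 0 <= e ->
  cube x e = box (fun i => `[x ord0 i - e, x ord0 i + e]%classic).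
Proof.
move=> e0; apply/seteqP; split => y /=.
  by move=> /(rV_norm_le _ e0) h i; rewrite /= in_itv /= -ler_distl; have := h i; rewrite !mxE.
move=> h; apply/(rV_norm_le _ e0) => i; rewrite !mxE ler_distl.
by have := h i; rewrite /= in_itv.
Qed.

Lemma measurable_cube x e : measurable (cube x e).
Proof.
have [e0|e0] := leP 0 e; last first.
  rewrite (_ : cube x e = set0)//; apply/seteqP; split => // y /=.
  by rewrite /cube /= leNgt (lt_le_trans e0 (normr_ge0 _)).
by rewrite cubeE//; apply: measurable_box => i; exact: measurable_itv.
Qed.

Lemma rV_lebesgue_cube x e : 0 <= e -> mu (cube x e) = ((2 * e) ^+ d)%:E.
Proof.
move=> e0; rewrite cubeE// rV_lebesgue_box => [|i]; last exact: measurable_itv.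
rewrite -[X in _ ^+ X]card_ord -prodr_const -prodEFin; apply: eq_bigr => i _.
rewrite lebesgue_measure_itv /= lte_fin.
by case: ltP => h; rewrite -?EFinB; congr (_%:E); lra.
Qed.

Lemma compact_cube x e : compact (cube x e).
Proof.
have [e0|e0] := leP 0 e; last first.
  rewrite (_ : cube x e = set0); first exact: compact0.
  apply/seteqP; split => // y /=.
  by rewrite /cube /= leNgt (lt_le_trans e0 (normr_ge0 _)).
by rewrite cubeE//; apply: rV_compact => i; exact: segment_compact.
Qed.

Lemma bigcup_cube (x : V) : \bigcup_(k : nat) cube x k%:R = setT.
Proof.
apply/seteqP; split => // y _; exists (Num.trunc `|y - x|).+1 => //=.
by rewrite /cube /= ltW// truncnS_gt.
Qed.

Lemma measurable_rV_add (z : V) : measurable_fun setT (fun x : V => x + z).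
Proof.
apply/measurable_fun_rVP => i.
rewrite (_ : _ \o _ = (rV_coord i \+ cst (z ord0 i)) :> (V -> R)); last first.
  by apply/funext => x; rewrite /= /rV_coord mxE.
by apply: measurable_funD => //; exact: measurable_rV_coord.
Qed.

(** Boxes form a generating family stable under intersection, and the cubes centred at 0 exhaust the
    space with finite measure. Agreement on boxes is therefore enough, and there it is
    one-dimensional invariance in each coordinate. *)
Lemma rV_lebesgue_translation (z : V) (A : set V) : measurable A ->
  mu ((fun x => x + z) @^-1` A) = mu A.
Proof.
move=> mA; apply/esym.
have boxes_cube (k : nat) : boxes (cube 0 k%:R).
  rewrite cubeE//.
  by exists (fun i => `[(0 : V) ord0 i - k%:R, (0 : V) ord0 i + k%:R]%classic).
have mz := measurable_rV_add z.
have K := measure_unique boxes (fun k : nat => cube 0 k%:R) measurable_boxes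
  boxes_setI boxes_cube (bigcup_cube 0) mu (pushforward mu (fun x => x + z)).
apply: (K mz) => //.
- move=> _ [B mB <-].
  rewrite -[RHS]/(mu ((fun x => x + z) @^-1` box B)).
  have -> : (fun x => x + z) @^-1` box B =
     box (fun i => (fun x : R => x + z ord0 i) @^-1` B i).
    by apply/seteqP; split => x /= h i; have := h i; rewrite /= !mxE.
  rewrite rV_lebesgue_box; last first.
    move=> i; rewrite -[X in measurable X]setTI.
    have mf : measurable_fun setT ((fun x : R => x + z ord0 i) : measurableTypeR R -> measurableTypeR R).
      by apply: (@measurable_funD _ _ R setT (@id R) (cst (z ord0 i))).
    by apply: mf => //; exact: mB.
  transitivity (\prod_(i < d) lebesgue_measure (B i))%E.
    exact: (rV_lebesgue_box mB).
  by apply: eq_bigr => i _; rewrite lebesgue_translation.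
- move=> k; have h : (mu (cube 0 k%:R) < +oo)%E by rewrite rV_lebesgue_cube// ltry.
  exact: h.
Qed.

End rV_measure.

(** * Square-integrable real functions *)

Section real_integral.
Context d (T : measurableType d) (R : realType) (mu : {measure set T -> \bar R}).
Implicit Types f g : T -> R.

Definition intble f := mu.-integrable [set: T] (EFin \o f).

Lemma le_intble f g : measurable_fun setT f -> (forall x, `|f x| <= g x) ->
  intble g -> intble f.
Proof.
move=> mf fg ig; apply: (le_integrable measurableT _ _ ig).
  exact/measurable_EFinP.
move=> x _ /=; rewrite lee_fin (le_trans (fg x))//; exact: ler_norm.
Qed.

Lemma intbleD f g : intble f -> intble g -> intble (fun x => f x + g x).
Proof. by move=> hf hg; exact: (integrableD measurableT hf hg). Qed.

Lemma intbleB f g : intble f -> intble g -> intble (fun x => f x - g x).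
Proof. by move=> hf hg; exact: (integrableB measurableT hf hg). Qed.

Lemma intbleZ k f : intble f -> intble (fun x => k * f x).
Proof. by move=> hf; exact: (integrableZl measurableT k hf). Qed.

Lemma intbleN f : intble f -> intble (fun x => - f x).
Proof. by move=> hf; under eq_fun do rewrite -mulN1r; exact: intbleZ. Qed.

Lemma intble0 : intble (fun=> 0).
Proof. exact: (integrable0 mu setT). Qed.

Lemma intble_sum (I : finType) (F : I -> T -> R) :
  (forall i, intble (F i)) -> intble (fun x => \sum_i F i x).
Proof.
move=> h; rewrite /intble.
have -> : EFin \o (fun x => \sum_i F i x) = (fun x => (\sum_i (F i x)%:E)%E).
  by apply/funext => x /=; rewrite sumEFin.
by apply: (@integrable_sum _ _ _ mu setT measurableT I (index_enum I) xpredT (fun i x => (F i x)%:E)) => i _; exact: h.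
Qed.

Lemma intble_norm f : intble f -> intble (fun x => `|f x|).
Proof. exact: integrable_norm. Qed.

Lemma intble_ge0 f : measurable_fun setT f -> (forall x, 0 <= f x) ->
  (\int[mu]_x (f x)%:E < +oo)%E -> intble f.
Proof.
move=> mf f0 h; apply/integrableP; split; first exact/measurable_EFinP.
by under eq_integral => x _ do rewrite /= ger0_norm//.
Qed.

Lemma intble_fin f : intble f -> (\int[mu]_x (f x)%:E)%E = (\int[mu]_x f x)%:E.
Proof.
move=> hf; rewrite /Rintegral fineK//; exact: (integrable_fin_num measurableT hf).
Qed.

Lemma RintD f g : intble f -> intble g ->
  \int[mu]_x (f x + g x) = \int[mu]_x f x + \int[mu]_x g x.
Proof. by move=> hf hg; rewrite RintegralD. Qed.

Lemma RintB f g : intble f -> intble g ->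
  \int[mu]_x (f x - g x) = \int[mu]_x f x - \int[mu]_x g x.
Proof. by move=> hf hg; rewrite RintegralB. Qed.

Lemma RintZ k f : intble f -> \int[mu]_x (k * f x) = k * \int[mu]_x f x.
Proof. by move=> hf; rewrite RintegralZl. Qed.

Lemma RintN f : intble f -> \int[mu]_x (- f x) = - \int[mu]_x f x.
Proof.
by move=> hf; under eq_Rintegral do rewrite -mulN1r; rewrite RintZ// mulN1r.
Qed.

Lemma Rint_sum (I : finType) (F : I -> T -> R) :
  (forall i, intble (F i)) ->
  \int[mu]_x (\sum_i F i x) = \sum_i \int[mu]_x F i x.
Proof.
move=> h; apply: EFin_inj; rewrite -intble_fin; last exact: intble_sum.
rewrite -sumEFin; under [RHS]eq_bigr do rewrite -intble_fin//.
under eq_integral do rewrite -sumEFin.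
by rewrite integral_sum.
Qed.

Lemma le_Rint f g : intble f -> intble g -> (forall x, f x <= g x) ->
  \int[mu]_x f x <= \int[mu]_x g x.
Proof. by move=> hf hg fg; apply: le_Rintegral. Qed.

Lemma Rint_ge0 f : (forall x, 0 <= f x) -> 0 <= \int[mu]_x f x.
Proof. by move=> h; apply: Rintegral_ge0. Qed.

Lemma Rint0 : \int[mu]_x (0 : R) = 0.
Proof. by rewrite Rintegral_cst// mul0r. Qed.

Lemma norm_Rint f : intble f -> `|\int[mu]_x f x| <= \int[mu]_x `|f x|.
Proof. by move=> hf; apply: le_normr_Rintegral. Qed.

Lemma Rint_dct (f_ : nat -> T -> R) f g : (forall n, measurable_fun setT (f_ n)) ->
  measurable_fun setT f -> {ae mu, forall x, f_ ^~ x @ \oo --> f x} ->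
  intble g -> (forall n x, `|f_ n x| <= g x) ->
  intble f /\ \int[mu]_x f_ n x @[n --> \oo] --> \int[mu]_x f x.
Proof.
move=> mf_ mf cf ig fg.
have mf_' n : measurable_fun setT (EFin \o f_ n) by exact/measurable_EFinP.
have mf' : measurable_fun setT (EFin \o f) by exact/measurable_EFinP.
have [] := @dominated_convergence _ _ _ mu setT measurableT (fun n => EFin \o f_ n) (EFin \o f) (EFin \o g) mf_' mf'.
- apply: filterS cf => x h _ /=; apply: cvg_EFin => //; exact: nearW.
- exact: ig.
- by apply: aeW => x n _ /=; rewrite lee_fin.
move=> h _ h2; split => //.
rewrite (intble_fin h) in h2; exact: (fine_cvg h2).
Qed.

Lemma Rint_dctW (f_ : nat -> T -> R) f g : (forall n, measurable_fun setT (f_ n)) ->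
  (forall x, f_ ^~ x @ \oo --> f x) ->
  intble g -> (forall n x, `|f_ n x| <= g x) ->
  intble f /\ \int[mu]_x f_ n x @[n --> \oo] --> \int[mu]_x f x.
Proof.
move=> mf_ cf ig fg; apply: (Rint_dct mf_ _ _ ig fg); last exact: aeW.
by apply: measurable_fun_cvg; [exact: mf_|move=> x _; exact: cf].
Qed.

Definition l2 f := measurable_fun setT f /\ intble (fun x => f x ^+ 2).
Definition dot f g : R := \int[mu]_x (f x * g x).

Lemma l2_meas f : l2 f -> measurable_fun setT f. Proof. by case. Qed.

Lemma l2_intble f g : l2 f -> l2 g -> intble (fun x => f x * g x).
Proof.
move=> [mf hf] [mg hg].
apply: (le_intble _ _ (intbleD hf hg)); first exact: measurable_funM.
move=> x; rewrite normrM -(real_normK (num_real (f x))) -(real_normK (num_real (g x))).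
have := sqr_ge0 (`|f x| - `|g x|); have := normr_ge0 (f x); have := normr_ge0 (g x).
by nra.
Qed.

Lemma l2_le f g : measurable_fun setT f -> (forall x, `|f x| <= `|g x|) -> l2 g -> l2 f.
Proof.
move=> mf fg [mg hg]; split => //.
apply: (le_intble _ _ hg); first exact: measurable_funX.
move=> x; rewrite normrX -(real_normK (num_real (g x))).
by rewrite lerXn2r ?nnegrE.
Qed.

Lemma l2Z k f : l2 f -> l2 (fun x => k * f x).
Proof.
move=> [mf hf]; split; first exact: measurable_funM.
by under eq_fun do rewrite exprMn; exact: intbleZ.
Qed.

Lemma l2D f g : l2 f -> l2 g -> l2 (fun x => f x + g x).
Proof.
move=> hf hg; have [mf if_] := hf; have [mg ig] := hg.
split; first exact: measurable_funD.
under eq_fun do rewrite sqrrD -mulr_natl.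
apply: intbleD => //; apply: intbleD => //; apply: intbleZ; exact: l2_intble.
Qed.

Lemma l2N f : l2 f -> l2 (fun x => - f x).
Proof. by move=> hf; under eq_fun do rewrite -mulN1r; exact: l2Z. Qed.

Lemma l2B f g : l2 f -> l2 g -> l2 (fun x => f x - g x).
Proof. by move=> hf hg; apply: l2D => //; exact: l2N. Qed.

Lemma dotC f g : dot f g = dot g f.
Proof. by apply: eq_Rintegral => x _; rewrite mulrC. Qed.

Lemma dotDl f g h : l2 f -> l2 g -> l2 h ->
  dot (fun x => f x + g x) h = dot f h + dot g h.
Proof.
move=> hf hg hh; rewrite /dot -RintD; [|exact: l2_intble..].
by apply: eq_Rintegral => x _; rewrite mulrDl.
Qed.

Lemma dotZl k f h : l2 f -> l2 h -> dot (fun x => k * f x) h = k * dot f h.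
Proof.
move=> hf hh; rewrite /dot -RintZ; last exact: l2_intble.
by apply: eq_Rintegral => x _; rewrite mulrA.
Qed.

Lemma dotNl f h : l2 f -> l2 h -> dot (fun x => - f x) h = - dot f h.
Proof.
by move=> hf hh; rewrite /dot -RintN; [apply: eq_Rintegral => x _; rewrite mulNr|exact: l2_intble].
Qed.

Lemma dotBl f g h : l2 f -> l2 g -> l2 h ->
  dot (fun x => f x - g x) h = dot f h - dot g h.
Proof. by move=> hf hg hh; rewrite dotDl ?dotNl//; exact: l2N. Qed.

Lemma dotDr f g h : l2 f -> l2 g -> l2 h ->
  dot h (fun x => f x + g x) = dot h f + dot h g.
Proof. by move=> ? ? ?; rewrite dotC dotDl// !(dotC h). Qed.

Lemma dotBr f g h : l2 f -> l2 g -> l2 h ->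
  dot h (fun x => f x - g x) = dot h f - dot h g.
Proof. by move=> ? ? ?; rewrite dotC dotBl// !(dotC h). Qed.

Lemma dotZr k f h : l2 f -> l2 h -> dot h (fun x => k * f x) = k * dot h f.
Proof. by move=> ? ?; rewrite dotC dotZl// (dotC h). Qed.

Lemma dot_ge0 f : 0 <= dot f f.
Proof. by apply: Rint_ge0 => x; rewrite -expr2 sqr_ge0. Qed.

Lemma dot_sq f : dot f f = \int[mu]_x f x ^+ 2.
Proof. by apply: eq_Rintegral => x _; rewrite expr2. Qed.

Lemma dotDD f g : l2 f -> l2 g ->
  dot (fun x => f x + g x) (fun x => f x + g x) = dot f f + 2 * dot f g + dot g g.
Proof.
move=> hf hg; rewrite dotDl ?dotDr//; last exact: l2D.
rewrite (dotC g f); ring.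
Qed.

Lemma dotBB f g : l2 f -> l2 g ->
  dot (fun x => f x - g x) (fun x => f x - g x) = dot f f - 2 * dot f g + dot g g.
Proof.
move=> hf hg; rewrite dotBl ?dotBr//; last exact: l2B.
rewrite (dotC g f); ring.
Qed.

Lemma dot_CS f g : l2 f -> l2 g -> dot f g ^+ 2 <= dot f f * dot g g.
Proof.
move=> hf hg.
have key t : 0 <= dot f f + t * 2 * dot f g + t ^+ 2 * dot g g.
  have hz : l2 (fun x => t * g x) by exact: l2Z.
  have := dot_ge0 (fun x => f x + t * g x); rewrite dotDD//.
  rewrite dotZr// dotZl// dotZr//; set a := dot _ _; set b := dot _ _; set c := dot _ _.
  by move=> h; apply: le_trans h _; rewrite le_eqVlt; apply/orP; left; apply/eqP; ring.
have [g0|g0] := eqVneq (dot g g) 0.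
  rewrite g0 mulr0 le_eqVlt; apply/orP; left; rewrite sqrf_eq0.
  apply/negPn/negP => fg0.
  (* Without its quadratic coefficient the polynomial is affine in [t]; at this [t] it takes the
     value -1. *)
  have := key (- (dot f f + 1) / (2 * dot f g)); rewrite g0.
  rewrite (_ : _ / _ * _ * _ = - (dot f f + 1)); last by field.
  by rewrite mulr0; lra.
have gp : 0 < dot g g by rewrite lt0r g0 dot_ge0.
have := key (- dot f g / dot g g).
have -> : dot f f + - dot f g / dot g g * 2 * dot f g + (- dot f g / dot g g) ^+ 2 * dot g g
   = dot f f - dot f g ^+ 2 / dot g g by field.
by rewrite subr_ge0 ler_pdivrMr.
Qed.

Lemma dot_le2 f g : l2 f -> l2 g ->
  dot (fun x => f x + g x) (fun x => f x + g x) <= 2 * (dot f f + dot g g).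
Proof.
move=> hf hg; rewrite dotDD//.
have := dot_ge0 (fun x => f x - g x); rewrite dotBB//; lra.
Qed.

Lemma dot_cvg0 (b : nat -> T -> R) a : l2 a -> (forall n, l2 (b n)) ->
  dot (b n) (b n) @[n --> \oo] --> 0 -> dot a (b n) @[n --> \oo] --> 0.
Proof.
move=> ha hb b0.
have h2 : (dot a (b n)) ^+ 2 @[n --> \oo] --> 0.
  apply: (@squeeze_cvgr _ _ _ _ (cst 0) (fun n => dot a a * dot (b n) (b n))).
  - by apply: nearW => n; rewrite sqr_ge0 dot_CS.
  - exact: cvg_cst.
  - by rewrite -(mulr0 (dot a a)); apply: cvgMr.
have h3 : Num.sqrt ((dot a (b n)) ^+ 2) @[n --> \oo] --> 0.
  rewrite -sqrtr0; apply: continuous_cvg => //; exact: sqrt_continuous.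
apply: norm_cvg0; apply: cvg_trans h3; apply: near_eq_cvg.
by apply: nearW => n /=; rewrite sqrtr_sqr.
Qed.

Lemma dot_cvgD (b : nat -> T -> R) a : l2 a -> (forall n, l2 (b n)) ->
  dot (b n) (b n) @[n --> \oo] --> 0 ->
  dot (fun x => a x + b n x) (fun x => a x + b n x) @[n --> \oo] --> dot a a.
Proof.
move=> ha hb b0; under eq_fun do rewrite dotDD//.
suff h : dot a a + 2 * dot a (b n) + dot (b n) (b n) @[n --> \oo] -->
    dot a a + 2 * 0 + 0 by move: h; rewrite mulr0 !addr0.
apply: cvgD => //; apply: cvgD; first exact: cvg_cst.
by apply: cvgMr; exact: dot_cvg0.
Qed.

Lemma ae_dot f g : measurable_fun setT f -> measurable_fun setT g ->
  {ae mu, forall x, f x = g x} -> dot f f = dot g g.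
Proof.
move=> mf mg fg; rewrite /dot /Rintegral; congr fine.
apply: ae_eq_integral => //.
- by apply/measurable_EFinP/measurable_funM.
- by apply/measurable_EFinP/measurable_funM.
- by apply: filterS fg => x h _; rewrite h.
Qed.

Lemma ae_l2 f g : measurable_fun setT f -> l2 g ->
  {ae mu, forall x, f x = g x} -> l2 f.
Proof.
move=> mf [mg hg] fg; split => //; apply: intble_ge0.
- exact: measurable_funX.
- by move=> x; exact: sqr_ge0.
- rewrite (ae_eq_integral (fun x => (g x ^+ 2)%:E))//; last first.
  + by apply: filterS fg => x h _; rewrite h.
  + by apply/measurable_EFinP/measurable_funX.
  + by apply/measurable_EFinP/measurable_funX.
  by rewrite (intble_fin hg) ltry.
Qed.

End real_integral.

(** Subtracting the tail bound [2 * K * 2^-1 ^+ n] makes the sequence nondecreasing, so the limit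
    comes from monotonicity and boundedness. *)
Lemma geometric_cvg (R : realType) (u : nat -> R) (K : R) :
  (forall n, `|u n.+1 - u n| <= K * 2^-1 ^+ n) ->
  exists2 l, u n @[n --> \oo] --> l & forall n, `|l - u n| <= 2 * K * 2^-1 ^+ n.
Proof.
move=> hu.
have K0 : 0 <= K by have := hu 0%N; rewrite expr0 mulr1; apply: le_trans.
have hk n k : `|u (n + k)%N - u n| <= 2 * K * 2^-1 ^+ n * (1 - 2^-1 ^+ k).
  elim: k => [|k IH]; first by rewrite addn0 !subrr normr0 mulr0.
  rewrite addnS -(subrK (u (n + k)%N) (u _.+1)) -addrA.
  apply: (le_trans (ler_normD _ _)); apply: (le_trans (lerD (hu _) IH)).
  rewrite exprD exprS.
  have : 0 <= K * 2^-1 ^+ n * 2^-1 ^+ k by rewrite !mulr_ge0 ?exprn_ge0 ?invr_ge0.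
  set a := 2^-1 ^+ n; set b := 2^-1 ^+ k => h; rewrite le_eqVlt; apply/orP; left.
  by apply/eqP; field.
have p0 : 2 * K * 2^-1 ^+ n @[n --> \oo] --> 0.
  suff h : 2 * K * 2^-1 ^+ n @[n --> \oo] --> 2 * K * 0 by move: h; rewrite mulr0.
  apply: cvgMr; apply: cvg_expr.
  by rewrite ger0_norm ?invr_ge0// invf_lt1// ltr1n.
pose v n := u n - 2 * K * 2^-1 ^+ n.
have ndv : nondecreasing_seq v.
  apply/nondecreasing_seqP => n; rewrite /v exprS.
  have := hu n; rewrite ler_norml => /andP[h _]; move: h.
  set a := 2^-1 ^+ n; lra.
have cv : cvgn v.
  apply: nondecreasing_is_cvgn => //; exists (u 0%N + 2 * K) => _ [n _ <-].
  have := hk 0%N n; rewrite add0n expr0 mulr1 ler_norml => /andP[_].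
  have : 0 <= K * 2^-1 ^+ n by rewrite mulr_ge0// exprn_ge0// invr_ge0.
  rewrite /v; lra.
have cu : u n @[n --> \oo] --> limn v.
  rewrite (_ : u = (fun n => v n + 2 * K * 2^-1 ^+ n)); last first.
    by apply/funext => n; rewrite /v subrK.
  have h := cvgD cv p0; move: h; rewrite addr0; exact.
exists (limn v) => // n.
have c1 : `|u (n + k)%N - u n| @[k --> \oo] --> `|limn v - u n|.
  apply: cvg_norm; apply: cvgB; last exact: cvg_cst.
  by rewrite (_ : (fun k => u (n + k)%N) = (fun k => u (k + n)%N)); [rewrite cvg_shiftn|apply/funext => k; rewrite addnC].
apply: (cvgr_to_le c1); apply: nearW => k; apply: le_trans (hk n k) _.
by rewrite ler_piMr// ?gerBl ?mulr_ge0 ?exprn_ge0 ?invr_ge0.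
Qed.

(** * Completeness of L2 and a density criterion for subspaces *)

Section l2_projection.
Context d (T : measurableType d) (R : realType) (mu : {measure set T -> \bar R}).
Local Notation l2 := (l2 mu).
Local Notation dot := (dot mu).
Local Notation intble := (intble mu).

(** The passage to a fast subsequence in the Riesz-Fischer theorem is built into the hypothesis:
    squared increments of order [16^-1 ^+ n] leave room for pointwise increments of order
    [2^-1 ^+ n] almost everywhere. *)
Lemma l2_complete (s : nat -> T -> R) (C : R) : (forall n, l2 (s n)) ->
  (forall n, dot (fun x => s n.+1 x - s n x) (fun x => s n.+1 x - s n x)
     <= C * 16^-1 ^+ n) ->
  exists2 w, l2 w &
    dot (fun x => w x - s n x) (fun x => w x - s n x) @[n --> \oo] --> 0.
Proof.
move=> ls hs.
pose D n x := s n.+1 x - s n x.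
have lD n : l2 (D n) by exact: l2B.
have C0 : 0 <= C by have := hs 0%N; rewrite expr0 mulr1; apply: le_trans; exact: dot_ge0.
(* The weight [4 ^+ n] against [16^-1 ^+ n] leaves the summable [4^-1 ^+ n]. Where the sum [G] of
   these terms is finite, [D n] is at most the square root of [G] times [2^-1 ^+ n]. *)
pose F n x := (4 ^+ n * (D n x) ^+ 2)%:E.
have F0 n x : setT x -> (0 <= F n x)%E by move=> _; rewrite /F lee_fin; apply: mulr_ge0; [exact: exprn_ge0|exact: sqr_ge0].
have mF n : measurable_fun setT (F n).
  by apply/measurable_EFinP/measurable_funM => //; apply/measurable_funX/l2_meas/lD.
pose G x := (\sum_(n <oo) F n x)%E.
have mG : measurable_fun setT G by apply: ge0_emeasurable_sum => // k x _ _; exact: F0.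
have G0 x : (0 <= G x)%E by apply: nneseries_ge0 => n _ _; exact: F0.
have iG : (\int[mu]_x G x < +oo)%E.
  rewrite integral_nneseries//.
  have h n : (\int[mu]_x F n x <= (C * 4^-1 ^+ n)%:E)%E.
    have := intbleZ (4 ^+ n) (lD n).2 => h.
    rewrite intble_fin// lee_fin RintZ; last exact: (lD n).2.
    rewrite -dot_sq; apply: (le_trans (ler_wpM2l _ (hs n))); first by rewrite exprn_ge0.
    rewrite mulrCA ler_wpM2l// -exprMn.
    by rewrite (_ : 4 * 16^-1 = 4^-1 :> R); last by field.
  apply: (@le_lt_trans _ _ (\sum_(n <oo) (C * 4^-1 ^+ n)%:E)%E).
    by apply: lee_nneseries => // n _ _; apply: integral_ge0 => x _; exact: F0.
  have q1 : `|4^-1 : R| < 1 by rewrite ger0_norm ?invr_ge0// invf_lt1// ltr1n.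
  have hc : series (geometric C (4^-1)) @ \oo --> C * (1 - 4^-1)^-1 by exact: cvg_geometric_series.
  have -> : (\sum_(n <oo) (C * 4^-1 ^+ n)%:E)%E = (C * (1 - 4^-1)^-1)%:E.
    apply/cvg_lim => //; rewrite (_ : (fun _ => _) = EFin \o series (geometric C 4^-1)).
      by apply: cvg_EFin => //; exact: nearW.
    by apply/funext => n /=; rewrite /series /= -sumEFin.
  exact: ltry.
pose g x := fine (G x).
have ig : intble g.
  apply: intble_ge0.
  - by apply: measurableT_comp => //.
  - by move=> x; exact: fine_ge0.
  - apply: le_lt_trans iG; apply: ge0_le_integral => //.
    + by move=> x _; rewrite lee_fin; exact: fine_ge0.
    + by apply/measurable_EFinP; apply: measurableT_comp => //.
    + by move=> x _; rewrite /g; case: (G x) (G0 x) => //= *; exact: leey.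
have mS : measurable [set x | (G x < +oo)%E].
  rewrite (_ : [set x | _] = setT `&` [set x | (G x < +oo)%E]); last by rewrite setTI.
  by apply: emeasurable_fun_infty_o.
have aeG : {ae mu, forall x, (G x < +oo)%E}.
  have iG' : mu.-integrable setT G.
    by apply/integrableP; split => //; under eq_integral do rewrite gee0_abs//.
  by have := integrable_ae measurableT iG'; apply: filterS => x /(_ I); rewrite ge0_fin_numE.
(* Multiplication by [chi] replaces the sequence by 0 on the null set where [G] is infinite, so that
   the limit exists at every point and is measurable. *)
pose chi : T -> R := \1_[set x | (G x < +oo)%E].
pose t n x := chi x * s n x.
have mchi : measurable_fun setT chi by exact: measurable_indic.
have mt n : measurable_fun setT (t n) by apply: measurable_funM => //; exact: (l2_meas (ls n)).
have ht x : exists2 l, t n x @[n --> \oo] --> l &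
    forall n, `|l - t n x| <= 2 * Num.sqrt (g x) * 2^-1 ^+ n.
  apply: geometric_cvg => n; rewrite /t /chi indicE.
  case: (boolP (x \in _)) => [|_] /=; last first.
    by rewrite !mul0r subrr normr0 mulr_ge0 ?sqrtr_ge0 ?exprn_ge0 ?invr_ge0.
  rewrite inE /= => Gx; rewrite !mul1r -/(D n x).
  have h : 4 ^+ n * D n x ^+ 2 <= g x.
    rewrite -lee_fin /g fineK ?ge0_fin_numE//.
    apply: le_trans (nneseries_lim_ge n.+1 (fun k _ _ => F0 k x I)).
    by rewrite big_nat_recr//= leeDr// sume_ge0// => k _; exact: F0.
  rewrite -sqrtr_sqr.
  have -> : 2^-1 ^+ n = Num.sqrt (4^-1 ^+ n) :> R.
    rewrite -[4^-1](_ : 2^-1 ^+ 2 = _); last by rewrite expr2; field.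
    by rewrite exprAC sqrtr_sqr ger0_norm// exprn_ge0// invr_ge0.
  rewrite -sqrtrM ?fine_ge0// ler_wsqrtr// exprVn ler_pdivlMr ?exprn_gt0//.
  by rewrite mulrC.
have /choice[w hw] : forall x, exists l, t n x @[n --> \oo] --> l /\
    forall n, `|l - t n x| <= 2 * Num.sqrt (g x) * 2^-1 ^+ n.
  by move=> x; have [l h1 h2] := ht x; exists l.
have mw : measurable_fun setT w.
  by apply: measurable_fun_cvg; [exact: mt|move=> x _; exact: (hw x).1].
have hd n x : (w x - t n x) ^+ 2 <= 4 * 4^-1 ^+ n * g x.
  have := (hw x).2 n; rewrite -ler_sqr ?nnegrE ?mulr_ge0 ?sqrtr_ge0 ?exprn_ge0 ?invr_ge0//.
  rewrite real_normK ?num_real// => h; apply: (le_trans h); rewrite !exprMn sqr_sqrtr ?fine_ge0//.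
  rewrite exprAC (_ : 2^-1 ^+ 2 = 4^-1 :> R); last by rewrite expr2; field.
  have -> : 2 ^+ 2 = 4 :> R by rewrite expr2 -natrM.
  by rewrite mulrAC.
have lwt n : l2 (fun x => w x - t n x).
  split; first exact: measurable_funB.
  apply: (@le_intble _ _ _ mu _ (fun x => 4 * 4^-1 ^+ n * g x)).
  - by apply/measurable_funX/measurable_funB.
  - by move=> x; rewrite ger0_norm ?sqr_ge0.
  - exact: intbleZ.
have aet n : {ae mu, forall x, w x - s n x = w x - t n x}.
  apply: filterS aeG => x Gx; rewrite /t /chi indicE mem_set// mul1r//.
have lws n : l2 (fun x => w x - s n x).
  by apply: (ae_l2 _ (lwt n)) => //; apply: measurable_funB => //; exact: (l2_meas (ls n)).
exists w.
  have := l2D (lws 0%N) (ls 0%N); congr l2; apply/funext => x; by rewrite subrK.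
apply: (@squeeze_cvgr _ _ _ _ (cst 0) (fun n => 4 * \int[mu]_x g x * 4^-1 ^+ n)).
- apply: nearW => n; rewrite dot_ge0 /= (@ae_dot _ _ _ mu _ (fun x => w x - t n x))//.
  + rewrite dot_sq mulrAC -RintZ//; apply: le_Rint.
    * exact: (lwt n).2.
    * exact: intbleZ.
    * by move=> x; exact: hd.
  + exact: l2_meas (lws n).
  + exact: l2_meas (lwt n).
- exact: cvg_cst.
- suff h : 4 * (\int[mu]_x g x) * 4^-1 ^+ n @[n --> \oo] --> 4 * (\int[mu]_x g x) * 0.
    by move: h; rewrite mulr0.
  by apply: cvgMr; apply: cvg_expr; rewrite ger0_norm ?invr_ge0// invf_lt1// ltr1n.
Qed.

(** The projection theorem in the form used for density. A sequence in [S] minimising the distance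
    to [y] is Cauchy by the parallelogram law; its limit differs from [y] by a vector orthogonal to
    [S], which has norm 0 by the last hypothesis, so the minimal distance is 0. *)
Lemma l2_projection (S : (T -> R) -> Prop) y : l2 y ->
  (forall f, S f -> l2 f) -> S (fun=> 0) ->
  (forall f g k, S f -> S g -> S (fun x => f x + k * g x)) ->
  (forall z, l2 z -> (forall f, S f -> dot z f = 0) -> dot z z = 0) ->
  exists2 s : nat -> T -> R, forall n, S (s n) &
    dot (fun x => y x - s n x) (fun x => y x - s n x) @[n --> \oo] --> 0.
Proof.
move=> ly lS S0 SD Sperp.
pose D f := dot (fun x => y x - f x) (fun x => y x - f x).
pose E := [set D f | f in [set f | S f]].
have infE : has_inf E.
  split; first by exists (D (fun=> 0)), (fun=> 0).
  by exists 0 => _ [f _ <-]; exact: dot_ge0.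
pose m := inf E.
have mD f : S f -> m <= D f by move=> Sf; apply: (ge_inf infE.2); exists f.
have /choice[s hs] : forall n : nat, exists s, S s /\ D s <= m + 16^-1 ^+ n.
  move=> n; have e0 : 0 < 16^-1 ^+ n :> R by rewrite exprn_gt0// invr_gt0.
  by have [_ [f Sf <-] h] := inf_adherent e0 infE; exists f; split => //; exact: ltW.
have Ss n : S (s n) by have [] := hs n.
have ls n : l2 (s n) by apply: lS.
have [w lw cw] : exists2 w, l2 w &
    dot (fun x => w x - s n x) (fun x => w x - s n x) @[n --> \oo] --> 0.
  (* With [e = 16^-1 ^+ n], the parallelogram law bounds the squared increment by
     [2 * (m + e) + 2 * (m + e / 16) - 4 * m], because the midpoint lies in [S] and so has squared
     distance at least [m]. This is below [4 * e]. *)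
  apply: (@l2_complete s 4) => // n.
  have Sh : S (fun x => 0 + 2^-1 * (s n x + 1 * s n.+1 x)) by apply: (SD) => //; exact: SD.
  have := mD _ Sh; have := (hs n).2; have := (hs n.+1).2; rewrite /D.
  have -> : (fun x => y x - (0 + 2^-1 * (s n x + 1 * s n.+1 x))) =
      (fun x => 2^-1 * ((y x - s n x) + (y x - s n.+1 x))).
    by apply/funext => x; field.
  have la := l2B ly (ls n); have lb := l2B ly (ls n.+1).
  have lab := l2D la lb; rewrite (dotZl _ lab (l2Z 2^-1 lab)) (dotZr _ lab lab) (dotDD la lb).
  have -> : (fun x => s n.+1 x - s n x) = (fun x => (y x - s n x) - (y x - s n.+1 x)).
    by apply/funext => x; ring.
  rewrite (dotBB la lb).
  set a := dot (fun x => y x - s n x) _; set b := dot _ (fun x => y x - s n.+1 x); set c := dot _ (fun x => y x - s n.+1 x).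
  rewrite exprS; set e := 16^-1 ^+ n => h1 h2 h3.
  have e0 : 0 <= e by rewrite exprn_ge0// invr_ge0.
  lra.
pose z x := y x - w x.
have lz : l2 z by exact: l2B.
have ce : m + 16^-1 ^+ n @[n --> \oo] --> m.
  suff h : m + 16^-1 ^+ n @[n --> \oo] --> m + 0 by move: h; rewrite addr0.
  apply: cvgD; first exact: cvg_cst.
  by apply: cvg_expr; rewrite ger0_norm ?invr_ge0// invf_lt1// ltr1n.
have cD : D (s n) @[n --> \oo] --> m.
  apply: (@squeeze_cvgr _ _ _ _ (cst m) (fun n => m + 16^-1 ^+ n)) => //.
  - by apply: nearW => n; rewrite mD//= (hs n).2.
  - exact: cvg_cst.
have lws n : l2 (fun x => w x - s n x) by exact: l2B.
have zm : dot z z = m.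
  apply: (cvg_unique _ (dot_cvgD lz lws cw)) => //.
  rewrite (_ : (fun n => _) = (fun n => D (s n)))//.
  by apply/funext => n; congr dot; apply/funext => x; rewrite /z addrA subrK.
have zS f : S f -> dot z f = 0.
  move=> Sf; have lf := lS _ Sf.
  have key t : m <= m - 2 * t * dot z f + t ^+ 2 * dot f f.
    have ltf : l2 (fun x => t * f x) by exact: l2Z.
    have lzt : l2 (fun x => z x - t * f x) by exact: l2B.
    have := dot_cvgD lzt lws cw.
    rewrite dotBB// zm dotZr// dotZl// dotZr//.
    rewrite (_ : m - _ + _ = m - 2 * t * dot z f + t ^+ 2 * dot f f); last by ring.
    move=> h; apply: (cvgr_to_ge h); apply: nearW => n.
    have := mD _ (SD _ _ t (Ss n) Sf); rewrite /D.
    congr (_ <= dot _ _); apply/funext => x; rewrite /z; ring.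
  have q0 := dot_ge0 mu f.
  (* The natural minimiser divides by [dot f f], which may be 0; with 1 added to the denominator the
     bound still forces [dot z f] to vanish. *)
  have := key (dot z f / (dot f f + 1)).
  set p := dot z f; set q := dot f f in q0 *.
  have q1 : q + 1 != 0 by rewrite gt_eqF// ltr_wpDl.
  have -> : m - 2 * (p / (q + 1)) * p + (p / (q + 1)) ^+ 2 * q =
     m - p ^+ 2 * ((q + 2) / (q + 1) ^+ 2) by field.
  set Y := (q + 2) / _ => h; apply/eqP; rewrite -sqrf_eq0 eq_le sqr_ge0 andbT.
  have Y0 : 0 < Y by rewrite divr_gt0 ?exprn_gt0//; lra.
  by rewrite -(pmulr_lle0 _ Y0); lra.
by exists s => //; rewrite -[X in _ --> X](Sperp z lz zS) zm.
Qed.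

End l2_projection.

(** * Almost everywhere derivatives of Lipschitz functions *)

Lemma ae_imp d (T : measurableType d) (R : realType) (mu : {measure set T -> \bar R})
    (P Q : T -> Prop) : (forall x, P x -> Q x) ->
  {ae mu, forall x, P x} -> {ae mu, forall x, Q x}.
Proof. by move=> PQ; apply: filterS. Qed.

Section half_lipschitz.
Variables (R : realType) (f : R -> R).
Hypothesis lf : forall x y, `|f y - f x| <= 2^-1 * `|y - x|.
Local Notation mu := (@lebesgue_measure R).

(** Since the slopes of [f] are at most 1/2, both [half_up] and [half_down] are nondecreasing, and
    their sum is the identity. Their Stieltjes measures thus add up to Lebesgue measure, which makes
    each of them absolutely continuous. *)
Definition half_up x := f x + 2^-1 * x.
Definition half_down x := 2^-1 * x - f x.

Let cf : continuous f.
Proof.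
move=> x; apply/cvgrPdist_le => e e0; near=> y.
rewrite (le_trans (lf _ _))//.
have : `|x - y| <= e by near: y; apply: cvgr_dist_le => //; exact: cvg_id.
lra.
Unshelve. all: by end_near. Qed.

Let nd_up : {homo half_up : x y / x <= y}.
Proof.
move=> x y xy; rewrite /half_up; have := lf x y.
rewrite [X in 2^-1 * X]ger0_norm ?subr_ge0// ler_norml => /andP[]; lra.
Qed.

Let nd_down : {homo half_down : x y / x <= y}.
Proof.
move=> x y xy; rewrite /half_down; have := lf x y.
rewrite [X in 2^-1 * X]ger0_norm ?subr_ge0// ler_norml => /andP[]; lra.
Qed.

Let cl : continuous (fun x : R => 2^-1 * x).
Proof. by move=> x; apply: cvgMr; exact: cvg_id. Qed.

Let rc_up : forall x, half_up @ at_right x --> half_up x.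
Proof. by apply: right_continuousW => x; apply: cvgD; [exact: cf|exact: cl]. Qed.

Let rc_down : forall x, half_down @ at_right x --> half_down x.
Proof. by apply: right_continuousW => x; apply: cvgB; [exact: cl|exact: cf]. Qed.

HB.instance Definition _ := isCumulative.Build R _ R half_up nd_up rc_up.
HB.instance Definition _ := isCumulative.Build R _ R half_down nd_down rc_down.

Let nu := lebesgue_stieltjes_measure half_up.
Let nu' := lebesgue_stieltjes_measure half_down.

Let nu_itv (a b : R) : a <= b -> nu `]a, b]%classic = (half_up b - half_up a)%:E.
Proof.
move=> ab; rewrite /nu /lebesgue_stieltjes_measure /measure_extension/=.
by rewrite measurable_mu_extE/=; [rewrite wlength_itv_bnd|exact: is_ocitv].
Qed.

Let nu'_itv (a b : R) : a <= b -> nu' `]a, b]%classic = (half_down b - half_down a)%:E.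
Proof.
move=> ab; rewrite /nu' /lebesgue_stieltjes_measure /measure_extension/=.
by rewrite measurable_mu_extE/=; [rewrite wlength_itv_bnd|exact: is_ocitv].
Qed.

Let nu_dom : nu `<< mu.
Proof.
apply/null_content_dominatesP => A mA A0.
have muE : mu A = measure_add nu nu' A.
  apply: lebesgue_measure_unique => // _ [[a b] _ <-].
  rewrite -[[set` _]]/(`]a, b]%classic).
  have [ab|ba] := leP a b; last first.
    by rewrite set_itv_ge ?bnd_simp -?leNgt ?ltW// !measure0.
  transitivity (nu `]a, b]%classic + nu' `]a, b]%classic)%E; last exact: (esym (measure_addE nu nu' _)).
  rewrite nu_itv// nu'_itv// lebesgue_measure_itv /= lte_fin.
  rewrite -EFinD /half_up /half_down.
  case: ltP => h; rewrite -?EFinB; congr (_%:E); lra.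
have h : (nu A <= measure_add nu nu' A)%E by rewrite measure_addE leeDl.
by apply/eqP; rewrite eq_le measure_ge0 andbT (le_trans h)// -muE A0.
Qed.

(** Restriction to a bounded interval makes the Stieltjes measure finite, so its Radon-Nikodym
    density is integrable. Lebesgue differentiation applies to the primitive of the density, and
    inside the interval that primitive is [half_up] up to a constant. *)
Let derivable_up_itv (N : nat) :
  {ae mu, forall x, `]- N%:R, N%:R[%classic x -> derivable half_up x 1}.
Proof.
pose D : set (measurableTypeR R) := `]- N%:R, N%:R]%classic.
have mD : measurable D by exact: measurable_itv.
have Noo : - N%:R <= N%:R :> R by rewrite (@le_trans _ _ 0)// oppr_le0.
have nuD : (nu D < +oo)%E by rewrite nu_itv// ltry.
pose nuN := mfrestr mD nuD.
have nuN_dom : nuN `<< mu.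
  apply/null_content_dominatesP => A mA A0.
  have /null_content_dominatesP dom := nu_dom.
  apply/eqP; rewrite eq_le measure_ge0 andbT -(dom A mA A0).
  by apply: le_measure; rewrite ?inE//; exact: measurableI.
have [h [h0 hfin ih nuE]] := @radon_nikodym_sigma_finite _ _ _ mu nuN nuN_dom.
pose hr x := fine (h x).
have hE : EFin \o hr = h by apply/funext => x /=; rewrite fineK.
have ihr y : mu.-integrable [set` Interval (BRight (- N%:R)) (BRight y)] (EFin \o hr).
  by rewrite hE; apply: (integrableS measurableT) => //.
have lhr : locally_integrable [set: R] hr.
  by apply: open_integrable_locally; [exact: openT|rewrite hE].
have := FTC1 ihr lhr; apply: ae_imp => x hx /=; rewrite in_itv /= => /andP[x1 x2].
have ax : (BRight (- N%:R : R) < BRight (x : R))%O by rewrite bnd_simp.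
have [dF _] := hx ax.
pose F y := \int[mu]_(t in [set` Interval (BRight (- N%:R)) (BRight y)]) hr t.
have FE y : - N%:R <= y <= N%:R -> half_up y = F y + half_up (- N%:R).
  move=> /andP[y1 y2]; apply/eqP; rewrite -subr_eq; apply/eqP.
  apply: EFin_inj; rewrite -nu_itv// /F /Rintegral fineK; last first.
    by apply: integrable_fin_num => //; exact: ihr.
  under eq_integral do rewrite fineK//.
  rewrite -nuE// /nuN /mfrestr /mrestr; congr (nu _).
  apply/seteqP; split => z /=; rewrite !in_itv /=.
    by move=> /andP[z1 zy]; rewrite z1 zy /D /= in_itv /= z1 (le_trans zy y2).
  by move=> [].
have : derivable (fun y => F y + half_up (- N%:R)) x 1.
  exact: (derivableD dF (derivable_cst _ _ _)).
apply: near_eq_derivable.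
near=> y; apply/esym/FE; apply/andP; split.
  by apply: ltW; near: y; exact: lt_nbhsr.
by apply: ltW; near: y; exact: lt_nbhsl.
Unshelve. all: by end_near. Qed.

Lemma half_lipschitz_derivable : {ae mu, forall x, derivable f x 1}.
Proof.
have : {ae mu, forall x, forall N : nat, `]- N%:R, N%:R[%classic x -> derivable half_up x 1}.
  by apply/ae_foralln => N; exact: derivable_up_itv.
apply: ae_imp => x hx.
have -> : f = (fun y => half_up y - 2^-1 * y) by apply/funext => y; rewrite /half_up addrK.
apply: derivableB; last by apply: derivableZ; exact: derivable_id.
apply: (hx (Num.trunc `|x|).+1); rewrite /= in_itv /= -ltr_norml.
exact: truncnS_gt.
Qed.

End half_lipschitz.

Lemma lipschitz_ae_derivable (R : realType) (f : R -> R) (L : R) :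
  (forall x y, `|f y - f x| <= L * `|y - x|) ->
  {ae @lebesgue_measure R, forall x, derivable f x 1}.
Proof.
move=> lf.
pose K := `|L| + 1; have K0 : 0 < K by rewrite ltr_wpDl.
have K2 : 0 < 2 * K by rewrite mulr_gt0.
have hK : forall x y, `|(2 * K)^-1 * f y - (2 * K)^-1 * f x| <= 2^-1 * `|y - x|.
  move=> x y; rewrite -mulrBr normrM gtr0_norm ?invr_gt0// invfM -mulrA.
  rewrite ler_wpM2l ?invr_ge0// ler_pdivrMl//.
  apply: (le_trans (lf x y)); rewrite ler_wpM2r//.
  by rewrite (le_trans (ler_norm _))// lerDl.
apply: ae_imp (half_lipschitz_derivable hK) => x hd.
rewrite (_ : f = (fun y => (2 * K) *: ((2 * K)^-1 * f y))); last first.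
  by apply/funext => y; rewrite /GRing.scale /= mulVKf// gt_eqF.
exact: derivableZ.
Qed.

Section rV_integral.
Variables (R : realType) (d : nat).
Local Notation V := 'rV[R]_d.
Local Notation mu := (rV_lebesgue R d).
Implicit Types f g : V -> R.

Lemma ge0_integral_translation (F : V -> \bar R) (z : V) :
  measurable_fun setT F -> (forall x, 0 <= F x)%E ->
  (\int[mu]_x F (x + z)%R = \int[mu]_x F x)%E.
Proof.
move=> mF F0; have mz := measurable_rV_add z.
have := @ge0_integral_pushforward _ _ _ _ R _ mz mu setT F measurableT mF (fun y _ => F0 y).
rewrite preimage_setT => E; rewrite -[LHS]/(\int[mu]_x (F \o (+%R^~ z)) x)%E -E.
apply: eq_measure_integral => A mA _; exact: rV_lebesgue_translation.
Qed.

Lemma intble_translation f z : intble mu f -> intble mu (fun x => f (x + z)).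
Proof.
move=> /integrableP[mf hf]; apply/integrableP; split.
  by apply: (measurableT_comp mf); exact: measurable_rV_add.
rewrite (@ge0_integral_translation (fun x => `|(EFin \o f) x|%E))//.
exact: measurableT_comp.
Qed.

Lemma Rint_translation f z : intble mu f ->
  \int[mu]_x f (x + z) = \int[mu]_x f x.
Proof.
move=> hf; have mz := measurable_rV_add z; congr fine.
have mf := measurable_int _ hf.
have := @integral_pushforward _ _ _ _ R _ mz mu setT (EFin \o f) mf.
rewrite preimage_setT => /(_ (intble_translation z hf) measurableT) E.
rewrite -[LHS]/(\int[mu]_x ((EFin \o f) \o (+%R^~ z)) x)%E -E.
apply: eq_measure_integral => A mA _; exact: rV_lebesgue_translation.
Qed.

Lemma intble_cube x e : intble mu \1_(cube x e).
Proof.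
have [e0|e0] := leP 0 e; last first.
  rewrite (_ : cube x e = set0) ?indic0; first exact: intble0.
  apply/seteqP; split => // y; rewrite /cube /= leNgt.
  by rewrite (lt_le_trans e0 (normr_ge0 _)).
apply: intble_ge0; first by apply: measurable_indic; exact: measurable_cube.
  by move=> y; rewrite indicE.
rewrite integral_indic//; last exact: measurable_cube.
have := rV_lebesgue_cube x e0; rewrite setIT /= => ->; exact: ltry.
Qed.

Lemma Rint_cube x e : 0 <= e -> \int[mu]_y (\1_(cube x e) y : R) = (2 * e) ^+ d.
Proof.
move=> e0; rewrite /Rintegral integral_indic//; last exact: measurable_cube.
have := rV_lebesgue_cube x e0; rewrite setIT /= => -> //.
Qed.

Lemma intble_bounded_cube f (M r : R) : measurable_fun setT f ->
  (forall x, `|f x| <= M) -> (forall x, ~ cube 0 r x -> f x = 0) -> intble mu f.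
Proof.
move=> mf fM f0; apply: (le_intble mf _ (intbleZ M (intble_cube 0 r))) => x.
rewrite indicE; case: (boolP (x \in cube 0 r)) => [_|].
  by rewrite mulr1.
by rewrite notin_setE => /f0 ->; rewrite normr0 mulr0.
Qed.

End rV_integral.

Section ae_derivable.
Variables (R : realType) (d : nat) (F : 'rV[R]_d -> R) (L : R) (v : 'rV[R]_d).
Local Notation V := 'rV[R]_d.
Local Notation mu := (rV_lebesgue R d).
Hypothesis lF : forall x y, `|F y - F x| <= L * `|y - x|.

Let cF : continuous F.
Proof. exact: lipschitz_continuous_rV lF. Qed.

Let q (h : R) (x : V) : R := h^-1 * (F (h *: v + x) - F x).

Let cq h : continuous (q h).
Proof.
apply: continuousZ_rV; apply: continuousB_rV => //.
under eq_fun do rewrite addrC; exact: continuous_translation_rV.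
Qed.

(** Comparing two difference quotients with each other, instead of with a candidate limit, gives
    sets that are open by continuity of [F]. The set [N] of points of non-differentiability is then
    Borel. *)
Let osc (k n : nat) : set V := [set x | exists h h' : R,
  [/\ 0 < `|h| < n.+1%:R^-1, 0 < `|h'| < n.+1%:R^-1 & k.+1%:R^-1 < `|q h x - q h' x|]].

Let open_osc k n : open (osc k n).
Proof.
rewrite (_ : osc k n = \bigcup_(p in [set p : R * R | (0 < `|p.1| < n.+1%:R^-1) && (0 < `|p.2| < n.+1%:R^-1)])
   [set x | k.+1%:R^-1 < `|q p.1 x - q p.2 x|]); last first.
  apply/seteqP; split => x.
    by move=> [h [h' [h1 h2 h3]]]; exists (h, h') => //=; rewrite h1 h2.
  by move=> [[h h'] /= /andP[h1 h2] h3]; exists h, h'.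
apply: bigcup_open => -[h h'] _ /=.
apply: (@open_comp _ _ (fun x => `|q h x - q h' x|) [set y | k.+1%:R^-1 < y]).
  move=> x _; apply: (@continuous_norm_rV _ _ (fun x => q h x - q h' x)).
  by apply: continuousB_rV; exact: cq.
exact: open_gt.
Qed.

Let N : set V := \bigcup_k \bigcap_n osc k n.

Let mN : measurable N.
Proof.
apply: bigcup_measurable => k _; apply: bigcap_measurable => // n _.
by apply: open_measurable_rV; exact: open_osc.
Qed.

Let derivableE x : derivable F x v <-> cvg (q h x @[h --> 0^']).
Proof. by []. Qed.

Let derivable_notN x : derivable F x v -> ~ N x.
Proof.
move=> /derivableE /cvg_ex[l /= hl] [k _ hk].
have e0 : 0 < k.+1%:R^-1 / 2 :> R by rewrite divr_gt0// invr_gt0.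
move/cvgrPdist_le : hl => /(_ _ e0).
move=> [r /= r0 hr].
have [n _ hn] := near_infty_natSinv_lt (PosNum r0).
have [h [h' [/andP[h0 h1] /andP[h'0 h'1] hh]]] := hk n I.
have n1 : n.+1%:R^-1 < r by apply: (hn n) => /=.
have := hr h; rewrite /ball /= sub0r normrN -normr_gt0 => /(_ (lt_trans h1 n1) h0) a1.
have := hr h'; rewrite /ball /= sub0r normrN -normr_gt0 => /(_ (lt_trans h'1 n1) h'0) a2.
have : `|q h x - q h' x| <= k.+1%:R^-1.
  rewrite (splitr k.+1%:R^-1) (_ : _ - _ = (l - q h' x) - (l - q h x)); last by ring.
  by apply: (le_trans (ler_normB _ _)); rewrite lerD.
by rewrite leNgt hh.
Qed.

Let notN_derivable x : ~ N x -> derivable F x v.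
Proof.
move=> Nx; apply/derivableE; apply: cauchy_cvg; apply/cauchy_ballP => e e0.
have [k _ hk] := near_infty_natSinv_lt (PosNum e0).
have [n hn] : exists n, ~ osc k n x.
  by apply: contrapT => h; apply: Nx; exists k => // n _; apply: contrapT => h2; apply: h; exists n.
have hnear : \forall h \near (0:R)^', 0 < `|h| < n.+1%:R^-1.
  exists n.+1%:R^-1 => /=; first by rewrite invr_gt0.
  by move=> h /=; rewrite sub0r normrN => h1 h2; rewrite normr_gt0 h2.
have : \forall a & b \near (q h x @[h --> (0:R)^']), ball a e b.
  pose P := q^~ x @` [set h : R | 0 < `|h| < n.+1%:R^-1].
  exists (P, P) => /=.
    by split; rewrite /= near_simpl; apply: filterS hnear => h hh; exists h.
  move=> [a b] /= [[h hh <-] [h' hh' <-]]; rewrite /ball /= ltNge; apply/negP => he.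
  apply: hn; exists h, h'; split => //.
  by apply: lt_le_trans he; apply: hk => /=.
by [].
Qed.

Let slice_null x : {ae @lebesgue_measure R, forall t : R, ~ N (t *: v + x)}.
Proof.
have h1 : forall s t, `|F (t *: v + x) - F (s *: v + x)| <= (L * `|v|) * `|t - s|.
  move=> s t; apply: (le_trans (lF _ _)).
  by rewrite opprD addrACA subrr addr0 -scalerBl normrZ mulrA mulrAC.
apply: ae_imp (lipschitz_ae_derivable h1) => t ht; apply: derivable_notN.
move: ht; rewrite /derivable.
set A := (fun h => _); set B := (fun h => _); suff -> : A = B by [].
by apply/funext => h; rewrite /A /B /= [h *: 1]mulr1 scalerDl addrA.
Qed.

Lemma measurable_derivable_rV : measurable [set x | derivable F x v].
Proof.
rewrite (_ : [set x | _] = ~` N); first exact: measurableC.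
by apply/seteqP; split => x /=; [exact: derivable_notN|exact: notN_derivable].
Qed.

(** Along each line in the direction [v] the set [N] is null by the one-dimensional theorem. The
    indicator of [N] at [t *: v + x], integrated over [t] in the unit interval and over [x], is 0 in
    one order and, by translation invariance, the measure of [N] in the other. *)
Lemma rV_lipschitz_ae_derivable : {ae mu, forall x, derivable F x v}.
Proof.
exists N; split => //; last by move=> x /= h; apply: contrapT => /notN_derivable.
pose I01 : set (measurableTypeR R) := `[0, 1]%classic.
have mI : measurable I01 by exact: measurable_itv.
pose g (p : V * measurableTypeR R) : \bar R := (\1_N ((p.2 : R) *: v + p.1) * \1_I01 p.2)%:E.
have mg : measurable_fun setT g.
  apply/measurable_EFinP/measurable_funM; last first.
    by apply: measurableT_comp => //; exact: measurable_indic.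
  have mN1 : measurable_fun setT (\1_N : V -> R) by exact: measurable_indic.
  apply: (measurableT_comp mN1).
  apply/measurable_fun_rVP => i.
  rewrite (_ : _ \o _ = (fun p : V * measurableTypeR R => (p.2 : R) * v ord0 i + rV_coord i p.1 : R)); last first.
    by apply/funext => p; rewrite /= /rV_coord !mxE.
  apply: measurable_funD.
    by apply: measurable_funM => //; exact: measurable_snd.
  by apply: measurableT_comp => //; exact: measurable_rV_coord.
have g0 p : (0 <= g p)%E by rewrite lee_fin mulr_ge0// indicE.
have := @fubini_tonelli _ _ _ _ R mu (@lebesgue_measure R) g mg g0.
have -> : (\int[mu]_x \int[@lebesgue_measure R]_y g (x, y) = 0)%E.
  apply: integral0_eq => x _.
  rewrite (ae_eq_integral (cst 0%E)) ?integral0//.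
    exact: measurable_fun_pair2 x mg.
  apply: ae_imp (slice_null x) => t ht _; rewrite /g /= indicE memNset// mul0r//.
have -> : (\int[@lebesgue_measure R]_y \int[mu]_x g (x, y) = mu N)%E.
  rewrite (_ : (fun y => _) = (fun y => mu N * (\1_I01 y)%:E)%E); last first.
    apply/funext => t.
    have mNt : measurable_fun setT (fun x : V => (\1_N (t *: v + x))%:E : \bar R).
      apply/measurable_EFinP; under eq_fun do rewrite addrC.
      have mN1 : measurable_fun setT (\1_N : V -> R) by exact: measurable_indic.
      exact: (measurableT_comp mN1 (measurable_rV_add _)).
    rewrite /g /=; under eq_integral do rewrite EFinM.
    rewrite ge0_integralZr//.
    congr (_ * _)%E; under eq_integral do rewrite addrC.
    rewrite (@ge0_integral_translation R d (fun x => (\1_N x)%:E))//.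
    - by rewrite integral_indic// setIT.
    - by apply/measurable_EFinP; exact: measurable_indic.
  rewrite ge0_integralZl//; last first.
    by apply/measurable_EFinP; exact: measurable_indic.
  have l1 : lebesgue_measure I01 = 1%E.
    by rewrite /I01 lebesgue_measure_itv /= lte_fin ltr01 -EFinB subr0.
  rewrite -[RHS]mule1; congr (_ * _)%E; rewrite integral_indic// setIT; exact: l1.
by move=> <-.
Qed.

End ae_derivable.

(** * Integration by parts and translations *)

Section weak_derivative.
Variables (R : realType) (d : nat).
Local Notation V := 'rV[R]_d.
Local Notation mu := (rV_lebesgue R d).

(** Steps 1/(n+1) make the derivative the limit of a sequence, as dominated convergence requires. *)
Definition diffquot (F : V -> R) (v : V) (n : nat) (x : V) : R :=
  n.+1%:R * (F (x + n.+1%:R^-1 *: v) - F x).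

Lemma cvg_harmonic0 : (n.+1%:R^-1 : R) @[n --> \oo] --> (0 : R).
Proof. exact: cvg_harmonic. Qed.

Lemma diffquot_cvg F v x : derivable F x v ->
  diffquot F v n x @[n --> \oo] --> 'D_v F x.
Proof.
move=> h; have c : (fun h => h^-1 *: (F (h *: v + x) - F x)) @ 0^' --> 'D_v F x := h.
have hu : (forall n : nat, n.+1%:R^-1 != 0 :> R) /\ n.+1%:R^-1 @[n --> \oo] --> (0 : R).
  by split=> [n|]; [rewrite invr_neq0|exact: cvg_harmonic0].
have/cvgr_dnbhsP/(_ (fun n => n.+1%:R^-1) hu) := c.
move=> {}c; apply: cvg_trans c => //; apply: near_eq_cvg; apply: nearW => n /=.
by rewrite /diffquot invrK (addrC (_ *: v)).
Qed.

(** The value 0 at points of non-differentiability gives, for a Lipschitz function, a weak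
    derivative that is measurable and bounded everywhere. *)
Definition aederive (F : V -> R) (v : V) (x : V) : R :=
  if `[< derivable F x v >] then 'D_v F x else 0.

Variables (F : V -> R) (L : R) (v : V).
Hypothesis lF : forall x y, `|F y - F x| <= L * `|y - x|.

Lemma norm_diffquot n x : `|diffquot F v n x| <= L * `|v|.
Proof.
rewrite /diffquot normrM ger0_norm// -ler_pdivlMl//.
apply: (le_trans (lF _ _)); rewrite addrAC subrr add0r normrZ.
by rewrite ger0_norm ?invr_ge0// mulrCA.
Qed.

Lemma measurable_diffquot n : measurable_fun setT (diffquot F v n).
Proof.
apply: continuous_measurable_rV; apply: continuousZ_rV; apply: continuousB_rV.
  exact/continuous_translation_rV/(lipschitz_continuous_rV lF).
exact: (lipschitz_continuous_rV lF).
Qed.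

Lemma measurable_aederive : measurable_fun setT (aederive F v).
Proof.
have mD := measurable_derivable_rV v lF.
apply: (@measurable_fun_cvg _ _ _ _ (fun n x => \1_[set x | derivable F x v] x * diffquot F v n x)).
  by move=> n; apply: measurable_funM; [exact: measurable_indic|exact: measurable_diffquot].
move=> x _; rewrite /aederive; case: asboolP => h.
  rewrite indicE mem_set//; under eq_fun do rewrite mul1r.
  exact: diffquot_cvg.
by rewrite indicE memNset//; under eq_fun do rewrite mul0r; exact: cvg_cst.
Qed.

Lemma norm_aederive x : `|aederive F v x| <= L * `|v|.
Proof.
rewrite /aederive; case: asboolP => h; last by rewrite normr0 (le_trans _ (norm_diffquot 0%N 0)).
have c : (`|diffquot F v n x| : R) @[n --> \oo] --> (`|'D_v F x| : R).
  exact: cvg_norm (diffquot_cvg h).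
exact: (cvgr_to_le c (nearW _ (norm_diffquot ^~ x))).
Qed.

Lemma ae_aederive : {ae mu, forall x, derivable F x v /\ 'D_v F x = aederive F v x}.
Proof.
apply: ae_imp (rV_lipschitz_ae_derivable v lF) => x h; split => //.
by rewrite /aederive asboolT.
Qed.

(** Difference quotients have integral 0 by translation invariance, and dominated convergence passes
    this on to the derivative. As all steps are at most 1, every quotient vanishes off the cube
    whose radius is [r] plus the norm of [v]. *)
Lemma Rint_aederive0 r : (forall x, ~ cube 0 r x -> F x = 0) ->
  intble mu (aederive F v) /\ \int[mu]_x aederive F v x = 0.
Proof.
move=> F0.
have cF : continuous F by exact: (lipschitz_continuous_rV lF).
have mF := continuous_measurable_rV cF.
have ig : intble mu (fun x => (L * `|v|) * \1_(cube 0 (r + `|v|)) x).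
  by apply: intbleZ; exact: intble_cube.
have iF : intble mu F.
  apply: (@intble_bounded_cube _ _ _ (`|F 0| + `|L| * `|r|) r) => // x.
  have [xr|xr] := pselect (cube 0 r x); last by rewrite F0// normr0 addr_ge0// mulr_ge0.
  rewrite -(subrK (F 0) (F x)) addrC; apply: (le_trans (ler_normD _ _)); rewrite lerD2l.
  apply: (le_trans (lF _ _)); apply: (le_trans (ler_wpM2r _ (ler_norm L))) => //.
  by rewrite ler_wpM2l// (le_trans xr)// ler_norm.
have L0 : 0 <= L * `|v| by rewrite (le_trans _ (norm_diffquot 0%N 0)).
have [] := @Rint_dct _ _ _ mu (diffquot F v) (aederive F v) (fun x => (L * `|v|) * \1_(cube 0 (r + `|v|)) x) measurable_diffquot measurable_aederive.
- by apply: ae_imp ae_aederive => x [dx <-]; exact: diffquot_cvg.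
- exact: ig.
- move=> n x; rewrite indicE; case: (boolP (x \in _)) => [_|].
    by rewrite mulr1; exact: norm_diffquot.
  rewrite notin_setE /cube /= subr0 => /negP; rewrite -ltNge => xr.
  rewrite mulr0 /diffquot !F0 ?subrr ?mulr0 ?normr0// /cube /= subr0.
    by apply/negP; rewrite -ltNge (le_lt_trans _ xr)// lerDl.
  apply/negP; rewrite -ltNge; rewrite -(ltrD2r `|v|); apply: (lt_le_trans xr).
  rewrite -[leLHS](_ : `|(x + n.+1%:R^-1 *: v) - n.+1%:R^-1 *: v| = _); last by rewrite addrK.
  apply: (le_trans (ler_normB _ _)); rewrite lerD2l normrZ ger0_norm ?invr_ge0//.
  by rewrite ler_piMl// invf_le1// ler1n.
move=> h1 h2.
split => //; have e n : \int[mu]_x diffquot F v n x = 0.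
  rewrite /diffquot RintZ; last by apply: intbleB => //; exact: intble_translation.
  rewrite RintB//; last exact: intble_translation.
  by rewrite Rint_translation// subrr mulr0.
move: h2; rewrite (_ : (fun n => _) = (fun=> 0)); last exact/funext/e.
by move=> h2; apply/esym; exact: (cvg_unique (@Rhausdorff R) (cvg_cst 0) h2).
Qed.

End weak_derivative.

(** * Continuity of translations in L2 *)

Section l2_translation.
Variables (R : realType) (d : nat).
Local Notation V := 'rV[R]_d.
Local Notation mu := (rV_lebesgue R d).
Implicit Types f g : V -> R.

Lemma l2_translation f z : l2 mu f -> l2 mu (fun x => f (x + z)).
Proof.
move=> [mf hf]; split; last exact: (intble_translation z hf).
exact: (measurableT_comp mf (measurable_rV_add z)).
Qed.

Lemma dot_translation f g z : l2 mu f -> l2 mu g ->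
  dot mu (fun x => f (x + z)) (fun x => g (x + z)) = dot mu f g.
Proof. by move=> hf hg; exact: (Rint_translation z (l2_intble hf hg)). Qed.

Definition shiftdiff f z x := f (x + z) - f x.

Lemma l2_shiftdiff f z : l2 mu f -> l2 mu (shiftdiff f z).
Proof. by move=> hf; apply: l2B => //; exact: l2_translation. Qed.

Definition osc2 f z : R := dot mu (shiftdiff f z) (shiftdiff f z).

(** Continuity at 0, in the L2 norm, of the map sending a shift to the shifted function. *)
Definition osc_small f := forall e, 0 < e ->
  exists2 r, 0 < r & forall z : V, `|z| < r -> osc2 f z <= e.

Lemma osc2D f g z : l2 mu f -> l2 mu g ->
  osc2 (fun x => f x + g x) z <= 2 * (osc2 f z + osc2 g z).
Proof.
move=> hf hg; have := dot_le2 (l2_shiftdiff z hf) (l2_shiftdiff z hg).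
apply: le_trans; rewrite /osc2 le_eqVlt; apply/orP; left; apply/eqP.
by congr (dot mu _ _); apply/funext => x; rewrite /shiftdiff; ring.
Qed.

Lemma osc2Z k f z : l2 mu f -> osc2 (fun x => k * f x) z = k ^+ 2 * osc2 f z.
Proof.
move=> hf; have hs := l2_shiftdiff z hf.
rewrite expr2 -mulrA -(dotZr k hs hs) -dotZl//; last exact: l2Z.
by congr (dot mu _ _); apply/funext => x; rewrite /shiftdiff; ring.
Qed.

Lemma osc2_le f z : l2 mu f -> osc2 f z <= 4 * dot mu f f.
Proof.
move=> hf; have := dot_le2 (l2_translation z hf) (l2N hf).
rewrite dot_translation// dotNl//; last exact: l2N.
rewrite dotC dotNl// opprK => h; apply: (le_trans h); lra.
Qed.

Lemma osc_smallD f g : l2 mu f -> l2 mu g -> osc_small f -> osc_small g ->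
  osc_small (fun x => f x + g x).
Proof.
move=> hf hg of_ og e e0; have e4 : 0 < e / 4 by rewrite divr_gt0.
have [r1 r10 h1] := of_ _ e4; have [r2 r20 h2] := og _ e4.
exists (Num.min r1 r2); first by rewrite lt_min r10.
move=> z; rewrite lt_min => /andP[z1 z2]; apply: (le_trans (osc2D z hf hg)).
have := h1 z z1; have := h2 z z2; lra.
Qed.

Lemma osc_smallZ k f : l2 mu f -> osc_small f -> osc_small (fun x => k * f x).
Proof.
move=> hf of_ e e0; have k0 : 0 < k ^+ 2 + 1 by rewrite ltr_wpDl// sqr_ge0.
have [r r0 h] := of_ _ (divr_gt0 e0 k0); exists r => // z zr.
have := h z zr; rewrite osc2Z// ler_pdivlMr// => h1; apply: le_trans h1.
by rewrite mulrC ler_wpM2l ?dot_ge0// lerDl.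
Qed.

Lemma osc_small_lim (s : nat -> V -> R) f : l2 mu f -> (forall n, l2 mu (s n)) ->
  (forall n, osc_small (s n)) ->
  dot mu (fun x => f x - s n x) (fun x => f x - s n x) @[n --> \oo] --> 0 ->
  osc_small f.
Proof.
move=> hf hs os c e e0; have e16 : 0 < e / 16 by rewrite divr_gt0.
have /cvgr_dist_le/(_ _ e16) [n _ hn] := c.
have hfs : l2 mu (fun x => f x - s n x) by exact: l2B.
have dn : dot mu (fun x => f x - s n x) (fun x => f x - s n x) <= e / 16.
  by have := hn n (leqnn n); rewrite /= sub0r normrN ger0_norm ?dot_ge0.
have e4 : 0 < e / 4 by rewrite divr_gt0.
have [r r0 hr] := os n _ e4; exists r => // z zr.
have -> : f = (fun x => s n x + (f x - s n x)) by apply/funext => x; rewrite addrC subrK.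
apply: (le_trans (osc2D z (hs n) hfs)).
have := osc2_le z hfs; have := hr z zr; lra.
Qed.

Lemma l2_indic_bounded (A : set V) r : measurable A -> A `<=` cube 0 r -> l2 mu \1_A.
Proof.
move=> mA Ar; have m1 : measurable_fun setT (\1_A : V -> R) by exact: measurable_indic.
split => //; apply: (@intble_bounded_cube _ _ _ 1 r).
- exact: measurable_funX.
- by move=> x; rewrite indicE; case: (_ \in _); rewrite ?expr1n ?expr0n /= ?normr1 ?normr0.
- by move=> x xr; rewrite indicE memNset ?expr0n// => /Ar.
Qed.

(** A point of an open set stays in it under small shifts, so the overlap of [U] with its translates
    converges by domination. Translation preserves the norm, hence convergence of the overlap is
    convergence in norm. *)
Lemma osc_small_open (U : set V) r : open U -> U `<=` cube 0 r -> osc_small \1_U.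
Proof.
move=> oU Ur e e0; apply: contrapT => H.
have mU := open_measurable_rV oU.
have lU := l2_indic_bounded mU Ur.
have /choice[z hz] : forall n : nat, exists z : V, `|z| < n.+1%:R^-1 /\ e < osc2 \1_U z.
  move=> n; apply: contrapT => h; apply: H; exists n.+1%:R^-1; first by rewrite invr_gt0.
  by move=> z zn; rewrite leNgt; apply/negP => ez; apply: h; exists z.
have mt n : measurable_fun setT (fun x : V => \1_U (x + z n) : R) by exact: (l2_translation (z n) lU).1.
have m1 := lU.1.
have z0 : `|z n| @[n --> \oo] --> (0 : R).
  apply: (@squeeze_cvgr _ _ _ _ (cst 0) (fun n => n.+1%:R^-1)).
  - by apply: nearW => n; rewrite normr_ge0 ltW//; case: (hz n).
  - exact: cvg_cst.
  - exact: cvg_harmonic0.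
have [||_ c] := @Rint_dctW _ _ _ mu (fun n x => \1_U (x + z n) * \1_U x) (fun x => \1_U x * \1_U x)
   (fun x => \1_U x ^+ 2) (fun n => measurable_funM (mt n) m1) _ lU.2 _.
- move=> x; have [xU|xU] := pselect (U x); last first.
    by rewrite !indicE (memNset xU) !mulr0; under eq_fun do rewrite mulr0; exact: cvg_cst.
  have /nbhs_ballP[s /= s0 hs] : nbhs x U by exact: open_nbhs_nbhs.
  have [N _ hN] : \forall n \near \oo, `|z n| < s.
    have /cvgr_dist_lt/(_ s s0) := z0; apply: filterS => n /=.
    by rewrite sub0r normrN normr_id.
  apply: cvg_near_cst; exists N => // n /= Nn.
  congr (_ * _); rewrite !indicE !mem_set//; apply: hs.
  by rewrite -ball_normE /ball_ /= opprD addrA subrr sub0r normrN hN.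
- move=> n x; rewrite !indicE; do 2 case: (_ \in _); rewrite ?mulr1 ?mulr0 ?mul0r ?normr0 ?normr1 ?expr1n ?expr0n//.
have oE n : osc2 \1_U (z n) = 2 * (dot mu \1_U \1_U - dot mu (fun x => \1_U (x + z n)) \1_U).
  rewrite /osc2 /shiftdiff dotBB//; last exact: l2_translation.
  by rewrite dot_translation//; ring.
have : 2 * (dot mu \1_U \1_U - dot mu (fun x => \1_U (x + z n)) \1_U) @[n --> \oo] -->
    2 * (dot mu \1_U \1_U - dot mu \1_U \1_U).
  by apply: cvgMr; apply: cvgB => //; exact: cvg_cst.
rewrite subrr mulr0 => /cvgr_to_ge h.
have : e <= 0 by apply: h; apply: nearW => n; rewrite -oE ltW//; case: (hz n).
by rewrite leNgt e0.
Qed.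

Lemma measurable_rV_open : @measurable _ V = <<s [set U : set V | open U] >>.
Proof.
apply/seteqP; split; last first.
  apply: smallest_sub; first exact: sigma_algebra_measurable.
  by move=> U; exact: open_measurable_rV.
apply: smallest_sub; first exact: smallest_sigma_algebra.
apply: (big_ind (fun X => X `<=` <<s [set U : set V | open U] >>)) => //.
- by move=> X Y hX hY; rewrite subUset; split.
- move=> i _ _ [B mB <-]; rewrite setTI.
  have {mB} : (@RGenOpens.G R).-sigma.-measurable B.
    by rewrite -(RGenOpens.measurableE R); exact: mB.
  move: B; apply: smallest_sub.
    split.
    + by rewrite preimage_set0; exact: sigma_algebra0.
    + move=> A hA; rewrite setTD -preimage_setC; exact: sigma_algebraC.
    + move=> F hF; rewrite preimage_bigcup; exact: sigma_algebra_bigcup.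
  move=> _ [a [b ->]]; apply: sub_gen_smallest.
  apply: open_comp; last exact: interval_open.
  by move=> x _; exact: continuous_coord_rV.
Qed.

(** Open sets are stable under intersection and generate the sigma-algebra, so the vanishing of
    integrals extends from them to all measurable sets by Dynkin induction, inside a ball that keeps
    [f] integrable. Applied to the set where [f] is positive, this makes that set null. *)
Lemma indic_orthogonal_npos f : l2 mu f ->
  (forall r (U : set V), open U -> U `<=` cube 0 r -> dot mu f \1_U = 0) ->
  {ae mu, forall x, ~ 0 < f x}.
Proof.
move=> hf hU.
pose Bl r : set V := ball (0 : V) r.
have oBl r : open (Bl r) by exact: ball_open.
have bB r : Bl r `<=` cube 0 r.
  by move=> x; rewrite /Bl -ball_normE /ball_ /cube /= sub0r normrN subr0 => /ltW.
have mB r : measurable (Bl r) by apply: open_measurable_rV; exact: oBl.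
have lB r A : measurable A -> l2 mu \1_(A `&` Bl r).
  by move=> mA; apply: (@l2_indic_bounded _ r); [exact: measurableI|move=> x [_ /bB]].
have iE r A : measurable A ->
    (\int[mu]_(x in A `&` Bl r) (f x)%:E = (dot mu f \1_(A `&` Bl r))%:E)%E.
  move=> mA; rewrite -intble_fin; last by apply: l2_intble => //; exact: lB.
  rewrite [LHS]integral_mkcond; apply: eq_integral => x _.
  by rewrite patchE indicE; case: ifP; rewrite ?mulr1 ?mulr0.
have iB r A : measurable A -> mu.-integrable (A `&` Bl r) (EFin \o f).
  move=> mA; apply/(integrable_mkcond _ _).2; first exact: measurableI.
  apply: eq_integrable (l2_intble hf (lB r A mA)) => // x _.
  by rewrite /= patchE indicE; case: ifP; rewrite ?mulr1 ?mulr0.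
have hA r A : measurable A -> (\int[mu]_(x in A `&` Bl r) (f x)%:E = 0)%E.
  move=> mA; move: (mA); rewrite measurable_rV_open; apply: (dynkin_induction
    (P := fun A => (\int[mu]_(x in A `&` Bl r) (f x)%:E = 0)%E) measurable_rV_open).
  - by move=> U U' oU oU'; exact: openI.
  - rewrite iE// (hU r)//; first by rewrite setTI; exact: oBl.
    by move=> x [_ /bB].
  - move=> U oU; rewrite iE; last exact: open_measurable_rV.
    rewrite (hU r)//; first by apply: openI => //; exact: oBl.
    by move=> x [_ /bB].
  - move=> S mS hS.
    have : (\int[mu]_(x in setT `&` Bl r) (f x)%:E = 0)%E.
      rewrite iE// (hU r)//; first by rewrite setTI; exact: oBl.
      by move=> x [_ /bB].
    rewrite (_ : setT `&` _ = (S `&` Bl r) `|` (~` S `&` Bl r)); last first.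
      by rewrite -setIUl setUv.
    rewrite integral_setU//.
    + by rewrite hS add0e.
    + exact: measurableI.
    + by apply: measurableI => //; exact: measurableC.
    + by rewrite -setIUl setUv; exact: (measurable_int _ (iB r _ measurableT)).
    + by apply/disj_setPS => x [[Sx _] [Sx' _]].
  - move=> F mF tF hF; rewrite setI_bigcupl integral_bigcup.
    + by apply: eseries0 => i _ _; exact: hF.
    + by apply: trivIset_setIr.
    + by move=> i; exact: measurableI.
    + by rewrite -setI_bigcupl; apply: iB; exact: bigcup_measurable.
have mf := hf.1.
have mP : measurable [set x | 0 < f x].
  rewrite (_ : [set x | _] = setT `&` f @^-1` `]0, +oo[%classic); last first.
    by rewrite setTI; apply/seteqP; split => x /=; rewrite in_itv /= andbT.
  exact: mf.
have key (n : nat) : {ae mu, forall x, ([set x | 0 < f x] `&` Bl n%:R) x -> f x = 0}.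
  have mPn : measurable ([set x | 0 < f x] `&` Bl n%:R) by exact: measurableI.
  have := (ae_eq_integral_abs mu mPn (measurable_int _ (iB n%:R _ mP))).1.
  rewrite (_ : (\int[mu]_(x in _) _)%E = 0%E); last first.
    rewrite -(hA n%:R _ mP); apply: eq_integral => x; rewrite inE => -[/= gx _].
    by rewrite gtr0_norm.
  by move=> /(_ erefl); apply: ae_imp => x h hx; have := h hx => -[].
have : {ae mu, forall x, forall n : nat, ([set x | 0 < f x] `&` Bl n%:R) x -> f x = 0}.
  by apply/ae_foralln => n; exact: key.
apply: ae_imp => x h gx; have gx0 : f x = 0.
  apply: (h (Num.trunc `|x|).+1); split => //.
  by rewrite /Bl -ball_normE /ball_ /= sub0r normrN; exact: truncnS_gt.
by rewrite gx0 ltxx in gx.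
Qed.

Lemma indic_orthogonal_ae f : l2 mu f ->
  (forall r (U : set V), open U -> U `<=` cube 0 r -> dot mu f \1_U = 0) ->
  {ae mu, forall x, f x = 0}.
Proof.
move=> hf hU; have h1 := indic_orthogonal_npos hf hU.
have h2 : {ae mu, forall x, ~ 0 < - f x}.
  apply: indic_orthogonal_npos (l2N hf) _ => r U oU Ur.
  rewrite dotNl ?(hU r)// ?oppr0//.
  by apply: l2_indic_bounded Ur; exact: open_measurable_rV.
apply: (ae_imp _ (filterI h1 h2)) => x /= [/negP + /negP].
by rewrite -!leNgt oppr_le0 => a b; apply/eqP; rewrite eq_le a b.
Qed.

(** The functions with this property form a closed subspace that contains the indicators of bounded
    open sets. Those indicators alone have trivial orthogonal complement, so the subspace is
    everything. *)
Lemma l2_osc_small f : l2 mu f -> osc_small f.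
Proof.
move=> hf; pose S g := l2 mu g /\ osc_small g.
have [] := @l2_projection _ _ _ mu S f hf.
- by move=> g [].
- have l0 : l2 mu (fun=> 0).
    by split; [exact: measurable_cst|under eq_fun do rewrite expr0n; exact: intble0].
  split => // e e0; exists 1 => // z _; rewrite /osc2 /shiftdiff /dot.
  by under eq_Rintegral do rewrite subrr mul0r; rewrite Rint0 ltW.
- move=> g h k [lg og] [lh oh]; split; first by apply: l2D => //; exact: l2Z.
  by apply: osc_smallD => //; [exact: l2Z|exact: osc_smallZ].
- move=> z lz hz.
  have z0 : {ae mu, forall x, z x = 0}.
    apply: indic_orthogonal_ae => // r U oU Ur; apply: hz; split.
      by apply: l2_indic_bounded Ur; exact: open_measurable_rV.
    exact: osc_small_open Ur.
  rewrite (ae_dot lz.1 (measurable_cst (0 : R)) z0) /dot /=.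
  by under eq_Rintegral do rewrite mul0r; exact: Rint0.
move=> s hs c; apply: (osc_small_lim hf _ _ c) => n; by case: (hs n).
Qed.

End l2_translation.

(** * Convolution and mollification *)

Section C1.
Variables (R : realType) (d : nat).
Local Notation V := 'rV[R]_d.
Local Notation mu := (rV_lebesgue R d).
Local Notation e_ i := (delta_mx ord0 i : V).
Implicit Types f g k : V -> R.

Lemma norm_delta_mx (i : 'I_d) : `|e_ i| <= 1.
Proof.
apply/rV_norm_le => // j; rewrite mxE /=.
by case: eqP; rewrite ?normr0 ?normr1.
Qed.

Lemma derivable_line f (x v : V) (t : R) : derivable f (x + t *: v) v ->
  derivable (fun s : R => f (x + s *: v)) t 1 /\
  'D_1 (fun s : R => f (x + s *: v)) t = 'D_v f (x + t *: v).
Proof.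
have E : (fun h : R => h^-1 *: (((fun s : R => f (x + s *: v)) \o shift t) (h *: (1 : R)) - f (x + t *: v)))
   = (fun h : R => h^-1 *: ((f \o shift (x + t *: v)) (h *: v) - f (x + t *: v))).
  apply/funext => h /=; congr (_ *: (f _ - _)).
  by rewrite [h *: 1]mulr1 scalerDl addrCA.
by move=> hd; split; [rewrite /derivable E|rewrite /derive E].
Qed.

Lemma derivable_line0 f (x v : V) : derivable f x v ->
  derivable (fun s : R => f (x + s *: v)) 0 1 /\
  'D_1 (fun s : R => f (x + s *: v)) 0 = 'D_v f x.
Proof.
have E : x + (0 : R) *: v = x by rewrite scale0r addr0.
by move=> df; have := @derivable_line f x v 0; rewrite E => /(_ df).
Qed.

Lemma line_MVT f (x v : V) (B s : R) : (forall t : R, derivable f (x + t *: v) v) ->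
  (forall t : R, `|t| <= `|s| -> `|'D_v f (x + t *: v)| <= B) ->
  `|f (x + s *: v) - f x| <= B * `|s|.
Proof.
move=> hd hB; have B0 : 0 <= B by apply: le_trans (hB 0 _); rewrite ?normr0.
pose phi (t : R) := f (x + t *: v).
have phi0 : phi 0 = f x by rewrite /phi scale0r addr0.
have dphi t : derivable phi t 1 by have [] := derivable_line (hd t).
have ephi (t : R) : is_derive t 1 phi ('D_v f (x + t *: v)).
  by apply: DeriveDef => //; have [] := derivable_line (hd t).
have cphi a b : {within `[a, b], continuous phi}.
  by apply: derivable_within_continuous => t _.
rewrite -phi0 -/(phi s); have [s0|s0|->] := ltgtP s 0.
- have [c cs E] := MVT s0 (fun t _ => ephi t) (cphi _ _).
  rewrite distrC E sub0r normrM normrN; apply: ler_wpM2r => //; apply: hB.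
  by move: cs; rewrite in_itv /= => /andP[? ?]; rewrite !ler0_norm; lra.
- have [c cs E] := MVT s0 (fun t _ => ephi t) (cphi _ _).
  rewrite E subr0 normrM; apply: ler_wpM2r => //; apply: hB.
  by move: cs; rewrite in_itv /= => /andP[? ?]; rewrite !ger0_norm; lra.
- by rewrite subrr normr0 mulr0.
Qed.

(** The coordinates of [x] are replaced by those of [y] one at a time, with the mean value theorem
    on each segment. In the sup norm the intermediate points stay in the cube; the [d] replacements
    give the factor [d]. *)
Lemma C1_lipschitz_cube f (B r : R) x : (forall i x, derivable f x (e_ i)) ->
  (forall i y, cube x r y -> `|partial i f y| <= B) ->
  forall y, cube x r y -> `|f y - f x| <= d%:R * B * `|y - x|.
Proof.
move=> hd hB y yr.
pose z (j : nat) : V := \row_i (if (i < j)%N then y ord0 i else x ord0 i).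
have z0 : z 0%N = x by apply/rowP => i; rewrite mxE.
have zd : z d = y by apply/rowP => i; rewrite mxE ltn_ord.
have r0 : 0 <= r by apply: le_trans yr.
have yxi i : `|y ord0 i - x ord0 i| <= r.
  by have := rV_coord_le (y - x) i; rewrite !mxE => /le_trans; apply.
have step (j : nat) : (j < d)%N -> `|f (z j.+1) - f (z j)| <= B * `|y - x|.
  move=> jd; pose i := Ordinal jd.
  have zE t l : (z j + t *: e_ i) ord0 l - x ord0 l =
      (if (l < j)%N then y ord0 l - x ord0 l else 0) + t * (l == i)%:R.
    by rewrite !mxE /=; case: ifP => _; rewrite ?subrr; [rewrite addrAC|rewrite addrAC subrr].
  have -> : z j.+1 = z j + (y - x) ord0 i *: e_ i.
    apply/rowP => l; rewrite !mxE /= ltnS leq_eqVlt.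
    have [->|li] := eqVneq l i.
      by rewrite /= eqxx /= ltnn mulr1 addrC subrK.
    have -> : (l == j :> nat) = false by apply/negbTE; move: li; rewrite -val_eqE.
    by rewrite /= mulr0 addr0.
  have zr t : `|t| <= `|(y - x) ord0 i| -> cube x r (z j + t *: e_ i).
    move=> tr; apply/rV_norm_le => // l; rewrite [X in `|X|]mxE [(- x) _ _]mxE zE.
    have [->|li] := eqVneq l i.
      by rewrite ltnn add0r mulr1 (le_trans tr)// !mxE.
    by rewrite mulr0 addr0; case: ifP => _ //; rewrite normr0.
  have B0 : 0 <= B.
    by apply: le_trans (hB i x _) => //; rewrite /cube /= subrr normr0.
  apply: (le_trans (@line_MVT _ _ _ B _ _ _)) => [t|t tr|]; [exact: hd|exact/hB/zr|].
  by rewrite ler_wpM2l// rV_coord_le.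
have -> : f y - f x = \sum_(0 <= j < d) (f (z j.+1) - f (z j)).
  by rewrite telescope_sumr// z0 zd.
apply: (le_trans (ler_norm_sum _ _ _)).
rewrite big_mkord -mulrA mulr_natl -[X in _ *+ X](card_ord d) -sumr_const.
by apply: ler_sum => j _; exact: step.
Qed.

Lemma C1_lipschitz f (B : R) : (forall i x, derivable f x (e_ i)) ->
  (forall i x, `|partial i f x| <= B) ->
  forall x y, `|f y - f x| <= d%:R * B * `|y - x|.
Proof.
move=> hd hB x y; apply: (@C1_lipschitz_cube _ _ `|y - x|) => [//|i z _|]; first exact: hB.
exact: lexx.
Qed.

Lemma continuous_bounded_cube f r : continuous f -> (forall x, ~ cube 0 r x -> f x = 0) ->
  exists2 B, 0 <= B & forall x, `|f x| <= B.
Proof.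
move=> cf f0.
have cK : compact (f @` cube 0 r).
  apply: continuous_compact; last exact: compact_cube.
  by apply: continuous_subspaceT => x; exact: cf.
have [M [_ hM]] := compact_bounded cK.
pose B := `|M| + 1; have MB : M < B by rewrite (le_lt_trans (ler_norm M))// ltrDl.
have B0 : 0 <= B by rewrite addr_ge0.
exists B => // x.
have [xr|xr] := pselect (cube 0 r x); last by rewrite f0// normr0.
by apply: (hM B MB); exists x.
Qed.

Lemma derive_near0 f r (x v : V) : (forall x, ~ cube 0 r x -> f x = 0) ->
  ~ cube 0 r x -> 'D_v f x = 0.
Proof.
move=> f0 xr.
have E : {near x, f =1 cst 0}.
  have : nbhs x (~` cube 0 r).
    apply: open_nbhs_nbhs; split => //; apply: closed_openC.
    by apply: compact_closed; [exact: norm_hausdorff|exact: compact_cube].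
  by apply: filterS => y; exact: f0.
by rewrite (near_eq_derive _ E) derive_cst.
Qed.

Definition supp_cube f r := forall x, ~ cube 0 r x -> f x = 0.

Lemma supp_cube_partial i f r : supp_cube f r -> supp_cube (partial i f) r.
Proof. by move=> f0 x xr; exact: derive_near0 f0 xr. Qed.

Lemma C1_supp_lipschitz f r : Ck 1 f -> supp_cube f r ->
  exists2 L, 0 <= L & forall x y, `|f y - f x| <= L * `|y - x|.
Proof.
move=> [cf hf] f0.
have /choice[B hB] : forall i, exists B, 0 <= B /\ forall x, `|partial i f x| <= B.
  move=> i; have [B B0 hB] := continuous_bounded_cube (hf i).2 (supp_cube_partial i f0).
  by exists B.
pose M := \sum_i B i; have M0 : 0 <= M by apply: sumr_ge0 => i _; case: (hB i).
exists (d%:R * M); first by rewrite mulr_ge0.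
apply: C1_lipschitz => [i x|i x]; first exact: (hf i).1.
apply: (le_trans ((hB i).2 x)); rewrite /M (bigD1 i)//= lerDl sumr_ge0// => j _.
by case: (hB j).
Qed.

Lemma Ck_continuous n f : Ck n f -> continuous f. Proof. by case: n => // n []. Qed.

Lemma CkS n f : Ck n.+1 f -> Ck n f.
Proof.
elim: n f => [f []//|n IH f [cf h]]; split => // i; have [h1 h2] := h i.
by split => //; exact: IH.
Qed.

Definition locint f := measurable_fun setT f /\ forall r, intble mu (fun x => \1_(cube 0 r) x * f x).

Lemma l2_locint f : l2 mu f -> locint f.
Proof.
move=> hf; split; first exact: l2_meas hf.
by move=> r; apply: l2_intble => //; apply: (l2_indic_bounded (r := r)) => //; exact: measurable_cube.
Qed.

Lemma bounded_locint f B : measurable_fun setT f -> (forall x, `|f x| <= B) -> locint f.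
Proof.
move=> mf fB; split => // r; apply: (@intble_bounded_cube _ _ _ B r).
- by apply: measurable_funM => //; apply: measurable_indic; exact: measurable_cube.
- move=> x; rewrite indicE; case: (_ \in _); rewrite ?mul1r// mul0r normr0.
  exact: le_trans (fB x).
- by move=> x xr; rewrite indicE memNset// mul0r.
Qed.

Definition conv k f x : R := \int[mu]_y (k (x - y) * f y).

Lemma continuous_sub_l (x : V) k : continuous k -> continuous (fun y : V => k (x - y)).
Proof.
move=> /rV_continuousP ck; apply/rV_continuousP => y e e0.
have [r r0 hr] := ck (x - y) e e0; exists r => // z zy; apply: hr.
by rewrite opprB addrC addrA subrK distrC.
Qed.

Lemma cube_sub (x y : V) e : cube 0 e (x - y) -> cube 0 (`|x| + e) y.
Proof.
rewrite /cube /= !subr0 => h; rewrite -(subKr x y).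
by apply: (le_trans (ler_normB _ _)); rewrite lerD2l.
Qed.

Lemma conv_intble k f e x : continuous k -> supp_cube k e -> locint f ->
  intble mu (fun y => k (x - y) * f y).
Proof.
move=> ck k0 [mf lf].
have [B B0 kB] := continuous_bounded_cube ck k0.
have h := intbleZ B (intble_norm (lf (`|x| + e))).
apply: (le_intble _ _ h).
  by apply: measurable_funM => //; apply: continuous_measurable_rV; exact: continuous_sub_l.
move=> y; rewrite normrM.
have [yx|yx] := pselect (cube 0 e (x - y)); last first.
  by rewrite k0// normr0 mul0r mulr_ge0.
by rewrite indicE mem_set ?mul1r; [exact: ler_wpM2r|exact: cube_sub].
Qed.

Lemma conv_derive k f e i x : Ck 1 k -> supp_cube k e -> locint f ->
  derivable (conv k f) x (e_ i) /\
  partial i (conv k f) x = conv (partial i k) f x.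
Proof.
move=> C1k k0 lf.
have [ck hk] := C1k.
have [D D0 hD] := continuous_bounded_cube (hk i).2 (supp_cube_partial i k0).
pose F (t : R) (y : V) := k ((x - y) + t *: e_ i) * f y.
pose E t := \int[mu]_(y in setT) F t y.
have FE t : E t = conv k f (x + t *: e_ i).
  by apply: eq_Rintegral => y _; rewrite /F addrAC.
have dk (t : R) y : derivable (fun t : R => k ((x - y) + t *: e_ i)) t 1 /\
   'D_1 (fun t : R => k ((x - y) + t *: e_ i)) t = partial i k ((x - y) + t *: e_ i).
  exact: derivable_line ((hk i).1 _).
have dF (t : R) y : derivable (F ^~ y) t 1 /\
   'D_1 (F ^~ y) t = f y * partial i k ((x - y) + t *: e_ i).
  have -> : F ^~ y = f y \*: (fun t : R => k ((x - y) + t *: e_ i)).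
    by apply/funext => s; rewrite /F mulrC.
  have [d1 d2] := dk t y; split; first exact: derivableZ.
  exact: etrans (deriveZ _ d1) (congr1 _ d2).
(* A move of length below 1 along a basis vector enlarges the relevant cube by at most 1: hence a
   dominating function that serves all [t] in the interval. *)
have iG : intble mu (fun y => D * `|\1_(cube 0 (`|x| + 1 + e)) y * f y|).
  by apply: intbleZ; apply: intble_norm; exact: lf.2.
have I0 : `]-1, 1[%classic (0 : R) by rewrite /= in_itv /= ltrN10 ltr01.
have hint (t : R) : `]-1, 1[%classic t -> mu.-integrable setT (EFin \o F t).
  move=> _; have := @conv_intble k f e (x + t *: e_ i) ck k0 lf.
  by congr (intble mu _); apply/funext => y; rewrite /F addrAC.
have hder (t : R) y : `]-1, 1[%classic t -> setT y -> derivable (F ^~ y) t 1.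
  by move=> _ _; exact: (dF t y).1.
have hub (t : R) y : `]-1, 1[%classic t -> setT y ->
    `|partial1of2 F t y| <= D * `|\1_(cube 0 (`|x| + 1 + e)) y * f y|.
  rewrite /= in_itv /= -ltr_norml => t1 _; rewrite partial1of2E (dF t y).2 mulrC normrM normrM mulrA.
  apply: ler_wpM2r => //.
  have [yx|yx] := pselect (cube 0 e ((x - y) + t *: e_ i)); last first.
    by rewrite (supp_cube_partial i k0 yx) normr0 mulr_ge0.
  rewrite indicE mem_set ?normr1 ?mulr1; first exact: hD.
  move: yx; rewrite addrAC => /cube_sub; rewrite /cube /= => h.
  apply: (le_trans h); rewrite lerD2r; apply: (le_trans (ler_normD _ _)); rewrite lerD2l normrZ.
  by rewrite -[leRHS]mulr1; apply: ler_pM => //; [exact: ltW|exact: norm_delta_mx].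
have G0 y : 0 <= D * `|\1_(cube 0 (`|x| + 1 + e)) y * f y| by rewrite mulr_ge0.
have c := @cvg_differentiation_under_integral R _ V mu F setT measurableT 0 (-1) 1 I0 hint hder _ G0 iG hub.
have {}c : (fun h : R => h^-1 *: (conv k f (h *: e_ i + x) - conv k f x)) @ 0^' -->
    conv (partial i k) f x.
  have -> : conv (partial i k) f x = \int[mu]_(y in setT) partial1of2 F 0 y.
    by apply: eq_Rintegral => y _; rewrite partial1of2E (dF 0 y).2 scale0r addr0 mulrC.
  rewrite (_ : (fun h => _) = (fun h : R => h^-1 *: (E (h + 0) - E 0))); first exact: c.
  by apply/funext => h; rewrite !FE addr0 scale0r addr0 (addrC x).
split; first by apply/cvg_ex; exists (conv (partial i k) f x).
exact: (cvg_lim (@Rhausdorff R) c).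
Qed.

Lemma conv_continuous k f e : Ck 1 k -> supp_cube k e -> locint f ->
  continuous (conv k f).
Proof.
move=> C1k k0 lf; apply/rV_continuousP => x eps eps0.
have ck := C1k.1.
have [L L0 hL] := C1_supp_lipschitz C1k k0.
have lr := lf.2 (`|x| + 1 + e).
pose I := \int[mu]_y `|\1_(cube 0 (`|x| + 1 + e)) y * f y|.
have I0 : 0 <= I by apply: Rint_ge0.
have LI : 0 < L * I + 1 by rewrite ltr_wpDl// mulr_ge0.
exists (Num.min 1 (eps / (L * I + 1))); first by rewrite lt_min ltr01 divr_gt0.
move=> z; rewrite lt_min => /andP[z1 z2].
have iz := conv_intble z ck k0 lf; have ix := conv_intble x ck k0 lf.
rewrite /conv -RintB//; apply: (le_trans (norm_Rint (intbleB iz ix))).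
apply: (@le_trans _ _ (L * `|z - x| * I)); last first.
  move: z2; rewrite ltr_pdivlMr// => /ltW; apply: le_trans.
  by rewrite mulrAC mulrC ler_wpM2l// lerDl.
rewrite /I -RintZ; last exact: intble_norm.
apply: le_Rint; [exact/intble_norm/intbleB|exact/intbleZ/intble_norm|].
move=> y; rewrite -mulrBl !normrM mulrA; apply: ler_wpM2r => //.
have [yx|yx] := pselect (cube 0 (`|x| + 1 + e) y).
  rewrite indicE mem_set// normr1 mulr1; apply: (le_trans (hL _ _)).
  by rewrite opprB addrA subrK.
rewrite !k0 ?subrr ?normr0 ?mulr_ge0//.
  by move=> /cube_sub; rewrite /cube /= => h; apply: yx; rewrite /cube /= (le_trans h)// -addrA lerD2l lerDr.
move=> /cube_sub; rewrite /cube /= => h; apply: yx; rewrite /cube /= (le_trans h)// lerD2r.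
rewrite -(subrK x z) addrC; apply: (le_trans (ler_normD _ _)); rewrite lerD2l; exact: ltW.
Qed.

(** One order of differentiability is given up because continuity of the convolution is obtained
    from a Lipschitz kernel, hence from one of class C1. For smooth kernels this costs nothing. *)
Lemma conv_Ck n k f e : Ck n.+1 k -> supp_cube k e -> locint f -> Ck n (conv k f).
Proof.
move=> Ckk k0 lf; elim: n k Ckk k0 => [|n IH] k Ckk k0 /=.
  exact: (conv_continuous Ckk k0 lf).
have C1k : Ck 1 k.
  by elim: n Ckk {IH} => [|n IHn] h; [exact: CkS h|apply: IHn; exact: CkS h].
split; first exact: (conv_continuous C1k k0 lf).
move=> i; split; first by move=> x; have [] := conv_derive i x C1k k0 lf.
have -> : partial i (conv k f) = conv (partial i k) f.
  by apply/funext => x; have [] := conv_derive i x C1k k0 lf.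
apply: IH; last exact: supp_cube_partial.
by have [_ /(_ i)[_]] := Ckk.
Qed.

Definition Cinf f := forall n, Ck n f.

Lemma conv_Cinf k f e : Cinf k -> supp_cube k e -> locint f -> Cinf (conv k f).
Proof. by move=> ck k0 lf n; exact: conv_Ck (ck _) k0 lf. Qed.

End C1.

(** * Fubini's theorem and the averaged oscillation *)

Section fubini_rV.
Variables (R : realType) (d : nat).
Local Notation V := 'rV[R]_d.
Local Notation mu := (rV_lebesgue R d).

Lemma Rint_fubini (G : V -> V -> R) :
  measurable_fun setT (fun p : V * V => G p.1 p.2) ->
  (forall x, intble mu (G x)) -> (forall y, intble mu (G ^~ y)) ->
  (exists2 H : V -> R, intble mu H & forall x, \int[mu]_y `|G x y| <= H x) ->
  [/\ intble mu (fun x => \int[mu]_y G x y), intble mu (fun y => \int[mu]_x G x y) &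
  \int[mu]_x (\int[mu]_y G x y) = \int[mu]_y (\int[mu]_x G x y)].
Proof.
move=> mG i1 i2 [H iH hH].
pose g (p : V * V) := (G p.1 p.2)%:E.
have mg : measurable_fun setT g by exact/measurable_EFinP.
have ig : (mu \x mu)%E.-integrable setT g.
  apply/(integrable12ltyP mu mu mg).2.
  apply: (@le_lt_trans _ _ (\int[mu]_x (H x)%:E)%E); last by rewrite (intble_fin iH) ltry.
  apply: ge0_le_integral => //.
  - by move=> x _; apply: integral_ge0 => y _; exact: abse_ge0.
  - have := @measurable_fun_fubini_tonelli_F _ _ _ _ R mu (fun p => `|g p|%E).
    by apply => //; exact: measurableT_comp.
  - exact: (measurable_int _ iH).
  - move=> x _; apply: le_trans (_ : (\int[mu]_y `|G x y|)%:E <= _)%E; last by rewrite lee_fin.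
    rewrite -intble_fin; last exact: intble_norm.
    by apply: ge0_le_integral => //; [exact: measurableT_comp (measurable_fun_pair2 x mg)|exact: measurable_int _ (intble_norm (i1 x))].
have eF x : (\int[mu]_y g (x, y) = (\int[mu]_y G x y)%:E)%E by rewrite -(intble_fin (i1 x)).
have eG y : (\int[mu]_x g (x, y) = (\int[mu]_x G x y)%:E)%E by rewrite -(intble_fin (i2 y)).
have iF : intble mu (fun x => \int[mu]_y G x y).
  apply: eq_integrable (integrable_fubini_F ig) => // x _.
  by rewrite /fubini_F eF.
have iG : intble mu (fun y => \int[mu]_x G x y).
  have mE : (fun y => \int[mu]_x g (x, y))%E = EFin \o (fun y => \int[mu]_x G x y).
    by apply/funext => y; exact: eG.
  have mg' : measurable_fun setT (fun p => `|g p|%E) by exact: measurableT_comp.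
  apply/integrableP; split.
    by have := measurable_fubini_G ig; rewrite /fubini_G mE.
  apply: le_lt_trans ((integrable12ltyP mu mu mg).1 ig).
  rewrite (@fubini_tonelli _ _ _ _ R mu mu _ mg' (fun=> abse_ge0 _)).
  apply: ge0_le_integral => //.
  - apply: measurableT_comp => //.
    by have := measurable_fubini_G ig; rewrite /fubini_G mE.
  - exact: (@measurable_fun_fubini_tonelli_G _ _ _ _ R mu _ mg' (fun=> abse_ge0 _)).
  - move=> y _; rewrite -[X in `|X|%E]/((EFin \o (fun y => \int[mu]_x G x y)) y) -mE.
    by apply: le_abse_integral => //; exact: measurable_fun_pair1 y mg.
split; [exact: iF|exact: iG|apply: EFin_inj; rewrite -(intble_fin iF) -(intble_fin iG)].
transitivity (\int[mu]_x \int[mu]_y g (x, y))%E.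
  by apply: eq_integral => x _; rewrite eF.
by rewrite (Fubini ig); apply: eq_integral => y _; exact: eG.
Qed.

Lemma measurable_add2 : measurable_fun setT (fun p : V * V => p.1 + p.2).
Proof.
apply/measurable_fun_rVP => i.
rewrite (_ : _ \o _ = (fun p : V * V => rV_coord i p.1 + rV_coord i p.2 : R)); last first.
  by apply/funext => p; rewrite /= /rV_coord mxE.
by apply: measurable_funD; apply: measurableT_comp => //; exact: measurable_rV_coord.
Qed.

Lemma measurable_sub2 : measurable_fun setT (fun p : V * V => p.1 - p.2).
Proof.
apply/measurable_fun_rVP => i.
rewrite (_ : _ \o _ = (fun p : V * V => rV_coord i p.1 - rV_coord i p.2 : R)); last first.
  by apply/funext => p; rewrite /= /rV_coord !mxE.
by apply: measurable_funB; apply: measurableT_comp => //; exact: measurable_rV_coord.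
Qed.

(** The one quantity that bounds both the mollification error and the commutators pointwise. Its L2
    norm tends to 0 with [e] because translations are continuous. *)
Definition kavg (e : R) (v : V -> R) (y : V) : R :=
  ((2 * e) ^+ d)^-1 * \int[mu]_z (\1_(cube 0 e) z * `|v (y + z) - v y|).

Section kavg_lemmas.
Variables (e : R) (v : V -> R).
Hypotheses (e0 : 0 < e) (lv : l2 mu v).

Let c0 : 0 < (2 * e) ^+ d. Proof. by rewrite exprn_gt0// mulr_gt0. Qed.

Let l1 : l2 mu \1_(cube 0 e).
Proof. by apply: (l2_indic_bounded (r := e)) => //; exact: measurable_cube. Qed.

Let lb y : l2 mu (fun z => \1_(cube 0 e) z * `|v (y + z) - v y|).
Proof.
have h1 : l2 mu (fun z => \1_(cube 0 e) z * v (z + y)).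
  apply: (l2_le _ _ (l2_translation y lv)).
    by apply: measurable_funM; [exact: l1.1|exact: (l2_translation y lv).1].
  by move=> z; rewrite indicE; case: (_ \in _); rewrite ?mul1r ?mul0r ?normr0.
have h2 := l2B h1 (l2Z (v y) l1).
apply: (l2_le _ _ h2).
  apply: measurable_funM; first exact: l1.1.
  apply: measurableT_comp => //; apply: measurable_funB => //.
  under eq_fun do rewrite addrC; exact: (l2_translation y lv).1.
by move=> z; rewrite [v y * _]mulrC -mulrBr !normrM normr_id (addrC y).
Qed.

Let mH : measurable_fun setT (fun p : V * V => \1_(cube 0 e) p.2 * `|v (p.1 + p.2) - v p.1|).
Proof.
apply: measurable_funM; first by apply: measurableT_comp => //; exact: l1.1.
apply: measurableT_comp => //; apply: measurable_funB.
  exact: (measurableT_comp lv.1 measurable_add2).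
by apply: measurableT_comp => //; exact: lv.1.
Qed.

Lemma kavg_ge0 y : 0 <= kavg e v y.
Proof.
apply: mulr_ge0; first by rewrite invr_ge0 ltW.
by apply: Rint_ge0 => z; rewrite mulr_ge0// indicE.
Qed.

Lemma measurable_kavg : measurable_fun setT (kavg e v).
Proof.
apply: measurable_funM => //.
have h : measurable_fun setT (fun y : V => (\int[mu]_z ((\1_(cube 0 e) z * `|v (y + z) - v y|)%R)%:E)%E).
  have := @measurable_fun_fubini_tonelli_F _ _ _ _ R mu (fun p : V * V => (\1_(cube 0 e) p.2 * `|v (p.1 + p.2) - v p.1|)%:E).
  by apply => //; exact/measurable_EFinP.
by apply: measurableT_comp h.
Qed.

Lemma kavg_sq y : kavg e v y ^+ 2 <=
  ((2 * e) ^+ d)^-1 * \int[mu]_z (\1_(cube 0 e) z * (v (y + z) - v y) ^+ 2).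
Proof.
have ie : (\1_(cube 0 e) : V -> R) = (fun z => \1_(cube 0 e) z * \1_(cube 0 e) z).
  by apply/funext => z; rewrite indicE; case: (_ \in _); rewrite ?mulr1 ?mulr0.
have := dot_CS l1 (lb y).
have -> : dot mu \1_(cube 0 e) \1_(cube 0 e) = (2 * e) ^+ d.
  by rewrite /dot -(@Rint_cube R d 0 e (ltW e0)); apply: eq_Rintegral => z _; rewrite [in RHS]ie.
have -> : dot mu \1_(cube 0 e) (fun z => \1_(cube 0 e) z * `|v (y + z) - v y|) =
    \int[mu]_z (\1_(cube 0 e) z * `|v (y + z) - v y|).
  by apply: eq_Rintegral => z _; rewrite mulrA; congr (_ * _); rewrite [in RHS]ie.
have -> : dot mu (fun z => \1_(cube 0 e) z * `|v (y + z) - v y|) (fun z => \1_(cube 0 e) z * `|v (y + z) - v y|) =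
    \int[mu]_z (\1_(cube 0 e) z * (v (y + z) - v y) ^+ 2).
  apply: eq_Rintegral => z _; rewrite mulrACA -[`|_| * _]expr2 -normrX ger0_norm ?sqr_ge0//.
  by congr (_ * _); rewrite [in RHS]ie.
rewrite /kavg; move: c0; set I := \int[mu]_z _; set J := \int[mu]_z _; set c := (2 * e) ^+ d.
move=> c_gt0 h; rewrite exprMn expr2 -mulrA ler_pM2l ?invr_gt0//.
by rewrite ler_pdivrMl.
Qed.

(** Cauchy-Schwarz on the cube and then Tonelli bound the squared norm by the mean over the cube of
    the squared translation errors [osc2 v z], each of which is at most [B]. *)
Lemma kavg_l2 B : (forall z, `|z| <= e -> osc2 v z <= B) ->
  l2 mu (kavg e v) /\ dot mu (kavg e v) (kavg e v) <= B.
Proof.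
move=> hB; have mk := measurable_kavg.
pose q (p : V * V) := (\1_(cube 0 e) p.2 * (v (p.1 + p.2) - v p.1) ^+ 2)%:E.
have mq : measurable_fun setT q.
  apply/measurable_EFinP/measurable_funM; first by apply: measurableT_comp => //; exact: l1.1.
  apply: measurable_funX; apply: measurable_funB.
    exact: (measurableT_comp lv.1 measurable_add2).
  by apply: measurableT_comp => //; exact: lv.1.
have q0 p : (0 <= q p)%E by rewrite lee_fin mulr_ge0 ?sqr_ge0// indicE.
have iq y : (\int[mu]_z q (y, z) = (\int[mu]_z (\1_(cube 0 e) z * (v (y + z) - v y) ^+ 2))%:E)%E.
  rewrite -intble_fin//; apply: eq_integrable (lb y).2 => // z _ /=; congr (_%:E).
  rewrite exprMn -normrX ger0_norm ?sqr_ge0//; congr (_ * _).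
  by rewrite indicE; case: (_ \in _); rewrite ?expr1n ?expr0n.
have key : (\int[mu]_y (kavg e v y ^+ 2)%:E <= B%:E)%E.
  apply: (@le_trans _ _ (\int[mu]_y (((2 * e) ^+ d)^-1%:E * \int[mu]_z q (y, z)))%E).
    apply: ge0_le_integral => //.
    - by move=> y _; rewrite lee_fin sqr_ge0.
    - by apply/measurable_EFinP; exact: measurable_funX.
    - apply: emeasurable_funM => //.
      exact: (@measurable_fun_fubini_tonelli_F _ _ _ _ R mu q mq q0).
    - by move=> y _; rewrite iq -EFinM lee_fin; exact: kavg_sq.
  rewrite ge0_integralZl//; last 3 first.
  - exact: (@measurable_fun_fubini_tonelli_F _ _ _ _ R mu q mq q0).
  - by move=> y _; apply: integral_ge0.
  - by rewrite lee_fin invr_ge0 ltW.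
  rewrite (@fubini_tonelli _ _ _ _ R mu mu q mq q0).
  have hz z : (\int[mu]_y q (y, z) <= (B * \1_(cube 0 e) z)%:E)%E.
    rewrite /q /=; under eq_integral do rewrite EFinM.
    rewrite ge0_integralZl//; last 2 first.
    - apply/measurable_EFinP/measurable_funX; exact: (l2_shiftdiff z lv).1.
    - by move=> y _; rewrite lee_fin sqr_ge0.
    have -> : (\int[mu]_y ((v (y + z) - v y) ^+ 2)%:E = (osc2 v z)%:E)%E.
      by rewrite (intble_fin (l2_shiftdiff z lv).2) /osc2 dot_sq.
    rewrite -EFinM lee_fin indicE; case: (boolP (z \in cube 0 e)) => [|_].
      by rewrite inE /cube /= subr0 => ze; rewrite mul1r mulr1; exact: hB.
    by rewrite mul0r mulr0.
  apply: (@le_trans _ _ (((2 * e) ^+ d)^-1%:E * \int[mu]_z (B * \1_(cube 0 e) z)%:E)%E).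
    apply: lee_pmul => //.
    - by rewrite lee_fin invr_ge0 ltW.
    - by apply: integral_ge0 => z _; apply: integral_ge0.
    - apply: ge0_le_integral => //.
      + by move=> z _; apply: integral_ge0.
      + exact: (@measurable_fun_fubini_tonelli_G _ _ _ _ R mu q mq q0).
      + by apply/measurable_EFinP/measurable_funM => //; exact: l1.1.
  have ic := intbleZ B (@intble_cube R d 0 e).
  rewrite (intble_fin ic) RintZ; last exact: intble_cube.
  have E : ((2 * e) ^+ d)^-1 * (B * \int[mu]_x \1_(cube 0 e) x) = B.
    by rewrite Rint_cube ?ltW// mulrCA mulVf ?mulr1 ?gt_eqF.
  by rewrite -EFinM E.
have lk : l2 mu (kavg e v).
  split => //; apply: intble_ge0; [exact: measurable_funX|by move=> y; exact: sqr_ge0|].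
  by apply: (le_lt_trans key); exact: ltry.
by split => //; rewrite dot_sq -lee_fin -(intble_fin lk.2).
Qed.

Lemma kernel_le_kavg (h : V -> R) (M : R) y : measurable_fun setT h ->
  (forall x, `|h x| <= M * ((2 * e) ^+ d)^-1 * \1_(cube 0 e) (x - y)) ->
  intble mu (fun x => h x * (v x - v y)) /\
  `|\int[mu]_x (h x * (v x - v y))| <= M * kavg e v y.
Proof.
move=> mh hM.
have ib := intbleZ (M * ((2 * e) ^+ d)^-1) (l2_intble l1 (lb y)).
have {}ib := intble_translation (- y) ib.
have hb x : `|h x * (v x - v y)| <= M * ((2 * e) ^+ d)^-1 *
    (\1_(cube 0 e) (x - y) * (\1_(cube 0 e) (x - y) * `|v (y + (x - y)) - v y|)).
  have -> : y + (x - y) = x by rewrite addrC subrK.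
  rewrite normrM [\1_(cube 0 e) (x - y) * (_ * _)]mulrA.
  rewrite (_ : \1_(cube 0 e) (x - y) * \1_(cube 0 e) (x - y) = \1_(cube 0 e) (x - y)); last first.
    by rewrite indicE; case: (_ \in _); rewrite ?mulr1 ?mulr0.
  by rewrite mulrA; apply: ler_wpM2r.
have mf : measurable_fun setT (fun x => h x * (v x - v y)).
  by apply: measurable_funM => //; apply: measurable_funB => //; exact: lv.1.
have i1 := le_intble mf hb ib.
split => //; apply: (le_trans (norm_Rint i1)).
apply: (le_trans (le_Rint (intble_norm i1) ib hb)).
have := Rint_translation (- y) (intbleZ (M * ((2 * e) ^+ d)^-1) (l2_intble l1 (lb y))).
move=> ->; rewrite RintZ; last exact: l2_intble.
rewrite /kavg mulrA le_eqVlt; apply/orP; left; apply/eqP; congr (_ * _).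
apply: eq_Rintegral => z _; rewrite mulrA; congr (_ * _).
by rewrite indicE; case: (_ \in _); rewrite ?mulr1 ?mulr0.
Qed.

End kavg_lemmas.

Lemma kavg_cvg0 v : l2 mu v -> forall eps, 0 < eps -> exists2 r, 0 < r &
  forall e, 0 < e < r -> l2 mu (kavg e v) /\ dot mu (kavg e v) (kavg e v) <= eps.
Proof.
move=> lv eps eps0; have [r r0 hr] := l2_osc_small lv eps0.
exists r => // e /andP[e0 er]; apply: kavg_l2 => // z ze.
by apply: hr; exact: le_lt_trans er.
Qed.

(** The transpose of convolution with [k] is convolution with the reflected kernel. The bounded
    supports of [k] and [w] provide the domination for Fubini, [v] being only locally integrable. *)
Lemma conv_dual (k v w : V -> R) e r : continuous k -> supp_cube k e ->
  locint v -> continuous w -> supp_cube w r ->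
  [/\ intble mu (fun x => conv k v x * w x), intble mu (fun x => v x * conv (fun z : V => k (- z)) w x) &
  \int[mu]_x (conv k v x * w x) = \int[mu]_x (v x * conv (fun z : V => k (- z)) w x)].
Proof.
move=> ck k0 lv cw w0.
have ck' : continuous (fun z : V => k (- z)).
  move/rV_continuousP : ck => ck; apply/rV_continuousP => x eps eps0.
  have [s s0 hs] := ck (- x) eps eps0; exists s => // y yx; apply: hs.
  by rewrite opprK addrC distrC.
have k0' : supp_cube (fun z : V => k (- z)) e.
  by move=> z ze; apply: k0; move: ze; rewrite /cube /= !subr0 normrN.
have [B B0 hB] := continuous_bounded_cube ck k0.
have [W W0 hW] := continuous_bounded_cube cw w0.
have mw := continuous_measurable_rV cw; have mk := continuous_measurable_rV ck.
have lw := bounded_locint mw hW.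
pose G x y := k (x - y) * v y * w x.
have mG : measurable_fun setT (fun p : V * V => G p.1 p.2).
  apply: measurable_funM; last by apply: measurableT_comp.
  apply: measurable_funM; last by apply: measurableT_comp => //; exact: lv.1.
  exact: (measurableT_comp mk measurable_sub2).
have i1 x : intble mu (G x).
  have := intbleZ (w x) (conv_intble x ck k0 lv); congr intble.
  by apply/funext => y; rewrite /G mulrC.
have i2 y : intble mu (G ^~ y).
  have := intbleZ (v y) (conv_intble y ck' k0' lw); congr intble.
  by apply/funext => x; rewrite /G opprB; ring.
have lvr := intble_norm (lv.2 (r + e)).
have [|h1 h2 h3] := Rint_fubini mG i1 i2.
  exists (fun x => (W * (B * \int[mu]_y `|\1_(cube 0 (r + e)) y * v y|)) * \1_(cube 0 r) x).
    by apply: intbleZ; exact: intble_cube.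
  move=> x; have [xr|xr] := pselect (cube 0 r x); last first.
    rewrite (_ : \int[mu]_y _ = 0); first by rewrite indicE memNset// mulr0.
    under eq_Rintegral do rewrite /G w0// mulr0 normr0; exact: Rint0.
  rewrite indicE mem_set// mulr1 -RintZ// -RintZ; last exact: intbleZ.
  apply: le_Rint; [exact: intble_norm|by apply: intbleZ; exact: intbleZ|] => y.
  rewrite /G normrM [leLHS]mulrC normrM; apply: ler_pM => //.
  have [xy|xy] := pselect (cube 0 e (x - y)); last first.
    by rewrite k0// normr0 mul0r mulr_ge0.
  rewrite indicE mem_set ?mul1r; first exact: ler_wpM2r.
  move: xy => /cube_sub; rewrite /cube /= => h; apply: (le_trans h); rewrite lerD2r.
  by move: xr; rewrite /cube /= subr0.
have e1 x : \int[mu]_y G x y = conv k v x * w x.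
  by rewrite /conv mulrC -RintZ; [apply: eq_Rintegral => y _; rewrite /G mulrC|exact: (conv_intble x ck k0 lv)].
have e2 y : \int[mu]_x G x y = v y * conv (fun z : V => k (- z)) w y.
  rewrite /conv -RintZ; last exact: (conv_intble y ck' k0' lw).
  by apply: eq_Rintegral => x _; rewrite /G opprB; ring.
split.
- by move: h1; congr intble; apply/funext.
- by move: h2; congr intble; apply/funext.
- by under eq_Rintegral do rewrite -e1; rewrite h3; apply: eq_Rintegral => y _; exact: e2.
Qed.

End fubini_rV.

Section Ck_calculus.
Variables (R : realType) (d : nat).
Local Notation V := 'rV[R]_d.
Local Notation e_ i := (delta_mx ord0 i : V).
Implicit Types f g : V -> R.

Lemma pderive_add f g i x : derivable f x (e_ i) -> derivable g x (e_ i) ->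
  derivable (fun x => f x + g x) x (e_ i) /\
  partial i (fun x => f x + g x) x = partial i f x + partial i g x.
Proof. by move=> df dg; split; [exact: derivableD|exact: (@deriveD _ _ _ f g x (e_ i))]. Qed.

Lemma pderive_mul f g i x : derivable f x (e_ i) -> derivable g x (e_ i) ->
  derivable (fun x => f x * g x) x (e_ i) /\
  partial i (fun x => f x * g x) x = f x * partial i g x + g x * partial i f x.
Proof.
move=> df dg; have -> : (fun x => f x * g x) = f * g by [].
split; first exact: (derivableM df dg).
exact: (deriveM df dg).
Qed.

Lemma pderive_scale a f i x : derivable f x (e_ i) ->
  derivable (fun x => a * f x) x (e_ i) /\
  partial i (fun x => a * f x) x = a * partial i f x.
Proof. by move=> df; split; [exact: derivableZ|exact: deriveZ]. Qed.

Lemma pderive_cst (a : R) i x : derivable (fun _ : V => a) x (e_ i) /\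
  partial i (fun _ : V => a) x = 0.
Proof. by split; [exact: derivable_cst|exact: derive_cst]. Qed.

Lemma Ck_cst n (a : R) : Ck n (fun _ : V => a).
Proof.
elim: n a => [|n IH] a; first exact: continuous_cst_rV.
split; first exact: continuous_cst_rV.
move=> i; split => [x|]; first by have [] := pderive_cst a i x.
rewrite (_ : partial i _ = fun=> 0); first exact: IH.
by apply/funext => x; have [] := pderive_cst a i x.
Qed.

Lemma CkD n f g : Ck n f -> Ck n g -> Ck n (fun x => f x + g x).
Proof.
elim: n f g => [|n IH] f g /=; first exact: continuousD_rV.
move=> [cf hf] [cg hg]; split; first exact: continuousD_rV.
move=> i; split => [x|].
  by have [] := pderive_add ((hf i).1 x) ((hg i).1 x).
rewrite (_ : partial i _ = fun x => partial i f x + partial i g x).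
  by apply: IH; [exact: (hf i).2|exact: (hg i).2].
by apply/funext => x; have [] := pderive_add ((hf i).1 x) ((hg i).1 x).
Qed.

Lemma CkM n f g : Ck n f -> Ck n g -> Ck n (fun x => f x * g x).
Proof.
elim: n f g => [|n IH] f g; first exact: continuousM_rV.
move=> Cf Cg; have [cf hf] := Cf; have [cg hg] := Cg; split; first exact: continuousM_rV.
move=> i; split => [x|].
  by have [] := pderive_mul ((hf i).1 x) ((hg i).1 x).
rewrite (_ : partial i _ = fun x => f x * partial i g x + g x * partial i f x).
  by apply: CkD; apply: IH; (try exact: CkS); [exact: (hg i).2|exact: (hf i).2].
by apply/funext => x; have [] := pderive_mul ((hf i).1 x) ((hg i).1 x).
Qed.

Lemma CkZ n a f : Ck n f -> Ck n (fun x => a * f x).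
Proof. by move=> Cf; apply: CkM => //; exact: Ck_cst. Qed.

Lemma CkN n f : Ck n f -> Ck n (fun x => - f x).
Proof. by move=> Cf; under eq_fun do rewrite -mulN1r; exact: CkZ. Qed.

Lemma CkB n f g : Ck n f -> Ck n g -> Ck n (fun x => f x - g x).
Proof. by move=> Cf Cg; apply: CkD => //; exact: CkN. Qed.

Lemma Ck_prod n (I : finType) (F : I -> V -> R) :
  (forall i, Ck n (F i)) -> Ck n (fun x => \prod_i F i x).
Proof.
move=> cF; elim: (index_enum I) => [|i s IH].
  by under eq_fun do rewrite big_nil; exact: Ck_cst.
by under eq_fun do rewrite big_cons; exact: CkM.
Qed.

Lemma pderive_dilation b f i x : derivable f (b *: x) (e_ i) ->
  derivable (fun x => f (b *: x)) x (e_ i) /\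
  partial i (fun x => f (b *: x)) x = b * partial i f (b *: x).
Proof.
move=> df; have [b0|b0] := eqVneq b 0.
  rewrite b0 mul0r (_ : (fun x => f (0 *: x)) = fun=> f 0); first exact: pderive_cst.
  by apply/funext => y; rewrite scale0r.
pose phi (t : R) := f (b *: x + t *: e_ i).
have [d0 e0] : derivable phi 0 1 /\ 'D_1 phi 0 = partial i f (b *: x).
  exact: (derivable_line0 df).
have dphi : is_derive (b * 0 : R) 1 phi (partial i f (b *: x)).
  by rewrite mulr0; exact: DeriveDef.
have dl : is_derive (0 : R) 1 (fun t : R => b * t) b.
  have h : is_derive (0 : R) 1 (b \*: id) (b *: (1 : R)) by apply: is_deriveZ.
  by apply: is_derive_eq; rewrite [b *: 1]mulr1.
have := is_derive1_comp dphi dl => dc.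
have E : (fun h : R => h^-1 *: (((phi \o (fun t => b * t)) \o shift 0) (h *: (1 : R)) - (phi \o (fun t => b * t)) 0))
   = (fun h : R => h^-1 *: (((fun x => f (b *: x)) \o shift x) (h *: e_ i) - f (b *: x))).
  apply/funext => h /=; rewrite /phi addr0 mulr0 scale0r addr0; congr (_ *: (f _ - _)).
  by rewrite [h *: 1]mulr1 scalerDr scalerA addrC.
have [h1 h2] := dc.
split; first by move: h1; rewrite /derivable E.
by rewrite /partial mulrC; move: h2; rewrite /derive E.
Qed.

Lemma Ck_dilation n b f : Ck n f -> Ck n (fun x => f (b *: x)).
Proof.
have cd g : continuous g -> continuous (fun x : V => g (b *: x)).
  move=> /rV_continuousP cg; apply/rV_continuousP => x e e0.
  have [r r0 hr] := cg (b *: x) e e0.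
  have b1 : 0 < `|b| + 1 by rewrite ltr_wpDl.
  exists (r / (`|b| + 1)); first by rewrite divr_gt0.
  move=> y; rewrite ltr_pdivlMr// => h; apply: hr; rewrite -scalerBr normrZ.
  by apply: le_lt_trans h; rewrite mulrC ler_wpM2l// lerDl.
elim: n f => [|n IH] f; first exact: cd.
move=> [cf hf]; split; first exact: cd.
move=> i; split => [x|]; first by have [] := pderive_dilation ((hf i).1 (b *: x)).
rewrite (_ : partial i _ = fun x => b * partial i f (b *: x)).
  by apply: CkZ; apply: (IH (partial i f)); exact: (hf i).2.
by apply/funext => x; have [] := pderive_dilation ((hf i).1 (b *: x)).
Qed.

Lemma pderive_coord (K : R -> R) K' (i j : 'I_d) (x : V) :
  is_derive (x ord0 i) 1 K K' ->
  derivable (fun x : V => K (x ord0 i)) x (e_ j) /\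
  partial j (fun x : V => K (x ord0 i)) x = (i == j)%:R * K'.
Proof.
move=> dK; have [<-|ij] := eqVneq i j.
  have E : (fun h : R => h^-1 *: ((K \o shift (x ord0 i)) (h *: (1 : R)) - K (x ord0 i)))
    = (fun h : R => h^-1 *: (((fun x : V => K (x ord0 i)) \o shift x) (h *: e_ i) - K (x ord0 i))).
    by apply/funext => h /=; rewrite !mxE !eqxx.
  have [h1 h2] := dK.
  split; first by move: h1; rewrite /derivable E.
  by rewrite mul1r; move: h2; rewrite /derive E.
have E : (fun h : R => h^-1 *: (((fun x : V => K (x ord0 i)) \o shift x) (h *: e_ j) - K (x ord0 i)))
   = (fun h : R => h^-1 *: (((fun x : V => 0 : R) \o shift x) (h *: e_ j) - (fun x : V => 0 : R) x)).
  by apply/funext => h /=; rewrite !mxE (negbTE ij) andbF mulr0 add0r !subrr.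
rewrite mul0r; have [h1 h2] := pderive_cst (0 : R) j x.
split; first by move: h1; rewrite /derivable E.
by move: h2; rewrite /partial /derive E.
Qed.

End Ck_calculus.

(** * A smooth bump function with support in the unit cube *)

Section bump.
Variable R : realType.

(** The functions $x^{-m} e^{-1/x}$ continued by 0. Derivatives of members of this family are
    combinations of members, so the smoothness of all of them is a single induction. *)
Definition hexp (m : nat) (x : R) : R := if 0 < x then x^-1 ^+ m * expR (- x^-1) else 0.

Lemma hexp_ge0 m x : 0 <= hexp m x.
Proof.
rewrite /hexp; case: ifP => // x0; rewrite mulr_ge0 ?expR_ge0// exprn_ge0// invr_ge0 ltW//.
Qed.

(** One term of the exponential series at [x^-1] suffices. A bound quadratic in [x] is what makes
    the difference quotient at 0 tend to 0. *)
Lemma hexp_bound m x : `|hexp m x| <= (m.+2)`!%:R * x ^+ 2.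
Proof.
rewrite ger0_norm ?hexp_ge0// /hexp; case: ifP => [x0|_]; last first.
  by rewrite mulr_ge0// sqr_ge0.
have y0 : 0 < x^-1 by rewrite invr_gt0.
rewrite expRN ler_pdivrMr ?expR_gt0//.
have h := expR_ge1Dxn m.+1 (ltW y0).
have k : x^-1 ^+ m.+2 <= (m.+2)`!%:R * expR x^-1.
  by rewrite mulrC -ler_pdivrMr ?ltr0n ?fact_gt0//; apply: le_trans h; rewrite lerDr.
have -> : x^-1 ^+ m = x ^+ 2 * x^-1 ^+ m.+2.
  by rewrite -[m.+2]add2n exprD mulrA -exprMn mulfV ?gt_eqF// expr1n mul1r.
have -> : (m.+2)`!%:R * x ^+ 2 * expR x^-1 = x ^+ 2 * ((m.+2)`!%:R * expR x^-1).
  by rewrite [RHS]mulrCA mulrA.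
by rewrite ler_wpM2l// sqr_ge0.
Qed.

Lemma hexp_derive (m : nat) (x : R) :
  is_derive x 1 (hexp m) (hexp m.+2 x - m%:R * hexp m.+1 x).
Proof.
have [x0|x0|x0] := ltgtP x 0.
- have E : {near x, cst 0 =1 hexp m}.
    by near=> y; rewrite /hexp ifF//; apply/negbTE; rewrite -leNgt ltW//; near: y; exact: lt_nbhsl.
  rewrite /hexp ltNge (ltW x0) /= mulr0 subrr.
  apply: DeriveDef; first by apply: (near_eq_derivable E); exact: derivable_cst.
  by rewrite -(near_eq_derive _ E) derive_cst.
- pose w := x^-1.
  have E : {near x, (fun y : R => y^-1 ^+ m * expR (- y^-1)) =1 hexp m}.
    by near=> y; rewrite /hexp ifT//; near: y; exact: lt_nbhsr.
  have xn : (@id R) x != 0 by rewrite gt_eqF.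
  have dV : is_derive x 1 (fun y : R => y^-1) (- w ^+ 2).
    have h := @is_deriveV R (@id R) x 1 1 xn (is_derive_id x 1).
    by apply: (is_derive_eq h); rewrite /w exprVn [RHS]/= -[LHS]/(- x ^- 2 * 1) mulr1.
  have dX : is_derive x 1 (fun y : R => y^-1 ^+ m) (m%:R * w ^+ m.-1 * (- w ^+ 2)).
    have h := is_deriveX m dV.
    by have <- : (fun y : R => y^-1) ^+ m = (fun y : R => y^-1 ^+ m) by apply/funext => y; rewrite exprfctE.
  have dE : is_derive x 1 (fun y : R => expR (- y^-1)) (expR (- w) * w ^+ 2).
    have h := is_deriveN dV; rewrite opprK in h.
    exact: (@is_derive1_comp R expR (fun y => - y^-1) x _ _ (is_derive_expR (- w)) h).
  have dM := is_deriveM dX dE.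
  have -> : hexp m.+2 x - m%:R * hexp m.+1 x = x^-1 ^+ m *: (expR (- w) * w ^+ 2) +
       expR (- x^-1) *: (m%:R * w ^+ m.-1 * (- w ^+ 2)).
    rewrite /hexp x0 -/w /GRing.scale /=; case: m {E dX dM} => [|n] /=; first by rewrite expr0 !exprS expr0; ring.
    by rewrite !exprS; ring.
  have [h1 h2] := dM; apply: DeriveDef; first exact: (near_eq_derivable E h1).
  by rewrite -(near_eq_derive _ E) h2.
- rewrite x0; have h0 k : hexp k 0 = 0 by rewrite /hexp ltxx.
  rewrite !h0 mulr0 subrr.
  have c : (fun h : R => h^-1 *: ((hexp m \o shift 0) (h *: (1 : R)) - hexp m 0)) @ 0^' --> (0 : R).
    apply/cvgrPdist_le => e e0; near=> h.
    rewrite sub0r normrN h0 subr0 /= addr0 [h *: 1]mulr1 normrM normfV.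
    have hn : h != 0 by near: h; exact: nbhs_dnbhs_neq.
    rewrite ler_pdivrMl ?normr_gt0//.
    apply: (le_trans (hexp_bound m h)); rewrite -(real_normK (num_real h)) expr2 mulrCA ler_wpM2l//.
    have : `|h| <= e / (m.+2)`!%:R.
      by near: h; apply: dnbhs0_le; rewrite divr_gt0// ltr0n fact_gt0.
    by rewrite ler_pdivlMr ?ltr0n ?fact_gt0// mulrC.
  by apply: DeriveDef; [apply/cvg_ex; exists 0|exact: (cvg_lim (@Rhausdorff R) c)].
Unshelve. all: by end_near. Qed.

Variable d : nat.
Local Notation V := 'rV[R]_d.
Local Notation mu := (rV_lebesgue R d).

Lemma hexp_continuous m : continuous (hexp m).
Proof.
move=> x; have [h _] := hexp_derive m x.
by apply: differentiable_continuous; apply/derivable1_diffP.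
Qed.

Lemma hexp_affine_derive m (a s t : R) :
  is_derive t 1 (fun t => hexp m (a + s * t))
    (s * (hexp m.+2 (a + s * t) - m%:R * hexp m.+1 (a + s * t))).
Proof.
have dl : is_derive t 1 (fun t : R => a + s * t) s.
  have h1 : is_derive t 1 (s \*: (@id R)) (s *: (1 : R)) by apply: is_deriveZ.
  have h2 := is_deriveD (is_derive_cst a t 1) h1.
  by apply: (is_derive_eq h2); rewrite add0r [s *: 1]mulr1.
by have := @is_derive1_comp R (hexp m) (fun t => a + s * t) t _ _ (hexp_derive m (a + s * t)) dl; rewrite mulrC.
Qed.

Lemma hexp_affine_Ck n m (a s : R) (i : 'I_d) :
  Ck n (fun x : V => hexp m (a + s * x ord0 i)).
Proof.
have cc k : continuous (fun x : V => hexp k (a + s * x ord0 i)).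
  apply: (continuous_comp_rV (f := fun x : V => a + s * x ord0 i)); last exact: hexp_continuous.
  apply: continuousD_rV; first exact: continuous_cst_rV.
  by apply: continuousZ_rV; exact: continuous_coord_rV.
elim: n m => [|n IH] m; first exact: cc.
split; first exact: cc.
have h j (x : V) := pderive_coord j (hexp_affine_derive m a s (x ord0 i)).
move=> j; split => [x|]; first by have [] := h j x.
rewrite (_ : partial j _ = fun x : V => ((i == j)%:R * s) *
   (hexp m.+2 (a + s * x ord0 i) - m%:R * hexp m.+1 (a + s * x ord0 i))).
  by apply: CkZ; apply: CkB => //; exact: CkZ.
by apply/funext => x; have [_ ->] := h j x; rewrite mulrA.
Qed.

(** A product over the coordinates reduces all derivatives to those of functions of one
    coordinate. *)
Definition bump (x : V) : R :=
  \prod_(i < d) (hexp 0 (1 + 1 * x ord0 i) * hexp 0 (1 + (- 1) * x ord0 i)).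

Lemma bump_Cinf : Cinf bump.
Proof. by move=> n; apply: Ck_prod => i; apply: CkM; exact: hexp_affine_Ck. Qed.

Lemma bump_ge0 x : 0 <= bump x.
Proof. by apply: prodr_ge0 => i _; rewrite mulr_ge0// hexp_ge0. Qed.

Lemma bump_even x : bump (- x) = bump x.
Proof.
by apply: eq_bigr => i _; rewrite !mxE mulrC; congr (_ * _); congr hexp; ring.
Qed.

Lemma bump_supp : supp_cube bump 1.
Proof.
move=> x xr.
have [i hi] : exists i, 1 < `|x ord0 i|.
  apply: contrapT => h; apply: xr; rewrite /cube /= subr0; apply/rV_norm_le => // i.
  by rewrite leNgt; apply/negP => hi; apply: h; exists i.
rewrite /bump (bigD1 i)//= /hexp !mul1r mulN1r.
rewrite -[X in X * _](_ : 0 = _) ?mul0r//.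
have [x0|x0] := leP 0 (x ord0 i).
  rewrite ger0_norm// in hi; rewrite [X in _ * X]ifF ?mulr0//.
  by apply/negbTE; rewrite -leNgt subr_le0 ltW.
rewrite ltr0_norm// in hi; rewrite ifF ?mul0r//.
by apply/negbTE; rewrite -leNgt -[x ord0 i]opprK subr_le0 ltW.
Qed.

Lemma bump_lower : exists2 m, 0 < m & forall x, cube 0 2^-1 x -> m <= bump x.
Proof.
have key (t : R) : 2^-1 <= t -> expR (- 2) <= hexp 0 t.
  move=> t2; have t0 : 0 < t by rewrite (lt_le_trans _ t2)// invr_gt0.
  rewrite /hexp t0 expr0 mul1r ler_expR lerN2 -[leRHS]invrK lef_pV2//.
  by rewrite posrE invr_gt0.
exists (\prod_(i < d) (expR (- 2) * expR (- 2))).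
  by apply: prodr_gt0 => i _; rewrite mulr_gt0// expR_gt0.
move=> x; rewrite /cube /= subr0 => hx; apply: ler_prod => i _.
have h2 : 0 <= 2^-1 :> R by rewrite invr_ge0.
have := (rV_norm_le x h2).1 hx i; rewrite ler_norml => /andP[a b].
rewrite mulr_ge0 ?expR_ge0//=; apply: ler_pM; rewrite ?expR_ge0//; apply: key.
  by rewrite mul1r; lra.
by rewrite mulN1r; lra.
Qed.

End bump.

Section mollifier.
Variables (R : realType) (d : nat).
Local Notation V := 'rV[R]_d.
Local Notation mu := (rV_lebesgue R d).

Let rho e (z : V) : R := bump (e^-1 *: z).

Let rho_supp e : 0 < e -> supp_cube (rho e) e.
Proof.
move=> e0 x; rewrite /cube /= subr0 => xe; apply: bump_supp; rewrite /cube /= subr0.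
rewrite normrZ gtr0_norm ?invr_gt0//; apply: contra_not xe.
by rewrite ler_pdivrMl// mulr1.
Qed.

Let rho_int e : 0 < e -> intble mu (rho e).
Proof.
move=> e0; have c : continuous (rho e) by apply: (@Ck_continuous _ _ 0); apply: Ck_dilation; exact: bump_Cinf.
have [B B0 hB] := continuous_bounded_cube c (rho_supp e0).
exact: (intble_bounded_cube (continuous_measurable_rV c) hB (rho_supp e0)).
Qed.

Definition moll e (z : V) : R := (\int[mu]_y rho e y)^-1 * rho e z.

(** The point is that [K] is uniform in [e]: the dilated bump has mass at least a multiple of
    [e ^+ d], and differentiating the kernel costs one factor [e^-1]. *)
Lemma moll_facts : exists2 K : R, 0 < K & forall e, 0 < e ->
  [/\ [/\ Cinf (moll e), supp_cube (moll e) e & forall z, moll e (- z) = moll e z],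
   forall z, 0 <= moll e z,
   \int[mu]_z moll e z = 1,
   forall z, moll e z <= K * ((2 * e) ^+ d)^-1 * \1_(cube 0 e) z &
   forall i z, `|partial i (moll e) z| <= K * e^-1 * ((2 * e) ^+ d)^-1 * \1_(cube 0 e) z].
Proof.
have [m m0 hm] := bump_lower R d.
have cb := Ck_continuous (@bump_Cinf R d 0).
have [B B0 hB] := continuous_bounded_cube cb (@bump_supp R d).
have /choice[D hD] : forall i : 'I_d, exists D, 0 <= D /\ forall x : V, `|partial i (@bump R d) x| <= D.
  move=> i; have [_ h] := @bump_Cinf R d 1%N.
  have [D D0 hD] := continuous_bounded_cube (h i).2 (supp_cube_partial i (@bump_supp R d)).
  by exists D.
pose M := B + \sum_i D i.
have M0 : 0 <= M by rewrite addr_ge0// sumr_ge0// => i _; case: (hD i).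
(* [M] bounds the bump and its partial derivatives from above, [m] bounds the bump from below on the
   cube of radius 1/2, and [2 ^+ d] converts [e ^+ d] into the volume of the cube of radius [e]. The
   summand 1 keeps the constant positive. *)
exists ((M + 1) * 2 ^+ d / m); first by rewrite divr_gt0// mulr_gt0 ?exprn_gt0// ltr_wpDl.
move=> e e0; set K := (M + 1) * 2 ^+ d / m.
have e2 : 0 < 2 * e by rewrite mulr_gt0.
have c0 : 0 < (2 * e) ^+ d by rewrite exprn_gt0.
pose I := \int[mu]_y rho e y.
have I_lb : m * e ^+ d <= I.
  have -> : e ^+ d = \int[mu]_y (\1_(cube 0 (e / 2)) y).
    by rewrite Rint_cube ?divr_ge0 ?ltW// mulrCA mulfV ?mulr1// pnatr_eq0.
  rewrite -RintZ; last exact: intble_cube.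
  apply: le_Rint; [exact/intbleZ/intble_cube|exact: rho_int|] => y.
  rewrite indicE; case: (boolP (y \in _)) => [|_]; last by rewrite mulr0 bump_ge0.
  rewrite inE mulr1 => hy; apply: hm; move: hy; rewrite /cube /= !subr0 normrZ gtr0_norm ?invr_gt0//.
  by move=> hy; rewrite ler_pdivrMl.
have I0 : 0 < I by rewrite (lt_le_trans _ I_lb)// mulr_gt0// exprn_gt0.
have Iinv : I^-1 * (M + 1) <= K * ((2 * e) ^+ d)^-1.
  have -> : K * ((2 * e) ^+ d)^-1 = (m * e ^+ d)^-1 * (M + 1).
    rewrite /K exprMn; field; rewrite !expf_neq0 ?gt_eqF//.
  by rewrite ler_pM2r ?lef_pV2 ?posrE ?mulr_gt0 ?exprn_gt0// ltr_wpDl.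
have Cr : Cinf (rho e) by move=> n; apply: Ck_dilation; exact: bump_Cinf.
have Cm : Cinf (moll e) by move=> n; apply: CkZ; exact: Cr.
have sm : supp_cube (moll e) e by move=> z ze; rewrite /moll rho_supp// mulr0.
have MB : B <= M + 1 by rewrite /M -addrA lerDl addr_ge0// sumr_ge0// => i _; case: (hD i).
split => //.
- by split => // z; rewrite /moll /rho scalerN bump_even.
- by move=> z; rewrite mulr_ge0 ?bump_ge0// invr_ge0 ltW.
- by rewrite /moll RintZ ?mulVf ?gt_eqF//; exact: rho_int.
- move=> z; have [ze|ze] := pselect (cube 0 e z); last by rewrite sm// indicE memNset// mulr0.
  rewrite indicE mem_set// mulr1; apply: le_trans Iinv; rewrite /moll ler_pM2l ?invr_gt0//.
  by apply: le_trans MB; apply: le_trans (hB _); exact: ler_norm.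
- move=> i z; have [ze|ze] := pselect (cube 0 e z); last first.
    by rewrite (supp_cube_partial i sm ze) normr0 indicE memNset// mulr0.
  rewrite indicE mem_set// mulr1.
  have [_ hb] := @bump_Cinf R d 1%N.
  have dr := pderive_dilation ((hb i).1 (e^-1 *: z)).
  have -> : partial i (moll e) z = I^-1 * (e^-1 * partial i (@bump R d) (e^-1 *: z)).
    by rewrite /moll (pderive_scale _ dr.1).2 -dr.2.
  have Ii0 : 0 < I^-1 by rewrite invr_gt0.
  have ei0 : 0 < e^-1 by rewrite invr_gt0.
  rewrite normrM (gtr0_norm Ii0) normrM (gtr0_norm ei0).
  have -> : K * e^-1 * ((2 * e) ^+ d)^-1 = e^-1 * (K * ((2 * e) ^+ d)^-1) by rewrite mulrAC mulrC.
  rewrite [leLHS]mulrCA ler_pM2l//.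
  apply: le_trans Iinv; rewrite ler_pM2l ?invr_gt0//.
  apply: (le_trans ((hD i).2 _)); rewrite /M (bigD1 i)//= addrCA -addrA lerDl addr_ge0// addr_ge0// sumr_ge0// => j _.
  by case: (hD j).
Qed.

End mollifier.

(** * Friedrichs commutators *)

Section parts.
Variables (R : realType) (d : nat).
Local Notation V := 'rV[R]_d.
Local Notation mu := (rV_lebesgue R d).
Local Notation e_ i := (delta_mx ord0 i : V).
Implicit Types f g k w u : V -> R.

Lemma pderive_affine (f : V -> R) (b : R) (z : V) i x : derivable f (z + b *: x) (e_ i) ->
  derivable (fun x => f (z + b *: x)) x (e_ i) /\
  partial i (fun x => f (z + b *: x)) x = b * partial i f (z + b *: x).
Proof.
move=> df.
have E y : (fun h : R => h^-1 *: (((fun x => f (z + x)) \o shift y) (h *: e_ i) - f (z + y)))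
    = (fun h : R => h^-1 *: ((f \o shift (z + y)) (h *: e_ i) - f (z + y))).
  by apply/funext => h /=; rewrite addrCA.
have d1 : derivable (fun x => f (z + x)) (b *: x) (e_ i) by rewrite /derivable E.
have [h1 h2] := pderive_dilation d1.
by split; [exact: h1|rewrite h2 /partial /derive E].
Qed.

Lemma continuous_affine (f : V -> R) (b : R) (z : V) : continuous f ->
  continuous (fun x : V => f (z + b *: x)).
Proof.
move=> cf; have := @Ck_dilation R d 0 b (fun x : V => f (z + x)); apply => /=.
by under eq_fun do rewrite addrC; exact: continuous_translation_rV.
Qed.

Lemma C1_affine (f : V -> R) (b : R) (z : V) : Ck 1 f -> Ck 1 (fun x : V => f (z + b *: x)).
Proof.
move=> [cf hf]; split; first exact: continuous_affine.
move=> i; split => [x|]; first by have [] := pderive_affine ((hf i).1 (z + b *: x)).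
rewrite (_ : partial i _ = fun x => b * partial i f (z + b *: x)).
  by apply: continuousZ_rV; apply: continuous_affine; exact: (hf i).2.
by apply/funext => x; have [] := pderive_affine ((hf i).1 (z + b *: x)).
Qed.

Lemma lipschitz_bounded_cube (c : V -> R) (L r : R) :
  (forall x y, `|c y - c x| <= L * `|y - x|) ->
  forall x, cube 0 r x -> `|c x| <= `|c 0| + `|L| * `|r|.
Proof.
move=> lc x xr; rewrite -(subrK (c 0) (c x)) addrC.
apply: (le_trans (ler_normD _ _)); rewrite lerD2l.
apply: (le_trans (lc _ _)); apply: (le_trans (ler_wpM2r _ (ler_norm L))) => //.
by rewrite ler_wpM2l// (le_trans xr)// ler_norm.
Qed.

Lemma lipschitz_mul_supp (c f : V -> R) (L r : R) :
  (forall x y, `|c y - c x| <= L * `|y - x|) -> Ck 1 f -> supp_cube f r ->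
  exists L', forall x y, `|c y * f y - c x * f x| <= L' * `|y - x|.
Proof.
move=> lc Cf f0.
have [Lf Lf0 hLf] := C1_supp_lipschitz Cf f0.
have [B B0 hB] := continuous_bounded_cube Cf.1 f0.
set A := `|c 0| + `|L| * `|r|.
have A0 : 0 <= A by rewrite addr_ge0// mulr_ge0.
exists (A * Lf + B * `|L|).
have key x y : cube 0 r y -> `|c y * f y - c x * f x| <= (A * Lf + B * `|L|) * `|y - x|.
  move=> yr; have -> : c y * f y - c x * f x = c y * (f y - f x) + f x * (c y - c x) by ring.
  apply: (le_trans (ler_normD _ _)); rewrite mulrDl !normrM -!mulrA; apply: lerD.
    by apply: ler_pM => //; exact: lipschitz_bounded_cube lc _ yr.
  apply: ler_pM => //; apply: (le_trans (lc _ _)); rewrite ler_wpM2r// ler_norm//.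
move=> x y; have [yr|yr] := pselect (cube 0 r y); first exact: key.
have [xr|xr] := pselect (cube 0 r x); first by rewrite distrC (distrC y); exact: key.
by rewrite !f0// !mulr0 subrr normr0 !mulr_ge0// addr_ge0// mulr_ge0.
Qed.

(** The product of [c] and [f] is Lipschitz with bounded support, so its derivative has integral 0,
    and the product rule holds at almost every point. *)
Lemma lipschitz_ibp (c f : V -> R) (L r : R) i :
  (forall x y, `|c y - c x| <= L * `|y - x|) -> Ck 1 f -> supp_cube f r ->
  [/\ intble mu (fun x => aederive c (e_ i) x * f x),
      intble mu (fun x => c x * partial i f x) &
      \int[mu]_x (aederive c (e_ i) x * f x) = - \int[mu]_x (c x * partial i f x)].
Proof.
move=> lc Cf f0.
have L0 : 0 <= L * `|e_ i| by rewrite (le_trans _ (norm_aederive (e_ i) lc 0)).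
have [B B0 hB] := continuous_bounded_cube Cf.1 f0.
have [D D0 hD] := continuous_bounded_cube (Cf.2 i).2 (supp_cube_partial i f0).
have mf := continuous_measurable_rV Cf.1.
have cc := lipschitz_continuous_rV lc.
have mD := measurable_aederive (e_ i) lc.
have i1 : intble mu (fun x => aederive c (e_ i) x * f x).
  apply: (@intble_bounded_cube _ _ _ (L * `|e_ i| * B) r).
  - exact: measurable_funM.
  - by move=> x; rewrite normrM; apply: ler_pM => //; exact: norm_aederive.
  - by move=> x xr; rewrite f0// mulr0.
have cpc : continuous (fun x => c x * partial i f x).
  by apply: continuousM_rV => //; exact: (Cf.2 i).2.
have spc : supp_cube (fun x => c x * partial i f x) r.
  by move=> x xr; rewrite (supp_cube_partial i f0)// mulr0.
have i2 : intble mu (fun x => c x * partial i f x).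
  have [B' _ hB'] := continuous_bounded_cube cpc spc.
  exact: (intble_bounded_cube (continuous_measurable_rV cpc) hB' spc).
split => //.
have [L' lF] := lipschitz_mul_supp lc Cf f0.
have sF : supp_cube (fun x => c x * f x) r by move=> x xr; rewrite f0// mulr0.
have [iF hF] := Rint_aederive0 (e_ i) lF sF.
apply/eqP; rewrite -subr_eq0 opprK -RintD//; apply/eqP; rewrite -[RHS]hF.
congr fine; apply: ae_eq_integral => //.
- exact: (measurable_int _ (intbleD i1 i2)).
- exact: (measurable_int _ iF).
apply: ae_imp (filterI (ae_aederive (e_ i) lc) (ae_aederive (e_ i) lF)) => x [[dc ec] [_ eF]] _ /=.
congr (_%:E); rewrite -eF -ec.
have := (pderive_mul dc ((Cf.2 i).1 x)).2; rewrite /partial => ->.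
by rewrite [RHS]addrC [f x * _]mulrC.
Qed.

Lemma cst_lipschitz (a : R) : forall x y : V, `|(fun=> a) y - (fun=> a) x| <= 0 * `|y - x|.
Proof. by move=> x y; rewrite subrr normr0 mul0r. Qed.

Lemma Rint_partial0 f r i : Ck 1 f -> supp_cube f r -> \int[mu]_x partial i f x = 0.
Proof.
move=> Cf f0; have [_ _] := lipschitz_ibp i (cst_lipschitz 1) Cf f0.
under [in X in _ = - X -> _]eq_Rintegral do rewrite mul1r.
move=> h; apply: oppr_inj; rewrite -h oppr0.
rewrite (_ : (fun x => _) = fun=> 0); first exact: Rint0.
apply/funext => x; have h0 := @norm_aederive R d (fun=> 1) 0 (e_ i) (cst_lipschitz 1) x.
by move: h0; rewrite mul0r normr_le0 => /eqP ->; rewrite mul0r.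
Qed.

Lemma conv_partial k w e r i x : Ck 1 k -> supp_cube k e -> Ck 1 w -> supp_cube w r ->
  conv (partial i k) w x = conv k (partial i w) x.
Proof.
move=> Ckk k0 Cw w0.
have E (y : V) : x - y = x + (-1) *: y by rewrite scaleN1r.
pose f (y : V) := k (x + (-1) *: y) * w y.
have Cf : Ck 1 f by apply: CkM; [exact: C1_affine|exact: Cw].
have f0 : supp_cube f r by move=> y yr; rewrite /f w0// mulr0.
have := Rint_partial0 i Cf f0.
have pf y : partial i f y = k (x - y) * partial i w y - partial i k (x - y) * w y.
  have h := pderive_affine ((Ckk.2 i).1 (x + (-1) *: y)).
  rewrite (pderive_mul h.1 ((Cw.2 i).1 y)).2 h.2 -E; ring.
under eq_Rintegral do rewrite pf.
have [B _ hB] := continuous_bounded_cube Cw.1 w0.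
have [B' _ hB'] := continuous_bounded_cube (Cw.2 i).2 (supp_cube_partial i w0).
have lw := bounded_locint (continuous_measurable_rV Cw.1) hB.
have lw' := bounded_locint (continuous_measurable_rV (Cw.2 i).2) hB'.
rewrite RintB.
- by move/eqP; rewrite subr_eq0 => /eqP h; rewrite /conv; apply/esym; exact: h.
- exact: (conv_intble x Ckk.1 k0 lw').
- exact: (conv_intble x (Ckk.2 i).2 (supp_cube_partial i k0) lw).
Qed.

Lemma locintM_bounded (f c : V -> R) (B : R) : locint f -> measurable_fun setT c -> (forall x, `|c x| <= B) ->
  locint (fun x => f x * c x).
Proof.
move=> [mf lf] mc cB; split; first exact: measurable_funM.
move=> r; apply: (le_intble _ _ (intbleZ B (intble_norm (lf r)))).
  by apply: measurable_funM; [apply: measurable_indic; exact: measurable_cube|exact: measurable_funM].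
by move=> x; rewrite mulrA normrM mulrC ler_wpM2r.
Qed.

Lemma locintM_lipschitz (f c : V -> R) (L : R) : locint f -> (forall x y, `|c y - c x| <= L * `|y - x|) ->
  locint (fun x => f x * c x).
Proof.
move=> [mf lf] lc.
have mc : measurable_fun setT c by apply: continuous_measurable_rV; exact: lipschitz_continuous_rV lc.
split; first exact: measurable_funM.
move=> r; apply: (le_intble _ _ (intbleZ (`|c 0| + `|L| * `|r|) (intble_norm (lf r)))).
  by apply: measurable_funM; [apply: measurable_indic; exact: measurable_cube|exact: measurable_funM].
move=> x; rewrite mulrA normrM mulrC.
have [xr|xr] := pselect (cube 0 r x); last first.
  by rewrite indicE memNset// mul0r normr0 !mulr0.
by rewrite ler_wpM2r//; exact: lipschitz_bounded_cube lc _ xr.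
Qed.

(* The commutator of mollification with the first-order operator c d_i; it
   is controlled by the local oscillation of v because the kernel has mean 0. *)
Definition commutator (c : V -> R) (i : 'I_d) (e : R) (v : V -> R) (y : V) : R :=
  conv (moll e) (fun x => v x * aederive c (e_ i) x) y
  - conv (partial i (moll e)) (fun x => v x * c x) y
  + c y * conv (partial i (moll e)) v y.

Lemma partial_odd k i z : Ck 1 k -> (forall z, k (- z) = k z) ->
  partial i k (- z) = - partial i k z.
Proof.
move=> Ckk kev.
have h := @pderive_affine k (-1) 0 i z ((Ckk.2 i).1 _).
have E : (fun x : V => k (0 + (-1) *: x)) = k.
  by apply/funext => x; rewrite add0r scaleN1r kev.
by move: h; rewrite E add0r scaleN1r mulN1r => -[_ ->]; rewrite opprK.
Qed.

Lemma aederiveBc (c : V -> R) (a : R) i x :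
  aederive (fun x => c x - a) (e_ i) x = aederive c (e_ i) x.
Proof.
have h (b : R) (g : V -> R) : derivable g x (e_ i) ->
    derivable (fun x => g x + b) x (e_ i) /\ 'D_(e_ i) (fun x => g x + b) x = 'D_(e_ i) g x.
  move=> dg; have hh := pderive_cst b i x.
  have [h1 h2] := pderive_add dg hh.1; split; first exact: h1.
  by rewrite hh.2 addr0 in h2.
rewrite /aederive; have [dc|dc] := pselect (derivable c x (e_ i)).
  by have [da ea] := h (- a) c dc; rewrite (asboolT dc) (asboolT da).
have da : ~ derivable (fun x => c x - a) x (e_ i).
  move=> da; apply: dc; have := (h a _ da).1.
  by under eq_fun do rewrite subrK.
by rewrite (asboolF dc) (asboolF da).
Qed.

(** The commutator is the integral of [v] against the kernel [h], and [h x] is almost everywhere the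
    derivative in [x] of [(c x - c y) * moll e (x - y)]. Its integral is 0, so [v x] may be replaced
    by [v x - v y]. The factor [e^-1] of the differentiated mollifier is compensated by [c x - c y],
    which is of order [e] on the support. *)
Lemma commutator_bound (c : V -> R) (L : R) i :
  (forall x y, `|c y - c x| <= L * `|y - x|) ->
  exists2 M, 0 <= M & forall e v, 0 < e -> l2 mu v ->
    continuous (commutator c i e v) /\
    forall y, `|commutator c i e v y| <= M * kavg e v y.
Proof.
move=> lc; have [K K0 hK] := moll_facts R d.
exists (2 * `|L| * K); first by rewrite !mulr_ge0// ltW.
move=> e v e0 lv; have [[Cm sm mev] mge0 _ mK dmK] := hK e e0.
have C1m : Ck 1 (moll e) := Cm 1%N.
have C1dm : Ck 1 (partial i (moll e)) by have [_ /(_ i)[_]] := Cm 2.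
have sdm := supp_cube_partial i sm.
have lv' := l2_locint lv.
have L0 x : `|aederive c (e_ i) x| <= `|L|.
  apply: (le_trans (norm_aederive (e_ i) lc x)).
  apply: (le_trans (ler_wpM2r _ (ler_norm L))) => //.
  by rewrite -[leRHS]mulr1 ler_wpM2l// norm_delta_mx.
have mD := measurable_aederive (e_ i) lc.
have cc := lipschitz_continuous_rV lc; have mc := continuous_measurable_rV cc.
have l1 := locintM_bounded lv' mD L0.
have l2' := locintM_lipschitz lv' lc.
split.
  apply: continuousD_rV; first apply: continuousB_rV.
  - exact: conv_continuous C1m sm l1.
  - exact: conv_continuous C1dm sdm l2'.
  - by apply: continuousM_rV => //; exact: conv_continuous C1dm sdm lv'.
move=> y.
pose h x := moll e (x - y) * aederive c (e_ i) x + partial i (moll e) (x - y) * (c x - c y).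
have i1 := conv_intble y C1m.1 sm l1.
have i2 := conv_intble y C1dm.1 sdm l2'.
have i3 := conv_intble y C1dm.1 sdm lv'.
have moddE x : moll e (y - x) = moll e (x - y) by rewrite -mev opprB.
have doddE x : partial i (moll e) (y - x) = - partial i (moll e) (x - y).
  by rewrite -(partial_odd i _ C1m mev) opprB.
have eC : commutator c i e v y = \int[mu]_x (h x * v x).
  rewrite /commutator /conv -RintB// -RintZ// -RintD//; [|exact: intbleB|exact: intbleZ].
  by apply: eq_Rintegral => x _; rewrite /h moddE doddE; ring.
have mh : measurable_fun setT h.
  apply: measurable_funD; apply: measurable_funM => //.
  - by apply: continuous_measurable_rV; apply: continuous_translation_rV; exact: C1m.1.
  - by apply: continuous_measurable_rV; apply: continuous_translation_rV; exact: C1dm.1.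
  - exact: measurable_funB.
have hM x : `|h x| <= 2 * `|L| * K * ((2 * e) ^+ d)^-1 * \1_(cube 0 e) (x - y).
  have c0 : 0 < (2 * e) ^+ d by rewrite exprn_gt0// mulr_gt0.
  set Q := ((2 * e) ^+ d)^-1; have Q0 : 0 < Q by rewrite invr_gt0.
  have [xy|xy] := pselect (cube 0 e (x - y)); last first.
    by rewrite /h sm// sdm// !mul0r addr0 normr0 indicE memNset// mulr0.
  have := mK (x - y); have := dmK i (x - y).
  rewrite indicE mem_set// !mulr1 -/Q => b2 b1.
  rewrite /h; apply: (le_trans (ler_normD _ _)).
  rewrite (normrM (moll e _)) (normrM (partial i _ _)) (ger0_norm (mge0 _)).
  have t1 : moll e (x - y) * `|aederive c (e_ i) x| <= K * Q * `|L| by apply: ler_pM.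
  have t2 : `|partial i (moll e) (x - y)| * `|c x - c y| <= K * Q * `|L|.
    apply: (@le_trans _ _ ((K * e^-1 * Q) * (`|L| * e))).
      apply: ler_pM => //; apply: (le_trans (lc _ _)).
      apply: (le_trans (ler_wpM2r _ (ler_norm L))) => //.
      by rewrite ler_wpM2l//; move: xy; rewrite /cube /= subr0.
    rewrite le_eqVlt; apply/orP; left; apply/eqP; field; exact: lt0r_neq0.
  apply: (le_trans (lerD t1 t2)); rewrite le_eqVlt; apply/orP; left; apply/eqP; ring.
have [ih bh] := kernel_le_kavg lv mh hM.
suff h0 : intble mu h /\ \int[mu]_x h x = 0.
  rewrite eC; have -> : \int[mu]_x (h x * v x) = \int[mu]_x (h x * (v x - v y)); last exact: bh.
  rewrite -[RHS]addr0 -(mulr0 (v y)) -h0.2 -RintZ; last exact: h0.1.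
  rewrite -RintD//; last by apply: intbleZ; exact: h0.1.
  by apply: eq_Rintegral => x _; ring.
have lcy : forall a b : V, `|(c b - c y) - (c a - c y)| <= L * `|b - a|.
  by move=> a b; rewrite opprB addrA subrK; exact: lc.
have Cf : Ck 1 (fun x : V => moll e (- y + 1 *: x)) by exact: C1_affine.
have E (x : V) : - y + 1 *: x = x - y by rewrite scale1r addrC.
have sf : supp_cube (fun x : V => moll e (- y + 1 *: x)) (`|y| + e).
  move=> x xe; rewrite E -mev opprB; apply: sm => yx; apply: xe; exact: cube_sub.
have [j1 j2 j3] := lipschitz_ibp i lcy Cf sf.
have pf x : partial i (fun x : V => moll e (- y + 1 *: x)) x = partial i (moll e) (x - y).
  by rewrite (pderive_affine ((C1m.2 i).1 _)).2 mul1r E.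
have dcy := aederiveBc c (c y) i.
have eh x : h x = aederive (fun x => c x - c y) (e_ i) x * moll e (- y + 1 *: x) +
    (c x - c y) * partial i (fun x : V => moll e (- y + 1 *: x)) x.
  by rewrite /h pf dcy E; ring.
rewrite (funext eh); split; first exact: intbleD.
by rewrite RintD// j3 addNr.
Qed.

(** The left-hand integrand is what the second-order operator produces on a mollified test function.
    Transposing the mollifier leaves one derivative on the mollified [v], as the energy form
    requires, and the commutator collects the rest. *)
Lemma commutator_identity (c : V -> R) (L : R) i e v W r :
  (forall x y, `|c y - c x| <= L * `|y - x|) -> 0 < e -> l2 mu v ->
  continuous W -> supp_cube W r ->
  [/\ intble mu (fun x => v x * (aederive c (e_ i) x * conv (moll e) W x + c x * conv (partial i (moll e)) W x)),
      intble mu (fun y => commutator c i e v y * W y),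
      intble mu (fun y => c y * partial i (conv (moll e) v) y * W y) &
  \int[mu]_x (v x * (aederive c (e_ i) x * conv (moll e) W x + c x * conv (partial i (moll e)) W x)) =
  \int[mu]_y (commutator c i e v y * W y) - \int[mu]_y (c y * partial i (conv (moll e) v) y * W y)].
Proof.
move=> lc e0 lv cW W0; have [K K0 hK] := moll_facts R d.
have [[Cm sm mev] mge0 _ mK dmK] := hK e e0.
have C1m : Ck 1 (moll e) := Cm 1%N.
have C1dm : Ck 1 (partial i (moll e)) by have [_ /(_ i)[_]] := Cm 2.
have sdm := supp_cube_partial i sm.
have lv' := l2_locint lv.
have mD := measurable_aederive (e_ i) lc.
have cc := lipschitz_continuous_rV lc.
have l1 := locintM_bounded lv' mD (norm_aederive (e_ i) lc).
have l2' := locintM_lipschitz lv' lc.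
have [a1 a2 a3] := conv_dual C1m.1 sm l1 cW W0.
have [b1 b2 b3] := conv_dual C1dm.1 sdm l2' cW W0.
have em : (fun z : V => moll e (- z)) = moll e by apply/funext => z; exact: mev.
have edm : (fun z : V => partial i (moll e) (- z)) = (fun z => -1 * partial i (moll e) z).
  by apply/funext => z; rewrite partial_odd// mulN1r.
rewrite em in a2 a3.
have [Wb _ hWb] := continuous_bounded_cube cW W0.
have lW := bounded_locint (continuous_measurable_rV cW) hWb.
have e4 x : conv (fun z : V => partial i (moll e) (- z)) W x = - conv (partial i (moll e)) W x.
  rewrite edm /conv -RintN; last exact: conv_intble x C1dm.1 sdm lW.
  by apply: eq_Rintegral => y _; rewrite mulN1r mulNr.
have b2' : intble mu (fun x => v x * c x * conv (partial i (moll e)) W x).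
  have := intbleN b2; congr intble; apply/funext => x.
  apply: (etrans (congr1 (fun t => - (v x * c x * t)) (e4 x))).
  by rewrite mulrN opprK.
have b3' : \int[mu]_x (conv (partial i (moll e)) (fun x => v x * c x) x * W x) =
    - \int[mu]_x (v x * c x * conv (partial i (moll e)) W x).
  rewrite b3 -(RintN b2'); apply: eq_Rintegral => x _.
  by apply: (etrans (congr1 (fun t => (v x * c x * t)) (e4 x))); rewrite mulrN.
have pc y : partial i (conv (moll e) v) y = conv (partial i (moll e)) v y.
  by have [_] := conv_derive i y C1m sm lv'.
have i3 : intble mu (fun y => c y * partial i (conv (moll e) v) y * W y).
  have cF : continuous (fun y => c y * partial i (conv (moll e) v) y * W y).
    apply: continuousM_rV => //; apply: continuousM_rV => //.
    by rewrite (funext pc); exact: conv_continuous C1dm sdm lv'.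
  have sF : supp_cube (fun y => c y * partial i (conv (moll e) v) y * W y) r.
    by move=> y yr; rewrite W0// mulr0.
  have [B _ hB] := continuous_bounded_cube cF sF.
  exact: (intble_bounded_cube (continuous_measurable_rV cF) hB sF).
have eL x : v x * (aederive c (e_ i) x * conv (moll e) W x + c x * conv (partial i (moll e)) W x)
    = v x * aederive c (e_ i) x * conv (moll e) W x + v x * c x * conv (partial i (moll e)) W x.
  by rewrite mulrDr !mulrA.
have eR y : commutator c i e v y * W y = conv (moll e) (fun x => v x * aederive c (e_ i) x) y * W y
   - conv (partial i (moll e)) (fun x => v x * c x) y * W y + c y * partial i (conv (moll e) v) y * W y.
  by rewrite /commutator pc; ring.
have i2 : intble mu (fun y => commutator c i e v y * W y).
  by rewrite (funext eR); apply: intbleD => //; exact: intbleB.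
split => //; first by rewrite (funext eL); exact: intbleD.
rewrite (funext eL) RintD// (funext eR) RintD//; last exact: intbleB.
by rewrite RintB// b3' a3 addrK opprK.
Qed.

(** McShane's formula: the infimum of the cones of slope [L] over the graph of [f]. With it the
    coefficients can be convolved over the whole space; positivity is not extended and remains
    available on [U] only. *)
Lemma lipschitz_extension (U : set V) (f : V -> R) (L : R) : 0 <= L ->
  (forall x y, U x -> U y -> `|f y - f x| <= L * `|y - x|) ->
  exists2 g : V -> R, forall x, U x -> g x = f x &
    forall x y, `|g y - g x| <= L * `|y - x|.
Proof.
move=> L0 lf; have [[z0 Uz0]|U0] := pselect (exists z, U z); last first.
  exists (fun=> 0) => [x Ux|x y]; first by exfalso; apply: U0; exists x.
  by rewrite subrr normr0 mulr_ge0.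
pose E x := [set f z + L * `|x - z| | z in U].
have infE x : has_inf (E x).
  split; first by exists (f z0 + L * `|x - z0|), z0.
  exists (f z0 - L * `|x - z0|) => _ [z Uz <-].
  have := lf _ _ Uz Uz0; rewrite ler_norml => /andP[_ h].
  have : L * `|z0 - z| <= L * (`|x - z0| + `|x - z|).
    rewrite ler_wpM2l// (_ : z0 - z = (x - z) - (x - z0)); last by apply/rowP => i; rewrite !mxE; ring.
    by apply: (le_trans (ler_normB _ _)); rewrite addrC.
  rewrite mulrDr; lra.
have half x y : inf (E y) <= inf (E x) + L * `|y - x|.
  rewrite -lerBlDr; apply: lb_le_inf; first by case: (infE x).
  move=> _ [z Uz <-]; rewrite lerBlDr -addrA -mulrDr.
  apply: (le_trans (ge_inf (infE y).2 _)); first by exists z; [exact: Uz|reflexivity].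
  rewrite lerD2l ler_wpM2l// (_ : y - z = (x - z) + (y - x)); first exact: ler_normD.
  by apply/rowP => i; rewrite !mxE; ring.
exists (fun x => inf (E x)) => [x Ux|x y].
  apply/eqP; rewrite eq_le; apply/andP; split.
    by apply: (ge_inf (infE x).2); exists x => //; rewrite subrr normr0 mulr0 addr0.
  apply: lb_le_inf; first by case: (infE x).
  move=> _ [z Uz <-]; have := lf _ _ Uz Ux; rewrite ler_norml => /andP[_]; lra.
rewrite ler_norml; apply/andP; split; last by have := half x y; lra.
by have := half y x; rewrite distrC; lra.
Qed.

End parts.

(** * Euclidean distance to the boundary *)

Section euclid.
Variables (R : realType) (d : nat).
Local Notation V := 'rV[R]_d.
Implicit Types (u v w x y z : V) (U : set V).

(** Lagrange's identity: twice the defect is a sum of squares of minors. *)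
Lemma sum_CS (I : finType) (u v : I -> R) :
  (\sum_i u i * v i) ^+ 2 <= (\sum_i u i ^+ 2) * (\sum_i v i ^+ 2).
Proof.
set S := \sum_i _ * _; set A := \sum_i _; set B := \sum_i _.
have E : \sum_i \sum_j (u i * v j - u j * v i) ^+ 2 = A * B + B * A - 2 * (S * S).
  rewrite /A /B /S !big_distrlr mulr_sumr /= -big_split -sumrB; apply: eq_bigr => i _.
  rewrite mulr_sumr -big_split -sumrB; apply: eq_bigr => j _ /=; ring.
have : 0 <= \sum_i \sum_j (u i * v j - u j * v i) ^+ 2.
  by apply: sumr_ge0 => i _; apply: sumr_ge0 => j _; exact: sqr_ge0.
rewrite E (mulrC B) expr2; lra.
Qed.

Lemma enorm_ge0 v : 0 <= enorm v. Proof. exact: sqrtr_ge0. Qed.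

Lemma enorm_sqr v : enorm v ^+ 2 = \sum_i v ord0 i ^+ 2.
Proof. by rewrite sqr_sqrtr// sumr_ge0// => i _; exact: sqr_ge0. Qed.

Lemma norm_le_enorm v : `|v| <= enorm v.
Proof.
apply/rV_norm_le => [|i]; first exact: enorm_ge0.
rewrite -(@ler_pXn2r _ 2) ?nnegrE ?enorm_ge0// enorm_sqr real_normK ?num_real//.
by rewrite (bigD1 i)//= lerDl sumr_ge0// => j _; exact: sqr_ge0.
Qed.

Lemma enorm_le_norm v : enorm v <= d%:R * `|v|.
Proof.
rewrite -(@ler_pXn2r _ 2) ?nnegrE ?enorm_ge0 ?mulr_ge0// enorm_sqr exprMn.
apply: (@le_trans _ _ (d%:R * `|v| ^+ 2)).
  rewrite mulr_natl -[X in _ *+ X](card_ord d) -sumr_const; apply: ler_sum => i _.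
  by rewrite -real_normK ?num_real// lerXn2r ?nnegrE//; exact: rV_coord_le.
rewrite ler_wpM2r ?sqr_ge0// -natrX ler_nat.
by case: d => // n; rewrite expnS expn1 leq_pmulr.
Qed.

Lemma enorm_coord v i : `|v ord0 i| <= enorm v.
Proof. exact: le_trans (rV_coord_le v i) (norm_le_enorm v). Qed.

Lemma enormZ (a : R) v : enorm (a *: v) = `|a| * enorm v.
Proof.
rewrite /enorm -sqrtr_sqr -sqrtrM ?sqr_ge0// mulr_sumr; congr Num.sqrt.
by apply: eq_bigr => i _; rewrite mxE exprMn.
Qed.

Lemma enormN v : enorm (- v) = enorm v.
Proof. by rewrite -scaleN1r enormZ normrN1 mul1r. Qed.

Lemma enormC u v : enorm (u - v) = enorm (v - u).
Proof. by rewrite -enormN opprB. Qed.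

Lemma enorm_CS u v : \sum_i u ord0 i * v ord0 i <= enorm u * enorm v.
Proof.
apply: (le_trans (ler_norm _)); rewrite -(@ler_pXn2r _ 2) ?nnegrE ?mulr_ge0 ?enorm_ge0//.
by rewrite real_normK ?num_real// exprMn !enorm_sqr sum_CS.
Qed.

Lemma enormD u v : enorm (u + v) <= enorm u + enorm v.
Proof.
rewrite -(@ler_pXn2r _ 2) ?nnegrE ?addr_ge0 ?enorm_ge0// sqrrD !enorm_sqr.
have -> : \sum_i (u + v) ord0 i ^+ 2 = \sum_i u ord0 i ^+ 2 +
    (\sum_i u ord0 i * v ord0 i) *+ 2 + \sum_i v ord0 i ^+ 2.
  by rewrite -sumrMnl -!big_split; apply: eq_bigr => i _; rewrite mxE sqrrD.
by rewrite lerD2r lerD2l lerMn2r /=; exact: enorm_CS.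
Qed.

Lemma enorm0 : enorm (0 : V) = 0.
Proof. by rewrite -(scale0r 0) enormZ normr0 mul0r. Qed.

(* Distance to the complement of U, truncated at r.  On U it agrees with the
   distance to the boundary, and it is globally 1-Lipschitz. *)
Definition dst U (r : R) x : R :=
  inf ([set r] `|` [set enorm (x - z) | z in ~` U]).

Lemma has_inf_dst U r x : 0 <= r ->
  has_inf ([set r] `|` [set enorm (x - z) | z in ~` U]).
Proof.
move=> r0; split; first by exists r; left.
by exists 0 => _ [->//|[z _ <-]]; exact: enorm_ge0.
Qed.

Lemma dst_geP U r x t : 0 <= r ->
  (t <= dst U r x) <-> t <= r /\ forall z, ~ U z -> t <= enorm (x - z).
Proof.
move=> r0; have [ne lb] := has_inf_dst U x r0; split.
  move=> h; split => [|z Uz]; apply: (le_trans h); apply: ge_inf => //; first by left.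
  by right; exists z.
by move=> [h1 h2]; apply: lb_le_inf => // _ [->//|[z Uz <-]]; exact: h2.
Qed.

Lemma dst_le U r x : 0 <= r -> dst U r x <= r.
Proof. by move=> r0; have /dst_geP[] := lexx (dst U r x). Qed.

Lemma dst_le_enorm U r x z : 0 <= r -> ~ U z -> dst U r x <= enorm (x - z).
Proof. by move=> r0 Uz; have /dst_geP[//|_] := lexx (dst U r x); apply. Qed.

Lemma dst_ge0 U r x : 0 <= r -> 0 <= dst U r x.
Proof. by move=> r0; apply/dst_geP => //; split => // z _; exact: enorm_ge0. Qed.

Lemma dst_out U r x : 0 <= r -> ~ U x -> dst U r x = 0.
Proof.
move=> r0 Ux; apply/eqP; rewrite eq_le dst_ge0// andbT.
by rewrite (le_trans (dst_le_enorm x r0 Ux))// subrr enorm0.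
Qed.

Lemma dst_lip U r x y : 0 <= r -> `|dst U r y - dst U r x| <= enorm (y - x).
Proof.
move=> r0; have half a b : dst U r a - enorm (b - a) <= dst U r b.
  apply/dst_geP => //; split => [|z Uz].
    by rewrite lerBlDr (le_trans (dst_le U a r0))// lerDl enorm_ge0.
  rewrite lerBlDr (le_trans (dst_le_enorm a r0 Uz))//.
  have -> : a - z = (b - z) + (a - b) by apply/rowP => i; rewrite !mxE; ring.
  by rewrite (enormC b a); exact: enormD.
have := half x y; have := half y x; rewrite (enormC x) ler_norml => h1 h2.
by apply/andP; split; lra.
Qed.

Lemma dst_lipschitz U r x y : 0 <= r -> `|dst U r y - dst U r x| <= d%:R * `|y - x|.
Proof. by move=> r0; exact: le_trans (dst_lip _ _ _ r0) (enorm_le_norm _). Qed.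

Lemma continuous_dst U r : 0 <= r -> continuous (dst U r).
Proof. by move=> r0; apply: lipschitz_continuous_rV => x y; exact: dst_lipschitz. Qed.

Lemma open_cube U x : open U -> U x -> exists2 e : R, 0 < e & cube x e `<=` U.
Proof.
move=> oU Ux; have /nbhs_ballP[e /= e0 he] := open_nbhs_nbhs (conj oU Ux).
exists (e / 2); first by rewrite divr_gt0.
move=> y yx; apply: he; rewrite -ball_normE /= distrC (le_lt_trans yx)//; lra.
Qed.

Lemma dst_gt0 U r x : open U -> 0 < r -> U x -> 0 < dst U r x.
Proof.
move=> oU r0 Ux; have [e e0 he] := open_cube oU Ux.
apply: (@lt_le_trans _ _ (Num.min r e)); first by rewrite lt_min r0 e0.
apply/dst_geP; [exact: ltW|split; first by rewrite ge_min lexx].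
move=> z Uz; rewrite ge_min; apply/orP; right; rewrite leNgt; apply/negP => h.
apply: Uz; apply: he; rewrite /cube /= distrC (le_trans (norm_le_enorm _))//.
exact: ltW.
Qed.

Lemma dst_min U r t x : 0 <= t -> t <= r -> dst U t x = Num.min t (dst U r x).
Proof.
move=> t0 tr; have r0 := le_trans t0 tr.
apply/eqP; rewrite eq_le le_min dst_le//=; apply/andP; split.
  by apply/dst_geP => //; split => [|z Uz]; [exact: le_trans (dst_le _ _ t0) tr|exact: dst_le_enorm].
apply/dst_geP => //; split => [|z Uz]; first by rewrite ge_min lexx.
by rewrite ge_min dst_le_enorm ?orbT.
Qed.

(** The point where the segment first leaves [U] is outside [U], because [U] is open, while points
    just before it are inside; so it is a boundary point. This is why the distance to the complement
    equals the distance to the boundary. *)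
Lemma segment_boundary U x z : open U -> U x -> ~ U z ->
  exists2 y, boundary U y & enorm (x - y) <= enorm (x - z).
Proof.
move=> oU Ux Uz; pose p (t : R) : V := x + t *: (z - x).
have pp s t : p s - p t = (s - t) *: (z - x).
  by rewrite /p opprD addrACA subrr add0r -scalerBl.
pose T := [set t : R | 0 <= t <= 1 /\ ~ U (p t)].
have T1 : T 1 by split; [rewrite ler01 lexx|rewrite /p scale1r addrC subrK].
have iT : has_inf T by split; [exists 1|exists 0 => t [/andP[]]].
set t0 := inf T.
have t00 : 0 <= t0 by apply: lb_le_inf => [|t [/andP[]]//]; exists 1.
have t01 : t0 <= 1 by apply: ge_inf => //; case: iT.
have close (W : set V) : open W -> W (p t0) -> exists2 e : R, 0 < e &
    forall t, `|t - t0| < e -> W (p t).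
  move=> oW Wp; have [e e0 he] := open_cube oW Wp.
  have N0 : 0 < `|z - x| + 1 by rewrite ltr_wpDl.
  exists (e / (`|z - x| + 1)); first by rewrite divr_gt0.
  move=> t; rewrite ltr_pdivlMr// => te; apply: he; rewrite /cube /= pp normrZ.
  by rewrite (le_trans _ (ltW te))// ler_wpM2l// lerDl.
have Up : ~ U (p t0).
  move=> Up; have [e e0 he] := close U oU Up.
  have [t Tt tlt] := inf_adherent e0 iT.
  have : t0 <= t by apply: ge_inf => //; case: iT.
  by move=> t0t; apply: Tt.2; apply: he; rewrite ger0_norm ?subr_ge0// ltrBlDl.
have t0gt : 0 < t0.
  rewrite lt_neqAle t00 andbT; apply/eqP => t0E; apply: Up.
  by rewrite -t0E /p scale0r addr0.
exists (p t0); last first.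
  have -> : x - p t0 = t0 *: (x - z).
    by apply/rowP => i; rewrite !mxE; ring.
  by rewrite enormZ ger0_norm// ler_piMl ?enorm_ge0.
split; last by move=> /interior_subset.
move=> W /nbhs_interior; rewrite nbhsE => -[W' [oW' W'p] W'W].
have [e e0 he] := close W' oW' W'p.
(* Slightly before the exit, cut at 0 so as to remain on the segment. *)
pose t := Num.max 0 (t0 - e / 2).
have tt0 : t < t0 by rewrite gt_max t0gt /=; lra.
have t0' : 0 <= t by rewrite le_max lexx.
exists (p t); split; last first.
  apply: interior_subset; apply: W'W; apply: he; rewrite ler0_norm ?subr_le0 ?ltW// opprB.
  by have : t0 - e / 2 <= t by [rewrite le_max lexx orbT]; lra.
apply: contrapT => Upt.
suff : t0 <= t by rewrite leNgt tt0.
apply: ge_inf; first by case: iT.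
by split => //; rewrite t0' (le_trans (ltW tt0)).
Qed.

(** One inequality holds because boundary points of an open set lie outside it, the other by
    [segment_boundary]. The truncation at [r] absorbs the value +oo that [bdist] takes when the
    boundary is empty. *)
Lemma bdist_dst U r x : open U -> 0 <= r -> U x ->
  (dst U r x)%:E = Order.min (bdist U x) r%:E.
Proof.
move=> oU r0 Ux; apply/eqP; rewrite eq_le; apply/andP; split.
  rewrite le_min lee_fin dst_le// andbT; apply: le_ereal_inf_tmp => _ [y [_ Uy] <-].
  by rewrite lee_fin dst_le_enorm// => Uy'; apply: Uy; apply: open_nbhs_nbhs.
have b0 : (0 <= bdist U x)%E.
  by apply: le_ereal_inf_tmp => _ [y _ <-]; rewrite lee_fin enorm_ge0.
set m := Order.min _ _.
have m0 : (0 <= m)%E by rewrite le_min b0 lee_fin.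
have mr : (m <= r%:E)%E by rewrite ge_min lexx orbT.
have mE : m = (fine m)%:E.
  by rewrite fineK// ge0_fin_numE// (le_lt_trans mr)// ltry.
rewrite mE lee_fin; apply/dst_geP => //; split; first by rewrite -lee_fin -mE.
move=> z Uz; have [y By xy] := segment_boundary oU Ux Uz.
rewrite -lee_fin -mE; apply: (@le_trans _ _ (enorm (x - y))%:E); last by rewrite lee_fin.
by rewrite ge_min; apply/orP; left; apply: ereal_inf_lbound; exists y.
Qed.

Lemma collarP U r t x : open U -> 0 <= r -> t <= r ->
  collar U t x <-> U x /\ dst U r x < t.
Proof.
move=> oU r0 tr; split => -[Ux h]; split => //.
  by rewrite -lte_fin bdist_dst// gt_min h.
move: h; rewrite -lte_fin bdist_dst// gt_min => /orP[//|].
by rewrite lte_fin ltNge tr.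
Qed.

Lemma bdist_collar U r t x : open U -> 0 <= r -> t <= r -> collar U t x ->
  fine (bdist U x) = dst U r x.
Proof.
move=> oU r0 tr [Ux h]; have := bdist_dst oU r0 Ux.
rewrite min_l; first by move=> <-.
by rewrite (le_trans (ltW h))// lee_fin.
Qed.

(** For positive [k] these compact sets exhaust [U]. Supports are measured by the two numbers [k]
    and [n], so that mollification acts on them by simple arithmetic. *)
Definition core U (k n : R) : set V := [set x | cube 0 n x /\ k <= dst U 1 x].

Lemma compact_core U k n : compact (core U k n).
Proof.
apply: compact_closedI; first exact: compact_cube.
have := @closed_comp _ _ (dst U 1) [set t | k <= t].
by apply => [x _|]; [exact: continuous_dst|exact: closed_ge].
Qed.

Lemma core_sub U k n : 0 < k -> core U k n `<=` U.
Proof.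
move=> k0 x [_ kx]; apply: contrapT => Ux.
by move: kx; rewrite dst_out// leNgt k0.
Qed.

Lemma compact_pos_min (K : set V) (f : V -> R) : compact K -> continuous f ->
  (forall x, K x -> 0 < f x) -> exists2 k, 0 < k & forall x, K x -> k <= f x.
Proof.
move=> cK cf f0; have [Kne|K0] := pselect (K !=set0); last first.
  by exists 1 => // x Kx; exfalso; apply: K0; exists x.
have [|c /set_mem Kc hc] := @EVT_min_rV _ _ f _ Kne cK; first exact: continuous_subspaceT.
by exists (f c); [exact: f0|move=> x Kx; apply: hc; exact: mem_set].
Qed.

Lemma compact_core_sub U K : open U -> compact K -> K `<=` U ->
  exists k n, [/\ 0 < k, 0 < n & K `<=` core U k n].
Proof.
move=> oU cK KU; have [k k0 hk] := compact_pos_min cK (@continuous_dst U 1 ler01)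
  (fun x Kx => dst_gt0 oU ltr01 (KU x Kx)).
have [M [_ hM]] := compact_bounded cK.
exists k, (`|M| + 1); split; [exact: k0|by rewrite ltr_wpDl|].
move=> x Kx; split; last exact: hk.
by rewrite /cube /= subr0; apply: hM => //; rewrite (le_lt_trans (ler_norm M))// ltrDl.
Qed.

(** The factor [d] compares the two norms: cubes are taken in the sup norm, whereas the distance is
    1-Lipschitz in the Euclidean one. *)
Lemma core_shift U k n e x y : cube x e y -> core U k n y ->
  core U (k - d%:R * e) (n + e) x.
Proof.
rewrite /cube /= => xy [ny ky]; split.
  rewrite /cube /= subr0 -(subrK y x) addrC (le_trans (ler_normD _ _))// lerD//.
  - by rewrite /cube /= subr0 in ny.
  - by rewrite distrC.
have := @dst_lipschitz U 1 x y ler01; rewrite ler_norml => /andP[_ h].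
have : d%:R * `|y - x| <= d%:R * e by rewrite ler_wpM2l.
lra.
Qed.

End euclid.

(** * The operator on real test functions and its energy *)

Section form.
Variables (R : realType) (d : nat).
Local Notation V := 'rV[R]_d.
Implicit Types (M : 'I_d -> 'I_d -> R) (u w z : 'I_d -> R).

Definition qf M u w : R := \sum_k \sum_l M k l * (u k * w l).

Lemma qf_linl M (p q : R) u w z :
  qf M (fun k => p * u k + q * w k) z = p * qf M u z + q * qf M w z.
Proof.
rewrite /qf !mulr_sumr -big_split; apply: eq_bigr => k _ /=.
rewrite !mulr_sumr -big_split; apply: eq_bigr => l _ /=; ring.
Qed.

Lemma qf_sym M u w : (forall k l, M k l = M l k) -> qf M u w = qf M w u.
Proof.
move=> MS; rewrite /qf exchange_big; apply: eq_bigr => k _; apply: eq_bigr => l _ /=.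
by rewrite MS [u l * _]mulrC.
Qed.

Lemma qf_linr M (p q : R) u w z : (forall k l, M k l = M l k) ->
  qf M z (fun k => p * u k + q * w k) = p * qf M z u + q * qf M z w.
Proof. by move=> MS; rewrite qf_sym// qf_linl !(qf_sym z). Qed.

Lemma qf0 M u : (forall k, u k = 0) -> qf M u u = 0.
Proof.
by move=> u0; rewrite /qf big1// => k _; rewrite big1// => l _; rewrite u0 mul0r mulr0.
Qed.

(** The difference of the two sides is [t^-1] times the form at [t * u - w]. *)
Lemma qf_young M (t : R) u w : (forall k l, M k l = M l k) ->
  (forall u, 0 <= qf M u u) -> 0 < t ->
  qf M (fun k => u k + w k) (fun k => u k + w k) <=
  (1 + t) * qf M u u + (1 + t^-1) * qf M w w.
Proof.
move=> MS M0 t0; have := M0 (fun k => t * u k + (- 1) * w k).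
have -> : qf M (fun k => u k + w k) (fun k => u k + w k) =
    qf M (fun k => 1 * u k + 1 * w k) (fun k => 1 * u k + 1 * w k).
  by rewrite /qf; apply: eq_bigr => k _; apply: eq_bigr => l _; rewrite !mul1r.
rewrite !qf_linl !qf_linr// (qf_sym w u)//; set a := qf M u u; set b := qf M u w; set e := qf M w w.
move=> h; rewrite -subr_ge0.
have -> : (1 + t) * a + (1 + t^-1) * e - (1 * (1 * a + 1 * b) + 1 * (1 * b + 1 * e)) =
   t^-1 * (t * (t * a + -1 * b) + -1 * (t * b + -1 * e)) by field; exact: lt0r_neq0.
by rewrite mulr_ge0// invr_ge0 ltW.
Qed.

Lemma qf_bound M u (B : R) : (forall k l, `|M k l| <= B) ->
  qf M u u <= d%:R * B * \sum_i u i ^+ 2.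
Proof.
move=> hB; have [d0|d0] := posnP d.
  rewrite /qf !big1 ?mulr0// => i; by move: (ltn_ord i); rewrite {2}d0.
have B0 : 0 <= B by apply: le_trans (hB (Ordinal d0) (Ordinal d0)).
set b := B / 2; set S := \sum_i _.
have h k l : M k l * (u k * u l) <= b * u k ^+ 2 + b * u l ^+ 2.
  rewrite -mulrDr; apply: (le_trans (ler_norm _)); rewrite normrM /b -mulrA; apply: ler_pM => //.
  have h1 := sqr_ge0 (u k - u l); have h2 := sqr_ge0 (u k + u l).
  by rewrite ler_norml; apply/andP; split; rewrite !expr2 in h1 h2 *; lra.
apply: (le_trans (ler_sum _ (fun k _ => ler_sum _ (fun l _ => h k l)))).
under eq_bigr do rewrite big_split /= sumr_const card_ord -mulr_sumr -/S.
rewrite big_split /= sumr_const card_ord sumrMnl -mulr_sumr -/S.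
rewrite -mulr_natl le_eqVlt; apply/orP; left; apply/eqP; rewrite /b; by field.
Qed.

End form.

Section operator.
Variables (R : realType) (d : nat).
Local Notation V := 'rV[R]_d.
Local Notation mu := (rV_lebesgue R d).
Local Notation e_ i := (delta_mx ord0 i : V).
Implicit Types (f g v w : V -> R).

Definition grad f (x : V) : 'I_d -> R := fun i => partial i f x.

Lemma partial_off (K : set V) f i x : closed K -> (forall y, ~ K y -> f y = 0) ->
  ~ K x -> partial i f x = 0.
Proof.
move=> cK f0 Kx; have E : {near x, f =1 cst 0}.
  have : nbhs x (~` K) by apply: open_nbhs_nbhs; split => //; exact: closed_openC.
  by apply: filterS => y; exact: f0.
by rewrite /partial (near_eq_derive _ E) derive_cst.
Qed.

Lemma closed_core U k n : closed (@core R d U k n).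
Proof. by apply: compact_closed; [exact: norm_hausdorff|exact: compact_core]. Qed.

Lemma intble_csupp f r : continuous f -> supp_cube f r -> intble mu f.
Proof.
move=> cf f0; have [B _ hB] := continuous_bounded_cube cf f0.
exact: (intble_bounded_cube (continuous_measurable_rV cf) hB f0).
Qed.

Lemma l2_csupp f r : continuous f -> supp_cube f r -> l2 mu f.
Proof.
move=> cf f0; split; first exact: continuous_measurable_rV.
apply: (@intble_csupp _ r) => [|x xr]; last by rewrite f0// expr0n.
by under eq_fun do rewrite expr2; exact: continuousM_rV.
Qed.

Variables (cc : 'I_d -> 'I_d -> V -> R) (L : R).
Hypothesis lcc : forall k l x y, `|cc k l y - cc k l x| <= L * `|y - x|.

(** Minus the divergence of $C\nabla\phi$, expanded by the product rule with [aederive], so that it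
    has a value also where a coefficient is not differentiable. *)
Definition dop (phi : V -> R) (x : V) : R :=
  - \sum_k \sum_l (aederive (cc k l) (e_ k) x * partial l phi x +
                   cc k l x * partial k (partial l phi) x).

(** Since [v] has no gradient, the test function is itself a mollification. Moving the mollifier
    across makes the gradient of the mollified [v] appear against that of [w], up to commutators. *)
Lemma weak_identity v w e r lam : l2 mu v -> 0 < e -> Ck 1 w -> supp_cube w r ->
  let phi := conv (moll e) w in let ve := conv (moll e) v in
  let F x := \sum_k \sum_l cc k l x * (partial k ve x * partial l w x)
     - \sum_k \sum_l commutator (cc k l) k e v x * partial l w x + lam * (ve x * w x) in
  intble mu F /\
  \int[mu]_x (v x * (dop phi x + lam * phi x)) = \int[mu]_x F x.
Proof.
move=> lv e0 Cw w0 phi ve F; have [K K0 hK] := moll_facts R d.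
have [[Cm sm mev] mge0 _ mK dmK] := hK e e0.
have C1m : Ck 1 (moll e) := Cm 1%N.
have lv' := l2_locint lv.
have [Bw _ hBw] := continuous_bounded_cube Cw.1 w0.
have lw := bounded_locint (continuous_measurable_rV Cw.1) hBw.
have pphi l : partial l phi = conv (moll e) (partial l w).
  apply/funext => x; rewrite -(conv_partial _ _ C1m sm Cw w0).
  by have [_] := conv_derive l x C1m sm lw.
have ppphi k l x : partial k (partial l phi) x = conv (partial k (moll e)) (partial l w) x.
  have cl := (Cw.2 l).2; have sl := supp_cube_partial l w0.
  have [B _ hB] := continuous_bounded_cube cl sl.
  rewrite pphi; have [_] := conv_derive k x C1m sm (bounded_locint (continuous_measurable_rV cl) hB).
  by [].
have ci k l := commutator_identity k (lcc k l) e0 lv (Cw.2 l).2 (supp_cube_partial l w0).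
pose A k l x := v x * (aederive (cc k l) (e_ k) x * conv (moll e) (partial l w) x +
     cc k l x * conv (partial k (moll e)) (partial l w) x).
pose B k l y := commutator (cc k l) k e v y * partial l w y.
pose D k l y := cc k l y * partial k ve y * partial l w y.
have iA k l : intble mu (A k l) by have [] := ci k l.
have iB k l : intble mu (B k l) by have [] := ci k l.
have iD k l : intble mu (D k l) by have [] := ci k l.
have [a1 a2 a3] := conv_dual C1m.1 sm lv' Cw.1 w0.
have em : (fun z : V => moll e (- z)) = moll e by apply/funext => z; exact: mev.
rewrite em -/phi -/ve in a1 a2 a3.
have eL : (fun x => v x * (dop phi x + lam * phi x)) =
    (fun x => lam * (v x * phi x) - \sum_k \sum_l A k l x).
  apply/funext => x; rewrite mulrDr addrC mulrCA; congr (_ + _).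
  rewrite /dop mulrN mulr_sumr; congr (- _); apply: eq_bigr => k _.
  by rewrite mulr_sumr; apply: eq_bigr => l _; rewrite ppphi pphi.
have iSA : intble mu (fun x => \sum_k \sum_l A k l x).
  by apply: intble_sum => k; apply: intble_sum.
have iSB : intble mu (fun x => \sum_k \sum_l B k l x).
  by apply: intble_sum => k; apply: intble_sum.
have iSD : intble mu (fun x => \sum_k \sum_l D k l x).
  by apply: intble_sum => k; apply: intble_sum.
have iL := intbleZ lam a2; have iM := intbleZ lam a1.
have eR : F =
   (fun x => \sum_k \sum_l D k l x - \sum_k \sum_l B k l x + lam * (ve x * w x)).
  apply/funext => x; congr (_ - _ + _); apply: eq_bigr => k _; apply: eq_bigr => l _.
  exact: mulrA.
rewrite eL eR; split; first by apply: intbleD => //; exact: intbleB.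
rewrite [in RHS]RintD//; last exact: intbleB.
rewrite !RintB// !RintZ// [RHS]addrC a3; congr (_ + _).
have dsum (G : 'I_d -> 'I_d -> V -> R) : (forall k l, intble mu (G k l)) ->
    \int[mu]_x (\sum_k \sum_l G k l x) = \sum_k \sum_l \int[mu]_x G k l x.
  move=> iF; rewrite Rint_sum => [|k]; last exact: intble_sum.
  by apply: eq_bigr => k _; rewrite Rint_sum.
rewrite !dsum// -sumrN -sumrB; apply: eq_bigr => k _; rewrite -sumrN -sumrB.
by apply: eq_bigr => l _; have [_ _ _ ->] := ci k l; rewrite opprB.
Qed.

Lemma commutator_bounds : exists2 M, 0 <= M & forall k l e v, 0 < e -> l2 mu v ->
  forall y, `|commutator (cc k l) k e v y| <= M * kavg e v y.
Proof.
have /choice[M hM] : forall p : 'I_d * 'I_d, exists M, 0 <= M /\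
    forall e v, 0 < e -> l2 mu v ->
    forall y, `|commutator (cc p.1 p.2) p.1 e v y| <= M * kavg e v y.
  move=> p; have [M M0 hM] := commutator_bound p.1 (lcc p.1 p.2).
  by exists M; split => // e v e0 lv; have [] := hM e v e0 lv.
have M0 p : 0 <= M p by case: (hM p).
exists (\sum_p M p); first by rewrite sumr_ge0.
move=> k l e v e0 lv y; apply: (le_trans ((hM (k, l)).2 e v e0 lv y)).
rewrite ler_wpM2r ?kavg_ge0//.
by rewrite (bigD1 (k, l))//= lerDl sumr_ge0.
Qed.

Variable U : set V.
Hypothesis oU : open U.
Hypothesis ccS : forall x, U x -> forall k l, cc k l x = cc l k x.
Hypothesis ccP : forall x, U x -> forall u : V, u != 0 ->
  0 < qf (fun k l => cc k l x) (fun i => u ord0 i) (fun i => u ord0 i).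

Lemma continuous_cc k l : continuous (cc k l).
Proof. exact: lipschitz_continuous_rV (lcc k l). Qed.

Lemma qf_ge0 x (u : 'I_d -> R) : U x -> 0 <= qf (fun k l => cc k l x) u u.
Proof.
move=> Ux; have [u0|u0] := eqVneq (\row_i u i) 0.
  rewrite qf0// => k; have := congr1 (fun z : V => z ord0 k) u0.
  by rewrite !mxE.
have := ccP Ux u0; rewrite /qf.
by under eq_bigr do under eq_bigr do rewrite !mxE; exact: ltW.
Qed.

(** Pointwise positivity becomes uniform by compactness of the product of the core with the
    Euclidean unit sphere; homogeneity does the rest. *)
Lemma elliptic_core k n : 0 < k -> exists2 kap, 0 < kap &
  forall x, core U k n x -> forall u : 'I_d -> R,
    kap * \sum_i u i ^+ 2 <= qf (fun k l => cc k l x) u u.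
Proof.
move=> k0; pose K := core U k n `*` [set u : V | enorm u = 1].
have cenorm : continuous (@enorm R d).
  apply: (@lipschitz_continuous_rV _ _ _ d%:R) => x y.
  apply: le_trans (enorm_le_norm _).
  have h a b : enorm a - enorm b <= enorm (a - b) :> R.
    by rewrite lerBlDr (le_trans _ (enormD _ _))// subrK.
  by rewrite ler_norml h andbT lerNl opprB enormC h.
have cS : compact [set u : V | enorm u = 1].
  apply: (@subclosed_compact _ _ (cube 0 1)); last 2 first.
  - exact: compact_cube.
  - by move=> u /= <-; rewrite /cube /= subr0 norm_le_enorm.
  have := @closed_comp _ _ (@enorm R d) [set t | t = 1].
  by apply => [x _|]; [exact: cenorm|exact: closed_eq].
have cK : compact K by apply: compact_setX => //; exact: compact_core.
pose F (p : V * V) := qf (fun k l => cc k l p.1) (fun i => p.2 ord0 i) (fun i => p.2 ord0 i).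
have cF : continuous F.
  have cs (I : finType) (G : I -> V * V -> R) :
      (forall i, continuous (G i)) -> continuous (fun x => \sum_i G i x).
    move=> cG; rewrite (_ : (fun x => _) = (fun x => \sum_(i <- index_enum I) G i x))//.
    elim: (index_enum I) => [|i s IH].
      by under eq_fun do rewrite big_nil; move=> p; exact: cst_continuous.
    by under eq_fun do rewrite big_cons; move=> p; exact: (continuousD (cG i p) (IH p)).
  apply: (cs) => i; apply: (cs) => j p.
  have c1 : {for p, continuous (fun p : V * V => cc i j p.1)}.
    by apply: (@continuous_comp _ _ _ fst (cc i j)); [exact: cvg_fst|exact: continuous_cc].
  have c2 m : {for p, continuous (fun p : V * V => p.2 ord0 m)}.
    by apply: (@continuous_comp _ _ _ snd (fun x : V => x ord0 m)); [exact: cvg_snd|exact: continuous_coord_rV].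
  exact: (continuousM c1 (continuousM (c2 i) (c2 j))).
have [kap kap0 hk] : exists2 kap, 0 < kap & forall p, K p -> kap <= F p.
  have [Kne|K0] := pselect (K !=set0); last first.
    by exists 1 => // p Kp; exfalso; apply: K0; exists p.
  have [|[x u] /set_mem [Kx u1] hc] := @compact_EVT_min _ _ F _ Kne cK.
    exact: continuous_subspaceT.
  exists (F (x, u)); last by move=> p Kp; apply: hc; exact: mem_set.
  apply: ccP; first exact: core_sub Kx.
  by apply/eqP => /= u0; move: u1 => /=; rewrite u0 enorm0 => /eqP; rewrite eq_sym oner_eq0.
exists kap => // x Kx u; set w : V := \row_i u i.
have eS : \sum_i u i ^+ 2 = enorm w ^+ 2.
  by rewrite enorm_sqr; apply: eq_bigr => i _; rewrite mxE.
rewrite eS; have [w0|w0] := eqVneq (enorm w) 0.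
  by rewrite w0 expr0n mulr0 qf_ge0//; exact: core_sub Kx.
have wp : 0 < enorm w by rewrite lt_neqAle eq_sym w0 enorm_ge0.
have /hk : K (x, (enorm w)^-1 *: w).
  by split => //=; rewrite enormZ gtr0_norm ?invr_gt0// mulVf.
rewrite /F /= /qf; under eq_bigr do under eq_bigr do rewrite !mxE mulrACA [cc _ _ _ * _]mulrCA.
under eq_bigr do rewrite -mulr_sumr.
by rewrite -mulr_sumr -invfM -expr2 ler_pdivlMl ?exprn_gt0// mulrC.
Qed.

(** Vanishing off a core is a support condition that sums and mollifications at small scale
    preserve, and it makes the function and its derivatives vanish off [U]. *)
Definition tst (phi : V -> R) :=
  Cinf phi /\ exists k n, 0 < k /\ forall x, ~ core U k n x -> phi x = 0.

Lemma conv_moll_off k n e w x : 0 < e -> (forall y, ~ core U k n y -> w y = 0) ->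
  ~ core U (k - d%:R * e) (n + e) x -> conv (moll e) w x = 0.
Proof.
move=> e0 w0 xK; have [K K0 hK] := moll_facts R d.
have [[_ sm _] _ _ _ _] := hK e e0.
rewrite /conv (_ : (fun y => _) = (fun=> 0)); first exact: Rint0.
apply/funext => y; have [xy|xy] := pselect (cube 0 e (x - y)); last by rewrite sm// mul0r.
rewrite w0 ?mulr0// => yK; apply: xK; apply: core_shift yK.
by move: xy; rewrite /cube /= subr0 distrC.
Qed.

Lemma conv_moll_tst k n e w : 0 < e -> d%:R * e < k -> locint w ->
  (forall y, ~ core U k n y -> w y = 0) -> tst (conv (moll e) w).
Proof.
move=> e0 ek lw w0; have [K K0 hK] := moll_facts R d.
have [[Cm sm _] _ _ _ _] := hK e e0.
split; first exact: conv_Cinf Cm sm lw.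
exists (k - d%:R * e), (n + e); split; last by move=> x; exact: conv_moll_off.
by rewrite subr_gt0.
Qed.

End operator.

(** * The energy inequality for mollified weak solutions *)

Section energy.
Variables (R : realType) (d : nat).
Local Notation V := 'rV[R]_d.
Local Notation mu := (rV_lebesgue R d).
Local Notation e_ i := (delta_mx ord0 i : V).

Lemma young (a b q : R) : 0 < q -> a * b <= q * b ^+ 2 + a ^+ 2 / (4 * q).
Proof.
move=> q0; rewrite -subr_ge0.
have -> : q * b ^+ 2 + a ^+ 2 / (4 * q) - a * b = (2 * q * b - a) ^+ 2 / (4 * q).
  by field; exact: lt0r_neq0.
by rewrite divr_ge0 ?sqr_ge0// mulr_ge0// ltW.
Qed.

Variables (cc : 'I_d -> 'I_d -> V -> R) (L : R).
Hypothesis lcc : forall k l x y, `|cc k l y - cc k l x| <= L * `|y - x|.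
Variable U : set V.
Hypothesis oU : open U.
Hypothesis ccS : forall x, U x -> forall k l, cc k l x = cc l k x.
Hypothesis ccP : forall x, U x -> forall u : V, u != 0 ->
  0 < qf (fun k l => cc k l x) (fun i => u ord0 i) (fun i => u ord0 i).
Local Notation c x := (fun k l => cc k l x).

Lemma continuous_qf_grad f : Ck 1 f -> continuous (fun x => qf (c x) (grad f x) (grad f x)).
Proof.
move=> Cf; apply: continuous_sum_rV => k; apply: continuous_sum_rV => l.
apply: continuousM_rV; first exact: (continuous_cc lcc).
by apply: continuousM_rV; exact: (Cf.2 _).2.
Qed.

(** The test function is built from [w = eta * psi], that is [eta] squared times the mollified [v].
    The commutators meet the gradient of [w], which is of first order in [psi]; Young's inequality
    pays for them with a fraction [t] of the energy, one unit of [lam] and a multiple [C] of the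
    oscillation. [C] depends on [eta] but not on [e], so the last term disappears as [e] tends to 0
    with [eta] fixed. *)
Lemma energy (v eta : V -> R) k n lam t : l2 mu v -> 0 < k -> Ck 1 eta ->
  (forall x, ~ core U k n x -> eta x = 0) -> 0 < t ->
  (forall phi, tst U phi -> \int[mu]_x (v x * (dop cc phi x + lam * phi x)) = 0) ->
  exists C, 0 <= C /\ exists2 e0, 0 < e0 & forall e, 0 < e < e0 ->
    l2 mu (kavg e v) /\ let psi := fun x => eta x * conv (moll e) v x in
    (1 - t) * \int[mu]_x qf (c x) (grad psi x) (grad psi x) +
      (lam - 1) * \int[mu]_x psi x ^+ 2 <=
    \int[mu]_x (conv (moll e) v x ^+ 2 * qf (c x) (grad eta x) (grad eta x)) +
      C * dot mu (kavg e v) (kavg e v).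
Proof.
move=> lv k0 Ceta eta0 t0 vorth; have [K K0 hK] := moll_facts R d.
have sn f : (forall x, ~ core U k n x -> f x = 0) -> supp_cube f n.
  by move=> f0 x xn; apply: f0 => -[].
have se := sn _ eta0; have lv' := l2_locint lv.
have [B1 B10 hB1] := continuous_bounded_cube Ceta.1 se.
have /choice[Bi hBi] : forall i, exists B, 0 <= B /\ forall x, `|partial i eta x| <= B.
  move=> i; have [B B0 hB] := continuous_bounded_cube (Ceta.2 i).2 (supp_cube_partial i se).
  by exists B.
pose B := B1 + \sum_i Bi i.
have B0 : 0 <= B by rewrite addr_ge0// sumr_ge0// => i _; case: (hBi i).
have hBe x : `|eta x| <= B.
  by apply: (le_trans (hB1 x)); rewrite lerDl sumr_ge0// => i _; case: (hBi i).
have hBd i x : `|partial i eta x| <= B.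
  apply: (le_trans ((hBi i).2 x)); rewrite /B (bigD1 i)//= addrCA lerDl addr_ge0//.
  by rewrite sumr_ge0// => j _; case: (hBi j).
have [M M0 hM] := commutator_bounds lcc.
have [kap kap0 hk] := elliptic_core lcc ccP n k0.
pose T := d%:R * M * B.
(* The two summands are the remainders in the two uses of [young]: against the gradient of [psi]
   with weight [t * kap], where [kap] is the ellipticity constant on the core, and against [psi]
   with weight 1. *)
pose C : R := d%:R * (T ^+ 2 / (4 * (t * kap))) + d%:R ^+ 2 * T ^+ 2 / 4.
have C0 : 0 <= C.
  apply: addr_ge0; first by rewrite mulr_ge0// divr_ge0 ?sqr_ge0// !mulr_ge0// ltW.
  by rewrite divr_ge0// mulr_ge0// sqr_ge0.
have [e1 e10 hkav] := kavg_cvg0 lv ltr01.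
have D0 : 0 < d%:R + 1 :> R by rewrite ltr_wpDl.
(* This gives [d%:R * e < k], so the mollified test function is still supported in a core. *)
pose e2 := k / 2 / (d%:R + 1); have e20 : 0 < e2 by rewrite !divr_gt0.
exists C; split => //; exists (Num.min e1 e2); first by rewrite lt_min e10.
move=> e /andP[e0]; rewrite lt_min => /andP[ee1 ee2].
have [lk _] := hkav e (introT andP (conj e0 ee1)); split; first exact: lk.
move=> psi.
have [[Cm sm mev] mge0 _ mK dmK] := hK e e0.
set ve := conv (moll e) v in psi *.
have Cve : Ck 1 ve by exact: conv_Cinf Cm sm lv' 1%N.
have Cpsi : Ck 1 psi by exact: CkM.
pose w x := eta x * psi x.
have Cw : Ck 1 w by exact: CkM.
have psi0 x : ~ core U k n x -> psi x = 0 by move=> h; rewrite /psi eta0// mul0r.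
have w0 x : ~ core U k n x -> w x = 0 by move=> h; rewrite /w eta0// mul0r.
have dpsi i x : partial i psi x = eta x * partial i ve x + ve x * partial i eta x.
  by have [_] := pderive_mul ((Ceta.2 i).1 x) ((Cve.2 i).1 x).
have dw i x : partial i w x = eta x * partial i psi x + psi x * partial i eta x.
  by have [_] := pderive_mul ((Ceta.2 i).1 x) ((Cpsi.2 i).1 x).
have [] := weak_identity lcc lam lv e0 Cw (sn _ w0); rewrite -/ve.
set F := (fun x : V => _ - _ + _) => iF; rewrite vorth; last first.
  have [Bw _ hBw] := continuous_bounded_cube Cw.1 (sn _ w0).
  apply: (conv_moll_tst e0 _ (bounded_locint (continuous_measurable_rV Cw.1) hBw) w0).
  by move: ee2; rewrite /e2 ltr_pdivlMr// mulrDr mulr1; lra.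
move=> /esym F0.
pose G x := (1 - t) * qf (c x) (grad psi x) (grad psi x) + (lam - 1) * psi x ^+ 2
   - ve x ^+ 2 * qf (c x) (grad eta x) (grad eta x) - C * kavg e v x ^+ 2.
have GF x : G x <= F x.
  have [xK|xK] := pselect (core U k n x); last first.
    have p0 f : (forall x, ~ core U k n x -> f x = 0) -> forall i, partial i f x = 0.
      by move=> f0 i; apply: (@partial_off _ _ (core U k n)) => //; exact: closed_core.
    rewrite /G /F !qf0; [|exact: p0|exact: p0].
    rewrite psi0// w0// expr0n !mulr0 !addr0 subr0 sub0r.
    rewrite big1 => [|i _]; last by rewrite big1// => j _; rewrite (p0 _ w0) !mulr0.
    rewrite big1 => [|i _]; last by rewrite big1// => j _; rewrite (p0 _ w0) !mulr0.
    by rewrite subr0 oppr_le0 mulr_ge0// sqr_ge0.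
  have Ux : U x by exact: core_sub xK.
  have MS := ccS Ux.
  set a := grad ve x; set b := grad eta x; set h := eta x; set s := ve x.
  set p := grad psi x; set q := qf (c x).
  have pE : p = fun i => h * a i + s * b i by apply/funext => i; exact: dpsi.
  have psE : psi x = h * s by [].
  have wE : grad w x = fun i => h * p i + (h * s) * b i.
    by apply/funext => i; rewrite -psE; exact: dw.
  have E1 : \sum_i \sum_j cc i j x * (partial i ve x * partial j w x) = q a (grad w x) by [].
  (* By symmetry of $C$, $C\nabla v_e\cdot\nabla(\eta^2 v_e) = C\nabla\psi\cdot\nabla\psi -
     v_e^2\,C\nabla\eta\cdot\nabla\eta$ with $\psi = \eta v_e$: the mixed terms cancel. *)
  have E2 : \sum_i \sum_j cc i j x * (partial i ve x * partial j w x) =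
      q p p - s ^+ 2 * q b b.
    rewrite E1 wE /q qf_linr// pE !qf_linl !qf_linr// (qf_sym b a)//; ring.
  set km := kavg e v x.
  have km0 : 0 <= km by exact: kavg_ge0.
  have E3 : \sum_i \sum_j commutator (cc i j) i e v x * partial j w x <=
      t * q p p + psi x ^+ 2 + C * km ^+ 2.
    have b1 i j : commutator (cc i j) i e v x * partial j w x <=
        M * km * B * (`|p j| + `|psi x|).
      apply: (le_trans (ler_norm _)); rewrite normrM -(mulrA (M * km)); apply: ler_pM => //.
        by have := hM i j e v e0 lv x.
      rewrite dw mulrDr; apply: (le_trans (ler_normD _ _)); rewrite !normrM; apply: lerD.
        by rewrite ler_wpM2r.
      by rewrite mulrC ler_wpM2r.
    apply: (le_trans (ler_sum _ (fun i _ => ler_sum _ (fun j _ => b1 i j)))).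
    rewrite sumr_const card_ord -mulr_natl mulr_sumr.
    have b2 j : d%:R * (M * km * B * (`|p j| + `|psi x|)) <=
        (t * kap) * p j ^+ 2 + ((T * km) ^+ 2 / (4 * (t * kap)) + T * km * `|psi x|).
      have := @young (T * km) `|p j| (t * kap) (mulr_gt0 t0 kap0).
      by rewrite real_normK ?num_real// /T => h1; clear - h1; lra.
    apply: (le_trans (ler_sum _ (fun j _ => b2 j))).
    rewrite big_split /= -mulr_sumr sumr_const card_ord -[(_ + _) *+ _]mulr_natl.
    have b3 := hk x xK p.
    have b4 := @young (d%:R * (T * km)) `|psi x| 1 ltr01.
    rewrite real_normK ?num_real// in b4.
    have b5 : t * kap * \sum_i p i ^+ 2 <= t * q p p by rewrite -mulrA ler_wpM2l// ltW.
    have eC : C * km ^+ 2 = d%:R * ((T * km) ^+ 2 / (4 * (t * kap))) +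
        (d%:R * (T * km)) ^+ 2 / (4 * 1).
      by rewrite /C; field; rewrite !lt0r_neq0.
    rewrite eC; set X := (T * km) ^+ 2 / (4 * (t * kap)).
    have -> : d%:R * (X + T * km * `|psi x|) = d%:R * X + d%:R * (T * km) * `|psi x| by ring.
    by clear - b4 b5; lra.
  rewrite /G /F E2 -/p -/b -/q -/s -/km /w psE -/h -/s.
  rewrite psE in E3.
  have -> : lam * (s * (h * (h * s))) = (lam - 1) * (h * s) ^+ 2 + (h * s) ^+ 2 by ring.
  by clear - E3; lra.
have iQ f : Ck 1 f -> (forall x, ~ core U k n x -> f x = 0) ->
   intble mu (fun x => qf (c x) (grad f x) (grad f x)).
  move=> Cf f0; apply: (@intble_csupp _ _ _ n); first exact: continuous_qf_grad.
  move=> x xn; apply: qf0 => i; exact: (supp_cube_partial i (sn _ f0)).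
have i1 := iQ psi Cpsi psi0.
have i2 : intble mu (fun x => psi x ^+ 2) := (l2_csupp Cpsi.1 (sn _ psi0)).2.
have i3 : intble mu (fun x => ve x ^+ 2 * qf (c x) (grad eta x) (grad eta x)).
  apply: (@intble_csupp _ _ _ n).
    apply: continuousM_rV; last exact: continuous_qf_grad.
    by under eq_fun do rewrite expr2; apply: continuousM_rV; exact: Cve.1.
  by move=> x xn; rewrite qf0 ?mulr0// => i; exact: (supp_cube_partial i se).
have i4 : intble mu (fun x => kavg e v x ^+ 2) := lk.2.
have j1 := intbleZ (1 - t) i1; have j2 := intbleZ (lam - 1) i2.
have j4 := intbleZ C i4; have j12 := intbleD j1 j2; have j123 := intbleB j12 i3.
have iG : intble mu G by exact: intbleB.
have := le_Rint iG iF GF; rewrite F0 /G.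
rewrite (RintB j123 j4) (RintB j12 i3) (RintD j1 j2) (RintZ _ i1) (RintZ _ i2) (RintZ _ i4).
by rewrite dot_sq => h; clear - h; lra.
Qed.

End energy.

(** * Cutoff functions *)

Section smoothing.
Variables (R : realType) (d : nat).
Local Notation V := 'rV[R]_d.
Local Notation mu := (rV_lebesgue R d).
Local Notation e_ i := (delta_mx ord0 i : V).
Implicit Types (f g v : V -> R) (x y z : V).

Lemma pderive_linear (a : 'I_d -> R) i y :
  derivable (fun y : V => \sum_j a j * y ord0 j) y (e_ i) /\
  partial i (fun y : V => \sum_j a j * y ord0 j) y = a i.
Proof.
have key (s : seq 'I_d) : derivable (fun y : V => \sum_(j <- s) a j * y ord0 j) y (e_ i) /\
    partial i (fun y : V => \sum_(j <- s) a j * y ord0 j) y = \sum_(j <- s) a j * (j == i)%:R.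
  elim: s => [|j s [h1 h2]].
    by rewrite big_nil; under eq_fun do rewrite big_nil; exact: pderive_cst.
  have [h3 h4] := pderive_coord i (is_derive_id (y ord0 j : R) 1).
  have [h5 h6] := pderive_scale (a j) h3.
  have [h7 h8] := pderive_add h5 h1.
  rewrite big_cons; under eq_fun do rewrite big_cons.
  by split => //; rewrite h8 h6 h2 h4 mulr1.
have [h1 h2] := key (index_enum 'I_d); split => //.
rewrite h2 (bigD1 i)//= eqxx mulr1 big1 ?addr0// => j /negbTE ->; exact: mulr0.
Qed.

(** A small step along the gradient raises [f] to first order by the step times the squared norm of
    the gradient, while the hypothesis allows only [M] times the length of the move. Once the linear
    part [ell] is subtracted, the partial derivatives are small near [x] and the cube estimate
    controls the remainder. The Euclidean norm keeps the bound free of dimensional factors. *)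
Lemma grad_lipschitz f (M : R) x : Ck 1 f -> 0 <= M ->
  (forall x y, `|f y - f x| <= M * enorm (y - x)) -> \sum_i partial i f x ^+ 2 <= M ^+ 2.
Proof.
move=> Cf M0 lf; pose g : V := \row_i partial i f x.
have -> : \sum_i partial i f x ^+ 2 = enorm g ^+ 2.
  by rewrite enorm_sqr; apply: eq_bigr => i _; rewrite mxE.
rewrite ler_pXn2r ?nnegrE ?enorm_ge0//.
have [g0|g0] := eqVneq (enorm g) 0; first by rewrite g0.
have gp : 0 < enorm g by rewrite lt_neqAle eq_sym g0 enorm_ge0.
pose ell (y : V) := \sum_i partial i f x * y ord0 i.
pose phi (y : V) := f y + (- 1) * ell y.
have dphi i y : derivable phi y (e_ i) /\ partial i phi y = partial i f y - partial i f x.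
  have [d1 d2] := pderive_linear (fun i => partial i f x) i y.
  have h := pderive_scale (-1) d1.
  have [h1 h2] := pderive_add ((Cf.2 i).1 y) h.1.
  by split => //; rewrite h2 h.2 d2 mulN1r.
apply/ler_addgt0Pr => eps eps0.
have D0 : 0 < d%:R + 1 :> R by rewrite ltr_wpDl.
pose e1 := eps / (d%:R + 1); have e10 : 0 < e1 by rewrite divr_gt0.
have : continuous (fun y => \sum_i `|partial i f y - partial i f x|).
  apply: continuous_sum_rV => i; apply: continuous_norm_rV; apply: continuousB_rV.
    exact: (Cf.2 i).2.
  exact: continuous_cst_rV.
move=> /rV_continuousP/(_ x e1 e10)[r r0 hr].
have G0 : 0 < `|g| + 1 by rewrite ltr_wpDl.
pose h := r / 2 / (`|g| + 1); have h0 : 0 < h by rewrite !divr_gt0.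
have hg : cube x (r / 2) (x + h *: g).
  rewrite /cube /= [x + _]addrC addrK normrZ gtr0_norm// /h mulrAC ler_pdivrMr//.
  by rewrite ler_wpM2l ?lerDl// divr_ge0// ltW.
have := @C1_lipschitz_cube _ _ phi e1 (r / 2) x (fun i y => (dphi i y).1) _ _ hg.
have -> : x + h *: g - x = h *: g by rewrite addrC addKr.
rewrite normrZ gtr0_norm// => H.
have {}H : `|phi (x + h *: g) - phi x| <= d%:R * e1 * (h * `|g|).
  apply: H => i y xy; rewrite (dphi i y).2.
  have : `|y - x| < r by rewrite (le_lt_trans xy)// ltr_pdivrMr//; lra.
  move=> /(hr y); rewrite [X in _ - X]big1 ?subr0 => [|j _]; last by rewrite subrr normr0.
  rewrite ger0_norm ?sumr_ge0//; apply: le_trans.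
  by rewrite (bigD1 i)//= lerDl sumr_ge0.
have eE : phi (x + h *: g) - phi x = f (x + h *: g) - f x - h * enorm g ^+ 2.
  rewrite /phi /ell enorm_sqr.
  have -> : \sum_i partial i f x * (x + h *: g) ord0 i = \sum_i partial i f x * x ord0 i +
     h * \sum_i g ord0 i ^+ 2.
    rewrite mulr_sumr -big_split; apply: eq_bigr => i _.
    have -> : g ord0 i = partial i f x by rewrite mxE.
    have -> : (x + h *: g) ord0 i = x ord0 i + h * partial i f x by rewrite !mxE.
    rewrite /=; ring.
  ring.
have h1 := lf x (x + h *: g); have h2 := norm_le_enorm g.
rewrite [x + _]addrC addrK enormZ (gtr0_norm h0) in h1.
move: H; rewrite eE ler_norml => /andP[H _].
move: h1; rewrite [h *: g + x]addrC ler_norml => /andP[_ h1].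
have h3 : d%:R * e1 * (h * `|g|) <= eps * (h * enorm g).
  apply: ler_pM; [by rewrite mulr_ge0// ltW|by rewrite mulr_ge0// ltW| |by rewrite ler_pM2l].
  rewrite /e1 mulrCA ler_piMr//; first exact: ltW.
  by rewrite ler_pdivrMr// mul1r lerDl.
have : h * enorm g * enorm g <= h * enorm g * (M + eps) by rewrite expr2 in H; lra.
by rewrite ler_pM2l// mulr_gt0.
Qed.

Lemma lipschitz_locint g (L : R) : (forall x y, `|g y - g x| <= L * `|y - x|) -> locint g.
Proof.
move=> lg; have h1 : locint (fun _ : V => 1 : R).
  by apply: (@bounded_locint _ _ _ 1) => // x; rewrite normr1.
have := locintM_lipschitz h1 lg.
by congr locint; apply/funext => x; rewrite mul1r.
Qed.

Lemma moll_avg e (h : V -> R) (B : R) : 0 < e -> measurable_fun setT h ->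
  (forall z, cube 0 e z -> `|h z| <= B) ->
  intble mu (fun z => moll e z * h z) /\ `|\int[mu]_z (moll e z * h z)| <= B.
Proof.
move=> e0 mh hB; have [K K0 hK] := moll_facts R d.
have [[Cm sm _] mge0 m1 _ _] := hK e e0.
have cm := Ck_continuous (Cm 0%N).
have im := intble_csupp cm sm.
have le z : `|moll e z * h z| <= B * moll e z.
  rewrite normrM (ger0_norm (mge0 z)) mulrC.
  have [ze|ze] := pselect (cube 0 e z); last by rewrite sm// !mulr0.
  by rewrite ler_wpM2r// hB.
have mm : measurable_fun setT (fun z => moll e z * h z).
  by apply: measurable_funM => //; exact: continuous_measurable_rV.
have ii : intble mu (fun z => moll e z * h z) by exact: (le_intble mm le (intbleZ B im)).
split => //; apply: (le_trans (norm_Rint ii)).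
by apply: (le_trans (le_Rint (intble_norm ii) (intbleZ B im) le)); rewrite RintZ// m1 mulr1.
Qed.

(** In this centred form the kernel no longer depends on [x], so increments in [x] fall on [g]
    alone. *)
Lemma conv_moll_shift e g x : 0 < e -> locint g ->
  intble mu (fun z => moll e z * g (z + x)) /\
  conv (moll e) g x = \int[mu]_z (moll e z * g (z + x)).
Proof.
move=> e0 lg; have [K K0 hK] := moll_facts R d.
have [[Cm sm mev] _ _ _ _] := hK e e0.
have ic := conv_intble x (Ck_continuous (Cm 0%N)) sm lg.
have E : (fun z => moll e (x - (z + x)%R) * g (z + x)) = (fun z => moll e z * g (z + x)).
  by apply/funext => z; rewrite opprD addrCA subrr addr0 mev.
split; first by rewrite -E; exact: (intble_translation x ic).
by rewrite -E; exact/esym/(Rint_translation x ic).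
Qed.

Lemma measurable_shift g x : measurable_fun setT g -> measurable_fun setT (fun z : V => g (z + x)).
Proof. by move=> mg; exact: (measurableT_comp mg (measurable_rV_add x)). Qed.

Lemma conv_moll_le e g x (B : R) : 0 < e -> locint g ->
  (forall y, cube x e y -> `|g y| <= B) -> `|conv (moll e) g x| <= B.
Proof.
move=> e0 lg hB; have [_ ->] := conv_moll_shift x e0 lg.
apply: (moll_avg e0 (measurable_shift x lg.1) _).2 => z ze.
by apply: hB; move: ze; rewrite /cube /= subr0 addrK.
Qed.

Lemma conv_moll_ge0 e g x : 0 < e -> (forall y, 0 <= g y) -> 0 <= conv (moll e) g x.
Proof.
move=> e0 g0; have [K K0 hK] := moll_facts R d; have [_ mge0 _ _ _] := hK e e0.
by apply: Rint_ge0 => y; exact: mulr_ge0.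
Qed.

(** Averaging against a probability density keeps the Euclidean Lipschitz constant. The gradient
    bound is thus lossless, which matters because the final inequality has room only for factors
    close to 1. *)
Lemma conv_moll_lipschitz e g (M : R) : 0 < e -> 0 <= M ->
  (forall x y, `|g y - g x| <= M * enorm (y - x)) ->
  let S := conv (moll e) g in
  [/\ Ck 1 S, forall x, `|S x - g x| <= M * (d%:R * e) &
      forall x, \sum_i partial i S x ^+ 2 <= M ^+ 2].
Proof.
move=> e0 M0 lg S; have [K K0 hK] := moll_facts R d.
have [[Cm sm mev] mge0 m1 _ _] := hK e e0.
have lg' x y : `|g y - g x| <= M * d%:R * `|y - x|.
  by apply: (le_trans (lg x y)); rewrite -mulrA ler_wpM2l// enorm_le_norm.
have li := lipschitz_locint lg'.
have CS : Ck 1 S by exact: conv_Cinf Cm sm li 1%N.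
have im := intble_csupp (Ck_continuous (Cm 0%N)) sm.
have diff x y : `|S y - S x| <= M * enorm (y - x).
  have [i1 e1] := conv_moll_shift x e0 li; have [i2 e2] := conv_moll_shift y e0 li.
  rewrite /S e1 e2 -RintB//.
  have -> : (fun z => moll e z * g (z + y) - moll e z * g (z + x)) =
      (fun z => moll e z * (g (z + y) - g (z + x))) by apply/funext => z; rewrite mulrBr.
  apply: (moll_avg e0 _ _).2 => [|z _].
    by apply: measurable_funB; apply: measurable_shift; exact: li.1.
  by have := lg (z + x) (z + y); rewrite opprD addrACA subrr add0r.
split => // [x|x]; last exact: grad_lipschitz.
have [i1 e1] := conv_moll_shift x e0 li.
have -> : g x = \int[mu]_z (g x * moll e z) by rewrite RintZ// m1 mulr1.
rewrite /S e1 -RintB//; last exact: intbleZ.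
have -> : (fun z => moll e z * g (z + x) - g x * moll e z) =
      (fun z => moll e z * (g (z + x) - g x)) by apply/funext => z; rewrite mulrBr [g x * _]mulrC.
apply: (moll_avg e0 _ _).2 => [|z].
  by apply: measurable_funB => //; apply: measurable_shift; exact: li.1.
rewrite /cube /= subr0 => ze; apply: (le_trans (lg _ _)); rewrite addrK ler_wpM2l//.
by apply: (le_trans (enorm_le_norm z)); rewrite ler_wpM2l.
Qed.

Lemma conv_moll_kavg : exists2 K, 0 <= K & forall e v, 0 < e -> l2 mu v ->
  forall y, `|conv (moll e) v y - v y| <= K * kavg e v y.
Proof.
have [K K0 hK] := moll_facts R d; exists K; first exact: ltW.
move=> e v e0 lv y; have [[Cm sm mev] mge0 m1 mK _] := hK e e0.
have cm := Ck_continuous (Cm 0%N); have lv' := l2_locint lv.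
have im := intble_csupp cm sm.
have cmy : continuous (fun x : V => moll e (x - y)) by exact: continuous_translation_rV.
have [] := @kernel_le_kavg R d e v lv (fun x => moll e (x - y)) K y.
- exact: continuous_measurable_rV.
- by move=> x; rewrite ger0_norm.
move=> ih; congr (`|_| <= _).
have e1 : (fun x => moll e (x - y) * (v x - v y)) =
   (fun x => moll e (y - x) * v x - v y * moll e (x - y)).
  by apply/funext => x; rewrite -(mev (y - x)) opprB mulrBr [v y * _]mulrC.
have i1 := conv_intble y cm sm lv'.
have i2 := intble_translation (- y) im.
rewrite e1 (RintB i1 (intbleZ (v y) i2)) (RintZ (v y) i2) (Rint_translation (- y) im).
by rewrite m1 mulr1.
Qed.

Lemma conv_moll_l2 : exists2 K, 0 <= K & forall e v, 0 < e -> l2 mu v -> l2 mu (kavg e v) ->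
  let D x := conv (moll e) v x - v x in
  l2 mu D /\ dot mu D D <= K * dot mu (kavg e v) (kavg e v).
Proof.
have [K K0 hK] := conv_moll_kavg; exists (K ^+ 2); first exact: sqr_ge0.
move=> e v e0 lv lk D; have [KM _ hKM] := moll_facts R d.
have mve : measurable_fun setT (conv (moll e) v).
  have [[Cm sm _] _ _ _ _] := hKM _ e0.
  by apply: continuous_measurable_rV; exact: conv_continuous (Cm 1%N) sm (l2_locint lv).
have ld : l2 mu D.
  apply: (l2_le _ _ (l2Z K lk)); first exact: measurable_funB mve lv.1.
  move=> x; rewrite [leRHS]ger0_norm; first exact: (hK _ _ e0 lv).
  by rewrite mulr_ge0// kavg_ge0.
split => //; rewrite !dot_sq -(RintZ _ lk.2); apply: le_Rint.
- exact: ld.2.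
- exact: (intbleZ _ lk.2).
move=> x; rewrite -exprMn -real_normK ?num_real//; apply: lerXn2r.
- by rewrite nnegrE.
- by rewrite nnegrE; apply: mulr_ge0 => //; exact: kavg_ge0.
- exact: (hK _ _ e0 lv).
Qed.

(** One sequence of scales serves every bounded multiplier [m]: the limits for the cutoff, for an
    indicator and for the constant 1 are taken along the same scales. *)
Lemma conv_moll_seq v (e0 : R) : l2 mu v -> 0 < e0 -> exists s : nat -> R,
  [/\ forall n, 0 < s n < e0, forall n, l2 mu (kavg (s n) v),
      dot mu (kavg (s n) v) (kavg (s n) v) @[n --> \oo] --> 0,
      forall n, l2 mu (conv (moll (s n)) v) &
      forall (m : V -> R) B, measurable_fun setT m -> (forall x, `|m x| <= B) ->
        dot mu (fun x => m x * conv (moll (s n)) v x)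
               (fun x => m x * conv (moll (s n)) v x) @[n --> \oo] -->
        dot mu (fun x => m x * v x) (fun x => m x * v x)].
Proof.
move=> lv e00; have [K K0 hK] := conv_moll_l2.
have /choice[r hr] : forall n : nat, exists r, 0 < r /\ forall e, 0 < e < r ->
    l2 mu (kavg e v) /\ dot mu (kavg e v) (kavg e v) <= n.+1%:R^-1.
  move=> n; have [r r0 h] := kavg_cvg0 lv (eps := n.+1%:R^-1) (ltac:(by rewrite invr_gt0)).
  by exists r.
pose s n := Num.min (r n) e0 / 2.
have m0 n : 0 < Num.min (r n) e0 by rewrite lt_min e00 (hr n).1.
have s0 n : 0 < s n by rewrite divr_gt0.
have sr n : 0 < s n < r n.
  rewrite s0 /s ltr_pdivrMr//; have : Num.min (r n) e0 <= r n by rewrite ge_min lexx.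
  have := (hr n).1; lra.
have se n : 0 < s n < e0.
  rewrite s0 /s ltr_pdivrMr//; have : Num.min (r n) e0 <= e0 by rewrite ge_min lexx orbT.
  lra.
have lk n : l2 mu (kavg (s n) v) by have [] := (hr n).2 _ (sr n).
have k0 : dot mu (kavg (s n) v) (kavg (s n) v) @[n --> \oo] --> 0.
  apply: (@squeeze_cvgr _ _ _ _ (cst 0) (fun n => n.+1%:R^-1)).
  - by apply: nearW => n; rewrite dot_ge0 /=; have [] := (hr n).2 _ (sr n).
  - exact: cvg_cst.
  - exact: cvg_harmonic0.
have ld n := (hK _ _ (s0 n) lv (lk n)).1; have ddE n := (hK _ _ (s0 n) lv (lk n)).2.
exists s; split => // [n|m B mm mB].
  have := l2D (ld n) lv; congr (l2 mu); apply/funext => x; exact: subrK.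
have B0 : 0 <= B by apply: le_trans (mB 0).
have lm f : l2 mu f -> l2 mu (fun x => m x * f x).
  move=> lf; apply: (l2_le _ _ (l2Z B lf)); first exact: measurable_funM mm lf.1.
  by move=> x; rewrite !normrM ler_wpM2r// (ger0_norm B0).
have := @dot_cvgD _ _ _ mu (fun n x => m x * (conv (moll (s n)) v x - v x)) (fun x => m x * v x)
   (lm _ lv) (fun n => lm _ (ld n)).
have -> : (fun n => dot mu (fun x => m x * v x + m x * (conv (moll (s n)) v x - v x))
      (fun x => m x * v x + m x * (conv (moll (s n)) v x - v x))) =
   (fun n => dot mu (fun x => m x * conv (moll (s n)) v x) (fun x => m x * conv (moll (s n)) v x)).
  apply/funext => n; congr dot; apply/funext => x; ring.
apply; apply: (@squeeze_cvgr _ _ _ _ (cst 0)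
  (fun n => B ^+ 2 * (K * dot mu (kavg (s n) v) (kavg (s n) v)))).
- apply: nearW => n; rewrite dot_ge0 /=.
  apply: (@le_trans _ _ (B ^+ 2 * dot mu (fun x => conv (moll (s n)) v x - v x)
     (fun x => conv (moll (s n)) v x - v x))); last by rewrite ler_wpM2l// sqr_ge0.
  rewrite !dot_sq -(RintZ _ (ld n).2); apply: le_Rint.
  + exact: (lm _ (ld n)).2.
  + exact: (intbleZ _ (ld n).2).
  move=> x; rewrite exprMn ler_wpM2r ?sqr_ge0//.
  by rewrite -real_normK ?num_real// lerXn2r ?nnegrE.
- exact: cvg_cst.
- rewrite -(mulr0 (B ^+ 2)); apply: cvgMr; rewrite -(mulr0 K).
  exact: cvgMr.
Qed.

End smoothing.

(** * A continuously differentiable cutoff modelled on a power *)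

Section cutoff.
Variable R : realType.
Implicit Types (a t x y : R).

Definition posp2 x : R := Num.max x 0 ^+ 2.

Lemma posp2_derive x : is_derive x 1 posp2 (2 * Num.max x 0).
Proof.
have dsq : is_derive x 1 (fun y : R => y ^+ 2) (2 * x).
  have h := is_deriveX 2 (is_derive_id x (1 : R)).
  have -> : (fun y : R => y ^+ 2) = (@id R) ^+ 2 by apply/funext => y; rewrite exprfctE.
  by apply: (is_derive_eq h) => /=; rewrite expr1 [LHS]mulr1.
have [x0|x0|x0] := ltgtP x 0.
- have E : {near x, cst 0 =1 posp2}.
    near=> y; rewrite /posp2 max_r ?expr0n//; apply: ltW.
    by near: y; exact: lt_nbhsl.
  rewrite mulr0.
  apply: DeriveDef; first by apply: (near_eq_derivable E); exact: derivable_cst.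
  by rewrite -(near_eq_derive _ E) derive_cst.
- have E : {near x, (fun y : R => y ^+ 2) =1 posp2}.
    near=> y; rewrite /posp2 max_l//; apply: ltW.
    by near: y; exact: lt_nbhsr.
  have [h1 h2] := dsq.
  apply: DeriveDef; first exact: (near_eq_derivable E h1).
  by rewrite -(near_eq_derive _ E) h2.
- rewrite x0 mulr0.
  have c : (fun h : R => h^-1 *: ((posp2 \o shift 0) (h *: (1 : R)) - posp2 0)) @ 0^' --> (0 : R).
    apply/cvgrPdist_le => e e0; near=> h.
    rewrite sub0r normrN /posp2 max_l// expr0n subr0 /= addr0 [h *: 1]mulr1 normrM normfV.
    have hn : h != 0 by near: h; exact: nbhs_dnbhs_neq.
    rewrite ler_pdivrMl ?normr_gt0//.
    apply: (@le_trans _ _ (`|h| ^+ 2)).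
      rewrite ger0_norm ?sqr_ge0// real_normK ?num_real//.
      by have [h0|h0] := leP h 0; rewrite ?expr0n ?sqr_ge0.
    rewrite expr2 ler_wpM2l//.
    by near: h; exact: dnbhs0_le.
  by apply: DeriveDef; [apply/cvg_ex; exists 0|exact: (cvg_lim (@Rhausdorff R) c)].
Unshelve. all: by end_near. Qed.

Lemma is_derive_continuous (f g : R -> R) : (forall x, is_derive x 1 f (g x)) -> continuous f.
Proof.
move=> df x; have [h _] := df x.
by apply: differentiable_continuous; apply/derivable1_diffP.
Qed.

(* The regularised power (t^a - t0^a)_+^2 / t^a: unlike (t^a - t0^a)_+ it is
   continuously differentiable, while its derivative is still at most a t^(a-1). *)
Variables (a t0 : R).
Hypotheses (a0 : 0 < a) (t00 : 0 < t0).
Let E := t0 `^ a.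
Let u t := Num.max t t0 `^ a.

Definition hcut t : R := (u t - E) ^+ 2 / u t.
Definition dhcut t : R := a / Num.max t t0 * (u t - E) * (2 - (u t - E) / u t).

Let E0 : 0 < E. Proof. exact: powR_gt0. Qed.

Let max0 t : 0 < Num.max t t0. Proof. by rewrite lt_max t00 orbT. Qed.

Let uE t : E <= u t.
Proof.
apply: ge0_ler_powR; rewrite ?nnegrE; [exact: ltW|exact: ltW|exact: ltW|].
by rewrite le_max lexx orbT.
Qed.

Let u0 t : 0 < u t. Proof. exact: lt_le_trans (uE t). Qed.

Lemma hcut_ge0 t : 0 <= hcut t.
Proof. by rewrite divr_ge0 ?sqr_ge0// ltW. Qed.

Lemma hcut_le0 t : t <= t0 -> hcut t = 0 /\ dhcut t = 0.
Proof.
move=> tt; have uu : u t = E by rewrite /u max_r.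
by rewrite /hcut /dhcut uu subrr expr0n !mul0r mulr0 mul0r.
Qed.

Lemma hcut_le t : t0 <= t -> hcut t <= t `^ a.
Proof.
move=> tt; have uu : u t = t `^ a by rewrite /u max_l.
have h1 := uE t; have h2 := E0; rewrite /hcut -uu ler_pdivrMr// expr2; apply: ler_pM; lra.
Qed.

(** Once $t_0^a$ is at most the fraction [tau] of $t^a$, the regularisation costs only the factor
    $(1-\tau)^2$ and the cutoff is comparable to the pure power. *)
Lemma hcut_ge t tau : t0 <= t -> tau <= 1 -> E <= tau * t `^ a -> (1 - tau) ^+ 2 * t `^ a <= hcut t.
Proof.
move=> tt tau1 Et; have uu : u t = t `^ a by rewrite /u max_l.
rewrite /hcut -uu ler_pdivlMr// -mulrA -expr2 -exprMn; apply: lerXn2r.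
- by rewrite nnegrE mulr_ge0 ?subr_ge0// ltW.
- by rewrite nnegrE subr_ge0.
- by rewrite mulrBl mul1r lerB// uu.
Qed.

Lemma dhcut_ge0 t : 0 <= dhcut t.
Proof.
have := u0 t; have := uE t; have := E0 => h1 h2 h3.
apply: mulr_ge0; last by rewrite subr_ge0 ler_pdivrMr//; lra.
by apply: mulr_ge0; rewrite ?subr_ge0// divr_ge0// ltW.
Qed.

(** The last two factors of [dhcut] multiply to [u t - E ^+ 2 / u t], so the regularisation only
    lowers the derivative of the power. *)
Lemma dhcut_le t : t0 <= t -> dhcut t <= a / t * t `^ a.
Proof.
move=> tt; have uu : u t = t `^ a by rewrite /u max_l.
rewrite /dhcut (max_l tt) -uu -mulrA; apply: ler_wpM2l.
  by apply: divr_ge0; [exact: ltW|exact: le_trans (ltW t00) tt].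
have h := u0 t.
have -> : (u t - E) * (2 - (u t - E) / u t) = u t - E ^+ 2 / u t.
  by field; exact: lt0r_neq0.
by rewrite lerBlDr lerDl divr_ge0 ?sqr_ge0// ltW.
Qed.

Let continuous_u : continuous u.
Proof.
move=> t; apply: (@continuous_comp _ _ _ (fun t => Num.max t t0) (fun x => x `^ a)).
  by apply: continuous_max => //; exact: cst_continuous.
have [h _] := is_derive1_powR a (max0 t).
by apply: differentiable_continuous; apply/derivable1_diffP.
Qed.

Lemma continuous_dhcut : continuous dhcut.
Proof.
move=> t.
have cm : {for t, continuous (fun t : R => Num.max t t0)}.
  by apply: continuous_max => //; exact: cst_continuous.
have cc (b : R) : {for t, continuous (fun _ : R => b)} by exact: cst_continuous.
have cu := @continuous_u t.
have cmV : {for t, continuous (fun t : R => (Num.max t t0)^-1)}.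
  by apply: continuousV => //; exact/lt0r_neq0/max0.
have cuV : {for t, continuous (fun t : R => (u t)^-1)}.
  by apply: continuousV => //; exact/lt0r_neq0/u0.
have c1 := continuousM (cc a) cmV; have c2 := continuousB cu (cc E).
have c3 := continuousM c2 cuV.
exact: (continuousM (continuousM c1 c2) (continuousB (cc 2) c3)).
Qed.

Lemma hcut_derive t : is_derive t 1 hcut (dhcut t).
Proof.
have [tt|tt] := ltP t t0.
  have Eq : {near t, cst 0 =1 hcut}.
    near=> y; rewrite (hcut_le0 _).1//; apply: ltW.
    by near: y; exact: lt_nbhsl.
  rewrite (hcut_le0 (ltW tt)).2.
  apply: DeriveDef; first by apply: (near_eq_derivable Eq); exact: derivable_cst.
  by rewrite -(near_eq_derive _ Eq) derive_cst.
have tp : 0 < t by exact: lt_le_trans tt.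
pose p (y : R) := y `^ a.
(* A single formula, valid on both sides of [t0]: the differentiability of [posp2] at 0 takes care
   of the junction. *)
have Eq : {near t, (fun y : R => posp2 (p y - E) * (p y)^-1) =1 hcut}.
  near=> y; have y0 : 0 < y by near: y; exact: lt_nbhsr.
  rewrite /hcut /u; have [yt|yt] := leP y t0.
    rewrite -/E subrr expr0n mul0r /posp2 max_r ?expr0n ?mul0r// subr_le0.
    by apply: ge0_ler_powR; rewrite ?nnegrE// ltW.
  rewrite /posp2 max_l// subr_ge0; apply: ge0_ler_powR; rewrite ?nnegrE; exact: ltW.
have dp : is_derive t 1 p (a * t `^ (a - 1)) by exact: is_derive1_powR.
have dpE : is_derive t 1 (fun y => p y - E) (a * t `^ (a - 1)).
  have h := is_deriveB dp (is_derive_cst E t 1).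
  by apply: (is_derive_eq h); rewrite subr0.
have d1 := @is_derive1_comp R posp2 (fun y => p y - E) t _ _ (posp2_derive (p t - E)) dpE.
have pt0 : p t != 0 by exact/lt0r_neq0/powR_gt0.
have d2 := is_deriveV pt0 dp.
have [h1 h2] := is_deriveM d1 d2.
apply: DeriveDef; first exact: (near_eq_derivable Eq h1).
rewrite -(near_eq_derive _ Eq).
have ut : u t = p t by rewrite /u max_l.
apply: (etrans h2); rewrite /dhcut (max_l tt) ut.
have pE : E <= p t by rewrite -ut; exact: uE.
have -> : t `^ (a - 1) = t^-1 * p t by rewrite /p -(mulr_powRB1 (ltW tp) a0) mulKf// lt0r_neq0.
rewrite /= /posp2 max_l ?subr_ge0// -exprVn /GRing.scale /=.
by rewrite exprVn; field; rewrite pt0 lt0r_neq0.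
Unshelve. all: by end_near. Qed.

End cutoff.

Section chain.
Variables (R : realType) (d : nat).
Local Notation V := 'rV[R]_d.
Local Notation e_ i := (delta_mx ord0 i : V).

Lemma pderive_comp (H H' : R -> R) (f : V -> R) i x : (forall t : R, is_derive t (1 : R) H (H' t)) ->
  derivable f x (e_ i) ->
  derivable (fun x => H (f x)) x (e_ i) /\ partial i (fun x => H (f x)) x = H' (f x) * partial i f x.
Proof.
move=> dH df; pose phi (t : R) := f (x + t *: e_ i).
have [d0 e0] : derivable phi 0 1 /\ 'D_1 phi 0 = partial i f x.
  exact: (derivable_line0 df).
have dphi : is_derive (0 : R) 1 phi (partial i f x) by exact: DeriveDef.
have := @is_derive1_comp R H phi 0 _ _ (dH (phi 0)) dphi.
have -> : phi 0 = f x by rewrite /phi scale0r addr0.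
move=> dc.
have E : (fun h : R => h^-1 *: (((H \o phi) \o shift 0) (h *: (1 : R)) - (H \o phi) 0))
   = (fun h : R => h^-1 *: (((fun x => H (f x)) \o shift x) (h *: e_ i) - H (f x))).
  apply/funext => h /=; rewrite /phi addr0 scale0r addr0; congr (_ *: (H (f _) - _)).
  by rewrite [h *: 1]mulr1 addrC.
have [h1 h2] := dc.
split; first by move: h1; rewrite /derivable E.
by move: h2; rewrite /partial /derive E.
Qed.

Lemma C1_comp (H H' : R -> R) (f : V -> R) : (forall t : R, is_derive t (1 : R) H (H' t)) ->
  continuous H' -> Ck 1 f -> Ck 1 (fun x => H (f x)).
Proof.
move=> dH cH' [cf hf]; split; first exact: (continuous_comp_rV cf (is_derive_continuous dH)).
move=> i; split => [x|]; first by have [] := pderive_comp dH ((hf i).1 x).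
rewrite (_ : partial i _ = fun x => H' (f x) * partial i f x).
  by apply: continuousM_rV; [exact: (continuous_comp_rV cf cH')|exact: (hf i).2].
by apply/funext => x; have [] := pderive_comp dH ((hf i).1 x).
Qed.

End chain.

(** * The squared gradient of the cutoff, zone by zone *)

Section scalar_estimates.
Variables (R : realType) (a t t0 : R).
Hypotheses (a01 : 0 < a <= 1) (t01 : 0 < t < 1) (t00 : 0 < t0).

Let a0 : 0 < a. Proof. by case/andP: a01. Qed.
Let a1 : a <= 1. Proof. by case/andP: a01. Qed.
Let tp : 0 < t. Proof. by case/andP: t01. Qed.
Let tl : 0 < 1 - t. Proof. by case/andP: t01; rewrite subr_gt0. Qed.

(** An exponent at most 1 brings $1+t$ and $1-t$ closer to 1, so a relative error [t] of the base
    bounds that of the power. *)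
Lemma powR_ratio (s S : R) : 0 < s -> 0 < S -> `|S - s| <= t * s ->
  S `^ a <= (1 + t) * s `^ a /\ (1 - t) * s `^ a <= S `^ a.
Proof.
move=> s0 S0; rewrite ler_norml => /andP[h1 h2]; split.
  apply: (@le_trans _ _ (((1 + t) * s) `^ a)).
    apply: ge0_ler_powR; rewrite ?nnegrE; [exact: ltW|exact: ltW| |lra].
    by rewrite mulr_ge0// ltW// addr_gt0.
  rewrite powRM; [|by rewrite ltW// addr_gt0|exact: ltW].
  by rewrite ler_wpM2r ?powR_ge0// ler1_powR// lerDl ltW.
apply: (@le_trans _ _ (((1 - t) * s) `^ a)).
  rewrite powRM; [|exact: ltW|exact: ltW].
  by rewrite ler_wpM2r ?powR_ge0// ger1_powR// tl /= lerBlDr lerDl ltW.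
apply: ge0_ler_powR; rewrite ?nnegrE; [exact: ltW| |exact: ltW|lra].
by rewrite mulr_ge0// ltW.
Qed.

(** In the application [s] is the distance, [S] its smoothing and [Q] the quadratic form at the
    gradient of [S]. At the exponent [a] the singular factors cancel up to the ratio of $S^a$ to
    $s^a$. Of the factor $(1+t)^3$, two powers come from [s] against [S] and one from the bound on
    [Q]. *)
Lemma dhcut_near (s S Q c : R) : t0 <= S -> 0 < s -> s <= (1 + t) * S -> 0 <= c -> 0 <= Q ->
  Q <= (1 + t) * c * (s / s `^ a) ^+ 2 ->
  dhcut a t0 S ^+ 2 * Q <= a ^+ 2 * (1 + t) ^+ 3 * c * (S `^ a / s `^ a) ^+ 2.
Proof.
move=> tS s0 sS c0 Q0 hQ; have S0 : 0 < S by exact: lt_le_trans tS.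
have y0 : 0 < S `^ a by exact: powR_gt0.
have z0 : 0 < s `^ a by exact: powR_gt0.
have t1 : 0 <= 1 + t by rewrite ltW// addr_gt0.
have h1 : dhcut a t0 S ^+ 2 <= (a / S * S `^ a) ^+ 2.
  apply: lerXn2r; rewrite ?nnegrE; [exact: dhcut_ge0|by rewrite !mulr_ge0 ?invr_ge0 ?ltW|exact: dhcut_le].
apply: (@le_trans _ _ ((a / S * S `^ a) ^+ 2 * ((1 + t) * c * (s / s `^ a) ^+ 2))).
  by apply: ler_pM => //; exact: sqr_ge0.
have -> : (a / S * S `^ a) ^+ 2 * ((1 + t) * c * (s / s `^ a) ^+ 2) =
   (s / S) ^+ 2 * (a ^+ 2 * (1 + t) * c * (S `^ a / s `^ a) ^+ 2).
  by field; rewrite !lt0r_neq0.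
have -> : a ^+ 2 * (1 + t) ^+ 3 * c * (S `^ a / s `^ a) ^+ 2 =
   (1 + t) ^+ 2 * (a ^+ 2 * (1 + t) * c * (S `^ a / s `^ a) ^+ 2) by ring.
apply: ler_wpM2r; first by apply: mulr_ge0; [apply: mulr_ge0 => //; apply: mulr_ge0 => //|]; exact: sqr_ge0.
apply: lerXn2r; rewrite ?nnegrE//; first by rewrite divr_ge0 ?ltW.
by rewrite ler_pdivrMr.
Qed.

(** Where the cutoff is comparable to the power, $S^a$ is turned back into [hcut] at the cost of
    $(1-t)^4$, and [c] into [th ^+ 2] at the cost of $1-t$. The result carries the Hardy weight. *)
Lemma hcut_near (s S Q c th : R) : t0 <= S -> 0 < s -> s <= (1 + t) * S -> 0 <= c -> 0 <= Q ->
  Q <= (1 + t) * c * (s / s `^ a) ^+ 2 -> t0 `^ a <= t * S `^ a -> (1 - t) * c <= th ^+ 2 ->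
  dhcut a t0 S ^+ 2 * Q <=
  a ^+ 2 * (1 + t) ^+ 3 / (1 - t) ^+ 5 * ((th / s `^ a) ^+ 2 * hcut a t0 S ^+ 2).
Proof.
move=> tS s0 sS c0 Q0 hQ hE hth.
apply: (le_trans (dhcut_near tS s0 sS c0 Q0 hQ)).
have S0 : 0 < S by exact: lt_le_trans tS.
have y0 : 0 < S `^ a by exact: powR_gt0.
have z0 : 0 < s `^ a by exact: powR_gt0.
have t1 : 0 <= 1 + t by rewrite ltW// addr_gt0.
have h : ((1 - t) ^+ 2 * S `^ a) ^+ 2 <= hcut a t0 S ^+ 2.
  apply: lerXn2r; rewrite ?nnegrE; [by rewrite mulr_ge0 ?sqr_ge0 ?ltW|exact: hcut_ge0|].
  by apply: hcut_ge => //; rewrite -subr_ge0; exact: ltW.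
apply: (@le_trans _ _ (a ^+ 2 * (1 + t) ^+ 3 / (1 - t) ^+ 5 *
   ((1 - t) * c / (s `^ a) ^+ 2 * ((1 - t) ^+ 2 * S `^ a) ^+ 2))).
  by rewrite le_eqVlt; apply/orP; left; apply/eqP; field; rewrite !lt0r_neq0.
apply: ler_wpM2l; first by rewrite divr_ge0// ?mulr_ge0 ?sqr_ge0 ?exprn_ge0// ltW.
apply: ler_pM => //.
- by rewrite divr_ge0 ?sqr_ge0// mulr_ge0// ltW.
- exact: sqr_ge0.
- by rewrite [leRHS]expr_div_n ler_wpM2r// invr_ge0 sqr_ge0.
Qed.

Lemma hcut_far (S rho Q Lam : R) : t0 <= S -> 0 < rho -> rho <= S -> 0 <= Q -> Q <= Lam ->
  t0 `^ a <= t * S `^ a ->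
  dhcut a t0 S ^+ 2 * Q <= Lam * (a / rho) ^+ 2 / (1 - t) ^+ 4 * hcut a t0 S ^+ 2.
Proof.
move=> tS rho0 rS Q0 hQ hE.
have S0 : 0 < S by exact: lt_le_trans tS.
have y0 : 0 < S `^ a by exact: powR_gt0.
have h1 : dhcut a t0 S ^+ 2 <= (a / rho * S `^ a) ^+ 2.
  apply: lerXn2r; rewrite ?nnegrE; [exact: dhcut_ge0|by rewrite !mulr_ge0 ?invr_ge0 ?ltW|].
  apply: (le_trans (dhcut_le a0 t00 tS)); rewrite ler_pM2r// ler_pM2l//.
  by rewrite lef_pV2 ?posrE.
have h : ((1 - t) ^+ 2 * S `^ a) ^+ 2 <= hcut a t0 S ^+ 2.
  apply: lerXn2r; rewrite ?nnegrE; [by rewrite mulr_ge0 ?sqr_ge0 ?ltW|exact: hcut_ge0|].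
  by apply: hcut_ge => //; rewrite -subr_ge0; exact: ltW.
apply: (@le_trans _ _ ((a / rho * S `^ a) ^+ 2 * Lam)).
  by apply: ler_pM => //; exact: sqr_ge0.
have -> : (a / rho * S `^ a) ^+ 2 * Lam =
  Lam * (a / rho) ^+ 2 / (1 - t) ^+ 4 * ((1 - t) ^+ 2 * S `^ a) ^+ 2.
  by field; rewrite !lt0r_neq0.
apply: ler_wpM2l => //; apply: divr_ge0; last by rewrite exprn_ge0// ltW.
by apply: mulr_ge0; [exact: le_trans hQ|exact: sqr_ge0].
Qed.

End scalar_estimates.

(** * Triviality of the deficiency spaces *)

Section collar.
Variables (R : realType) (d : nat).
Local Notation V := 'rV[R]_d.
Local Notation mu := (rV_lebesgue R d).
Local Notation e_ i := (delta_mx ord0 i : V).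

Lemma sqrt_lipschitz (c0 x y : R) : 0 < c0 -> c0 <= x -> c0 <= y ->
  `|Num.sqrt y - Num.sqrt x| <= (Num.sqrt c0)^-1 * `|y - x|.
Proof.
move=> c00 cx cy; have x0 := lt_le_trans c00 cx; have y0 := lt_le_trans c00 cy.
have s0 : 0 < Num.sqrt c0 by rewrite sqrtr_gt0.
rewrite ler_pdivlMl//.
have -> : y - x = (Num.sqrt y - Num.sqrt x) * (Num.sqrt y + Num.sqrt x).
  by rewrite -subr_sqr !sqr_sqrtr// ltW.
rewrite normrM mulrC ler_wpM2l// ger0_norm ?addr_ge0 ?sqrtr_ge0//.
by apply: (@le_trans _ _ (Num.sqrt y)); [rewrite ler_wsqrtr|rewrite lerDl sqrtr_ge0].
Qed.

Definition clip (u : R) : R := Num.max 0 (Num.min 1 u).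

Lemma clip_lipschitz u v : `|clip v - clip u| <= `|v - u|.
Proof.
have key a b : a <= b -> clip b - clip a <= b - a /\ clip a <= clip b.
  by rewrite /clip => ab; have [a1|a1] := leP 1 a; have [b1|b1] := leP 1 b;
    have [a2|a2] := leP 0 a; have [b2|b2] := leP 0 b; rewrite ?(max_r (@ler01 R)); split; lra.
have [uv|vu] := leP u v.
  by have [h1 h2] := key _ _ uv; rewrite !ger0_norm ?subr_ge0.
by have [h1 h2] := key _ _ (ltW vu); rewrite distrC (distrC v) !ger0_norm ?subr_ge0// ltW.
Qed.

Lemma clip_ge0 u : 0 <= clip u. Proof. by rewrite /clip le_max lexx. Qed.
Lemma clip_le1 u : clip u <= 1. Proof. by rewrite /clip ge_max ler01 ge_min lexx. Qed.

Variables (U : set V) (cc : 'I_d -> 'I_d -> V -> R) (L Bc : R).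
Hypothesis oU : open U.
Hypothesis lcc : forall k l x y, `|cc k l y - cc k l x| <= L * `|y - x|.
Hypothesis ccS : forall x, U x -> forall k l, cc k l x = cc l k x.
Hypothesis ccP : forall x, U x -> forall u : V, u != 0 ->
  0 < qf (fun k l => cc k l x) (fun i => u ord0 i) (fun i => u ord0 i).
Hypothesis ccB : forall x, U x -> forall k l, `|cc k l x| <= Bc.
Local Notation c x := (fun k l => cc k l x).

Variables (a t r b c0 Lc Bs : R) (cs : V -> R).
Hypotheses (a01 : 0 < a <= 1) (t01 : 0 < t < 1) (r01 : 0 < r <= 1) (b0 : 0 < b) (c00 : 0 < c0).
Hypothesis cs_lip : forall x y, `|cs y - cs x| <= Lc * `|y - x|.
Hypothesis cs_itv : forall x, c0 <= cs x <= Bs.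
Local Notation s := (dst U r).
Local Notation z x := (dst U r x `^ a).
Hypothesis cmp : forall x (u : 'I_d -> R), U x -> s x < r ->
  (1 - t) * cs x * (s x / z x) ^+ 2 * \sum_i u i ^+ 2 <= qf (c x) u u <=
  (1 + t) * cs x * (s x / z x) ^+ 2 * \sum_i u i ^+ 2.

Let a0 : 0 < a. Proof. by case/andP: a01. Qed.
Let tp : 0 < t. Proof. by case/andP: t01. Qed.
Let tl : 0 < 1 - t. Proof. by case/andP: t01; rewrite subr_gt0. Qed.
Let r0 : 0 < r. Proof. by case/andP: r01. Qed.
Let r0' : 0 <= r. Proof. exact: ltW. Qed.
Let r1 : r <= 1. Proof. by case/andP: r01. Qed.
Let cs0 x : 0 < cs x. Proof. by case/andP: (cs_itv x) => h _; exact: lt_le_trans h. Qed.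

Lemma theta_exists : exists th M, [/\ 0 <= M /\ Ck 1 th,
   forall x, th x ^+ 2 <= (1 + t) * cs x,
   forall x, s x <= r / 4 -> (1 - t) * cs x <= th x ^+ 2,
   forall x, 3 * r / 4 <= s x -> th x = 0 &
   forall x, \sum_i partial i th x ^+ 2 <= M ^+ 2].
Proof.
(* The clipped factor is 1 for [s x <= r / 4] and 0 for [r / 2 <= s x]. Mollification reaches over a
   distance of at most [r / 4], whence the level [3 * r / 4]. *)
pose g x := Num.sqrt (cs x) * clip (2 - 4 / r * s x).
pose M := Num.sqrt Bs * (4 / r) + (Num.sqrt c0)^-1 * `|Lc|.
have M0 : 0 <= M.
  by apply: addr_ge0; apply: mulr_ge0 => //; rewrite ?sqrtr_ge0// ?invr_ge0 ?sqrtr_ge0// divr_ge0.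
have lg x y : `|g y - g x| <= M * enorm (y - x).
  have -> : g y - g x = Num.sqrt (cs y) * (clip (2 - 4 / r * s y) - clip (2 - 4 / r * s x)) +
     (Num.sqrt (cs y) - Num.sqrt (cs x)) * clip (2 - 4 / r * s x) by rewrite /g; ring.
  have -> : M * enorm (y - x) = Num.sqrt Bs * (4 / r * enorm (y - x)) +
     (Num.sqrt c0)^-1 * (`|Lc| * enorm (y - x)) by rewrite /M; ring.
  apply: (le_trans (ler_normD _ _)); rewrite !normrM; apply: lerD.
    rewrite (ger0_norm (sqrtr_ge0 _)); apply: ler_pM; [exact: sqrtr_ge0|exact: normr_ge0| |].
      by rewrite ler_wsqrtr//; have /andP[] := cs_itv y.
    apply: (le_trans (clip_lipschitz _ _)).
    have -> : 2 - 4 / r * s y - (2 - 4 / r * s x) = - (4 / r * (s y - s x)) by ring.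
    rewrite normrN normrM gtr0_norm ?divr_gt0//.
    by rewrite ler_wpM2l ?divr_ge0// dst_lip.
  have /andP[hx _] := cs_itv x; have /andP[hy _] := cs_itv y.
  rewrite (ger0_norm (clip_ge0 _)) -[leRHS]mulr1; apply: ler_pM => //; [exact: clip_ge0| |exact: clip_le1].
  apply: (le_trans (sqrt_lipschitz c00 hx hy)); rewrite ler_wpM2l ?invr_ge0 ?sqrtr_ge0//.
  apply: (le_trans (cs_lip _ _)); apply: (le_trans (ler_wpM2r _ (ler_norm Lc))) => //.
  by rewrite ler_wpM2l// norm_le_enorm.
(* A relative error [t / 3] of the root changes the square by a factor between [1 - t] and [1 + t],
   as [t < 1]. *)
pose sg := t * Num.sqrt c0 / 3.
have sg0 : 0 < sg by rewrite divr_gt0// mulr_gt0// sqrtr_gt0.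
have D0 : 0 < d%:R + 1 :> R by rewrite ltr_wpDl.
have M10 : 0 < M + 1 by rewrite ltr_wpDl.
pose nu := Num.min sg (r / 4) / (M + 1) / (d%:R + 1).
have m0 : 0 < Num.min sg (r / 4) by rewrite lt_min sg0 divr_gt0.
have nu0 : 0 < nu by rewrite !divr_gt0.
have dnu : d%:R * nu * (M + 1) <= Num.min sg (r / 4).
  have -> : d%:R * nu * (M + 1) = Num.min sg (r / 4) * (d%:R / (d%:R + 1)).
    by rewrite /nu; field; rewrite !lt0r_neq0.
  rewrite ler_piMr//; first exact: ltW.
  by rewrite ler_pdivrMr// mul1r lerDl.
have dnu0 : 0 <= d%:R * nu by rewrite mulr_ge0// ltW.
have hsg : M * (d%:R * nu) <= sg.
  apply: (@le_trans _ _ (Num.min sg (r / 4))); last by rewrite ge_min lexx.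
  by apply: le_trans dnu; rewrite mulrC ler_wpM2l// lerDl.
have hr4 : d%:R * nu <= r / 4.
  apply: (@le_trans _ _ (Num.min sg (r / 4))); last by rewrite ge_min lexx orbT.
  by apply: le_trans dnu; rewrite ler_peMr// lerDr.
have [Cth hth dth] := conv_moll_lipschitz nu0 M0 lg.
have lg' x y : `|g y - g x| <= M * d%:R * `|y - x|.
  by apply: (le_trans (lg x y)); rewrite -mulrA ler_wpM2l// enorm_le_norm.
have lig := lipschitz_locint lg'.
set th := conv _ _ in Cth hth dth.
have g0 x : 0 <= g x by rewrite mulr_ge0 ?sqrtr_ge0 ?clip_ge0.
have th0 x : 0 <= th x by exact: conv_moll_ge0.
have sqc x : 0 < Num.sqrt (cs x) by rewrite sqrtr_gt0.
have sgc x : sg <= t / 3 * Num.sqrt (cs x).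
  rewrite /sg mulrAC; apply: ler_wpM2l; first by rewrite divr_ge0// ltW.
  by apply: ler_wsqrtr; have /andP[] := cs_itv x.
exists th, M; split => // [x|x sx|x sx].
- have h1 : th x <= (1 + t / 3) * Num.sqrt (cs x).
    have := hth x; rewrite ler_norml => /andP[_ h].
    have : g x <= Num.sqrt (cs x) by rewrite /g ler_piMr ?sqrtr_ge0// clip_le1.
    by have := sgc x; lra.
  apply: (@le_trans _ _ (((1 + t / 3) * Num.sqrt (cs x)) ^+ 2)).
    by apply: lerXn2r; rewrite ?nnegrE// mulr_ge0 ?sqrtr_ge0// addr_ge0// divr_ge0// ltW.
  rewrite exprMn (sqr_sqrtr (ltW (cs0 x))); apply: ler_wpM2r; first exact: ltW.
  have t1 : t < 1 by case/andP: t01.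
  have : t * t <= t * 1 by rewrite ler_pM2l// ltW.
  have := tp.
  have -> : (1 + t / 3) ^+ 2 = 1 + 2 / 3 * t + t * t / 9 by field.
  lra.
- have gx : g x = Num.sqrt (cs x).
    rewrite /g /clip min_l ?max_r ?mulr1//.
    have : 4 / r * s x <= 4 / r * (r / 4) by rewrite ler_wpM2l// divr_ge0.
    have -> : 4 / r * (r / 4) = 1 by field; rewrite lt0r_neq0.
    lra.
  have h1 : (1 - t / 3) * Num.sqrt (cs x) <= th x.
    by have := hth x; rewrite ler_norml gx => /andP[h _]; have := sgc x; lra.
  have t1 : t < 1 by case/andP: t01.
  apply: (@le_trans _ _ (((1 - t / 3) * Num.sqrt (cs x)) ^+ 2)); last first.
    apply: lerXn2r; rewrite ?nnegrE// mulr_ge0 ?sqrtr_ge0// subr_ge0; lra.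
  rewrite exprMn (sqr_sqrtr (ltW (cs0 x))); apply: ler_wpM2r; first exact: ltW.
  have : 0 <= t * t by rewrite mulr_ge0// ltW.
  have := tp.
  have -> : (1 - t / 3) ^+ 2 = 1 - 2 / 3 * t + t * t / 9 by field.
  lra.
- apply/eqP; rewrite -normr_le0; apply: conv_moll_le => // y xy.
  have h : r / 2 <= s y.
    have := @dst_lip _ _ U r x y r0'; rewrite ler_norml => /andP[h _].
    have : enorm (y - x) <= d%:R * nu.
      by apply: (le_trans (enorm_le_norm _)); rewrite ler_wpM2l.
    lra.
  rewrite /g /clip max_l ?mulr0 ?normr0// ge_min; apply/orP; right.
  have : 4 / r * (r / 2) <= 4 / r * s y by rewrite ler_wpM2l// divr_ge0.
  have -> : 4 / r * (r / 2) = 2 by field; rewrite lt0r_neq0.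
  lra.
Qed.

(** The Hardy inequality with its weights expressed through $z = s^a$: $s^\delta = (s/z)^2$ and
    $s^{\delta-2} = z^{-2}$. *)
Hypothesis HR : forall (f : V -> R) k n r', 0 < k -> r' < r -> Ck 1 f ->
  (forall x, ~ core U k n x -> f x = 0) -> (forall x, r' <= s x -> f x = 0) ->
  [/\ intble mu (fun x => (f x / z x) ^+ 2),
      intble mu (fun x => (s x / z x) ^+ 2 * \sum_i partial i f x ^+ 2) &
      b ^+ 2 * \int[mu]_x (f x / z x) ^+ 2 <=
      \int[mu]_x ((s x / z x) ^+ 2 * \sum_i partial i f x ^+ 2)].

Lemma weight_le1 x : 0 <= s x / z x <= 1.
Proof.
rewrite divr_ge0 ?powR_ge0 ?dst_ge0//=; have [s0|s0] := eqVneq (s x) 0; first by rewrite s0 mul0r.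
have sp : 0 < s x by rewrite lt_neqAle eq_sym s0 dst_ge0.
rewrite ler_pdivrMr ?powR_gt0// mul1r; apply: ger1_powR; last by case/andP: a01.
by rewrite sp (le_trans (dst_le _ _ r0')).
Qed.

Lemma sum_sq_young (q : R) (u w : 'I_d -> R) : 0 < q ->
  \sum_i (u i + w i) ^+ 2 <= (1 + q) * \sum_i u i ^+ 2 + (1 + q^-1) * \sum_i w i ^+ 2.
Proof.
move=> q0; rewrite !mulr_sumr -big_split; apply: ler_sum => i _ /=; rewrite -subr_ge0.
have -> : (1 + q) * u i ^+ 2 + (1 + q^-1) * w i ^+ 2 - (u i + w i) ^+ 2 =
  (q * u i - w i) ^+ 2 / q by field; exact: lt0r_neq0.
by rewrite divr_ge0 ?sqr_ge0// ltW.
Qed.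

(** Hardy's inequality is applied to [th * psi]. In $(1+t)^2/(1-t)$ one factor $1+t$ is Young's, for
    the two terms of the product rule, the other is the upper bound of [th ^+ 2] by [cs], and $1-t$
    comes from the lower comparison of the form. The gradient of [th] leaves only a multiple of
    [psi ^+ 2], as the weight is at most 1. *)
Lemma hardy_form (th psi : V -> R) M k n : 0 <= M -> Ck 1 th ->
  (forall x, th x ^+ 2 <= (1 + t) * cs x) -> (forall x, 3 * r / 4 <= s x -> th x = 0) ->
  (forall x, \sum_i partial i th x ^+ 2 <= M ^+ 2) ->
  0 < k -> Ck 1 psi -> (forall x, ~ core U k n x -> psi x = 0) ->
  intble mu (fun x => (th x / z x) ^+ 2 * psi x ^+ 2) /\
  b ^+ 2 * \int[mu]_x ((th x / z x) ^+ 2 * psi x ^+ 2) <=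
  (1 + t) ^+ 2 / (1 - t) * \int[mu]_x qf (c x) (grad psi x) (grad psi x) +
  (1 + t^-1) * M ^+ 2 * \int[mu]_x psi x ^+ 2.
Proof.
move=> M0 Cth th2 thr dth k0 Cpsi psi0.
pose f x := th x * psi x.
have Cf : Ck 1 f by exact: CkM.
have f0 x : ~ core U k n x -> f x = 0 by move=> h; rewrite /f psi0// mulr0.
have fr x : 3 * r / 4 <= s x -> f x = 0 by move=> h; rewrite /f thr// mul0r.
have r34 : 3 * r / 4 < r by have := r0; lra.
have [i1 i2 i3] := HR k0 r34 Cf f0 fr.
have e1 : (fun x => (f x / z x) ^+ 2) = (fun x => (th x / z x) ^+ 2 * psi x ^+ 2).
  by apply/funext => x; rewrite /f -exprMn mulrAC.
rewrite e1 in i1 i3; split => //; apply: (le_trans i3).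
have sn g : (forall x, ~ core U k n x -> g x = 0) -> supp_cube g n.
  by move=> g0 x xn; apply: g0 => -[].
have iq : intble mu (fun x => qf (c x) (grad psi x) (grad psi x)).
  apply: (@intble_csupp _ _ _ n); first exact: (continuous_qf_grad lcc).
  by move=> x xn; apply: qf0 => i; exact: (supp_cube_partial i (sn _ psi0)).
have ip : intble mu (fun x => psi x ^+ 2) := (l2_csupp Cpsi.1 (sn _ psi0)).2.
set p := (1 + t) ^+ 2 / (1 - t).
have p0 : 0 <= p by rewrite divr_ge0 ?sqr_ge0// ltW.
have K0 : 0 <= (1 + t^-1) * M ^+ 2.
  by rewrite mulr_ge0 ?sqr_ge0// addr_ge0// invr_ge0 ltW.
rewrite -(RintZ _ iq) -(RintZ _ ip) -RintD; [|exact: intbleZ|exact: intbleZ].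
apply: le_Rint => //; first by apply: intbleD; exact: intbleZ.
move=> x; have [xK|xK] := pselect (core U k n x); last first.
  have p00 g : (forall x, ~ core U k n x -> g x = 0) -> forall i, partial i g x = 0.
    by move=> g0 i; apply: (@partial_off _ _ (core U k n)) => //; exact: closed_core.
  rewrite big1 => [|i _]; last by rewrite (p00 _ f0) expr0n.
  by rewrite qf0 ?psi0 ?expr0n ?mulr0 ?addr0//; exact: p00.
have Ux : U x by exact: core_sub xK.
have q0 : 0 <= qf (c x) (grad psi x) (grad psi x) by exact: (qf_ge0 ccP).
have [sr|sr] := leP r (s x).
  rewrite big1 => [|i _]; last first.
    rewrite (@partial_off _ _ [set y | s y <= 3 * r / 4]) ?expr0n//.
    - have := @closed_comp _ _ s [set u | u <= 3 * r / 4].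
      by apply => [y _|]; [exact: continuous_dst|exact: closed_le].
    - by move=> y /negP; rewrite -ltNge => /ltW; exact: fr.
    - by apply/negP; rewrite -ltNge (lt_le_trans r34).
  by rewrite mulr0 addr_ge0// mulr_ge0// sqr_ge0.
have /andP[c1 _] := cmp (grad psi x) Ux sr.
have df i : partial i f x = th x * partial i psi x + psi x * partial i th x.
  by have [_] := pderive_mul ((Cth.2 i).1 x) ((Cpsi.2 i).1 x).
have h1 : \sum_i partial i f x ^+ 2 <= (1 + t) * (th x ^+ 2 * \sum_i partial i psi x ^+ 2) +
    (1 + t^-1) * (psi x ^+ 2 * \sum_i partial i th x ^+ 2).
  under eq_bigr do rewrite df.
  apply: (le_trans (sum_sq_young _ _ tp)).
  by under eq_bigr do rewrite exprMn; under [X in _ + _ * X]eq_bigr do rewrite exprMn; rewrite !mulr_sumr.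
set w := (s x / z x) ^+ 2; set P := \sum_i partial i psi x ^+ 2.
have w0 : 0 <= w by exact: sqr_ge0.
have w1 : w <= 1.
  by have /andP[? ?] := weight_le1 x; rewrite /w expr2 -[leRHS]mulr1; apply: ler_pM.
have P0 : 0 <= P by apply: sumr_ge0 => i _; exact: sqr_ge0.
apply: (le_trans (ler_wpM2l w0 h1)); rewrite mulrDr; apply: lerD.
  apply: (@le_trans _ _ ((1 + t) ^+ 2 * (cs x * w * P))).
    have -> : w * ((1 + t) * (th x ^+ 2 * P)) = th x ^+ 2 * ((1 + t) * w * P) by ring.
    have -> : (1 + t) ^+ 2 * (cs x * w * P) = (1 + t) * cs x * ((1 + t) * w * P) by ring.
    apply: ler_wpM2r => //; apply: mulr_ge0 => //; apply: mulr_ge0 => //.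
    by rewrite addr_ge0// ltW.
  rewrite /p -[leRHS]mulrA ler_wpM2l ?sqr_ge0// ler_pdivlMl//.
  by apply: le_trans c1; rewrite !mulrA.
rewrite mulrCA -[leRHS]mulrA ler_wpM2l ?addr_ge0 ?invr_ge0 ?(ltW tp)//.
rewrite mulrCA [leRHS]mulrC ler_wpM2l ?sqr_ge0//.
by rewrite -[leRHS]mul1r; apply: ler_pM => //; apply: sumr_ge0 => i _; exact: sqr_ge0.
Qed.

End collar.

(** * The cutoffs, the absorption of boundary terms and the vanishing of the weak solution *)

Section kernel.
Variables (R : realType) (d : nat).
Local Notation V := 'rV[R]_d.
Local Notation mu := (rV_lebesgue R d).
Local Notation e_ i := (delta_mx ord0 i : V).

Lemma qfZ (M : 'I_d -> 'I_d -> R) (p : R) (u : 'I_d -> R) :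
  qf M (fun k => p * u k) (fun k => p * u k) = p ^+ 2 * qf M u u.
Proof.
rewrite /qf mulr_sumr; apply: eq_bigr => k _; rewrite mulr_sumr; apply: eq_bigr => l _; ring.
Qed.

(** [AA] is the energy, [BB] the Hardy integral and [PP] the squared norm. The Hardy inequality
    trades [BB] for energy, which cancels against the left-hand side. The 2 in the condition on
    [lam] pays for the unit lost in [lam - 1] and for the [PP] that is kept. *)
Lemma absorb (q p b2 t lam AA BB PP K1 K3 W Y Z : R) : 0 < b2 -> 0 <= q -> 0 <= AA -> 0 <= PP ->
  b2 * BB <= p * AA + K1 * PP -> q / b2 * p <= 1 - t -> 2 + K3 + q / b2 * K1 <= lam ->
  (1 - t) * AA + (lam - 1) * PP <= W + Z -> W <= q * BB + K3 * PP + Y -> PP <= Y + Z.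
Proof.
move=> b20 q0 A0 P0 h1 h2 h3 h4 h5.
have G1 : q * BB <= q / b2 * (p * AA + K1 * PP).
  have -> : q * BB = q / b2 * (b2 * BB) by field; exact: lt0r_neq0.
  by apply: ler_wpM2l => //; rewrite divr_ge0// ltW.
have G3 : q / b2 * p * AA <= (1 - t) * AA by rewrite ler_wpM2r.
have G4 : (2 + K3 + q / b2 * K1) * PP <= lam * PP by rewrite ler_wpM2r.
rewrite mulrDr !mulrA in G1.
have e1 : (2 + K3 + q / b2 * K1) * PP = 2 * PP + K3 * PP + q / b2 * K1 * PP by ring.
have e2 : (lam - 1) * PP = lam * PP - PP by ring.
rewrite e1 in G4; rewrite e2 in h4; lra.
Qed.

(** The squared gradient decays like the inverse square of the radius, so with bounded coefficients
    the cutoff at infinity is free in the limit. *)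
Lemma bump_scaled : exists D m, [/\ 0 <= D, 0 < m & forall n : R, 0 < n ->
  let X := fun x : V => bump (n^-1 *: x) in
  [/\ Ck 1 X, supp_cube X n, forall x, 0 <= X x <= D,
     forall x, \sum_i partial i X x ^+ 2 <= D / n ^+ 2 &
     forall x, cube 0 (n / 2) x -> m <= X x]].
Proof.
have [m m0 hm] := bump_lower R d.
have cb := Ck_continuous (@bump_Cinf R d 0).
have [B B0 hB] := continuous_bounded_cube cb (@bump_supp R d).
have /choice[D hD] : forall i : 'I_d, exists D, 0 <= D /\ forall x : V, `|partial i (@bump R d) x| <= D.
  move=> i; have [_ h] := @bump_Cinf R d 1%N.
  have [D D0 hD] := continuous_bounded_cube (h i).2 (supp_cube_partial i (@bump_supp R d)).
  by exists D.
have S0 : 0 <= \sum_i D i ^+ 2 by apply: sumr_ge0 => i _; exact: sqr_ge0.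
exists (B + \sum_i D i ^+ 2), m; split => //; first exact: addr_ge0.
move=> n n0 X; have C1b := @bump_Cinf R d 1%N.
have nE (x : V) : `|n^-1 *: x - 0| = n^-1 * `|x - 0|.
  by rewrite !subr0 normrZ gtr0_norm ?invr_gt0.
split.
- exact: Ck_dilation.
- move=> x xn; apply: bump_supp => h; apply: xn; move: h.
  by rewrite /cube /= nE ler_pdivrMl// mulr1.
- move=> x; rewrite /X bump_ge0 /=; apply: (@le_trans _ _ B); last by rewrite lerDl.
  exact: le_trans (ler_norm _) (hB _).
- move=> x; apply: (@le_trans _ _ ((\sum_i D i ^+ 2) / n ^+ 2)).
    rewrite mulr_suml; apply: ler_sum => i _.
    have [_ ->] := pderive_dilation ((C1b.2 i).1 (n^-1 *: x)).
    rewrite exprMn exprVn mulrC ler_wpM2r ?invr_ge0 ?sqr_ge0//.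
    by rewrite -real_normK ?num_real//; apply: lerXn2r; rewrite ?nnegrE//; have [? ?] := hD i.
  by rewrite ler_wpM2r ?invr_ge0 ?sqr_ge0// lerDr.
- move=> x xn; apply: hm; move: xn; rewrite /cube /= nE ler_pdivrMl//.
Qed.

Variables (U : set V) (cc : 'I_d -> 'I_d -> V -> R) (L Bc : R).
Hypothesis oU : open U.
Hypothesis lcc : forall k l x y, `|cc k l y - cc k l x| <= L * `|y - x|.
Hypothesis ccS : forall x, U x -> forall k l, cc k l x = cc l k x.
Hypothesis ccP : forall x, U x -> forall u : V, u != 0 ->
  0 < qf (fun k l => cc k l x) (fun i => u ord0 i) (fun i => u ord0 i).
Hypothesis ccB : forall x, U x -> forall k l, `|cc k l x| <= Bc.
Local Notation c x := (fun k l => cc k l x).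

Variables (a t r b c0 Lc Bs : R) (cs : V -> R).
Hypotheses (a01 : 0 < a <= 1) (t01 : 0 < t < 1) (r01 : 0 < r <= 1) (b0 : 0 < b) (c00 : 0 < c0).
Hypothesis cs_lip : forall x y, `|cs y - cs x| <= Lc * `|y - x|.
Hypothesis cs_itv : forall x, c0 <= cs x <= Bs.
Local Notation s := (dst U r).
Local Notation z x := (dst U r x `^ a).
Hypothesis cmp : forall x (u : 'I_d -> R), U x -> s x < r ->
  (1 - t) * cs x * (s x / z x) ^+ 2 * \sum_i u i ^+ 2 <= qf (c x) u u <=
  (1 + t) * cs x * (s x / z x) ^+ 2 * \sum_i u i ^+ 2.

Let a0 : 0 < a. Proof. by case/andP: a01. Qed.
Let tp : 0 < t. Proof. by case/andP: t01. Qed.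
Let tl : 0 < 1 - t. Proof. by case/andP: t01; rewrite subr_gt0. Qed.
Let r0 : 0 < r. Proof. by case/andP: r01. Qed.
Let r0' : 0 <= r. Proof. exact: ltW. Qed.
Let r1 : r <= 1. Proof. by case/andP: r01. Qed.
Let cs0 x : 0 < cs x. Proof. by case/andP: (cs_itv x) => h _; exact: lt_le_trans h. Qed.

Hypothesis HR : forall (f : V -> R) k n r', 0 < k -> r' < r -> Ck 1 f ->
  (forall x, ~ core U k n x -> f x = 0) -> (forall x, r' <= s x -> f x = 0) ->
  [/\ intble mu (fun x => (f x / z x) ^+ 2),
      intble mu (fun x => (s x / z x) ^+ 2 * \sum_i partial i f x ^+ 2) &
      b ^+ 2 * \int[mu]_x (f x / z x) ^+ 2 <=
      \int[mu]_x ((s x / z x) ^+ 2 * \sum_i partial i f x ^+ 2)].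


Variables (th : V -> R) (M : R).
Hypotheses (M0 : 0 <= M) (Cth : Ck 1 th)
  (th_le : forall x, th x ^+ 2 <= (1 + t) * cs x)
  (th_ge : forall x, s x <= r / 4 -> (1 - t) * cs x <= th x ^+ 2)
  (th_r : forall x, 3 * r / 4 <= s x -> th x = 0)
  (th_grad : forall x, \sum_i partial i th x ^+ 2 <= M ^+ 2).

(** The coefficient of the Hardy weight: [a ^+ 2] with the losses of [hcut_near], and one more $1+t$
    for separating the gradient of the cutoff at infinity by Young's inequality. *)
Let q := (1 + t) * (a ^+ 2 * (1 + t) ^+ 3 / (1 - t) ^+ 5).
Local Notation sr := (dst U (r / 4)).

Let q0 : 0 <= q.
Proof.
have t1 : 0 <= 1 + t by rewrite ltW// addr_gt0.
rewrite /q mulr_ge0// divr_ge0//; last by rewrite exprn_ge0// ltW.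
by rewrite mulr_ge0 ?sqr_ge0// exprn_ge0.
Qed.

(** The power cutoff of a smoothed truncated distance, times a scaled bump. All constants are chosen
    before [t0] and [n]; this uniformity is what allows the cutoffs to be removed later for a [lam]
    fixed in advance. *)
Lemma eta_exists : exists K2 K3 K4 kap m, [/\ [/\ 0 <= K2, 0 <= K3, 0 <= K4, 1 <= kap & 0 < m] &
  forall t0 n, 0 < t0 -> kap * t0 < r / 4 -> 0 < n -> exists eta, [/\ Ck 1 eta,
    forall x, ~ core U (t0 / 2) n x -> eta x = 0,
    forall x, qf (c x) (grad eta x) (grad eta x) <= q * ((th x / z x) ^+ 2 * eta x ^+ 2) +
      K3 * eta x ^+ 2 + K4 * \1_[set x | sr x <= kap * t0] x + K2 / n ^+ 2 &
    forall x, cube 0 (n / 2) x -> kap * t0 < sr x -> m * (sr x / 2) `^ a <= eta x]].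
Proof.
have [D [m [D0 m0 hX]]] := bump_scaled.
pose rho := r / 4; have rho0 : 0 < rho by rewrite divr_gt0.
have rhor : rho < r by rewrite /rho; have := r0; lra.
pose Lam := d%:R * `|Bc|; have Lam0 : 0 <= Lam by rewrite mulr_ge0.
have t1 : 0 <= 1 + t by rewrite ltW// addr_gt0.
have Bs0 : 0 <= Bs by have /andP[h1 h2] := cs_itv 0; exact: le_trans (ltW c00) (le_trans h1 h2).
pose K4 := (1 + t) * (a ^+ 2 * (1 + t) ^+ 3 * Bs * (1 + t) ^+ 2 * D ^+ 2).
pose K3 := (1 + t) * (Lam * (a / (rho / 2)) ^+ 2 / (1 - t) ^+ 4).
pose K2 := (1 + t^-1) * (Lam * D).
(* Chosen so that [S] at least [kap0 * t0] gives $t_0^a \le t S^a$, the condition of [hcut_near].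
   The 1 added in [kap] covers the difference between the distance and its smoothing. *)
pose kap0 := (t `^ (- a^-1)); pose kap := kap0 + 1.
have kap00 : 0 <= kap0 by exact: powR_ge0.
exists K2, K3, K4, kap, ((1 - t) ^+ 2 * m); split.
  have ti : 0 <= 1 + t^-1 by rewrite addr_ge0// invr_ge0 ltW.
  split.
  - by rewrite mulr_ge0// mulr_ge0.
  - by apply: mulr_ge0 => //; apply: divr_ge0; [apply: mulr_ge0 => //; exact: sqr_ge0|rewrite exprn_ge0// ltW].
  - apply: mulr_ge0 => //; apply: mulr_ge0; last exact: sqr_ge0.
    apply: mulr_ge0; last exact: sqr_ge0; apply: mulr_ge0 => //.
    by apply: mulr_ge0; [exact: sqr_ge0|exact: exprn_ge0].
  - by rewrite lerDr.
  - by rewrite mulr_gt0// exprn_gt0.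
move=> t0 n t00 kt n0; have [CX sX X01 dX Xm] := hX n n0.
set X := (fun x : V => bump _) in CX sX X01 dX Xm.
have tl1 : t < 1 by case/andP: t01.
(* An error of this size is at most the fraction [t] of the distance wherever the distance exceeds
   [t0 / 2]; below that level it keeps [S] at most [t0], where the cutoff vanishes. *)
pose sg := t * t0 / 2; have sg0 : 0 < sg by rewrite divr_gt0// mulr_gt0.
have sgt : sg <= t0 / 2 by rewrite /sg ler_wpM2r// ler_piMl// ltW.
pose nu := sg / (d%:R + 1); have D10 : 0 < d%:R + 1 :> R by rewrite ltr_wpDl.
have nu0 : 0 < nu by rewrite divr_gt0.
have lsr x y : `|sr y - sr x| <= 1 * enorm (y - x) by rewrite mul1r dst_lip// ltW.
have [CS hS dS] := conv_moll_lipschitz nu0 ler01 lsr.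
have lis : locint sr.
  by apply: (@lipschitz_locint _ _ _ d%:R) => x y; apply: dst_lipschitz; exact: ltW.
set S := conv _ _ in CS hS dS.
have {}hS x : `|S x - sr x| <= sg.
  apply: (le_trans (hS x)); rewrite mul1r /nu mulrCA ler_piMr ?(ltW sg0)//.
  by rewrite ler_pdivrMr// mul1r lerDl.
have S0 x : 0 <= S x by apply: conv_moll_ge0 => // y; apply: dst_ge0; exact: ltW.
have S1 x : S x <= 1.
  apply: (le_trans (ler_norm _)); apply: conv_moll_le => // y _.
  rewrite ger0_norm ?dst_ge0 ?(ltW rho0)//; apply: (le_trans (dst_le _ _ (ltW rho0))).
  by apply: le_trans (ltW rhor) _.
pose h := hcut a t0; pose h' := dhcut a t0.
have dh := hcut_derive a0 t00; have ch := continuous_dhcut a0 t00.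
pose eta x := h (S x) * X x.
have ChS : Ck 1 (fun x => h (S x)) by exact: (C1_comp dh ch CS).
have Ceta : Ck 1 eta by exact: CkM.
have h0 x : sr x <= t0 / 2 -> h (S x) = 0.
  move=> sx; suff St : S x <= t0 by exact: (hcut_le0 a St).1.
  by have := hS x; rewrite ler_norml => /andP[_]; lra.
have eta0 x : ~ core U (t0 / 2) n x -> eta x = 0.
  move=> xK; have [xn|xn] := pselect (cube 0 n x); last by rewrite /eta sX// mulr0.
  rewrite /eta h0 ?mul0r// leNgt; apply/negP => sx; apply: xK; split => //.
  rewrite (@dst_min _ _ _ 1) ?(ltW rho0) ?(le_trans (ltW rhor))// lt_min in sx.
  by case/andP: sx => _ /ltW.
exists eta; split => //.
  move=> x; have K20 : 0 <= K2 / n ^+ 2.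
    by rewrite divr_ge0 ?sqr_ge0// mulr_ge0 ?mulr_ge0// addr_ge0// invr_ge0 ltW.
  have I0 : 0 <= K4 * \1_[set x | sr x <= kap * t0] x :> R.
    apply: mulr_ge0; last by rewrite indicE.
    apply: mulr_ge0 => //; apply: mulr_ge0; last exact: sqr_ge0.
    apply: mulr_ge0; last exact: sqr_ge0; apply: mulr_ge0 => //.
    by apply: mulr_ge0; [exact: sqr_ge0|exact: exprn_ge0].
  have K30 : 0 <= K3.
    by apply: mulr_ge0 => //; apply: divr_ge0; [apply: mulr_ge0 => //; exact: sqr_ge0|rewrite exprn_ge0// ltW].
  have e0 : 0 <= eta x ^+ 2 by exact: sqr_ge0.
  have w0 : 0 <= (th x / z x) ^+ 2 by exact: sqr_ge0.
  have [xK|xK] := pselect (core U (t0 / 2) n x); last first.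
    rewrite qf0 => [|i]; last by apply: (@partial_off _ _ (core U (t0 / 2) n)) => //; exact: closed_core.
    by rewrite addr_ge0// addr_ge0// addr_ge0// mulr_ge0// mulr_ge0.
  have Ux : U x by apply: core_sub xK; rewrite divr_gt0.
  have MS := ccS Ux; have Q0 u := qf_ge0 ccP u Ux.
  have QL u : qf (c x) u u <= Lam * \sum_i u i ^+ 2.
    by apply: qf_bound => k l; apply: (le_trans (ccB Ux k l)); exact: ler_norm.
  have de i : partial i eta x = (X x * h' (S x)) * partial i S x + h (S x) * partial i X x.
    have [d1 d2] := pderive_comp dh ((CS.2 i).1 x).
    by apply: (etrans (pderive_mul d1 ((CX.2 i).1 x)).2); rewrite d2 addrC mulrA.
  have -> : grad eta x = fun i => (X x * h' (S x)) * grad S x i + h (S x) * grad X x i.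
    by apply/funext => i; exact: de.
  apply: (le_trans (qf_young _ _ MS Q0 tp)); rewrite !qfZ.
  have b2 : (1 + t^-1) * (h (S x) ^+ 2 * qf (c x) (grad X x) (grad X x)) <= K2 / n ^+ 2.
    rewrite /K2 -[leRHS]mulrA ler_wpM2l// ?addr_ge0// ?invr_ge0 ?(ltW tp)//.
    have h1 : h (S x) ^+ 2 <= 1.
      have hh0 : 0 <= h (S x) by exact: hcut_ge0.
      suff hh : h (S x) <= 1 by rewrite -(expr1n _ 2); apply: lerXn2r; rewrite ?nnegrE.
      have [St|St] := leP (S x) t0; first by rewrite /h (hcut_le0 a St).1.
      apply: (le_trans (hcut_le a0 t00 (ltW St))).
      rewrite [leRHS](_ : 1 = 1 `^ a); last by rewrite powR1.
      by apply: ge0_ler_powR; rewrite ?nnegrE//; exact: ltW.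
    apply: (@le_trans _ _ (1 * (Lam * (D / n ^+ 2)))); last by rewrite mul1r mulrA.
    apply: ler_pM => //; first exact: sqr_ge0.
    by apply: (le_trans (QL _)); apply: ler_wpM2l => //; exact: dX.
  apply: lerD => //.
  rewrite exprMn; set Q := qf (c x) (grad S x) (grad S x).
  have Q00 : 0 <= Q by exact: Q0.
  have X20 : 0 <= X x ^+ 2 by exact: sqr_ge0.
  have eE : eta x ^+ 2 = X x ^+ 2 * h (S x) ^+ 2 by rewrite /eta exprMn mulrC.
  have qE (e : R) : q * ((th x / z x) ^+ 2 * e) =
     (1 + t) * (a ^+ 2 * (1 + t) ^+ 3 / (1 - t) ^+ 5 * ((th x / z x) ^+ 2 * e)) by exact/esym/mulrA.
  have [St|St] := leP (S x) t0.
    rewrite /h' (hcut_le0 a St).2 expr0n mulr0 !mul0r mulr0.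
    by rewrite addr_ge0// addr_ge0// mulr_ge0// mulr_ge0.
  have := hS x; rewrite ler_norml => /andP[hS1 hS2].
  have srSg : sr x <= S x + sg by rewrite -lerBlDl -opprB lerNl.
  have Sp : 0 < S x by exact: lt_trans St.
  have srt : t0 / 2 < sr x by lra.
  have srp : 0 < sr x by apply: lt_trans srt; rewrite divr_gt0.
  have ts1 : t * (t0 / 2) <= t * sr x by rewrite ler_wpM2l ?(ltW tp)// ltW.
  have ts2 : t * t0 <= t * S x by rewrite ler_wpM2l ?(ltW tp)// ltW.
  have sgE : sg = t * (t0 / 2) by rewrite /sg mulrA.
  have rat : `|S x - sr x| <= t * sr x by apply: (le_trans (hS x)); rewrite sgE.
  have srS : sr x <= (1 + t) * S x by rewrite mulrDl mul1r; lra.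
  have near_rho : sr x < rho -> s x = sr x.
    rewrite (@dst_min _ _ _ r) ?(ltW rho0) ?(ltW rhor)//.
    by rewrite -/rho; have [_|//] := leP rho (s x); rewrite ltxx.
  have nearQ : sr x < rho -> Q <= (1 + t) * cs x * (sr x / sr x `^ a) ^+ 2.
    move=> sx; have sE := near_rho sx.
    have sxr : s x < r by rewrite sE (lt_trans sx).
    have /andP[_ c2] := cmp (grad S x) Ux sxr; rewrite sE in c2.
    apply: (le_trans c2); rewrite ler_piMr//.
      by apply: mulr_ge0; [apply: mulr_ge0 => //; exact/ltW/cs0|exact: sqr_ge0].
    by apply: (le_trans (dS x)); rewrite expr1n.
  have csx : 0 <= cs x by exact/ltW/cs0.
  (* Three zones. Where $t_0^a > t S^a$ the cutoff is too small to control its gradient, which is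
     merely bounded: this is the [K4] term. Past this zone and below distance [rho] the Hardy weight
     controls the gradient, and from [rho] on the [K3] term does. *)
  have [hE|hE] := leP (t0 `^ a) (t * S x `^ a); last first.
    have Sk : S x < kap0 * t0.
      rewrite ltNge; apply/negP => kS; move: hE; apply/negP; rewrite -leNgt.
      rewrite mulrC -ler_pdivrMr//.
      have -> : t0 `^ a / t = (kap0 * t0) `^ a.
        rewrite powRM ?(ltW t00)// /kap0 -powRrM mulNr mulVf ?lt0r_neq0// powRN powRr1 ?(ltW tp)//.
        by rewrite mulrC.
      by apply: ge0_ler_powR; rewrite ?nnegrE// ?mulr_ge0// ltW.
    have xk : sr x <= kap * t0.
      have t0h : t0 / 2 <= t0 by rewrite ler_piMr ?(ltW t00)// invf_le1// ler1n.
      by rewrite /kap mulrDl mul1r; exact: le_trans srSg (lerD (ltW Sk) (le_trans sgt t0h)).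
    have sx : sr x < rho by exact: le_lt_trans kt.
    have d1 := dhcut_near a01 t01 t00 (ltW St) srp srS csx Q00 (nearQ sx).
    have [rt _] := powR_ratio a01 t01 srp Sp rat.
    have d2 : (S x `^ a / sr x `^ a) ^+ 2 <= (1 + t) ^+ 2.
      apply: lerXn2r; rewrite ?nnegrE//; first by rewrite divr_ge0 ?powR_ge0.
      by rewrite ler_pdivrMr ?powR_gt0.
    have d3 : h' (S x) ^+ 2 * Q <= a ^+ 2 * (1 + t) ^+ 3 * Bs * (1 + t) ^+ 2.
      apply: (le_trans d1); apply: ler_pM.
      - by apply: mulr_ge0 => //; apply: mulr_ge0; [exact: sqr_ge0|exact: exprn_ge0].
      - exact: sqr_ge0.
      - by rewrite ler_wpM2l//; [apply: mulr_ge0; [exact: sqr_ge0|exact: exprn_ge0]|have /andP[] := cs_itv x].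
      - exact: d2.
    rewrite indicE mem_set// mulr1.
    apply: (@le_trans _ _ K4); last by rewrite lerDr addr_ge0// mulr_ge0// mulr_ge0.
    rewrite /K4 ler_wpM2l//.
    have -> : X x ^+ 2 * h' (S x) ^+ 2 * Q = (h' (S x) ^+ 2 * Q) * X x ^+ 2 by ring.
    apply: ler_pM => //; first by rewrite mulr_ge0// sqr_ge0.
    by have /andP[? ?] := X01 x; apply: lerXn2r; rewrite ?nnegrE.
  have [sx|sx] := ltP (sr x) rho.
    have sE := near_rho sx.
    have th2 : (1 - t) * cs x <= th x ^+ 2 by apply: th_ge; rewrite sE; exact: ltW.
    have d1 := hcut_near a01 t01 t00 (ltW St) srp srS csx Q00 (nearQ sx) hE th2.
    apply: (@le_trans _ _ (q * ((th x / z x) ^+ 2 * eta x ^+ 2))); last first.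
      by rewrite -addrA lerDl addr_ge0// mulr_ge0.
    rewrite qE ler_wpM2l// eE sE.
    have -> : X x ^+ 2 * h' (S x) ^+ 2 * Q = X x ^+ 2 * (h' (S x) ^+ 2 * Q) by ring.
    apply: (le_trans (ler_wpM2l X20 d1)).
    by rewrite le_eqVlt; apply/orP; left; apply/eqP; rewrite /h; ring.
  have rS : rho / 2 <= S x.
    have : t0 <= kap * t0 by rewrite ler_peMl ?(ltW t00)// lerDr.
    move=> tk; have sgr : sg <= rho / 2.
      by apply: (le_trans sgt); rewrite ler_pM2r ?invr_gt0//; exact: le_trans tk (ltW kt).
    rewrite -(lerD2r (rho / 2)) -splitr; apply: (le_trans sx); apply: (le_trans srSg).
    by rewrite lerD2l.
  have QLam : Q <= Lam.
    by apply: (le_trans (QL _)); rewrite ler_piMr//; apply: (le_trans (dS x)); rewrite expr1n.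
  have rho20 : 0 < rho / 2 by rewrite divr_gt0.
  have d1 := hcut_far a01 t01 t00 (ltW St) rho20 rS Q00 QLam hE.
  apply: (@le_trans _ _ (K3 * eta x ^+ 2)); last first.
    by rewrite addrAC lerDr addr_ge0// mulr_ge0// mulr_ge0.
  rewrite /K3 -[leRHS]mulrA ler_wpM2l// eE.
  have -> : X x ^+ 2 * h' (S x) ^+ 2 * Q = X x ^+ 2 * (h' (S x) ^+ 2 * Q) by ring.
  apply: (le_trans (ler_wpM2l X20 d1)).
  by rewrite le_eqVlt; apply/orP; left; apply/eqP; rewrite /h; ring.
move=> x xn kx; have := hS x; rewrite ler_norml => /andP[hS1 hS2].
have tk : t0 <= kap * t0 by rewrite ler_peMl ?(ltW t00)// lerDr.
have Sk : kap0 * t0 <= S x by move: kx; rewrite /kap mulrDl mul1r; lra.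
have Ss : sr x / 2 <= S x by lra.
have kE : t0 `^ a <= t * S x `^ a.
  rewrite mulrC -ler_pdivrMr//.
  have -> : t0 `^ a / t = (kap0 * t0) `^ a.
    rewrite powRM ?(ltW t00)// /kap0 -powRrM mulNr mulVf ?lt0r_neq0// powRN powRr1 ?(ltW tp)//.
    by rewrite mulrC.
  by apply: ge0_ler_powR; rewrite ?nnegrE// ?mulr_ge0// ltW.
have k01 : 1 <= kap0.
  rewrite /kap0 powRN invf_ge1 ?powR_gt0// [leRHS](_ : 1 = 1 `^ a^-1); last by rewrite powR1.
  by apply: ge0_ler_powR; rewrite ?nnegrE ?invr_ge0// ltW.
have tS : t0 <= S x by apply: le_trans Sk; rewrite ler_peMl// ltW.
have d1 := hcut_ge a0 t00 tS (ltW tl1) kE.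
have Xx := Xm x xn.
rewrite /eta mulrAC; apply: ler_pM => //; [|exact: ltW|].
  by rewrite mulr_ge0 ?sqr_ge0 ?powR_ge0.
apply: le_trans d1; rewrite ler_wpM2l ?sqr_ge0//.
apply: ge0_ler_powR; rewrite ?nnegrE//; first exact: ltW.
by rewrite divr_ge0// dst_ge0// ltW.
Qed.

Hypothesis qp : a ^+ 2 * (1 + t) ^+ 6 <= (1 - t) ^+ 7 * b ^+ 2.

Lemma measurable_sublevel t1 : measurable [set x : V | sr x <= t1].
Proof.
apply: closed_measurable_rV; have := @closed_comp _ _ sr [set u | u <= t1].
by apply => [y _|]; [apply: continuous_dst; rewrite divr_ge0|exact: closed_le].
Qed.

(** For a fixed cutoff, the energy inequality with its boundary term absorbed. As the mollification
    scale tends to 0 the oscillation term disappears, and the limit involves only L2 norms of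
    multiples of [v]. *)
Lemma kernel_bound (v eta : V -> R) k n lam K2 K3 K4 (A : set V) : l2 mu v -> 0 < k ->
  Ck 1 eta -> (forall x, ~ core U k n x -> eta x = 0) -> measurable A ->
  (forall x, qf (c x) (grad eta x) (grad eta x) <= q * ((th x / z x) ^+ 2 * eta x ^+ 2) +
      K3 * eta x ^+ 2 + K4 * \1_A x + K2) ->
  2 + K3 + q / b ^+ 2 * ((1 + t^-1) * M ^+ 2) <= lam ->
  (forall phi, tst U phi -> \int[mu]_x (v x * (dop cc phi x + lam * phi x)) = 0) ->
  dot mu (fun x => eta x * v x) (fun x => eta x * v x) <=
  K4 * dot mu (fun x => \1_A x * v x) (fun x => \1_A x * v x) + K2 * dot mu v v.
Proof.
move=> lv k0 Ceta eta0 mA Peta hlam vorth.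
have [C [C0 [e0 e00 he]]] := energy lcc ccS ccP lv k0 Ceta eta0 tp vorth.
have [es [hes lk k0' lve cve]] := conv_moll_seq lv e00.
pose ve j := conv (moll (es j)) v.
have sn (f : V -> R) : (forall x, ~ core U k n x -> f x = 0) -> supp_cube f n.
  by move=> f0 x xn; apply: f0 => -[].
have meta := continuous_measurable_rV Ceta.1.
have [B _ hB] := continuous_bounded_cube Ceta.1 (sn _ eta0).
have mI : measurable_fun setT (\1_A : V -> R) by exact: measurable_indic.
have hI x : `|\1_A x : R| <= 1 by rewrite indicE; case: (_ \in _); rewrite ?normr1 ?normr0.
have m1 : measurable_fun setT (fun _ : V => 1 : R) by [].
have h1 (x : V) : `|(fun _ : V => 1 : R) x| <= 1 by rewrite normr1.
have c1 := cve eta B meta hB; have c2 := cve _ 1 mI hI; have c3 := cve _ 1 m1 h1.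
have e1 f : (fun x => (fun _ : V => 1 : R) x * f x) = f by apply/funext => x; exact: mul1r.
rewrite e1 in c3.
have c3' : dot mu (ve j) (ve j) @[j --> \oo] --> dot mu v v.
  by apply: cvg_trans c3; apply: near_eq_cvg; apply: nearW => j; rewrite e1.
have key j : dot mu (fun x => eta x * ve j x) (fun x => eta x * ve j x) <=
    K4 * dot mu (fun x => \1_A x * ve j x) (fun x => \1_A x * ve j x) + K2 * dot mu (ve j) (ve j)
    + C * dot mu (kavg (es j) v) (kavg (es j) v).
  have [_ E] := he _ (hes j); rewrite -/(ve j) in E; cbv zeta in E.
  have [KK KK0 hK] := moll_facts R d; have /andP[esj _] := hes j.
  have [[Cm sm _] _ _ _ _] := hK _ esj.
  have Cve : Ck 1 (ve j) by exact: conv_Cinf Cm sm (l2_locint lv) 1%N.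
  set psi := (fun x => eta x * _) in E.
  have Cpsi : Ck 1 psi by exact: CkM.
  have psi0 x : ~ core U k n x -> psi x = 0 by move=> h; rewrite /psi eta0// mul0r.
  have [iB hH] := hardy_form lcc ccP a01 t01 r01 cmp HR M0 Cth th_le th_r th_grad k0 Cpsi psi0.
  set AA := \int[mu]_x qf _ (grad psi x) (grad psi x) in E hH.
  have AA0 : 0 <= AA.
    apply: Rint_ge0 => x; have [xK|xK] := pselect (core U k n x).
      by apply: (qf_ge0 ccP); exact: core_sub xK.
    by rewrite qf0// => i; apply: (@partial_off _ _ (core U k n)) => //; exact: closed_core.
  set BB := \int[mu]_x ((th x / z x) ^+ 2 * psi x ^+ 2) in hH.
  rewrite (dot_sq _ (fun x => eta x * ve j x)).
  set PP := \int[mu]_x psi x ^+ 2 in E hH *.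
  have PP0 : 0 <= PP by apply: Rint_ge0 => x; exact: sqr_ge0.
  have iP : intble mu (fun x => psi x ^+ 2) := (l2_csupp Cpsi.1 (sn _ psi0)).2.
  have lI : l2 mu (fun x => \1_A x * ve j x).
    apply: (l2_le _ _ (lve j)); first by apply: measurable_funM => //; exact: (lve j).1.
    by move=> x; rewrite normrM ler_piMl.
  have iI := lI.2; have iv := (lve j).2; rewrite -/(ve j) in iv.
  have i3 : intble mu (fun x => ve j x ^+ 2 * qf (c x) (grad eta x) (grad eta x)).
    apply: (@intble_csupp _ _ _ n).
      apply: continuousM_rV; last exact: (continuous_qf_grad lcc).
      by under eq_fun do rewrite expr2; apply: continuousM_rV; exact: Cve.1.
    by move=> x xn; rewrite qf0 ?mulr0// => i; exact: (supp_cube_partial i (sn _ eta0)).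
  have F : \int[mu]_x (ve j x ^+ 2 * qf (c x) (grad eta x) (grad eta x)) <=
      q * BB + K3 * PP + K4 * \int[mu]_x (\1_A x * ve j x) ^+ 2 + K2 * \int[mu]_x ve j x ^+ 2.
    have j1 := intbleZ q iB; have j2 := intbleZ K3 iP; have j3 := intbleZ K4 iI.
    have j4 := intbleZ K2 iv; have j12 := intbleD j1 j2; have j123 := intbleD j12 j3.
    rewrite -(RintZ q iB) -(RintZ K3 iP) -(RintZ K4 iI) -(RintZ K2 iv).
    rewrite -(RintD j1 j2) -(RintD j12 j3) -(RintD j123 j4).
    apply: le_Rint => //; first exact: intbleD.
    move=> x; apply: (le_trans (ler_wpM2l (sqr_ge0 _) (Peta x))).
    have I2 : (\1_A x : R) ^+ 2 = \1_A x by rewrite indicE; case: (_ \in _); rewrite ?expr1n ?expr0n.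
    rewrite le_eqVlt; apply/orP; left; apply/eqP.
    by rewrite /psi -/(ve j) [(\1_A x * _) ^+ 2]exprMn I2; ring.
  rewrite !dot_sq in E *.
  set II := \int[mu]_x (\1_A x * _) ^+ 2 in F *.
  set VV := \int[mu]_x ve j x ^+ 2 in F *.
  set p := (1 + t) ^+ 2 / (1 - t) in hH; set K1 := (1 + t^-1) * M ^+ 2 in hH hlam.
  have b20 : 0 < b ^+ 2 by rewrite exprn_gt0.
  (* Here [qp] is used: [q * p] equals $a^2(1+t)^6/(1-t)^6$, which must not exceed $(1-t)b^2$. *)
  have G2 : q / b ^+ 2 * p <= 1 - t.
    have -> : q / b ^+ 2 * p = a ^+ 2 * (1 + t) ^+ 6 / ((1 - t) ^+ 6 * b ^+ 2).
      by rewrite /q /p; field; rewrite !lt0r_neq0.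
    rewrite ler_pdivrMr; last by rewrite mulr_gt0// exprn_gt0.
    by have -> : (1 - t) * ((1 - t) ^+ 6 * b ^+ 2) = (1 - t) ^+ 7 * b ^+ 2 by ring.
  by rewrite -[q * BB + _ + _ + _]addrA in F; exact: (absorb b20 q0 AA0 PP0 hH G2 hlam E F).
have c4 : C * dot mu (kavg (es j) v) (kavg (es j) v) @[j --> \oo] --> (0 : R).
  by rewrite -(mulr0 C); exact: cvgMr.
have c2' : K4 * dot mu (fun x => \1_A x * ve j x) (fun x => \1_A x * ve j x) @[j --> \oo] -->
    K4 * dot mu (fun x => \1_A x * v x) (fun x => \1_A x * v x) by exact: cvgMr.
have c3'' : K2 * dot mu (ve j) (ve j) @[j --> \oo] --> K2 * dot mu v v by exact: cvgMr.
rewrite -[leRHS]addr0.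
exact: (ler_cvg_to c1 (cvgD (cvgD c2' c3'') c4) (nearW _ key)).
Qed.

(** As the level of the cutoffs tends to 0 and their radius to infinity, the bound tends to 0: the
    sublevel sets [A j] shrink to the complement of [U], where [v] is 0, so dominated convergence
    applies. On each [Q N] the cutoffs are eventually above a fixed positive number, hence [v] is
    null there, and these sets exhaust [U]. *)
Lemma kernel : exists2 lam, 0 < lam & forall v, l2 mu v -> (forall x, ~ U x -> v x = 0) ->
  (forall phi, tst U phi -> \int[mu]_x (v x * (dop cc phi x + lam * phi x)) = 0) ->
  dot mu v v = 0.
Proof.
have [K2 [K3 [K4 [kap [m [[K20 K30 K40 kap1 m0] heta]]]]]] := eta_exists.
pose K1 := q / b ^+ 2 * ((1 + t^-1) * M ^+ 2).
have K10 : 0 <= K1.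
  apply: mulr_ge0; first by rewrite divr_ge0// sqr_ge0.
  by apply: mulr_ge0; [rewrite addr_ge0// invr_ge0 ltW|exact: sqr_ge0].
exists (2 + K3 + K1); first by rewrite ltr_wpDr// ltr_wpDr.
move=> v lv v0 vorth.
have kap0 : 0 < kap by exact: lt_le_trans kap1.
(* With [r / 8] the requirement [kap * T j < r / 4] holds for every [j], the index 0 included. *)
pose T j : R := r / 8 / kap / j.+1%:R.
have kT j : kap * T j = r / 8 * j.+1%:R^-1.
  by rewrite /T; field; rewrite !lt0r_neq0// ltr0Sn.
have T0 j : 0 < T j by rewrite !divr_gt0.
have kT4 j : kap * T j < r / 4.
  rewrite kT; apply: (@le_lt_trans _ _ (r / 8)); last by have := r0; lra.
  by rewrite ler_piMr ?divr_ge0// invf_le1// ler1n.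
have /choice[eta he] := fun j : nat => heta (T j) j.+1%:R (T0 j) (kT4 j) (ltr0Sn R j).
pose A j := [set x | sr x <= kap * T j].
have mA j : measurable (A j) by exact: measurable_sublevel.
have bnd j : dot mu (fun x => eta j x * v x) (fun x => eta j x * v x) <=
   K4 * dot mu (fun x => \1_(A j) x * v x) (fun x => \1_(A j) x * v x)
   + K2 * dot mu v v * j.+1%:R^-1.
  have [h1 h2 h3 _] := he j.
  have k0 : 0 < T j / 2 by rewrite divr_gt0.
  apply: (le_trans (kernel_bound lv k0 h1 h2 (mA j) h3 (lexx _) vorth)).
  rewrite lerD2l mulrAC; apply: ler_wpM2l; first by rewrite mulr_ge0// dot_ge0.
  by rewrite lef_pV2 ?posrE ?exprn_gt0// expr2 ler_peMr// ler1n.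
have lI (B : set V) : measurable B -> l2 mu (fun x => \1_B x * v x).
  move=> mB; apply: (l2_le _ _ lv); first by apply: measurable_funM; [exact: measurable_indic|exact: lv.1].
  by move=> x; rewrite indicE; case: (_ \in _); rewrite ?mul1r// mul0r normr0.
have Isq (B : set V) x : `|(\1_B x * v x) ^+ 2| <= v x ^+ 2.
  by rewrite indicE; case: (_ \in _); rewrite ?mul1r ?mul0r ?expr0n ?normr0 ?sqr_ge0// ger0_norm ?sqr_ge0.
have rp4 : 0 < r / 4 by rewrite divr_gt0.
have near_small (y : R) : 0 < y -> \forall j \near \oo, j.+1%:R^-1 < y.
  by move=> y0; exact: (near_infty_natSinv_lt (PosNum y0)).
have c1 : dot mu (fun x => \1_(A j) x * v x) (fun x => \1_(A j) x * v x) @[j --> \oo] --> (0 : R).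
  under eq_fun do rewrite dot_sq; rewrite -(@Rint0 _ _ _ mu).
  apply: (@Rint_dctW _ _ _ mu (fun j x => (\1_(A j) x * v x) ^+ 2) (fun=> 0) (fun x => v x ^+ 2) _ _ lv.2 _).2.
  - by move=> j; apply: measurable_funX; exact: (lI _ (mA j)).1.
  - move=> x; apply: cvg_near_cst; have [Ux|Ux] := pselect (U x); last first.
      by apply: nearW => j; rewrite v0// mulr0 expr0n.
    have sx := dst_gt0 oU rp4 Ux.
    have y0 : 0 < sr x / (r / 8) by rewrite !divr_gt0.
    apply: filterS (near_small _ y0) => j; rewrite ltr_pdivlMr ?divr_gt0// mulrC -kT => h.
    by rewrite indicE memNset ?mul0r ?expr0n// /A /= ; apply/negP; rewrite -ltNge.
  - by move=> j x; exact: Isq.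
have c2 : K4 * dot mu (fun x => \1_(A j) x * v x) (fun x => \1_(A j) x * v x)
   + K2 * dot mu v v * j.+1%:R^-1 @[j --> \oo] --> (0 : R).
  rewrite -[X in _ --> X]addr0 -[X in _ --> X + _](mulr0 K4) -[X in _ --> _ + X](mulr0 (K2 * dot mu v v)).
  by apply: cvgD; apply: cvgMr => //; exact: cvg_harmonic0.
pose Q (N : nat) := [set x : V | cube 0 N%:R x /\ N.+1%:R^-1 <= sr x].
have mQ N : measurable (Q N).
  apply: (@measurableI _ _ (cube 0 N%:R) [set x | N.+1%:R^-1 <= sr x]); first exact: measurable_cube.
  apply: closed_measurable_rV; have := @closed_comp _ _ sr [set u | N.+1%:R^-1 <= u].
  by apply => [y _|]; [apply: continuous_dst; exact: ltW|exact: closed_ge].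
have Q0 N : dot mu (fun x => \1_(Q N) x * v x) (fun x => \1_(Q N) x * v x) = 0.
  pose g := m * (N.+1%:R^-1 / 2) `^ a.
  have N0 : 0 < N.+1%:R^-1 :> R by rewrite invr_gt0.
  have g0 : 0 < g by rewrite mulr_gt0// powR_gt0// divr_gt0.
  suff : g ^+ 2 * dot mu (fun x => \1_(Q N) x * v x) (fun x => \1_(Q N) x * v x) <= 0.
    move=> h; apply/eqP; rewrite eq_le dot_ge0 andbT.
    by rewrite -(pmulr_rle0 _ (exprn_gt0 2 g0)).
  apply: (cvgr_to_ge c2).
  have y0 : 0 < N.+1%:R^-1 / (r / 8) by rewrite !divr_gt0.
  (* [2 * N <= j] puts the cube of radius [N] inside the cube of radius [j.+1%:R / 2], where the
     bump is bounded below. *)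
  have h1 := near_small _ y0; have h2 : \forall j \near \oo, (2 * N <= j)%N by exact: nbhs_infty_ge.
  near=> j; apply: le_trans (bnd j).
  have [e1 e2 e3 e4] := he j.
  have le : l2 mu (fun x => eta j x * v x).
    have se : supp_cube (eta j) j.+1%:R by move=> x xn; apply: e2 => -[].
    have [B B0 hB] := continuous_bounded_cube e1.1 se.
    apply: (l2_le _ _ (l2Z B lv)).
      by apply: measurable_funM; [exact: continuous_measurable_rV e1.1|exact: lv.1].
    by move=> x; rewrite !normrM ler_wpM2r// (ger0_norm B0).
  rewrite !dot_sq -RintZ; last exact: (lI _ (mQ N)).2.
  apply: le_Rint; [exact: (intbleZ _ (lI _ (mQ N)).2)|exact: le.2|].
  move=> x; have [Qx|Qx] := pselect (Q N x); last first.
    by rewrite indicE memNset// mul0r expr0n mulr0 sqr_ge0.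
  have -> : \1_(Q N) x = 1 :> R by rewrite indicE mem_set.
  rewrite mul1r [leRHS]exprMn; apply: ler_wpM2r; first exact: sqr_ge0.
  case: Qx => xN xs.
  have kj : kap * T j < sr x.
    apply: lt_le_trans xs; rewrite kT mulrC -ltr_pdivlMr ?divr_gt0//.
    by near: j; exact: h1.
  have xj : cube 0 (j.+1%:R / 2) x.
    apply: (le_trans xN); rewrite ler_pdivlMr// mulrC -natrM ler_nat.
    by apply: leqW; near: j; exact: h2.
  apply: lerXn2r; rewrite ?nnegrE; [exact: ltW|apply: le_trans (e4 x xj kj)|].
    by rewrite mulr_ge0 ?powR_ge0// ltW.
  apply: le_trans (e4 x xj kj); rewrite /g ler_wpM2l ?(ltW m0)//.
  apply: ge0_ler_powR; rewrite ?nnegrE; [exact: ltW|by rewrite divr_ge0// ltW|by rewrite divr_ge0// dst_ge0// ltW|].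
  by rewrite ler_wpM2r.
have c3 : dot mu (fun x => \1_(Q N) x * v x) (fun x => \1_(Q N) x * v x) @[N --> \oo] --> dot mu v v.
  under eq_fun do rewrite dot_sq; rewrite dot_sq.
  apply: (@Rint_dctW _ _ _ mu (fun N x => (\1_(Q N) x * v x) ^+ 2) (fun x => v x ^+ 2) (fun x => v x ^+ 2) _ _ lv.2 _).2.
  - by move=> N; apply: measurable_funX; exact: (lI _ (mQ N)).1.
  - move=> x; apply: cvg_near_cst; have [Ux|Ux] := pselect (U x); last first.
      by apply: nearW => j; rewrite v0// mulr0.
    have sx := dst_gt0 oU rp4 Ux.
    have h1 := near_small _ sx; have h2 : \forall j \near \oo, `|x| <= j%:R :> R by exact: nbhs_infty_ger.
    near=> N; rewrite indicE mem_set ?mul1r//; split; first by rewrite /cube /= subr0; near: N; exact: h2.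
    by apply: ltW; near: N; exact: h1.
  - by move=> j x; exact: Isq.
apply: (cvg_unique (@Rhausdorff R) c3).
by apply: cvg_near_cst; apply: nearW => N; exact: Q0.
Unshelve. all: by end_near. Qed.

End kernel.

(** * From the hypotheses of the theorem to real inequalities with the truncated distance *)

Section hypotheses.
Variables (R : realType) (d : nat).
Local Notation V := 'rV[R]_d.
Local Notation mu := (rV_lebesgue R d).
Variable U : set V.
Hypothesis oU : open U.

Lemma bounded_lipschitz_global (f : V -> R) : bounded_lipschitz U f -> exists B L (g : V -> R),
  [/\ 0 <= B, 0 <= L, forall x, U x -> `|f x| <= B, forall x, U x -> g x = f x &
      forall x y, `|g y - g x| <= L * `|y - x|].
Proof.
move=> [/pinfty_ex_gt0[B B0 hB] /pinfty_ex_gt0[L L0 hL]].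
have lf x y : U x -> U y -> `|f y - f x| <= L * `|y - x|.
  by move=> Ux Uy; exact: (hL (y, x) (conj Uy Ux)).
have [g gf lg] := lipschitz_extension (ltW L0) lf.
by exists B, L, g; split => //; exact: ltW.
Qed.

Lemma normc_sqr (z : R[i]) : normc z ^+ 2 = complex.Re z ^+ 2 + complex.Im z ^+ 2.
Proof. by case: z => x y; rewrite /normc sqr_sqrtr// addr_ge0// sqr_ge0. Qed.

Lemma integral_indic (D : set V) (F G : V -> R) :
  (forall x, D x -> F x = G x) -> (forall x, ~ D x -> G x = 0) ->
  (\int[mu]_(x in D) (F x)%:E = \int[mu]_x (G x)%:E)%E.
Proof.
move=> FG G0; rewrite [LHS]integral_mkcond; apply: eq_integral => x _.
rewrite /patch; case: ifPn => [/set_mem Dx|/negP xD]; first by rewrite FG.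
by rewrite G0// => Dx; apply: xD; exact: mem_set.
Qed.

Lemma integral_EFin_setT (D : set V) (F G : V -> R) : intble mu G ->
  (forall x, D x -> F x = G x) -> (forall x, ~ D x -> G x = 0) ->
  (\int[mu]_(x in D) (F x)%:E)%E = (\int[mu]_x G x)%:E.
Proof. by move=> iG FG G0; rewrite -(intble_fin iG); exact: integral_indic. Qed.

(** Both Hardy weights become squares built from $s^a$, the form in which the cutoff estimates are
    stated. *)
Lemma powR_weights (delta s : R) : 0 < s ->
  s `^ delta = (s / s `^ ((2 - delta) / 2)) ^+ 2 /\
  s `^ (delta - 2) = (s `^ ((2 - delta) / 2))^-1 ^+ 2.
Proof.
move=> s0; set a := (2 - delta) / 2.
have z2 : (s `^ a) ^+ 2 = s `^ (2 - delta).
  by rewrite -powR_mulrn ?powR_ge0// -powRrM /a mulfVK.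
have E : s `^ (delta - 2) = (s `^ a)^-1 ^+ 2.
  by rewrite exprVn z2 -powRN opprB.
split => //; rewrite expr_div_n -exprVn -E -powR_mulrn ?ltW// -powRD; last by rewrite lt0r_neq0// implybT.
by congr (_ `^ _); ring.
Qed.

(** A function supported in the smaller collar is a test function for the larger one, so the
    constant [b] of [r1] serves every smaller [r]. On the compact support [K] the truncated distance
    is the true one and stays away from 0, which makes both integrals finite. *)
Lemma hardy_real (delta r r1 b : R) : 0 <= delta < 2 -> 0 < r <= 1 -> r <= r1 ->
  hardy U delta r1 b -> forall (f : V -> R) k n r', 0 < k -> r' < r -> Ck 1 f ->
  (forall x, ~ core U k n x -> f x = 0) -> (forall x, r' <= dst U r x -> f x = 0) ->
  let z x := dst U r x `^ ((2 - delta) / 2) in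
  [/\ intble mu (fun x => (f x / z x) ^+ 2),
      intble mu (fun x => (dst U r x / z x) ^+ 2 * \sum_i partial i f x ^+ 2) &
      b ^+ 2 * \int[mu]_x (f x / z x) ^+ 2 <=
      \int[mu]_x ((dst U r x / z x) ^+ 2 * \sum_i partial i f x ^+ 2)].
Proof.
move=> /andP[delta0 delta2] r01 rr1 hU f k n r' k0 r'r Cf f0 fr z.
have /andP[r0 r_le1] := r01; have r0' := ltW r0.
set a := (2 - delta) / 2 in z *.
have a0 : 0 < a by rewrite divr_gt0// subr_gt0.
have a1 : a <= 1 by rewrite ler_pdivrMr// mul1r lerBlDr lerDl.
have a01 : 0 < a <= 1 by rewrite a0.
pose s := dst U r; pose K := core U k n `&` [set x | s x <= r'].
have clK : closed K.
  apply: closedI; first exact: closed_core.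
  have := @closed_comp _ _ s [set u | u <= r'].
  by apply => [y _|]; [exact: continuous_dst|exact: closed_le].
have cpK : compact K.
  apply: (@subclosed_compact _ _ (core U k n)) => //; first exact: compact_core.
  by move=> x [].
have fK x : ~ K x -> f x = 0.
  move=> xK; have [xc|xc] := pselect (core U k n x); last exact: f0.
  by apply: fr; rewrite leNgt; apply/negP => h; apply: xK; split => //; exact: ltW.
have dfK i x : ~ K x -> partial i f x = 0 by exact: partial_off.
have KU : K `<=` U by move=> x [xc _]; exact: core_sub xc.
have Kcol x : K x -> collar U r x.
  move=> Kx; apply/(collarP _ oU r0' (lexx r)); split; first exact: KU.
  by case: Kx => _ h; exact: le_lt_trans h r'r.
have Kcol1 x : K x -> collar U r1 x.
  move=> /Kcol[Ux h]; split => //; apply: (lt_le_trans h).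
  by rewrite lee_fin.
have sK x : K x -> 0 < s x by move=> Kx; apply: dst_gt0 => //; exact: KU.
pose psi x : R[i] := Complex (f x) 0.
have psiK : [set x | psi x != 0] `<=` K.
  by move=> x; apply: contraPP => xK /=; rewrite /psi fK//; case/eqP.
have clpsi : closure [set x | psi x != 0] `<=` K.
  by move=> x h; apply: clK; apply: closure_subset h.
have Cpsi : Cck 1 (collar U r1) psi.
  split.
  - exact: Cf.
  - exact: (@Ck_cst R d 1 0).
  - by apply: (@subclosed_compact _ _ K) => //; exact: closed_closure.
  - by move=> x /clpsi; exact: Kcol1.
pose k' := Num.min r k; have k'0 : 0 < k' by rewrite lt_min r0.
have sk x : K x -> k' <= s x.
  move=> [[_ kx] _]; rewrite /s (@dst_min _ _ _ 1)// le_min /k' ge_min lexx /=.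
  by rewrite ge_min kx orbT.
have ms : measurable_fun setT s by apply: continuous_measurable_rV; exact: continuous_dst.
have mz : measurable_fun setT (fun x => (z x)^-1).
  rewrite (_ : (fun x => _) = (fun x => s x `^ (- a))).
    exact: (measurableT_comp (measurable_powR (- a)) ms).
  by apply/funext => x; rewrite powRN.
have sup f' : (forall x, ~ K x -> f' x = 0) -> supp_cube f' n.
  by move=> h x xn; apply: h => -[[]].
have [B B0 hB] := continuous_bounded_cube Cf.1 (sup _ fK).
have i1 : intble mu (fun x => (f x / z x) ^+ 2).
  apply: (@intble_bounded_cube _ _ _ ((B / k' `^ a) ^+ 2) n).
  - by apply: measurable_funX; apply: measurable_funM => //; exact: continuous_measurable_rV Cf.1.
  - move=> x; rewrite normrX; apply: lerXn2r; rewrite ?nnegrE ?divr_ge0 ?powR_ge0//.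
    have [Kx|Kx] := pselect (K x); last by rewrite fK// mul0r normr0 divr_ge0 ?powR_ge0.
    rewrite normrM normfV (ger0_norm (powR_ge0 _ _)); apply: ler_pM => //.
      by rewrite invr_ge0 powR_ge0.
    rewrite lef_pV2 ?posrE ?powR_gt0//; last exact: sK.
    apply: ge0_ler_powR; rewrite ?nnegrE; [exact: ltW|exact: ltW|exact/ltW/sK|exact: sk].
  - by apply: sup => x xK; rewrite fK// mul0r expr0n.
have cS : continuous (fun x => \sum_i partial i f x ^+ 2).
  apply: continuous_sum_rV => i; under eq_fun do rewrite expr2.
  by apply: continuousM_rV; exact: (Cf.2 i).2.
have SK x : ~ K x -> \sum_i partial i f x ^+ 2 = 0.
  by move=> xK; rewrite big1// => i _; rewrite dfK// expr0n.
have [B' B'0 hB'] := continuous_bounded_cube cS (sup _ SK).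
have i2 : intble mu (fun x => (s x / z x) ^+ 2 * \sum_i partial i f x ^+ 2).
  apply: (@intble_bounded_cube _ _ _ B' n).
  - apply: measurable_funM; last exact: continuous_measurable_rV cS.
    by apply: measurable_funX; exact: measurable_funM.
  - move=> x; rewrite normrM -[leRHS]mul1r; apply: ler_pM => //.
    have /andP[w0 w1] := weight_le1 U a01 r01 x.
    by rewrite ger0_norm ?sqr_ge0// -[leRHS](expr1n _ 2); apply: lerXn2r; rewrite ?nnegrE.
  - by apply: sup => x xK; rewrite SK// mulr0.
split => //; have := hU _ Cpsi.
have bE x p : K x -> bweight U p x = s x `^ p.
  by move=> Kx; rewrite /bweight (bdist_collar oU r0' (lexx r) (Kcol _ Kx)).
have nR (x y : R) : normc (Complex x y) ^+ 2 = x ^+ 2 + y ^+ 2 by exact: normc_sqr.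
have sqE x : sqgrad psi x = \sum_i partial i f x ^+ 2.
  apply: eq_bigr => i _; rewrite /cpartial nR.
  have -> : partial i (fun y => complex.Im (psi y)) x = 0 by have [] := @pderive_cst R d 0 i x.
  by rewrite expr0n addr0.
rewrite (integral_EFin_setT i1); first last.
- by move=> x xD; rewrite fK ?mul0r ?expr0n// => /Kcol1.
- move=> x _; have [Kx|Kx] := pselect (K x); last first.
    by rewrite /psi nR fK// mul0r expr0n /= addr0 mulr0.
  rewrite /psi nR expr0n addr0 bE// (powR_weights delta (sK _ Kx)).2 -/a.
  by rewrite -exprMn mulrC.
rewrite (integral_EFin_setT i2); first last.
- by move=> x xD; rewrite SK ?mulr0// => /Kcol1.
- move=> x _; rewrite sqE; have [Kx|Kx] := pselect (K x); last by rewrite SK// !mulr0.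
  by rewrite bE// (powR_weights delta (sK _ Kx)).1.
by rewrite -EFinM lee_fin.
Qed.

(** Rescaling to the unit ball; a crude bound by the sum of the entries shows that the set in
    [opnorm] is bounded, as [sup] demands. *)
Lemma enorm_opnorm (M : 'M[R]_d) (v : V) : enorm (v *m M^T) <= opnorm M * enorm v.
Proof.
have bnd (w : V) : enorm w <= 1 -> enorm (w *m M^T) <= d%:R * \sum_j \sum_k `|M j k|.
  move=> w1; apply: (le_trans (enorm_le_norm _)); rewrite ler_wpM2l//.
  apply/rV_norm_le => [|j]; first by apply: sumr_ge0 => j _; apply: sumr_ge0.
  rewrite mxE; apply: (le_trans (ler_norm_sum _ _ _)).
  apply: (@le_trans _ _ (\sum_k `|M j k|)).
    apply: ler_sum => k _; rewrite mxE normrM -[leRHS]mul1r; apply: ler_wpM2r => //.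
    exact: le_trans (enorm_coord w k) w1.
  by rewrite [leRHS](bigD1 j)//= lerDl; apply: sumr_ge0 => i _; exact: sumr_ge0.
have hub : has_ubound [set enorm (v *m M^T) | v in [set v : V | enorm v <= 1]].
  by exists (d%:R * \sum_j \sum_k `|M j k|) => _ [w w1 <-]; exact: bnd.
have [v0|v0] := eqVneq (enorm v) 0.
  have -> : v = 0.
    by apply/eqP; rewrite -normr_eq0 eq_le normr_ge0 andbT -v0 norm_le_enorm.
  by rewrite mul0mx enorm0 mulr0.
have vp : 0 < enorm v by rewrite lt_neqAle eq_sym v0 enorm_ge0.
rewrite -ler_pdivrMr//.
have -> : enorm (v *m M^T) / enorm v = enorm (((enorm v)^-1 *: v) *m M^T).
  by rewrite -scalemxAl enormZ gtr0_norm ?invr_gt0// mulrC.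
apply: ub_le_sup => //; exists ((enorm v)^-1 *: v) => //=.
by rewrite enormZ gtr0_norm ?invr_gt0// mulVf.
Qed.

Lemma qf_opnorm (M : 'M[R]_d) (u : 'I_d -> R) :
  `|qf (fun k l => M k l) u u| <= opnorm M * \sum_i u i ^+ 2.
Proof.
pose w : V := \row_i u i.
have wE i : w ord0 i = u i by rewrite mxE.
have e1 : \sum_i u i ^+ 2 = enorm w * enorm w.
  by rewrite -expr2 enorm_sqr; apply: eq_bigr => i _; rewrite wE.
have e2 : qf (fun k l => M k l) u u = \sum_i w ord0 i * (w *m M^T) ord0 i.
  apply: eq_bigr => k _; rewrite [(w *m _) _ _]mxE mulr_sumr; apply: eq_bigr => l _.
  by rewrite !wE [M^T _ _]mxE; ring.
rewrite e1 mulrA.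
have h := enorm_opnorm M w.
have h1 := enorm_CS w (w *m M^T).
have h2 := enorm_CS w (- (w *m M^T)).
have h3 : enorm w * enorm (w *m M^T) <= opnorm M * enorm w * enorm w.
  by rewrite mulrC ler_wpM2r ?enorm_ge0.
rewrite enormN in h2.
have e3 : \sum_i w ord0 i * (- (w *m M^T)) ord0 i = - qf (fun k l => M k l) u u.
  by rewrite e2 -sumrN; apply: eq_bigr => i _; rewrite -mulrN; congr (_ * _); rewrite mxE.
rewrite e3 in h2; rewrite -e2 in h1.
rewrite ler_norml; apply/andP; split; lra.
Qed.

Lemma qf_scalar_sub (M : 'M[R]_d) (w e : R) (u : 'I_d -> R) :
  qf (fun k l => (w *: M - e%:M) k l) u u = w * qf (fun k l => M k l) u u - e * \sum_i u i ^+ 2.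
Proof.
rewrite /qf !mulr_sumr -sumrB; apply: eq_bigr => k _.
rewrite mulr_sumr (bigD1 k)//= [X in _ = X - _](bigD1 k)//= !mxE eqxx mulr1n.
rewrite addrAC; congr (_ + _); first by ring.
apply: eq_bigr => l lk; have kl : (k == l) = false by rewrite eq_sym; exact/negbTE.
by rewrite !mxE kl mulr0n subr0 -mulrA.
Qed.

Lemma boundary_condition_le C (c : V -> R) (delta r0 tau : R) : 0 < tau ->
  boundary_condition U C c delta r0 -> exists2 r : R, 0 < r <= r0 &
  forall x, collar U r x -> opnorm (bweight U (- delta) x *: C x - (c x)%:M) <= tau.
Proof.
move=> tau0 hb.
move: hb; rewrite /boundary_condition; set X := (X in ereal_inf X) => hb.
have : (ereal_inf X < tau%:E)%E by rewrite hb lte_fin.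
move=> /ereal_inf_lt[_ [r r0r <-] h]; exists r => // x xr.
rewrite -lee_fin; apply: (le_trans _ (ltW h)); apply: ereal_sup_ubound; right.
by exists x.
Qed.

(** The operator norm controls the quadratic form of the difference, and [tau <= t * c] turns the
    absolute error into a relative one. *)
Lemma boundary_comparison (C : 'M[R]_d) (c t tau delta s w : R) (u : 'I_d -> R) :
  0 < s -> tau <= t * c -> w = (s / s `^ ((2 - delta) / 2)) ^+ 2 ->
  opnorm (s `^ (- delta) *: C - c%:M) <= tau ->
  (1 - t) * c * w * \sum_i u i ^+ 2 <= qf (fun k l => C k l) u u <=
  (1 + t) * c * w * \sum_i u i ^+ 2.
Proof.
move=> s0 tauc wE hop; rewrite -(powR_weights delta s0).1 in wE; rewrite powRN -wE in hop.
have w0 : 0 < w by rewrite wE powR_gt0.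
have := qf_opnorm (w^-1 *: C - c%:M) u; rewrite qf_scalar_sub.
set S := \sum_i u i ^+ 2; set Q := qf _ _ _ => h.
have S0 : 0 <= S by apply: sumr_ge0 => i _; exact: sqr_ge0.
have {}h : `|w^-1 * Q - c * S| <= t * c * S.
  apply: (le_trans h); apply: ler_wpM2r => //; exact: le_trans hop tauc.
have -> : Q = w * (w^-1 * Q) by rewrite mulrA mulfV ?mul1r// lt0r_neq0.
have -> (e : R) : e * c * w * S = w * (e * c * S) by ring.
have -> (e : R) : e * c * w * S = w * (e * c * S) by ring.
by rewrite !ler_pM2l//; move: h; rewrite ler_norml => /andP[h1 h2]; apply/andP; split; lra.
Qed.

End hypotheses.

(** * Choice of the parameters *)

Section main_kernel.
Variables (R : realType) (d : nat).
Local Notation V := 'rV[R]_d.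
Local Notation mu := (rV_lebesgue R d).

(** Bernoulli's inequality gives $(1-t)^7 \ge 1-7t$, and on the unit interval $(1+t)^6 \le
    1+(2^6-1)t$. The chosen [t] solves $a^2(1+63t) = b^2(1-7t)$. *)
Lemma exists_gap (a b : R) : 0 < a -> a < b -> exists2 t, 0 < t < 1 &
  a ^+ 2 * (1 + t) ^+ 6 <= (1 - t) ^+ 7 * b ^+ 2.
Proof.
move=> a0 ab; have b0 := lt_trans a0 ab.
have aa : 0 < a ^+ 2 by rewrite exprn_gt0.
have bb : a ^+ 2 < b ^+ 2 by rewrite ltr_pXn2r ?nnegrE ?ltW.
set A := a ^+ 2 in aa bb *; set B := b ^+ 2 in bb *.
pose t := (B - A) / (63 * A + 7 * B).
have D0 : 0 < 63 * A + 7 * B by lra.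
have t0 : 0 < t by rewrite divr_gt0// subr_gt0.
have t1 : t < 1 by rewrite ltr_pdivrMr// mul1r; lra.
have h1 n : 1 - n%:R * t <= (1 - t) ^+ n.
  elim: n => [|n IH]; first by rewrite mul0r subr0 expr0.
  rewrite exprS; have := ler_wpM2l (ltW (ltac:(by rewrite subr_gt0) : 0 < 1 - t)) IH.
  apply: le_trans; rewrite -natr1.
  have : 0 <= n%:R * (t * t) by rewrite mulr_ge0// mulr_ge0// ltW.
  lra.
have h2 n : (1 + t) ^+ n <= 1 + (2 ^+ n - 1) * t.
  elim: n => [|n IH]; first by rewrite !expr0 subrr mul0r addr0.
  have t10 : 0 <= 1 + t by rewrite addr_ge0// ltW.
  rewrite exprS; apply: (le_trans (ler_wpM2l t10 IH)).
  have p0 : 0 <= 2 ^+ n - 1 :> R by rewrite subr_ge0 exprn_ege1// ler1n.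
  have : (2 ^+ n - 1) * (t * t) <= (2 ^+ n - 1) * (t * 1).
    by rewrite ler_wpM2l// ler_pM2l// ltW.
  rewrite exprS; lra.
exists t; first by rewrite t0.
apply: (@le_trans _ _ (A * (1 + (2 ^+ 6 - 1) * t))); first by rewrite ler_wpM2l// ltW.
apply: (@le_trans _ _ ((1 - 7%:R * t) * B)); last by rewrite ler_wpM2r// ltW// (lt_trans aa).
have tE : t * (63 * A + 7 * B) = B - A by rewrite /t mulfVK// lt0r_neq0.
lra.
Qed.

(** Applied to the extension of [c], it makes the bounds valid on the collar hold everywhere,
    without changing the values there or the Lipschitz constant. *)
Definition clamp (m M u : R) : R := Num.max m (Num.min M u).

Lemma clamp_lipschitz m M u v : m <= M -> `|clamp m M v - clamp m M u| <= `|v - u|.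
Proof.
move=> mM; have key x y : x <= y -> clamp m M y - clamp m M x <= y - x /\ clamp m M x <= clamp m M y.
  by rewrite /clamp => xy; have [a1|a1] := leP M x; have [b1|b1] := leP M y;
    have [a2|a2] := leP m x; have [b2|b2] := leP m y; rewrite ?(max_r mM); split; lra.
have [uv|vu] := leP u v.
  by have [h1 h2] := key _ _ uv; rewrite !ger0_norm ?subr_ge0.
by have [h1 h2] := key _ _ (ltW vu); rewrite distrC (distrC v) !ger0_norm ?subr_ge0// ltW.
Qed.

Lemma clamp_itv m M u : m <= M -> m <= clamp m M u <= M.
Proof. by move=> mM; rewrite /clamp le_max lexx /= ge_max mM ge_min lexx. Qed.

Lemma clamp_id m M u : m <= u <= M -> clamp m M u = u.
Proof. by move=> /andP[mu_ uM]; rewrite /clamp min_r// max_r. Qed.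

Variables (U : set V) (C : V -> 'M[R]_d).
Hypothesis oU : open U.
Hypothesis C_sym : forall x, U x -> (C x)^T = C x.
Hypothesis C_lip : forall k l, bounded_lipschitz U (fun x => C x k l).
Hypothesis C_pos : forall x, U x -> posdef (C x).

Lemma coefficient_extension : exists cc L Bc, [/\
  forall k l x y, `|cc k l y - cc k l x| <= L * `|y - x|,
  forall k l x, U x -> cc k l x = C x k l & forall x, U x -> forall k l, `|cc k l x| <= Bc].
Proof.
have /choice[g hg] : forall p : 'I_d * 'I_d, exists g : V -> R, exists BL : R * R,
    [/\ 0 <= BL.1, 0 <= BL.2, forall x, U x -> `|C x p.1 p.2| <= BL.1,
     forall x, U x -> g x = C x p.1 p.2 & forall x y, `|g y - g x| <= BL.2 * `|y - x|].
  by move=> p; have [B [L [g h]]] := bounded_lipschitz_global (C_lip p.1 p.2); exists g, (B, L).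
have {hg} /choice[BL hg] := hg.
exists (fun k l => g (k, l)), (\sum_p (BL p).2), (\sum_p (BL p).1); split.
- move=> k l x y; have [_ _ _ _ h] := hg (k, l); apply: (le_trans (h x y)).
  rewrite ler_wpM2r// (bigD1 (k, l))//= lerDl sumr_ge0// => p _.
  by have [] := hg p.
- by move=> k l x Ux; have [_ _ _ h _] := hg (k, l); exact: h.
- move=> x Ux k l; have [_ _ h1 h2 _] := hg (k, l); rewrite h2//; apply: (le_trans (h1 x Ux)).
  by rewrite (bigD1 (k, l))//= lerDl sumr_ge0// => p _; have [] := hg p.
Qed.

Lemma qf_posdef (M : 'M[R]_d) (u : V) : posdef M -> u != 0 ->
  0 < qf (fun k l => M k l) (fun i => u ord0 i) (fun i => u ord0 i).
Proof.
move=> hM u0; have := hM u u0; rewrite mxE.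
suff -> : \sum_j (u *m M) ord0 j * (u^T) j ord0 =
  qf (fun k l => M k l) (fun i => u ord0 i) (fun i => u ord0 i) by [].
rewrite /qf exchange_big; apply: eq_bigr => l _ /=.
rewrite [(u *m M) _ _]mxE mulr_suml; apply: eq_bigr => k _.
by rewrite [u^T _ _]mxE; ring.
Qed.

Lemma kernel_main (c : V -> R) (delta r0 L : R) (cc : 'I_d -> 'I_d -> V -> R) Bc :
  (forall k l x y, `|cc k l y - cc k l x| <= L * `|y - x|) ->
  (forall k l x, U x -> cc k l x = C x k l) ->
  (forall x, U x -> forall k l, `|cc k l x| <= Bc) ->
  0 <= delta < 2 -> 0 < r0 -> bounded_lipschitz U c ->
  (0 < ereal_inf [set (c x)%:E | x in collar U r0])%E ->
  boundary_condition U C c delta r0 ->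
  (((2 - delta) / 2)%:E < hardy_constant U delta r0)%E ->
  exists2 lam, 0 < lam & forall v, l2 mu v -> (forall x, ~ U x -> v x = 0) ->
  (forall phi, tst U phi -> \int[mu]_x (v x * (dop cc phi x + lam * phi x)) = 0) ->
  dot mu v v = 0.
Proof.
move=> lcc ccC ccB delta02 r00 c_lip c_pos C_bnd hH.
have /andP[delta0 delta2] := delta02.
set a := (2 - delta) / 2 in hH.
have a0 : 0 < a by rewrite divr_gt0// subr_gt0.
have a1 : a <= 1 by rewrite ler_pdivrMr// mul1r lerBlDr lerDl.
have a01 : 0 < a <= 1 by rewrite a0.
move: hH => /ereal_sup_gt[_ [b [b0 [rH /andP[rH0 rHr0] hardyb]] <-]]; rewrite lte_fin => ab.
have [t t01 qp] := exists_gap a0 ab; have /andP[tp t1] := t01.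
have [c0 c00 hc0] : exists2 c0, 0 < c0 & forall x, collar U r0 x -> c0 <= c x.
  pose m := Order.min (ereal_inf [set (c x)%:E | x in collar U r0]) 1%E.
  have m0 : (0 < m)%E by rewrite lt_min c_pos lte_fin ltr01.
  have m1 : (m <= 1)%E by rewrite ge_min lexx orbT.
  have mE : m = (fine m)%:E.
    by rewrite fineK// ge0_fin_numE ?(ltW m0)// (le_lt_trans m1)// ltry.
  exists (fine m); first by rewrite -lte_fin -mE.
  move=> x xr; rewrite -lee_fin -mE ge_min; apply/orP; left.
  by apply: ereal_inf_lbound; exists x.
have tc0 : 0 < t * c0 by rewrite mulr_gt0.
have [r2 /andP[r20 r2r0] hr2] := boundary_condition_le tc0 C_bnd.
(* Below [rH] the Hardy inequality is available, below [r2] the form is within the relative error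
   [t] of $c d^\delta$, and [r <= 1] keeps the weight $s/s^a$ at most 1. *)
pose r := Num.min 1 (Num.min rH r2).
have r0' : 0 < r by rewrite !lt_min ltr01 rH0.
have r1 : r <= 1 by rewrite ge_min lexx.
have rrH : r <= rH by rewrite !ge_min lexx orbT.
have rr2 : r <= r2 by rewrite !ge_min lexx !orbT.
have r01 : 0 < r <= 1 by rewrite r0'.
have [B [Lc [g [B0 Lc0 cB gc lg]]]] := bounded_lipschitz_global c_lip.
pose Bs := c0 + B; have c0B : c0 <= Bs by rewrite lerDl.
pose cs x := clamp c0 Bs (g x).
have cs_lip x y : `|cs y - cs x| <= Lc * `|y - x|.
  exact: le_trans (clamp_lipschitz _ _ c0B) (lg x y).
have cs_itv x : c0 <= cs x <= Bs by exact: clamp_itv.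
have ccS x : U x -> forall k l, cc k l x = cc l k x.
  by move=> Ux k l; rewrite !ccC// -{1}(C_sym Ux) mxE.
have qfE x : U x -> (fun k l => cc k l x) = (fun k l => C x k l).
  by move=> Ux; apply/funext => k; apply/funext => l; exact: ccC.
have ccP x : U x -> forall u : V, u != 0 ->
  0 < qf (fun k l => cc k l x) (fun i => u ord0 i) (fun i => u ord0 i).
  by move=> Ux u u0; rewrite (qfE x Ux); apply: qf_posdef => //; exact: C_pos.
pose s := dst U r.
have cmp x (u : 'I_d -> R) : U x -> s x < r ->
   (1 - t) * cs x * (s x / s x `^ a) ^+ 2 * \sum_i u i ^+ 2 <= qf (fun k l => cc k l x) u u <=
   (1 + t) * cs x * (s x / s x `^ a) ^+ 2 * \sum_i u i ^+ 2.
  move=> Ux sx; have xr : collar U r x by apply/(collarP x oU (ltW r0') (lexx r)).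
  have xr2 : collar U r2 x by case: xr => _ h; split => //; apply: (lt_le_trans h); rewrite lee_fin.
  have xr0 : collar U r0 x by case: xr2 => _ h; split => //; apply: (lt_le_trans h); rewrite lee_fin.
  have csc : cs x = c x.
    rewrite /cs gc// clamp_id// hc0//=; apply: (le_trans (ler_norm _)).
    by apply: (le_trans (cB x Ux)); rewrite lerDr ltW.
  rewrite (qfE x Ux) csc; apply: (@boundary_comparison _ _ (C x) (c x) t (t * c0) delta (s x)) => //.
  - exact: dst_gt0.
  - by rewrite ler_wpM2l ?(ltW tp)// hc0.
  - by have := hr2 x xr2; rewrite /bweight (bdist_collar oU (ltW r0') (lexx r) xr).
have HR := hardy_real oU delta02 r01 rrH hardyb.
have [th [M [[M0 Cth] th1 th2 th3 th4]]] := theta_exists U t01 r01 c00 cs_lip cs_itv.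
exact: (kernel oU lcc ccS ccP ccB a01 t01 r01 b0 c00 cs_itv cmp HR M0 Cth th1 th2 th3 th4 qp).
Qed.

End main_kernel.

(** * The closure of the operator *)

Section realop.
Variables (R : realType) (d : nat).
Local Notation V := 'rV[R]_d.
Local Notation mu := (rV_lebesgue R d).
Local Notation e_ i := (delta_mx ord0 i : V).

Lemma l2_sum (I : finType) (F : I -> V -> R) :
  (forall i, l2 mu (F i)) -> l2 mu (fun x => \sum_i F i x).
Proof.
move=> lF; rewrite (_ : (fun x => _) = (fun x => \sum_(i <- index_enum I) F i x))//.
elim: (index_enum I) => [|i s IH].
  under eq_fun do rewrite big_nil.
  by split; [exact: measurable_cst|under eq_fun do rewrite expr0n; exact: intble0].
by under eq_fun do rewrite big_cons; exact: l2D.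
Qed.

Lemma l2_bounded_cube (f : V -> R) (B r : R) : measurable_fun setT f -> (forall x, `|f x| <= B) ->
  supp_cube f r -> l2 mu f.
Proof.
move=> mf fB f0; split => //; apply: (@intble_bounded_cube _ _ _ (B ^+ 2) r).
- exact: measurable_funX.
- by move=> x; rewrite normrX; apply: lerXn2r; rewrite ?nnegrE// (le_trans _ (fB x)).
- by move=> x xr; rewrite f0// expr0n.
Qed.

Lemma dot_cvgr (b : nat -> V -> R) (a v : V -> R) : l2 mu a -> l2 mu v -> (forall n, l2 mu (b n)) ->
  dot mu (fun x => b n x - v x) (fun x => b n x - v x) @[n --> \oo] --> (0 : R) ->
  dot mu a (b n) @[n --> \oo] --> dot mu a v.
Proof.
move=> la lv lb h.
have lbv n : l2 mu (fun x => b n x - v x) by exact: l2B.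
have h1 := dot_cvg0 la lbv h.
have h2 : dot mu a (fun x => b n x - v x) + dot mu a v @[n --> \oo] --> 0 + dot mu a v.
  by apply: cvgD => //; exact: cvg_cst.
rewrite add0r in h2; apply: cvg_trans h2; apply: near_eq_cvg; apply: nearW => n.
by rewrite dotBr// subrK.
Qed.

Lemma dot_restrict_le (f : V -> R) (A : set V) : measurable A -> l2 mu f ->
  l2 mu (fun x => \1_A x * f x) /\
  dot mu (fun x => \1_A x * f x) (fun x => \1_A x * f x) <= dot mu f f.
Proof.
move=> mA lf; have lI : l2 mu (fun x => \1_A x * f x).
  apply: (l2_le _ _ lf); first by apply: measurable_funM; [exact: measurable_indic|exact: lf.1].
  by move=> x; rewrite indicE; case: (_ \in _); rewrite ?mul1r// mul0r normr0.
split => //; rewrite !dot_sq; apply: le_Rint; [exact: lI.2|exact: lf.2|].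
by move=> x; rewrite indicE; case: (_ \in _); rewrite ?mul1r// mul0r expr0n sqr_ge0.
Qed.

Variables (U : set V) (cc : 'I_d -> 'I_d -> V -> R) (L : R).
Hypothesis oU : open U.
Hypothesis lcc : forall k l x y, `|cc k l y - cc k l x| <= L * `|y - x|.
Hypothesis ccS : forall x, U x -> forall k l, cc k l x = cc l k x.
Hypothesis ccP : forall x, U x -> forall u : V, u != 0 ->
  0 < qf (fun k l => cc k l x) (fun i => u ord0 i) (fun i => u ord0 i).
Local Notation c x := (fun k l => cc k l x).
Local Notation T := (dop cc).
Implicit Types (phi psi v g f : V -> R).

Lemma tst_supp phi : tst U phi -> exists n, supp_cube phi n.
Proof. by move=> [_ [k [n [_ h]]]]; exists n => x xn; apply: h => -[]. Qed.

Lemma tst_off phi x : tst U phi -> ~ U x ->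
  [/\ phi x = 0, forall i, partial i phi x = 0 & T phi x = 0].
Proof.
move=> [_ [k [n [k0 h]]]] Ux; have xK : ~ core U k n x by move=> /(core_sub k0).
have p1 i y : ~ core U k n y -> partial i phi y = 0.
  by apply: partial_off => //; exact: closed_core.
have p2 i j y : ~ core U k n y -> partial i (partial j phi) y = 0.
  by apply: partial_off => [|z]; [exact: closed_core|exact: p1].
split; [exact: h|by move=> i; exact: p1|].
rewrite /dop big1 ?oppr0// => i _; rewrite big1// => j _.
by rewrite p1// p2// !mulr0 addr0.
Qed.

Lemma tst0 : tst U (fun=> 0).
Proof. by split; [move=> n; exact: Ck_cst|exists 1, 1]. Qed.

Lemma tstD phi psi (b : R) : tst U phi -> tst U psi -> tst U (fun x => phi x + b * psi x).
Proof.
move=> [C1 [k1 [n1 [k10 h1]]]] [C2 [k2 [n2 [k20 h2]]]]; split.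
  by move=> n; apply: CkD; [exact: C1|apply: CkZ; exact: C2].
exists (Num.min k1 k2), (Num.max n1 n2); split; first by rewrite lt_min k10.
move=> x xK; rewrite h1 ?h2 ?mulr0 ?addr0//; move=> -[a1 a2]; apply: xK; split.
- by rewrite /cube /= le_max; apply/orP; right.
- by rewrite ge_min a2 orbT.
- by rewrite /cube /= le_max; apply/orP; left.
- by rewrite ge_min a2.
Qed.

Lemma tst_l2 phi : tst U phi -> l2 mu phi.
Proof. by move=> tp; have [n hn] := tst_supp tp; apply: l2_csupp hn; have := tp.1 0%N. Qed.

Lemma dopD phi psi (b : R) x : tst U phi -> tst U psi ->
  T (fun x => phi x + b * psi x) x = T phi x + b * T psi x.
Proof.
move=> [C1 _] [C2 _].
have p1 i y : partial i (fun x => phi x + b * psi x) y = partial i phi y + b * partial i psi y.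
  have h := pderive_scale b (((C2 1%N).2 i).1 y).
  by rewrite (pderive_add (((C1 1%N).2 i).1 y) h.1).2 h.2.
have p2 i j y : partial i (partial j (fun x => phi x + b * psi x)) y =
    partial i (partial j phi) y + b * partial i (partial j psi) y.
  rewrite (funext (p1 j)).
  have h := pderive_scale b ((((C2 2%N).2 j).2.2 i).1 y).
  by rewrite (pderive_add ((((C1 2%N).2 j).2.2 i).1 y) h.1).2 h.2.
rewrite /dop mulrN -opprD; congr (- _); rewrite mulr_sumr -big_split; apply: eq_bigr => i _ /=.
have lin (A B p q P Q : R) : A * (p + b * q) + B * (P + b * Q) = (A * p + B * P) + b * (A * q + B * Q).
  by ring.
by rewrite mulr_sumr -big_split; apply: eq_bigr => j _; rewrite p1 p2; exact: lin.
Qed.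

Lemma dop0 x : T (fun=> 0) x = 0.
Proof.
have p0 i : partial i (fun _ : V => 0 : R) = fun=> 0.
  by apply/funext => y; have [] := @pderive_cst R d 0 i y.
by rewrite /dop big1 ?oppr0// => i _; rewrite big1// => j _; rewrite !p0 !mulr0 addr0.
Qed.

Lemma dop_terms phi k l : tst U phi ->
  l2 mu (fun x => aederive (cc k l) (e_ k) x * partial l phi x) /\
  l2 mu (fun x => cc k l x * partial k (partial l phi) x).
Proof.
move=> tp; have [n hn] := tst_supp tp; have sl := supp_cube_partial l hn.
have Cl := ((tp.1 2%N).2 l).2.
have [B B0 hB] := continuous_bounded_cube Cl.1 sl.
split.
  apply: (@l2_bounded_cube _ (L * `|e_ k| * B) n).
  - apply: measurable_funM; first exact: measurable_aederive (e_ k) (lcc k l).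
    exact: continuous_measurable_rV Cl.1.
  - by move=> x; rewrite normrM; apply: ler_pM => //; exact: norm_aederive.
  - by move=> x xn; rewrite sl// mulr0.
apply: (@l2_csupp _ _ _ n).
  by apply: continuousM_rV; [exact: (continuous_cc lcc)|exact: (Cl.2 k).2].
by move=> x xn; rewrite (supp_cube_partial k sl)// mulr0.
Qed.

Lemma dop_l2 phi : tst U phi -> l2 mu (T phi).
Proof.
move=> tp; apply: l2N; apply: l2_sum => k; apply: l2_sum => l.
by have [h1 h2] := dop_terms k l tp; exact: l2D.
Qed.

Lemma dop_form phi psi : tst U phi -> tst U psi ->
  dot mu (T phi) psi = \int[mu]_x qf (c x) (grad psi x) (grad phi x).
Proof.
move=> tp tq; have [n hn] := tst_supp tp; have [m hm] := tst_supp tq.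
have Cq := tq.1 1%N.
pose F l x := partial l phi x * psi x.
have CF l : Ck 1 (F l) by apply: CkM => //; exact: ((tp.1 2%N).2 l).2.
have sF l : supp_cube (F l) m by move=> x xm; rewrite /F hm// mulr0.
have ibp k l := lipschitz_ibp k (lcc k l) (CF l) (sF l).
pose G k l x := cc k l x * (partial k psi x * partial l phi x).
have iG k l : intble mu (G k l).
  apply: (@intble_csupp _ _ _ n).
    apply: continuousM_rV; first exact: (continuous_cc lcc).
    by apply: continuousM_rV; [exact: (Cq.2 k).2|exact: ((tp.1 1%N).2 l).2].
  by move=> x xn; rewrite /G (supp_cube_partial l hn)// !mulr0.
pose H k l x := aederive (cc k l) (e_ k) x * F l x + cc k l x * partial k (F l) x - G k l x.
have iH k l : intble mu (H k l) by have [h1 h2 _] := ibp k l; apply: intbleB => //; exact: intbleD.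
have H0 k l : \int[mu]_x H k l x = - \int[mu]_x G k l x.
  have [h1 h2 h3] := ibp k l.
  by rewrite (RintB (intbleD h1 h2) (iG k l)) (RintD h1 h2) h3 addNr sub0r.
have dsum (P : 'I_d -> 'I_d -> V -> R) : (forall k l, intble mu (P k l)) ->
    \int[mu]_x (\sum_k \sum_l P k l x) = \sum_k \sum_l \int[mu]_x P k l x.
  move=> iP; rewrite Rint_sum => [|k]; last exact: intble_sum.
  by apply: eq_bigr => k _; rewrite Rint_sum.
have iHs : intble mu (fun x => \sum_k \sum_l H k l x).
  by apply: intble_sum => k; apply: intble_sum.
have e1 : (fun x => T phi x * psi x) = (fun x => - \sum_k \sum_l H k l x).
  apply/funext => x; rewrite /dop mulNr mulr_suml; congr (- _); apply: eq_bigr => k _.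
  rewrite mulr_suml; apply: eq_bigr => l _; rewrite /H /G /F.
  have -> : partial k (fun x => partial l phi x * psi x) x =
      partial l phi x * partial k psi x + psi x * partial k (partial l phi) x.
    by have [_] := pderive_mul ((((tp.1 2%N).2 l).2.2 k).1 x) ((Cq.2 k).1 x).
  ring.
rewrite /dot e1 (RintN iHs) (dsum _ iH) -sumrN [RHS](dsum _ iG); apply: eq_bigr => k _.
by rewrite -sumrN; apply: eq_bigr => l _; rewrite H0 opprK.
Qed.

Lemma dop_sym phi psi : tst U phi -> tst U psi -> dot mu (T phi) psi = dot mu phi (T psi).
Proof.
move=> tp tq; apply: (etrans (dop_form tp tq)); rewrite (dotC mu phi); apply/esym.
apply: (etrans (dop_form tq tp)); apply: eq_Rintegral => x _.
have [Ux|Ux] := pselect (U x); first by apply: qf_sym; exact: (ccS Ux).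
have [_ h1 _] := tst_off tp Ux; have [_ h2 _] := tst_off tq Ux.
by rewrite /qf !big1// => k _; rewrite big1// => l _; rewrite /grad h1 h2 mulr0 mulr0.
Qed.

Lemma dop_ge0 phi : tst U phi -> 0 <= dot mu (T phi) phi.
Proof.
move=> tp; rewrite dop_form//; apply: Rint_ge0 => x.
have [Ux|Ux] := pselect (U x); first exact: (qf_ge0 ccP).
by have [_ h1 _] := tst_off tp Ux; rewrite qf0.
Qed.

(** Restriction to a large core, then mollification at a scale that keeps the support inside [U].
    Each error is at most [eps / 4], and [dot_le2] doubles their sum. *)
Lemma tst_dense v : l2 mu v -> (forall x, ~ U x -> v x = 0) -> forall eps, 0 < eps ->
  exists2 phi, tst U phi & dot mu (fun x => phi x - v x) (fun x => phi x - v x) <= eps.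
Proof.
move=> lv v0 eps eps0; pose K (N : nat) := core U N.+1%:R^-1 N%:R.
have mK N : measurable (K N) by apply: closed_measurable_rV; exact: closed_core.
pose w N x := \1_(K N) x * v x.
have lw N : l2 mu (w N) by exact: (dot_restrict_le (mK N) lv).1.
have c1 : dot mu (fun x => w N x - v x) (fun x => w N x - v x) @[N --> \oo] --> (0 : R).
  under eq_fun do rewrite dot_sq; rewrite -(@Rint0 _ _ _ mu).
  apply: (@Rint_dctW _ _ _ mu (fun N x => (w N x - v x) ^+ 2) (fun=> 0) (fun x => v x ^+ 2) _ _ lv.2 _).2.
  - by move=> N; apply: measurable_funX; exact: (l2B (lw N) lv).1.
  - move=> x; apply: cvg_near_cst; have [Ux|Ux] := pselect (U x); last first.
      by apply: nearW => N; rewrite /w v0// mulr0 subrr expr0n.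
    have sx := dst_gt0 oU ltr01 Ux.
    have h1 := near_infty_natSinv_lt (PosNum sx).
    have h2 : \forall j \near \oo, `|x| <= j%:R :> R by exact: nbhs_infty_ger.
    near=> N; rewrite /w indicE mem_set ?mul1r ?subrr ?expr0n//.
    split; first by rewrite /cube /= subr0; near: N; exact: h2.
    by apply: ltW; near: N; exact: h1.
  - move=> N x; rewrite /w indicE; case: (_ \in _); rewrite ?mul1r ?mul0r ?subrr ?expr0n ?normr0 ?sqr_ge0//.
    by rewrite sub0r sqrrN ger0_norm ?sqr_ge0.
have e4 : 0 < eps / 4 by rewrite divr_gt0.
have [N hN] : exists N, dot mu (fun x => w N x - v x) (fun x => w N x - v x) <= eps / 4.
  have /cvgrPdist_le/(_ _ e4)[N _ h] := c1; exists N.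
  by apply: le_trans (h N (leqnn N)); rewrite sub0r normrN ler_norm.
have [KM KM0 hKM] := conv_moll_l2 R d.
have e5 : 0 < eps / 4 / (KM + 1) by rewrite divr_gt0// ltr_wpDl.
have [r r0 hr] := kavg_cvg0 (lw N) e5.
have D0 : 0 < d%:R + 1 :> R by rewrite ltr_wpDl.
pose e := Num.min (r / 2) (N.+1%:R^-1 / 2 / (d%:R + 1)).
have e0 : 0 < e by rewrite lt_min !divr_gt0// invr_gt0.
have er : 0 < e < r.
  rewrite e0 /=; apply: (@le_lt_trans _ _ (r / 2)); first by rewrite ge_min lexx.
  by rewrite ltr_pdivrMr//; lra.
have [lk hk] := hr e er.
have [ld hd] := hKM e _ e0 (lw N) lk.
exists (conv (moll e) (w N)).
  apply: (@conv_moll_tst _ _ U (N.+1%:R^-1) N%:R) => //.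
  - have : e <= N.+1%:R^-1 / 2 / (d%:R + 1) by rewrite ge_min lexx orbT.
    rewrite ler_pdivlMr// mulrDr mulr1 => h.
    have : 0 < N.+1%:R^-1 :> R by rewrite invr_gt0.
    by rewrite mulrC in h; move: h; set q := N.+1%:R^-1; have := e0; lra.
  - exact: l2_locint.
  - by move=> y yK; rewrite /w indicE memNset// mul0r.
have -> : (fun x => conv (moll e) (w N) x - v x) =
   (fun x => (conv (moll e) (w N) x - w N x) + (w N x - v x)).
  by apply/funext => x; rewrite addrA subrK.
apply: (le_trans (dot_le2 ld (l2B (lw N) lv))).
have h3 : KM * dot mu (kavg e (w N)) (kavg e (w N)) <= eps / 4.
  apply: (@le_trans _ _ ((KM + 1) * (eps / 4 / (KM + 1)))); last by rewrite mulrC divfK// lt0r_neq0// ltr_wpDl.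
  by apply: ler_pM => //; rewrite ?dot_ge0 ?lerDl.
lra.
Unshelve. all: by end_near. Qed.

Variable lam : R.
Hypothesis lam0 : 0 < lam.
Hypothesis ker : forall v, l2 mu v -> (forall x, ~ U x -> v x = 0) ->
  (forall phi, tst U phi -> \int[mu]_x (v x * (T phi x + lam * phi x)) = 0) -> dot mu v v = 0.

Let TL phi x := T phi x + lam * phi x.

Lemma TL_l2 phi : tst U phi -> l2 mu (TL phi).
Proof. by move=> tp; apply: l2D; [exact: dop_l2|apply: l2Z; exact: tst_l2]. Qed.

Lemma TLD phi psi (b : R) x : tst U phi -> tst U psi ->
  TL (fun x => phi x + b * psi x) x = TL phi x + b * TL psi x.
Proof.
move=> tp tq; have lin (A B p q : R) : A + b * B + lam * (p + b * q) = A + lam * p + b * (B + lam * q).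
  by ring.
by rewrite /TL (dopD b x tp tq); exact: lin.
Qed.

(** Nonnegativity of the form bounds [dot mu (TL phi) phi] below by [lam] times the squared norm of
    [phi], and Cauchy-Schwarz converts this into a bound on [TL phi]. *)
Lemma TL_bound phi : tst U phi -> lam ^+ 2 * dot mu phi phi <= dot mu (TL phi) (TL phi).
Proof.
move=> tp; have lp := tst_l2 tp; have lT := dop_l2 tp.
have h1 : lam * dot mu phi phi <= dot mu (TL phi) phi.
  by rewrite /TL dotDl ?dotZl//; [have := dop_ge0 tp; lra|exact: l2Z].
have [P0|P0] := eqVneq (dot mu phi phi) 0; first by rewrite P0 mulr0 dot_ge0.
have Pp : 0 < dot mu phi phi by rewrite lt_neqAle eq_sym P0 dot_ge0.
have h2 := dot_CS (TL_l2 tp) lp.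
rewrite -(ler_pM2r Pp); apply: le_trans h2; rewrite -mulrA -expr2 -exprMn.
apply: lerXn2r => //; rewrite nnegrE; first by rewrite mulr_ge0// ?ltW.
by apply: le_trans h1; rewrite mulr_ge0// ltW.
Qed.

(** The subspace [S] also contains every L2 function that vanishes on [U]. A function orthogonal to
    [S] is therefore null off [U], and its part on [U] is null by [ker]. *)
Lemma TL_range y : l2 mu y -> (forall x, ~ U x -> y x = 0) ->
  exists2 phi : nat -> V -> R, forall n, tst U (phi n) &
  dot mu (fun x => TL (phi n) x - y x) (fun x => TL (phi n) x - y x) @[n --> \oo] --> (0 : R).
Proof.
move=> ly y0; have mU := open_measurable_rV oU; have mUC := measurableC mU.
pose S f := exists phi g, [/\ tst U phi, l2 mu g, forall x, U x -> g x = 0 &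
   forall x, f x = TL phi x + g x].
have [||||s Ss cs] := @l2_projection _ _ _ mu S y ly.
- move=> f [phi [g [tp lg _ fE]]]; rewrite (funext fE); apply: l2D => //; exact: TL_l2.
- exists (fun=> 0), (fun=> 0); split => //; first exact: tst0.
    by split; [exact: measurable_cst|under eq_fun do rewrite expr0n; exact: intble0].
  by move=> x; rewrite /TL dop0 mulr0 !addr0.
- move=> f h b [p1 [g1 [t1 l1 u1 e1]]] [p2 [g2 [t2 l2' u2 e2]]].
  exists (fun x => p1 x + b * p2 x), (fun x => g1 x + b * g2 x); split.
  + exact: tstD.
  + by apply: l2D => //; exact: l2Z.
  + by move=> x Ux; rewrite u1// u2// mulr0 addr0.
  + move=> x; rewrite e1 e2 (TLD b x t1 t2).
    have lin (A B p q : R) : A + p + b * (B + q) = A + b * B + (p + b * q) by ring.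
    exact: lin.
- move=> z lz zS; pose z1 x := \1_U x * z x; pose z2 x := \1_(~` U) x * z x.
  have l1 : l2 mu z1 := (dot_restrict_le mU lz).1.
  have l2' : l2 mu z2 := (dot_restrict_le mUC lz).1.
  have zE : z = fun x => z1 x + z2 x.
    apply/funext => x; rewrite /z1 /z2 !indicE; have [Ux|Ux] := pselect (U x).
      by rewrite mem_set// memNset ?mul1r ?mul0r ?addr0//= => h; apply: h.
    by rewrite memNset// mem_set// mul1r mul0r add0r.
  have z12 : dot mu z1 z2 = 0.
    rewrite -[RHS](@Rint0 _ _ _ mu); apply: eq_Rintegral => x _; rewrite /z1 /z2 !indicE.
    have [Ux|Ux] := pselect (U x).
      have -> : (x \in ~` U) = false by apply/negbTE/negP => /set_mem; apply.
      by rewrite mul0r mulr0.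
    by rewrite memNset// mul0r mul0r.
  have h2 : dot mu z z2 = 0.
    apply: zS; exists (fun=> 0), z2; split => //; first exact: tst0.
      by move=> x Ux; rewrite /z2 indicE memNset ?mul0r//= => h; apply: h.
    by move=> x; rewrite /TL dop0 mulr0 !add0r.
  have h1 : dot mu z1 z1 = 0.
    apply: ker => //; first by move=> x Ux; rewrite /z1 indicE memNset// mul0r.
    move=> phi tp; have : dot mu z (TL phi) = 0.
      apply: zS; exists phi, (fun=> 0); split => //; last by move=> x; rewrite addr0.
      by split; [exact: measurable_cst|under eq_fun do rewrite expr0n; exact: intble0].
    rewrite /dot => <-; apply: eq_Rintegral => x _; rewrite /z1 indicE.
    have [Ux|Ux] := pselect (U x); first by rewrite mem_set// mul1r.
    by have [a1 _ a2] := tst_off tp Ux; rewrite /TL a1 a2 mulr0 addr0 !mulr0.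
  have h22 : dot mu z2 z2 = 0 by move: h2; rewrite zE dotDl// z12 add0r.
  by rewrite zE dotDD// h1 z12 h22 mulr0 !addr0.
have /choice[phi hphi] := Ss.
have {hphi} /choice[g hg] := hphi.
exists phi; first by move=> n; have [] := hg n.
apply: (@squeeze_cvgr _ _ _ _ (cst 0) (fun n => dot mu (fun x => y x - s n x) (fun x => y x - s n x)));
  [|exact: cvg_cst|exact: cs].
apply: nearW => n; rewrite dot_ge0 /=; have [tp lg gU sE] := hg n.
have lsn : l2 mu (fun x => y x - s n x).
  by apply: l2B => //; rewrite (funext sE); apply: l2D => //; exact: TL_l2.
apply: le_trans (dot_restrict_le mU lsn).2.
rewrite le_eqVlt; apply/orP; left; apply/eqP; apply: eq_Rintegral => x _.
rewrite indicE; have [Ux|Ux] := pselect (U x).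
  by rewrite mem_set// !mul1r sE gU// addr0; ring.
have [a1 _ a2] := tst_off tp Ux.
by rewrite memNset// !mul0r /TL a1 a2 y0// mulr0 addr0 subrr mul0r.
Qed.

Definition in_closure v g := exists phi : nat -> V -> R, [/\ forall n, tst U (phi n),
  dot mu (fun x => phi n x - v x) (fun x => phi n x - v x) @[n --> \oo] --> (0 : R) &
  dot mu (fun x => T (phi n) x - g x) (fun x => T (phi n) x - g x) @[n --> \oo] --> (0 : R)].

(** Choose [phi n] with [TL (phi n)] tending to [g + lam * v], with error [h n]. The difference
    [w n] of [phi n] and [v] then solves the weak equation with right-hand side [h n]. Testing with
    [psi] such that [TL psi] approximates [w n], [TL_bound] gives that the norm of [w n] is at most
    that of [h n] divided by [lam]. So [phi n] itself converges to [v], and its image to [g]. *)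
Lemma adjoint_in_closure v g : l2 mu v -> l2 mu g ->
  (forall x, ~ U x -> v x = 0) -> (forall x, ~ U x -> g x = 0) ->
  (forall phi, tst U phi -> dot mu v (T phi) = dot mu g phi) -> in_closure v g.
Proof.
move=> lv lg v0 g0 vg; pose y x := g x + lam * v x.
have ly : l2 mu y by apply: l2D => //; exact: l2Z.
have [|phi tphi cphi] := TL_range ly; first by move=> x Ux; rewrite /y v0// g0// mulr0 addr0.
pose w n x := phi n x - v x; pose h n x := TL (phi n) x - y x.
have lphi n := tst_l2 (tphi n); have lT n := dop_l2 (tphi n).
have lw n : l2 mu (w n) by exact: l2B.
have lh n : l2 mu (h n) by apply: l2B => //; exact: TL_l2.
have whE n psi : tst U psi -> dot mu (w n) (TL psi) = dot mu (h n) psi.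
  move=> tq; have lq := tst_l2 tq; have lTq := dop_l2 tq; have llq := l2Z lam lq.
  have lTL := TL_l2 tq.
  have e1 f : l2 mu f -> dot mu f (TL psi) = dot mu f (T psi) + lam * dot mu f psi.
    by move=> lf; rewrite (dotDr lTq llq lf) (dotZr lam lq lf).
  have e2 : dot mu (TL (phi n)) psi = dot mu (T (phi n)) psi + lam * dot mu (phi n) psi.
    by rewrite (dotDl (lT n) (l2Z lam (lphi n)) lq) (dotZl lam (lphi n) lq).
  have e3 : dot mu y psi = dot mu g psi + lam * dot mu v psi.
    by rewrite (dotDl lg (l2Z lam lv) lq) (dotZl lam lv lq).
  rewrite (dotBl (lphi n) lv lTL) (dotBl (TL_l2 (tphi n)) ly lq).
  by rewrite !e1// e2 e3 (dop_sym (tphi n) tq) (vg _ tq).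
have key n : lam ^+ 2 * dot mu (w n) (w n) <= dot mu (h n) (h n).
  have w0 x : ~ U x -> w n x = 0 by rewrite /w => Ux; have [-> _ _] := tst_off (tphi n) Ux; rewrite v0// subrr.
  have [psi tpsi cpsi] := TL_range (lw n) w0.
  have lTL j := TL_l2 (tpsi j).
  have c1 := dot_cvgr (lw n) (lw n) lTL cpsi.
  have c2 : dot mu (TL (psi j)) (TL (psi j)) @[j --> \oo] --> dot mu (w n) (w n).
    have := dot_cvgD (lw n) (fun j => l2B (lTL j) (lw n)) cpsi.
    apply: cvg_trans; apply: near_eq_cvg; apply: nearW => j.
    by congr dot; apply/funext => x; rewrite addrC subrK.
  have c3 : lam ^+ 2 * (dot mu (w n) (TL (psi j))) ^+ 2 @[j --> \oo] --> lam ^+ 2 * (dot mu (w n) (w n)) ^+ 2.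
    by apply: cvgMr; under eq_fun do rewrite expr2; rewrite expr2; exact: cvgM.
  have c4 : dot mu (h n) (h n) * dot mu (TL (psi j)) (TL (psi j)) @[j --> \oo] -->
     dot mu (h n) (h n) * dot mu (w n) (w n) by exact: cvgMr.
  have : lam ^+ 2 * (dot mu (w n) (w n)) ^+ 2 <= dot mu (h n) (h n) * dot mu (w n) (w n).
    apply: (ler_cvg_to c3 c4); apply: nearW => j; rewrite whE//.
    have h1 := dot_CS (lh n) (tst_l2 (tpsi j)); have h2 := TL_bound (tpsi j).
    apply: (le_trans (ler_wpM2l (sqr_ge0 lam) h1)).
    by rewrite mulrCA ler_wpM2l// dot_ge0.
  have [P0|P0] := eqVneq (dot mu (w n) (w n)) 0 => hh; first by rewrite P0 mulr0 dot_ge0.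
  have Pp : 0 < dot mu (w n) (w n) by rewrite lt_neqAle eq_sym P0 dot_ge0.
  by rewrite -(ler_pM2r Pp) -mulrA -expr2.
have cw : dot mu (w n) (w n) @[n --> \oo] --> (0 : R).
  apply: (@squeeze_cvgr _ _ _ _ (cst 0) (fun n => (lam ^+ 2)^-1 * dot mu (h n) (h n))).
  - apply: nearW => n; rewrite dot_ge0 /= ler_pdivlMl ?exprn_gt0//; exact: key.
  - exact: cvg_cst.
  - by rewrite -(mulr0 (lam ^+ 2)^-1); exact: cvgMr.
exists phi; split => //.
apply: (@squeeze_cvgr _ _ _ _ (cst 0) (fun n => 2 * (dot mu (h n) (h n) + lam ^+ 2 * dot mu (w n) (w n)))).
- apply: nearW => n; rewrite dot_ge0 /=.
  have -> : (fun x => T (phi n) x - g x) = (fun x => h n x + (- lam) * w n x).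
    by apply/funext => x; rewrite /h /w /TL /y; ring.
  apply: (le_trans (dot_le2 (lh n) (l2Z (- lam) (lw n)))).
  rewrite dotZl//; last exact: l2Z.
  by rewrite dotZr// mulrA mulrNN -expr2.
- exact: cvg_cst.
- rewrite -(mulr0 2) -[X in 2 * X]addr0 -[X in 2 * (_ + X)](mulr0 (lam ^+ 2)).
  by apply: cvgMr; apply: cvgD => //; exact: cvgMr.
Qed.

Lemma in_closure_sym v g v' g' : l2 mu v -> l2 mu g -> l2 mu v' -> l2 mu g' ->
  in_closure v g -> in_closure v' g' -> dot mu g v' = dot mu v g'.
Proof.
move=> lv lg lv' lg' [p [tp p1 p2]] [p' [tp' p1' p2']].
have e1 m : dot mu g (p' m) = dot mu v (T (p' m)).
  have lT := dop_l2 (tp' m); have lp := tst_l2 (tp' m).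
  have c1 := dot_cvgr lT lv (fun n => tst_l2 (tp n)) p1.
  have c2 := dot_cvgr lp lg (fun n => dop_l2 (tp n)) p2.
  rewrite (dotC mu g) (dotC mu v); apply: (cvg_unique (@Rhausdorff R) c2).
  apply: cvg_trans c1; apply: near_eq_cvg; apply: nearW => n.
  by rewrite dop_sym.
have c1 := dot_cvgr lg lv' (fun n => tst_l2 (tp' n)) p1'.
have c2 := dot_cvgr lv lg' (fun n => dop_l2 (tp' n)) p2'.
apply: (cvg_unique (@Rhausdorff R) c1).
by apply: cvg_trans c2; apply: near_eq_cvg; apply: nearW => n; rewrite e1.
Qed.

End realop.

(** * Complex-valued functions and the operator graphs *)

Section complex_bridge.
Variables (R : realType) (d : nat).
Local Notation V := 'rV[R]_d.
Local Notation mu := (rV_lebesgue R d).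
Local Notation e_ i := (delta_mx ord0 i : V).
Variable U : set V.
Hypothesis oU : open U.
Implicit Types (u f g h : V -> R[i]).

(** Extension by 0 turns integrals over [U] into integrals over the whole space, where the real
    theory is set. *)
Definition reU u (x : V) : R := \1_U x * complex.Re (u x).
Definition imU u (x : V) : R := \1_U x * complex.Im (u x).

Let mU : measurable U. Proof. exact: open_measurable_rV. Qed.

Lemma reU_off u x : ~ U x -> reU u x = 0.
Proof. by move=> Ux; rewrite /reU indicE memNset// mul0r. Qed.

Lemma imU_off u x : ~ U x -> imU u x = 0.
Proof. by move=> Ux; rewrite /imU indicE memNset// mul0r. Qed.

Lemma reU_on u x : U x -> reU u x = complex.Re (u x).
Proof. by move=> Ux; rewrite /reU indicE mem_set// mul1r. Qed.

Lemma imU_on u x : U x -> imU u x = complex.Im (u x).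
Proof. by move=> Ux; rewrite /imU indicE mem_set// mul1r. Qed.

Lemma measurable_mul_indic (F : V -> R) :
  measurable_fun U (F : V -> measurableTypeR R) <-> measurable_fun setT (fun x => \1_U x * F x).
Proof.
have mUC := measurableC mU; split => [mF|mF].
  rewrite -(setvU U); apply/(measurable_funU _ mUC mU); split.
    apply: (eq_measurable_fun (cst (0 : R))) => [x /set_mem Ux|]; last exact: measurable_cst.
    by rewrite indicE memNset ?mul0r.
  by apply: (eq_measurable_fun F) => // x /set_mem Ux; rewrite indicE mem_set// mul1r.
apply: (eq_measurable_fun (fun x => \1_U x * F x)) => [x /set_mem Ux|].
  by rewrite indicE mem_set// mul1r.
exact: measurable_funTS.
Qed.

Lemma L2sqE u : L2sq U u = (\int[mu]_x (reU u x ^+ 2 + imU u x ^+ 2)%:E)%E.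
Proof.
apply: integral_indic => x Ux; first by rewrite normc_sqr reU_on// imU_on.
by rewrite reU_off// imU_off// expr0n addr0.
Qed.

Lemma L2sq_dot u : l2 mu (reU u) -> l2 mu (imU u) ->
  L2sq U u = (dot mu (reU u) (reU u) + dot mu (imU u) (imU u))%:E.
Proof.
by move=> lr li; rewrite L2sqE (intble_fin (intbleD lr.2 li.2)) (RintD lr.2 li.2) !dot_sq.
Qed.

Lemma L2P u : L2 U u <-> l2 mu (reU u) /\ l2 mu (imU u).
Proof.
split=> [[mr mi fin]|[lr li]]; last first.
  have [mr mi] := (lr.1, li.1).
  split; [by apply/measurable_mul_indic|by apply/measurable_mul_indic|].
  by rewrite L2sq_dot// ltry.
have mr' : measurable_fun setT (reU u) by exact/measurable_mul_indic.
have mi' : measurable_fun setT (imU u) by exact/measurable_mul_indic.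
rewrite L2sqE in fin.
have key (F : V -> R) : measurable_fun setT F -> (forall x, F x ^+ 2 <= reU u x ^+ 2 + imU u x ^+ 2) ->
    l2 mu F.
  move=> mF hF; split => //; apply: intble_ge0; [exact: measurable_funX|by move=> x; exact: sqr_ge0|].
  apply: le_lt_trans fin; apply: ge0_le_integral => //.
  - by move=> x _; rewrite lee_fin sqr_ge0.
  - exact/measurable_EFinP/measurable_funX.
  - by apply/measurable_EFinP/measurable_funD; exact: measurable_funX.
  - by move=> x _; rewrite lee_fin.
by split; apply: key => // x; [rewrite lerDl sqr_ge0|rewrite lerDr sqr_ge0].
Qed.

Lemma L2cvgP (un : nat -> V -> R[i]) u : (forall n, L2 U (un n)) -> L2 U u ->
  L2cvg U un u <->
  (dot mu (fun x => reU (un n) x - reU u x) (fun x => reU (un n) x - reU u x) @[n --> \oo] --> (0 : R)) /\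
  (dot mu (fun x => imU (un n) x - imU u x) (fun x => imU (un n) x - imU u x) @[n --> \oo] --> (0 : R)).
Proof.
move=> Ln /L2P[lr li].
have lrn n : l2 mu (reU (un n)) by have /L2P[] := Ln n.
have lin n : l2 mu (imU (un n)) by have /L2P[] := Ln n.
have rE n : reU (fun x => un n x - u x) = (fun x => reU (un n) x - reU u x).
  by apply/funext => x; rewrite /reU -mulrBr; case: (un n x) => p q; case: (u x).
have iE n : imU (fun x => un n x - u x) = (fun x => imU (un n) x - imU u x).
  by apply/funext => x; rewrite /imU -mulrBr; case: (un n x) => p q; case: (u x).
have sE n : L2sq U (fun x => un n x - u x) =
   (dot mu (fun x => reU (un n) x - reU u x) (fun x => reU (un n) x - reU u x) +
    dot mu (fun x => imU (un n) x - imU u x) (fun x => imU (un n) x - imU u x))%:E.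
  by rewrite L2sq_dot ?rE ?iE//; exact: l2B.
rewrite /L2cvg (funext sE).
set A := (fun n => dot mu (fun x => reU (un n) x - _) _).
set B := (fun n => dot mu (fun x => imU (un n) x - _) _).
split => [/fine_cvg h|[hA hB]]; last first.
  apply: cvg_EFin; first exact: nearW.
  by rewrite -[X in _ --> X]addr0; exact: cvgD.
have {}h : A n + B n @[n --> \oo] --> (0 : R) by exact: h.
split; apply: (@squeeze_cvgr _ _ _ _ (cst 0) (fun n => A n + B n)) => //; try exact: cvg_cst.
- by apply: nearW => n; rewrite dot_ge0 /= lerDl dot_ge0.
- by apply: nearW => n; rewrite dot_ge0 /= lerDr dot_ge0.
Qed.

Lemma L2dotE f g : L2 U f -> L2 U g -> L2dot U f g =
  Complex (dot mu (reU f) (reU g) + dot mu (imU f) (imU g))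
          (dot mu (imU f) (reU g) - dot mu (reU f) (imU g)).
Proof.
move=> /L2P[lf1 lf2] /L2P[lg1 lg2]; rewrite /L2dot.
have i1 := l2_intble lf1 lg1; have i2 := l2_intble lf2 lg2.
have i3 := l2_intble lf2 lg1; have i4 := l2_intble lf1 lg2.
rewrite /dot -(RintD i1 i2) -(RintB i3 i4); congr Complex; rewrite /Rintegral; congr fine.
- apply: integral_indic => x Ux; last by rewrite !reU_off// !imU_off// !mul0r addr0.
  rewrite !reU_on// !imU_on//; case: (f x) => p q; case: (g x) => p' q' /=; ring.
- apply: integral_indic => x Ux; last by rewrite !reU_off// !imU_off// !mul0r subr0.
  rewrite !reU_on// !imU_on//; case: (f x) => p q; case: (g x) => p' q' /=; ring.
Qed.

Lemma sum_Complex (I : Type) (r : seq I) (a b : I -> R) :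
  \sum_(i <- r) Complex (a i) (b i) = Complex (\sum_(i <- r) a i) (\sum_(i <- r) b i).
Proof. by elim: r => [|i r IH]; rewrite ?big_nil// !big_cons IH. Qed.

Lemma pderive_sum (I : Type) (r : seq I) (F : I -> V -> R) i x :
  (forall j, derivable (F j) x (e_ i)) ->
  derivable (fun y => \sum_(j <- r) F j y) x (e_ i) /\
  partial i (fun y => \sum_(j <- r) F j y) x = \sum_(j <- r) partial i (F j) x.
Proof.
move=> dF; elim: r => [|j r [h1 h2]].
  by rewrite big_nil; under eq_fun do rewrite big_nil; exact: pderive_cst.
rewrite big_cons; under eq_fun do rewrite big_cons.
have [h3 h4] := pderive_add (dF j) h1.
by split => //; rewrite h4 h2.
Qed.

Variables (C : V -> 'M[R]_d) (cc : 'I_d -> 'I_d -> V -> R) (L : R).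
Hypothesis lcc : forall k l x y, `|cc k l y - cc k l x| <= L * `|y - x|.
Hypothesis ccC : forall k l x, U x -> cc k l x = C x k l.
Hypothesis ccS : forall x, U x -> forall k l, cc k l x = cc l k x.
Hypothesis ccP : forall x, U x -> forall u : V, u != 0 ->
  0 < qf (fun k l => cc k l x) (fun i => u ord0 i) (fun i => u ord0 i).
Local Notation T := (dop cc).

(** Off a null set all coefficients are differentiable in the directions concerned, and around a
    point of the open set [U] the extension [cc] coincides with [C], so their derivatives coincide
    as well. *)
Lemma div_form_dop (phi : V -> R[i]) :
  Ck 2 (fun x => complex.Re (phi x)) -> Ck 2 (fun x => complex.Im (phi x)) ->
  {ae mu, forall x, U x -> div_form C phi x =
    Complex (T (fun x => complex.Re (phi x)) x) (T (fun x => complex.Im (phi x)) x)}.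
Proof.
move=> C1 C2.
have hae : {ae mu, forall x, forall p : 'I_d * 'I_d, derivable (cc p.1 p.2) x (e_ p.1) /\
    'D_(e_ p.1) (cc p.1 p.2) x = aederive (cc p.1 p.2) (e_ p.1) x}.
  by apply: filter_forall => p; exact: ae_aederive (e_ p.1) (lcc p.1 p.2).
apply: ae_imp hae => x hx Ux.
have key (f : V -> R) k : Ck 2 f ->
    partial k (fun y => \sum_l C y k l * partial l f y) x =
    \sum_l (aederive (cc k l) (e_ k) x * partial l f x + cc k l x * partial k (partial l f) x).
  move=> Cf; have E : {near x, (fun y => \sum_l C y k l * partial l f y) =1
      (fun y => \sum_l cc k l y * partial l f y)}.
    have : nbhs x U by exact: open_nbhs_nbhs.
    by apply: filterS => y Uy; apply: eq_bigr => l _; rewrite ccC.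
  rewrite /partial (near_eq_derive _ E) -/(partial k _ x).
  have h l : derivable (fun y => cc k l y * partial l f y) x (e_ k) /\
     partial k (fun y => cc k l y * partial l f y) x =
     aederive (cc k l) (e_ k) x * partial l f x + cc k l x * partial k (partial l f) x.
    have [d1 d2] := hx (k, l).
    have [h1 h2] := pderive_mul d1 (((Cf.2 l).2.2 k).1 x).
    by split => //; rewrite h2 addrC /partial d2 [partial l f x * _]mulrC.
  have [_ ->] := pderive_sum (index_enum 'I_d) (fun l => (h l).1).
  by apply: eq_bigr => l _; exact: (h l).2.
have sumE k y : \sum_l (C y k l)%:C%C * cpartial l phi y =
    Complex (\sum_l C y k l * partial l (fun y => complex.Re (phi y)) y)
            (\sum_l C y k l * partial l (fun y => complex.Im (phi y)) y).
  rewrite -sum_Complex; apply: eq_bigr => l _; rewrite /cpartial.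
  by apply/eqP; rewrite eq_complex /= !mul0r subr0 addr0 !eqxx.
rewrite /div_form.
have -> : \sum_k cpartial k (fun y => \sum_l (C y k l)%:C%C * cpartial l phi y) x =
   \sum_k Complex (\sum_l (aederive (cc k l) (e_ k) x * partial l (fun y => complex.Re (phi y)) x +
             cc k l x * partial k (partial l (fun y => complex.Re (phi y))) x))
           (\sum_l (aederive (cc k l) (e_ k) x * partial l (fun y => complex.Im (phi y)) x +
             cc k l x * partial k (partial l (fun y => complex.Im (phi y))) x)).
  apply: eq_bigr => k _; apply: (etrans _ (f_equal2 (@Complex R) (key _ k C1) (key _ k C2))).
  rewrite /cpartial; congr Complex.
  - by congr (partial k _ x); apply/funext => y; rewrite sumE.
  - by congr (partial k _ x); apply/funext => y; rewrite sumE.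
by rewrite sum_Complex.
Qed.

Lemma tst_re (p q : V -> R) : tst U p -> reU (fun x => Complex (p x) (q x)) = p.
Proof.
move=> tp; apply/funext => x; have [Ux|Ux] := pselect (U x); first by rewrite reU_on.
by rewrite reU_off//; have [_ [k [n [k0 ->]]]] := tp => // /(core_sub k0).
Qed.

Lemma tst_im (p q : V -> R) : tst U q -> imU (fun x => Complex (p x) (q x)) = q.
Proof.
move=> tp; apply/funext => x; have [Ux|Ux] := pselect (U x); first by rewrite imU_on.
by rewrite imU_off//; have [_ [k [n [k0 ->]]]] := tp => // /(core_sub k0).
Qed.

Lemma dop_re (p : V -> R) q : tst U p -> reU (fun x => Complex (T p x) (q x)) = T p.
Proof.
move=> tp; apply/funext => x; have [Ux|Ux] := pselect (U x); first by rewrite reU_on.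
by rewrite reU_off//; have [_ _ ->] := tst_off cc tp Ux.
Qed.

Lemma dop_im p (q : V -> R) : tst U q -> imU (fun x => Complex (p x) (T q x)) = T q.
Proof.
move=> tp; apply/funext => x; have [Ux|Ux] := pselect (U x); first by rewrite imU_on.
by rewrite imU_off//; have [_ _ ->] := tst_off cc tp Ux.
Qed.

Lemma tst_minimal (p q : V -> R) : tst U p -> tst U q ->
  minimal_op U C (fun x => Complex (p x) (q x)) (fun x => Complex (T p x) (T q x)).
Proof.
move=> tp tq; split; last first.
- apply: ae_imp (@div_form_dop (fun x => Complex (p x) (q x)) (tp.1 2%N) (tq.1 2%N)) => x h Ux.
  by rewrite h.
- by apply/L2P; rewrite dop_re// dop_im//; exact: (conj (dop_l2 lcc tp) (dop_l2 lcc tq)).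
move=> m; have [_ [k1 [n1 [k10 h1]]]] := tp; have [_ [k2 [n2 [k20 h2]]]] := tq.
pose K := core U k1 n1 `|` core U k2 n2.
have cK : compact K by apply: compactU; exact: compact_core.
have sK : closure [set x | Complex (p x) (q x) != 0] `<=` K.
  have clK : closed K by apply: compact_closed => //; exact: norm_hausdorff.
  move=> x h; apply: clK; apply: closure_subset h => y.
  apply: contraPP => yK /=; rewrite h1 ?h2; [by case/eqP|by move=> ?; apply: yK; right|].
  by move=> ?; apply: yK; left.
split; [exact: tp.1|exact: tq.1| |].
- by apply: (@subclosed_compact _ _ K) => //; exact: closed_closure.
- by move=> x /sK[]; exact: core_sub.
Qed.

Lemma minimal_tst phi f : minimal_op U C phi f ->
  [/\ tst U (reU phi), tst U (imU phi), {ae mu, forall x, reU f x = T (reU phi) x} &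
      {ae mu, forall x, imU f x = T (imU phi) x}].
Proof.
move=> [Cphi Lf aef].
have [_ _ cpt sub] := Cphi 0%N.
have [k [n [k0 n0 hK]]] := compact_core_sub oU cpt sub.
have phi0 x : ~ core U k n x -> phi x = 0.
  move=> xK; apply: contrapT => px; apply: xK; apply: hK; apply: subset_closure.
  by apply/eqP.
have rE : reU phi = fun x => complex.Re (phi x).
  apply/funext => x; have [Ux|Ux] := pselect (U x); first by rewrite reU_on.
  by rewrite reU_off// phi0// => /(core_sub k0).
have iE : imU phi = fun x => complex.Im (phi x).
  apply/funext => x; have [Ux|Ux] := pselect (U x); first by rewrite imU_on.
  by rewrite imU_off// phi0// => /(core_sub k0).
have tr : tst U (reU phi).
  split; first by rewrite rE => m; have [] := Cphi m.
  by exists k, n; split => // x /phi0 px; rewrite rE px.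
have ti : tst U (imU phi).
  split; first by rewrite iE => m; have [] := Cphi m.
  by exists k, n; split => // x /phi0 px; rewrite iE px.
have [C1 C2 _ _] := Cphi 2%N.
have ae2 : {ae mu, forall x, (U x -> f x = div_form C phi x) /\
    (U x -> div_form C phi x = Complex (T (fun x => complex.Re (phi x)) x) (T (fun x => complex.Im (phi x)) x))}.
  by apply: filterI => //; exact: div_form_dop.
split => //; apply: ae_imp ae2 => x [h1 h2]; have [Ux|Ux] := pselect (U x).
- by rewrite (reU_on _ Ux) (h1 Ux) (h2 Ux) rE.
- by rewrite reU_off//; have [_ _ ->] := tst_off cc tr Ux.
- by rewrite (imU_on _ Ux) (h1 Ux) (h2 Ux) iE.
- by rewrite imU_off//; have [_ _ ->] := tst_off cc ti Ux.
Qed.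

(** The coefficients being real, the operator acts separately on real and imaginary parts, and
    convergence in L2 splits in the same way. The graph fixes [fn n] only up to a null set, which
    the norms do not see. *)
Lemma op_HP u f : op_H U C u f <-> [/\ L2 U u, L2 U f, in_closure U cc (reU u) (reU f) &
  in_closure U cc (imU u) (imU f)].
Proof.
split=> [[Lu Lf [un [fn [hmin cu cf]]]]|[Lu Lf [p [tp p1 p2]] [q [tq q1 q2]]]]; last first.
  split => //; exists (fun n x => Complex (p n x) (q n x)), (fun n x => Complex (T (p n) x) (T (q n) x)).
  have hmin n := tst_minimal (tp n) (tq n).
  split => //.
  - apply/L2cvgP => // [n|]; first by apply/L2P; rewrite tst_re// tst_im//; exact: (conj (tst_l2 (tp n)) (tst_l2 (tq n))).
    split.
      by apply: cvg_trans p1; apply: near_eq_cvg; apply: nearW => n; rewrite tst_re.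
    by apply: cvg_trans q1; apply: near_eq_cvg; apply: nearW => n; rewrite tst_im.
  - apply/L2cvgP => // [n|]; first by have [] := hmin n.
    split.
      by apply: cvg_trans p2; apply: near_eq_cvg; apply: nearW => n; rewrite dop_re.
    by apply: cvg_trans q2; apply: near_eq_cvg; apply: nearW => n; rewrite dop_im.
have hm n := minimal_tst (hmin n).
have Lun n : L2 U (un n).
  by apply/L2P; have [t1 t2 _ _] := hm n; exact: (conj (tst_l2 t1) (tst_l2 t2)).
have Lfn n : L2 U (fn n) by have [] := hmin n.
have /L2cvgP[//|//|u1 u2] := cu; have /L2cvgP[//|//|f1 f2] := cf.
have /L2P[lf1 lf2] := Lf.
split => //.
- exists (fun n => reU (un n)); split => //; first by move=> n; have [] := hm n.
  apply: cvg_trans f1; apply: near_eq_cvg; apply: nearW => n.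
  have [t1 _ ae1 _] := hm n; have /L2P[lfn _] := Lfn n.
  apply: ae_dot.
  + exact: (l2B lfn lf1).1.
  + exact: (l2B (dop_l2 lcc t1) lf1).1.
  + by apply: ae_imp ae1 => x ->.
- exists (fun n => imU (un n)); split => //; first by move=> n; have [] := hm n.
  apply: cvg_trans f2; apply: near_eq_cvg; apply: nearW => n.
  have [_ t1 _ ae1] := hm n; have /L2P[_ lfn] := Lfn n.
  apply: ae_dot.
  + exact: (l2B lfn lf2).1.
  + exact: (l2B (dop_l2 lcc t1) lf2).1.
  + by apply: ae_imp ae1 => x ->.
Qed.

Lemma in_closure_tst (p : V -> R) : tst U p -> in_closure U cc p (T p).
Proof.
move=> tp; exists (fun=> p); split => //; apply: cvg_near_cst; apply: nearW => n;
  by rewrite -[RHS](@Rint0 _ _ _ mu); apply: eq_Rintegral => x _; rewrite subrr mulr0.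
Qed.

Lemma op_H_tst (p q : V -> R) : tst U p -> tst U q ->
  op_H U C (fun x => Complex (p x) (q x)) (fun x => Complex (T p x) (T q x)).
Proof.
move=> tp tq; apply/op_HP; rewrite tst_re// tst_im// dop_re// dop_im//.
split; try exact: in_closure_tst.
- by apply/L2P; rewrite tst_re// tst_im//; exact: (conj (tst_l2 tp) (tst_l2 tq)).
- by apply/L2P; rewrite dop_re// dop_im//; exact: (conj (dop_l2 lcc tp) (dop_l2 lcc tq)).
Qed.

(** Symmetry on test functions passes to the closure and gives one inclusion. The other is
    [adjoint_in_closure], applied to the real and to the imaginary part. *)
Lemma self_adjoint_kernel lam : 0 < lam ->
  (forall v, l2 mu v -> (forall x, ~ U x -> v x = 0) ->
    (forall phi, tst U phi -> \int[mu]_x (v x * (T phi x + lam * phi x)) = 0) -> dot mu v v = 0) ->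
  self_adjoint U (op_H U C).
Proof.
move=> lam0 ker; split.
  move=> u Lu; have /L2P[lr li] := Lu.
  have n0 (n : nat) : 0 < n.+1%:R^-1 :> R by rewrite invr_gt0.
  have /choice[p hp] : forall n : nat, exists phi, tst U phi /\
      dot mu (fun x => phi x - reU u x) (fun x => phi x - reU u x) <= n.+1%:R^-1.
    by move=> n; have [phi t h] := tst_dense oU lr (fun x => @reU_off u x) (n0 n); exists phi.
  have /choice[q hq] : forall n : nat, exists phi, tst U phi /\
      dot mu (fun x => phi x - imU u x) (fun x => phi x - imU u x) <= n.+1%:R^-1.
    by move=> n; have [phi t h] := tst_dense oU li (fun x => @imU_off u x) (n0 n); exists phi.
  have tp n : tst U (p n) by case: (hp n).
  have tq n : tst U (q n) by case: (hq n).
  exists (fun n x => Complex (p n x) (q n x)), (fun n x => Complex (T (p n) x) (T (q n) x)).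
  split; first by move=> n; exact: op_H_tst.
  apply/L2cvgP => // [n|]; first by apply/L2P; rewrite tst_re// tst_im//; exact: (conj (tst_l2 (tp n)) (tst_l2 (tq n))).
  split; apply: (@squeeze_cvgr _ _ _ _ (cst 0) (fun n => n.+1%:R^-1)); try exact: cvg_cst;
    try exact: cvg_harmonic0.
  - by apply: nearW => n; rewrite tst_re// dot_ge0 /=; case: (hp n).
  - by apply: nearW => n; rewrite tst_im// dot_ge0 /=; case: (hq n).
move=> u f; split.
  move=> /op_HP[Lu Lf cr ci]; split => // u' f' /op_HP[Lu' Lf' cr' ci'].
  have /L2P[a1 a2] := Lu; have /L2P[b1 b2] := Lf.
  have /L2P[a1' a2'] := Lu'; have /L2P[b1' b2'] := Lf'.
  rewrite !L2dotE//.
  rewrite (in_closure_sym lcc ccS a1' b1' a1 b1 cr' cr) (in_closure_sym lcc ccS a2' b2' a2 b2 ci' ci).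
  by rewrite (in_closure_sym lcc ccS a2' b2' a1 b1 ci' cr) (in_closure_sym lcc ccS a1' b1' a2 b2 cr' ci).
move=> [Lu Lf adj]; apply/op_HP; have /L2P[lu1 lu2] := Lu; have /L2P[lf1 lf2] := Lf.
have dot0 (g : V -> R) : dot mu (fun=> 0) g = 0.
  by rewrite -[RHS](@Rint0 _ _ _ mu); apply: eq_Rintegral => x _; rewrite mul0r.
have T0 : T (fun=> 0) = (fun=> 0) by apply/funext => x; exact: dop0.
have t0 := tst0 U.
(* A real test function is enough: the real and imaginary parts of the complex adjoint identity give
   the two relations at once. *)
have test p : tst U p -> dot mu (T p) (reU u) = dot mu p (reU f) /\
    dot mu (T p) (imU u) = dot mu p (imU f).
  move=> tp; have hop := op_H_tst tp t0.
  have [Lp LTp _ _] : [/\ L2 U (fun x => Complex (p x) 0),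
     L2 U (fun x => Complex (T p x) (T (fun=> 0) x)), True & True].
    by have /op_HP[] := hop.
  have := adj _ _ hop; rewrite (L2dotE LTp Lu) (L2dotE Lp Lf).
  rewrite (tst_re _ tp) (tst_im _ t0) (dop_re _ tp) (dop_im _ t0) T0 !dot0 !addr0 !sub0r.
  by move=> [h1 h2]; split => //; exact: oppr_inj.
split => //.
- apply: (adjoint_in_closure oU lcc ccS ccP lam0 ker) => // [x|x|p tp]; [exact: reU_off|exact: reU_off|].
  by rewrite dotC (test p tp).1 dotC.
- apply: (adjoint_in_closure oU lcc ccS ccP lam0 ker) => // [x|x|p tp]; [exact: imU_off|exact: imU_off|].
  by rewrite dotC (test p tp).2 dotC.
Qed.

End complex_bridge.

Theorem theorem5p2 (R : realType) (d : nat) (d_gt0 : (0 < d)%N)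
  (Omega : set 'rV[R]_d) (domO : domain Omega)
  (C : 'rV[R]_d -> 'M[R]_d)
  (C_sym : forall x, Omega x -> (C x)^T = C x)
  (C_lip : forall k l, bounded_lipschitz Omega (fun x => C x k l))
  (C_pos : forall x, Omega x -> posdef (C x))
  (delta r0 : R) (delta_itv : 0 <= delta < 2) (r0_gt0 : 0 < r0)
  (c : 'rV[R]_d -> R)
  (c_lip : bounded_lipschitz Omega c)
  (c_pos : (0 < ereal_inf [set (c x)%:E | x in collar Omega r0])%E)
  (C_bnd : boundary_condition Omega C c delta r0)
  (hardyO : forall r : R, 0 < r <= r0 ->
    exists2 b : R, 0 < b & hardy Omega delta r b) :
  (((2 - delta) / 2)%:E < hardy_constant Omega delta r0)%E ->
  self_adjoint Omega (op_H Omega C).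
Proof.
move=> hb; have oO : open Omega by case: domO.
have [cc [L [Bc [lcc ccC ccB]]]] := coefficient_extension C_lip.
have [lam lam0 ker] := kernel_main oO C_sym C_pos lcc ccC ccB delta_itv r0_gt0 c_lip c_pos C_bnd hb.
apply: (self_adjoint_kernel oO lcc ccC _ _ lam0 ker) => x Ox.
  by move=> k l; rewrite !ccC// -[in LHS](C_sym x Ox) mxE.
move=> u u0; have := qf_posdef (C_pos x Ox) u0.
suff -> : qf (fun k l => C x k l) (fun i => u ord0 i) (fun i => u ord0 i) =
  qf (fun k l => cc k l x) (fun i => u ord0 i) (fun i => u ord0 i) by [].
by apply: eq_bigr => k _; apply: eq_bigr => l _; rewrite ccC.
Qed.
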